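(* Let $(M,a,Q)$ be subextremal Kerr–Newman parameters, $M>0$, $a^2+Q^2<M^2$. For every finite order $k\ge 0$, the Maxwell energy space admits the topological direct sum $$\mathcal H_{\mathrm{Max}}^{(k)}(\Sigma_0)=\operatorname{span}\{U_e,U_m\}\oplus\mathcal H_{\mathrm{Max},0}^{(k)}(\Sigma_0),$$ where $U_e,U_m$ are the Cauchy data of the normalized stationary electric and magnetic Kerr–Newman Coulomb fields $F_e,F_m$. With this normalization the associated projections $$\Pi_{\mathrm{stat}}U=q_E(U)U_e+q_B(U)U_m,\qquad \Pi_0U=U-\Pi_{\mathrm{stat}}U$$ are bounded. If $F$ is a finite-energy source-free Maxwell field, then $$F=F_{\mathrm{stat}}(q_E[F],q_B[F])+F_{\mathrm{rad}},\qquad q_E[F_{\mathrm{rad}}]=q_B[F_{\mathrm{rad}}]=0,$$ uniquely, where $F_{\mathrm{stat}}(q_E,q_B)=q_EF_e+q_BF_m$. No nonzero stationary charge representative $F_{\mathrm{stat}}(q_E,q_B)$, $(q_E,q_B)\neq(0,0)$, can decay locally to zero in a non-degenerate local $L^2$ norm.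
   Context: Geometry. $\Delta=r^2-2Mr+a^2+Q^2$, $\Sigma=r^2+a^2\cos^2\theta$, $r_\pm=M\pm\sqrt{M^2-a^2-Q^2}$. The Kerr–Newman metric $g$ in Boyer–Lindquist coordinates is $$g=-\tfrac{\Delta-a^2\sin^2\theta}{\Sigma}dt^2-\tfrac{2a\sin^2\theta(r^2+a^2-\Delta)}{\Sigma}dt\,d\phi+\tfrac{(r^2+a^2)^2-a^2\Delta\sin^2\theta}{\Sigma}\sin^2\theta\,d\phi^2+\tfrac{\Sigma}{\Delta}dr^2+\Sigma\,d\theta^2$$ on the exterior $r>r_+$, extended smoothly across the future event horizon $\mathcal H^+=\{r=r_+\}$ in horizon-penetrating coordinates $(\tilde t,r,\theta,\tilde\phi)$. $T=\partial_{\tilde t}$, $\Phi=\partial_{\tilde\phi}$ are the Killing fields. A regular foliation $\{\Sigma_\tau\}_{\tau\in\mathbb R}$ is a family of level sets of a smooth time function $\tau$ which are spacelike, cross $\mathcal H^+$ regularly with future unit normal $n_{\Sigma_\tau}$ smooth up to $\mathcal H^+$, have uniformly equivalent volume forms on compact radial sets, and agree in the far region with the level sets of $t$ up to a tortoise correction. $N$ is a smooth future timelike vector field equal to a red-shift multiplier near $\mathcal H^+$ and to $T$ for large $r$. A source-free Maxwell field is a real two-form $F$ with $dF=0$, $d\star_gF=0$. Energy. $\mathbf T_{\mu\nu}[G]=G_{\mu\alpha}G_\nu{}^\alpha-\frac14g_{\mu\nu}G_{\alpha\beta}G^{\alpha\beta}$. $\mathbb D_k$ is the finite set of products of at most $k$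 elements of $\{T,\Phi,r\partial_r,\text{regular angular derivatives}\}$ in regular coordinates, and $$\mathcal E_{\mathrm{Max}}^{(k)}[G](\tau)=\sum_{\Gamma^I\in\mathbb D_k}\int_{\Sigma_\tau}\mathbf T_{\mu\nu}[\mathcal L_{\Gamma^I}G]N^\mu n_{\Sigma_\tau}^\nu\,d\mu_{\Sigma_\tau}.$$ For Cauchy data, time derivatives are eliminated with Maxwell's equations. Charges. $q_E[F]=\frac1{4\pi}\lim_{r\to\infty}\int_{S_{\tau,r}}\star_gF$, $q_B[F]=\frac1{4\pi}\lim_{r\to\infty}\int_{S_{\tau,r}}F$, with $S_{\tau,r}\subset\Sigma_\tau$ the coordinate spheres; they are conserved. Stationary fields. $\widehat A_e=-\frac r\Sigma(dt-a\sin^2\theta\,d\phi)$, $F_e=\pm d\widehat A_e$ with sign such that $q_E[F_e]=1$; $F_m=\pm\star_gF_e$ with sign such that $q_B[F_m]=1$; then $q_B[F_e]=q_E[F_m]=0$. Spaces. Cauchy data on $\Sigma_0$ are pairs $U=(E,B)$ (electric and magnetic one-forms relative to $n_{\Sigma_0}$) with $\operatorname{div}_{\Sigma_0}E=\operatorname{div}_{\Sigma_0}B=0$. $\mathcal H_{\mathrm{Max},0}^{(k)}(\Sigma_0)$ is the completion, in the norm $(\mathcal E_{\mathrm{Max}}^{(k)}(0))^{1/2}$, of the smooth constrained data with both charges zero and finite $\mathcal E^{(k)}_{\mathrm{Max}}$. $\mathcal H_{\mathrm{Max}}^{(k)}(\Sigma_0)$ consists of the data $q_EU_e+q_BU_m+U_0$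 with $q_E,q_B\in\mathbb R$, $U_0\in\mathcal H_{\mathrm{Max},0}^{(k)}(\Sigma_0)$, with norm equivalent to $(|q_E|^2+|q_B|^2+\|U_0\|^2)^{1/2}$; the charges extend continuously to it. A finite-energy source-free Maxwell field is the solution with datum in $\mathcal H_{\mathrm{Max}}^{(k)}(\Sigma_0)$, obtained on each finite slab as the energy-norm limit of smooth solutions. Non-degenerate local $L^2$ norm: $\big(\int_{\Sigma_\tau\cap K}(|E|^2+|B|^2)\,d\mu_{\Sigma_\tau}\big)^{1/2}$ (or an equivalent norm) for a compact radial set $K$ with nonempty interior; decaying locally to zero means that this tends to $0$ as $\tau\to\infty$. *)

(* Defs.v *)
From HB Require Import structures.
From mathcomp Require Import all_boot all_order all_algebra.
From mathcomp Require Import perm ring.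
From mathcomp Require Import all_classical all_reals all_analysis.
Set Implicit Arguments.
Unset Strict Implicit.
Unset Printing Implicit Defensive.
Import Order.TTheory GRing.Theory Num.Theory.
Import numFieldNormedType.Exports.
Local Open Scope classical_set_scope.
Local Open Scope ring_scope.

(* Coordinates.  Let (t~, r, theta, phi~) be the ingoing horizon-penetrating
   coordinates,
     dt~ = dt + (2Mr - Q^2)/Delta dr,   dphi~ = dphi + a/Delta dr.
   The regular coordinates used here are (t~, y) with
     y = (r sin(theta) cos(phi~), r sin(theta) sin(phi~), r cos(theta)),
   so r = |y| and the axis is an ordinary smooth set.  The spacetime, horizon
   included, is {(t~, y) : |y| >= r_+}.  Tensor fields are total functions on
   the whole coordinate space; only their values on (a neighbourhood of) the
   spacetime matter.  Index 0 is t~, index lift ord0 i is y_i. *)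

Section coordinates.
Context {R : realType}.

Definition ev (t : R) (y : 'rV[R]_3) : 'rV[R]_4 :=
  \row_(i < 4) oapp (fun j : 'I_3 => y 0 j) t (unlift ord0 i).
Definition sp (p : 'rV[R]_4) : 'rV[R]_3 := \row_(j < 3) p 0 (lift ord0 j).
Definition row3 (u v w : R) : 'rV[R]_3 := \row_(i < 3) [:: u; v; w]`_i.
Definition radius (y : 'rV[R]_3) : R := Num.sqrt (\sum_(i < 3) y 0 i ^+ 2).

Definition sph (q : R * R * R) : 'rV[R]_3 :=
  let: (r, th, ph) := q in
  row3 (r * sin th * cos ph) (r * sin th * sin ph) (r * cos th).
Definition sph_th (q : R * R * R) : 'rV[R]_3 :=
  let: (r, th, ph) := q in
  row3 (r * cos th * cos ph) (r * cos th * sin ph) (- (r * sin th)).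
Definition sph_ph (q : R * R * R) : 'rV[R]_3 :=
  let: (r, th, ph) := q in
  row3 (- (r * sin th * sin ph)) (r * sin th * cos ph) 0.

End coordinates.

Section calculus.
Context {R : realType} {n : nat}.
Implicit Types (f : 'rV[R]_n.+1 -> R) (p : 'rV[R]_n.+1).

Definition pd (i : 'I_n.+1) f : 'rV[R]_n.+1 -> R :=
  fun p => 'D_(delta_mx 0 i) f p.

Definition pds (s : seq 'I_n.+1) f : 'rV[R]_n.+1 -> R := foldr pd f s.

Definition smooth_near (A : set 'rV[R]_n.+1) f : Prop :=
  exists U : set 'rV[R]_n.+1, [/\ open U, A `<=` U &
    forall (s : seq 'I_n.+1) p, U p -> differentiable (pds s f) p].

Definition smooth_mx_near (A : set 'rV[R]_n.+1) (k l : nat)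
    (F : 'rV[R]_n.+1 -> 'M[R]_(k, l)) : Prop :=
  forall i j, smooth_near A (fun p => F p i j).

End calculus.

(* Covariant tensors of rank two are 4 x 4 matrices, vectors and covectors are
   row vectors. *)
Section tensors.
Context {R : realType}.
Local Notation pt := 'rV[R]_4.

Definition two_form (F : pt -> 'M[R]_4) : Prop := forall p, (F p)^T = - F p.

Definition d1 (A : pt -> 'rV[R]_4) (p : pt) : 'M[R]_4 :=
  \matrix_(i, j) (pd i (fun q => A q 0 j) p - pd j (fun q => A q 0 i) p).

Definition d2 (F : pt -> 'M[R]_4) (i j k : 'I_4) (p : pt) : R :=
  pd i (fun q => F q j k) p + pd j (fun q => F q k i) p
  + pd k (fun q => F q i j) p.

Definition lie (X : pt -> 'rV[R]_4) (F : pt -> 'M[R]_4) (p : pt) : 'M[R]_4 :=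
  \matrix_(i, j) (\sum_k X p 0 k * pd k (fun q => F q i j) p
     + \sum_k F p k j * pd i (fun q => X q 0 k) p
     + \sum_k F p i k * pd j (fun q => X q 0 k) p).

Definition pair (g : 'M[R]_4) (u v : 'rV[R]_4) : R := (u *m g *m v^T) 0 0.

Definition levi_civita (i j k l : 'I_4) : R :=
  \sum_(s : 'S_4 | [&& s 0 == i, s 1 == j, s 2 == k & s 3 == l])
     (-1) ^+ odd_perm s.

(* Orientation: dt~ /\ dy_1 /\ dy_2 /\ dy_3 > 0. *)
Definition star (g F : 'M[R]_4) : 'M[R]_4 :=
  \matrix_(i, j) (2^-1 * Num.sqrt (- \det g) *
    \sum_k \sum_l levi_civita i j k l * (invmx g *m F *m invmx g) k l).

(* G_{mu al} G_nu^al - (1/4) g_{mu nu} G_{al be} G^{al be} *)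
Definition stress (g G : 'M[R]_4) : 'M[R]_4 :=
  G *m invmx g *m G^T
  - (4^-1 * \tr (G *m invmx g *m G^T *m invmx g)) *: g.

Definition wedge (u v : 'rV[R]_4) : 'M[R]_4 := u^T *m v - v^T *m u.

End tensors.

(* Parameters, time function tau, its leaves as graphs t~ = hgt (ev tau y), and
   the multiplier N.  The hypotheses on them are stated separately below. *)
Record setting (R : realType) := Setting {
  mass : R;
  spin : R;
  chg : R;
  tau : 'rV[R]_4 -> R;
  hgt : 'rV[R]_4 -> R;
  mult : 'rV[R]_4 -> 'rV[R]_4 }.

(* Cauchy data (E, B) on a leaf, as one-forms in the coordinates y:
   E = F(., n), B = - (star F)(., n), so that F = n /\ E + star (n /\ B). *)
Definition data (R : realType) : Type :=
  ('rV[R]_3 -> 'rV[R]_3) * ('rV[R]_3 -> 'rV[R]_3).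

Section kerr_newman.
Context {R : realType} (B : setting R).
Local Notation pt := 'rV[R]_4.
Local Notation M := (mass B).
Local Notation a := (spin B).
Local Notation Q := (chg B).

Definition subextremal : Prop := 0 < M /\ a ^+ 2 + Q ^+ 2 < M ^+ 2.

Definition rplus : R := M + Num.sqrt (M ^+ 2 - a ^+ 2 - Q ^+ 2).
Definition Delta (r : R) : R := r ^+ 2 - 2 * M * r + a ^+ 2 + Q ^+ 2.
(* r^2 + a^2 cos^2(theta) *)
Definition SigmaKN (y : 'rV[R]_3) : R :=
  radius y ^+ 2 + a ^+ 2 * (y 0 2 / radius y) ^+ 2.

Definition cov_dt : 'rV[R]_4 := ev 1 0.
Definition cov_dr (p : pt) : 'rV[R]_4 := ev 0 ((radius (sp p))^-1 *: sp p).
(* sin^2(theta) dphi~ = (y_1 dy_2 - y_2 dy_1) / r^2 *)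
Definition cov_phi (p : pt) : 'rV[R]_4 :=
  ev 0 ((radius (sp p) ^+ 2)^-1 *: row3 (- sp p 0 1) (sp p 0 0) 0).
(* dt~ + dr - a sin^2(theta) dphi~ *)
Definition cov_l (p : pt) : 'rV[R]_4 := cov_dt + cov_dr p - a *: cov_phi p.
(* dy_1^2 + dy_2^2 + dy_3^2 *)
Definition flat3 : 'M[R]_4 := 1%:M - cov_dt^T *m cov_dt.

(* The Kerr-Newman metric in the coordinates (t~, y),
   - dt~^2 + (dr - a sin^2(theta) dphi~)^2 + Sigma (dtheta^2 + sin^2(theta)
   dphi~^2) + (2Mr - Q^2)/Sigma (dt~ + dr - a sin^2(theta) dphi~)^2;
   [kn_metric_BL] below is the comparison with the Boyer-Lindquist form. *)
Definition kn_metric (p : pt) : 'M[R]_4 :=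
  let r := radius (sp p) in
  let S := SigmaKN (sp p) in
  let u := cov_dr p - a *: cov_phi p in
  - (cov_dt^T *m cov_dt) + u^T *m u
  + (S / r ^+ 2) *: (flat3 - (cov_dr p)^T *m cov_dr p)
  + ((2 * M * r - Q ^+ 2) / S) *: ((cov_l p)^T *m cov_l p).

Definition exterior : set pt := [set p | rplus <= radius (sp p)].
Definition slice_dom : set 'rV[R]_3 := [set y | rplus <= radius y].

Definition hodge (F : pt -> 'M[R]_4) (p : pt) : 'M[R]_4 :=
  star (kn_metric p) (F p).

Definition maxwell_on (A : set pt) (F : pt -> 'M[R]_4) : Prop :=
  forall p, A p -> forall i j k, d2 F i j k p = 0 /\ d2 (hodge F) i j k p = 0.

(* Commutation fields: T, Phi, r d_r and the rotations of the spheres. *)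

Definition Tfield (p : pt) : 'rV[R]_4 := ev 1 0.
Definition rot1 (p : pt) : 'rV[R]_4 := ev 0 (row3 0 (- sp p 0 2) (sp p 0 1)).
Definition rot2 (p : pt) : 'rV[R]_4 := ev 0 (row3 (sp p 0 2) 0 (- sp p 0 0)).
Definition rot3 (p : pt) : 'rV[R]_4 := ev 0 (row3 (- sp p 0 1) (sp p 0 0) 0).
Definition Phifield : pt -> 'rV[R]_4 := rot3.
Definition rdr (p : pt) : 'rV[R]_4 := ev 0 (sp p).

Definition commutator_field (c : 'I_6) : pt -> 'rV[R]_4 :=
  nth (fun=> 0) [:: Tfield; Phifield; rdr; rot1; rot2; rot3] c.

Definition lie_word (w : seq 'I_6) (G : pt -> 'M[R]_4) : pt -> 'M[R]_4 :=
  foldr (fun c H => lie (commutator_field c) H) G w.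

(* The foliation. *)

Definition dtau (p : pt) : 'rV[R]_4 := \row_i pd i (tau B) p.

Definition leaf (s : R) : set pt := [set p | exterior p /\ tau B p = s].

Definition emb (s : R) (y : 'rV[R]_3) : pt := ev (hgt B (ev s y)) y.

(* Push-forward to spacetime of a coordinate vector v of the leaf at y. *)
Definition lift_vec (s : R) (y v : 'rV[R]_3) : 'rV[R]_4 :=
  ev (\sum_i v 0 i * pd (lift ord0 i) (hgt B) (ev s y)) v.

Definition frame (s : R) (y : 'rV[R]_3) (i : 'I_3) : 'rV[R]_4 :=
  lift_vec s y (delta_mx 0 i).

Definition ind_metric (s : R) (y : 'rV[R]_3) : 'M[R]_3 :=
  \matrix_(i, j) pair (kn_metric (emb s y)) (frame s y i) (frame s y j).

Definition vol_density (s : R) (y : 'rV[R]_3) : R :=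
  Num.sqrt (\det (ind_metric s y)).

Definition normal (p : pt) : 'rV[R]_4 :=
  let gi := invmx (kn_metric p) in
  - (Num.sqrt (- pair gi (dtau p) (dtau p)))^-1 *: (dtau p *m gi).

(* "Tortoise correction": t = t~ - (r_* - r) with d(r_* - r)/dr =
   (2Mr - Q^2)/Delta = O(1/r), so t and t~ are both of the far form below. *)
Definition regular_foliation : Prop :=
  [/\ smooth_near exterior (tau B),
      smooth_near exterior (hgt B),
      forall t s y, slice_dom y -> tau B (ev t y) = s <-> t = hgt B (ev s y),
      forall p, exterior p ->
        pair (invmx (kn_metric p)) (dtau p) (dtau p) < 0 /\
        pair (invmx (kn_metric p)) (dtau p) cov_dt < 0 &
      (forall r1 : R, exists2 C : R, 0 < C & forall s s' y,
          slice_dom y -> radius y <= r1 ->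
          vol_density s y <= C * vol_density s' y) /\
      exists (R0 : R) (psi : R -> R) (C : R),
        [/\ rplus < R0,
            forall p, R0 <= radius (sp p) ->
              tau B p = p 0 0 + psi (radius (sp p)) &
            forall r, R0 < r ->
              derivable psi r 1 /\ `|r * derive1 psi r| <= C]].

(* Red-shift multiplier: near the horizon N is stationary and the divergence
   T^{mu nu} nabla_mu N_nu = (1/2) T^{mu nu} (L_N g)_{mu nu} of its energy
   current dominates T(N, N). *)
Definition redshift_multiplier : Prop :=
  [/\ smooth_mx_near exterior (mult B),
      forall p, exterior p ->
        pair (kn_metric p) (mult B p) (mult B p) < 0 /\ 0 < mult B p 0 0,
      exists R1 : R, forall p, R1 <= radius (sp p) -> mult B p = Tfield p &
      exists (r0 b : R), [/\ rplus < r0, 0 < b &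
        forall p, exterior p -> radius (sp p) <= r0 ->
          (forall j, pd 0 (fun q => mult B q 0 j) p = 0) /\
          forall G : 'M[R]_4, G^T = - G ->
            let g := kn_metric p in
            b * pair (stress g G) (mult B p) (mult B p) <=
            2^-1 * \tr (invmx g *m stress g G *m invmx g
                        *m lie (mult B) kn_metric p)]].

(* Integration over the leaves: dy = r^2 sin(theta) dr dtheta dphi~. *)

Local Notation leb := (@lebesgue_measure R).
Definition mu2 := (leb \x leb)%E.
Definition mu3 := (mu2 \x leb)%E.

Definition sph_dom (K : set R) : set (R * R * R) :=
  [set q | [/\ K q.1.1, 0 <= q.1.2 <= pi & 0 <= q.2 <= 2 * pi]].

Definition ext_sph : set (R * R * R) := sph_dom [set r | rplus <= r].

Definition leaf_integral (s : R) (K : set R) (f : 'rV[R]_3 -> R) : \bar R :=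
  (\int[mu3]_(q in sph_dom K)
     (f (sph q) * (vol_density s (sph q) * q.1.1 ^+ 2 * sin q.1.2))%:E)%E.

(* Two-forms along a leaf, T(N, n) energies. *)

Definition slice (s : R) (F : pt -> 'M[R]_4) : 'rV[R]_3 -> 'M[R]_4 :=
  fun y => F (emb s y).

Definition energy0 (s : R) (G : 'rV[R]_3 -> 'M[R]_4) : \bar R :=
  leaf_integral s [set r | rplus <= r] (fun y =>
    pair (stress (kn_metric (emb s y)) (G y))
      (mult B (emb s y)) (normal (emb s y))).

Definition energy (k : nat) (s : R) (G : pt -> 'M[R]_4) : \bar R :=
  (\sum_(m < k.+1) \sum_(w : m.-tuple 'I_6)
     energy0 s (slice s (lie_word w G)))%E.

(* Charges of a two-form along a leaf. *)

Definition flux (s : R) (G : 'rV[R]_3 -> 'M[R]_4) (r : R) : R :=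
  \int[mu2]_(q in [set q | 0 <= q.1 <= pi /\ 0 <= q.2 <= 2 * pi])
    (let x := (r, q.1, q.2) in
     pair (G (sph x)) (lift_vec s (sph x) (sph_th x))
       (lift_vec s (sph x) (sph_ph x))).

Definition chargeB (s : R) (G : 'rV[R]_3 -> 'M[R]_4) : R :=
  (4 * pi)^-1 * lim (flux s G r @[r --> +oo%R]).
Definition chargeE (s : R) (G : 'rV[R]_3 -> 'M[R]_4) : R :=
  chargeB s (fun y => star (kn_metric (emb s y)) (G y)).

(* The stationary fields.  In the ingoing coordinates
     -(r/Sigma)(dt - a sin^2(theta) dphi)
       = -(r/Sigma)(dt~ + dr - a sin^2(theta) dphi~) + (r/Delta) dr,
   and (r/Delta) dr is closed, so the potential below has the same
   differential and is regular at the horizon. *)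

Definition potential (p : pt) : 'rV[R]_4 :=
  - (radius (sp p) / SigmaKN (sp p)) *: cov_l p.

(* The factor Num.sg is the sign making the charge positive. *)
Definition Fe (p : pt) : 'M[R]_4 :=
  Num.sg (chargeE 0 (slice 0 (d1 potential))) *: d1 potential p.
Definition Fm (p : pt) : 'M[R]_4 :=
  Num.sg (chargeB 0 (slice 0 (hodge Fe))) *: hodge Fe p.
Definition Fstat (qe qb : R) (p : pt) : 'M[R]_4 := qe *: Fe p + qb *: Fm p.

Local Notation data := (data R).

Definition add_data (U V : data) : data :=
  (fun y => U.1 y + V.1 y, fun y => U.2 y + V.2 y).
Definition scale_data (c : R) (U : data) : data :=
  (fun y => c *: U.1 y, fun y => c *: U.2 y).
Definition sub_data (U V : data) : data := add_data U (scale_data (-1) V).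
Definition zero_data : data := (fun=> 0, fun=> 0).

Definition data_of (s : R) (G : 'rV[R]_3 -> 'M[R]_4) : data :=
  (fun y => \row_i pair (G y) (frame s y i) (normal (emb s y)),
   fun y => \row_i - pair (star (kn_metric (emb s y)) (G y))
                       (frame s y i) (normal (emb s y))).

(* Extension of a one-form of the leaf to the covector that kills n. *)
Definition ext_cov (s : R) (y e : 'rV[R]_3) : 'rV[R]_4 :=
  let n := normal (emb s y) in
  ev 0 e + (\sum_i e 0 i * n 0 (lift ord0 i)) *: (n *m kn_metric (emb s y)).

Definition field_of (s : R) (U : data) (y : 'rV[R]_3) : 'M[R]_4 :=
  let g := kn_metric (emb s y) in
  let n := normal (emb s y) *m g in
  wedge n (ext_cov s y (U.1 y)) + star g (wedge n (ext_cov s y (U.2 y))).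

Definition divergence (s : R) (e : 'rV[R]_3 -> 'rV[R]_3) (y : 'rV[R]_3) : R :=
  (vol_density s y)^-1 *
  \sum_i pd i (fun z => vol_density s z *
                 (e z *m invmx (ind_metric s z)) 0 i) y.

Definition smooth_data (U : data) : Prop :=
  [/\ smooth_mx_near slice_dom U.1, smooth_mx_near slice_dom U.2 &
      forall y, slice_dom y ->
        divergence 0 U.1 y = 0 /\ divergence 0 U.2 y = 0].

(* G restricts to U on Sigma_0 and solves Maxwell's equations to infinite order
   there.  This determines all derivatives of G on Sigma_0 from U, and is how
   the time derivatives in the energies of Cauchy data are eliminated. *)
Definition prolongs (U : data) (G : pt -> 'M[R]_4) : Prop :=
  [/\ two_form G, smooth_mx_near (leaf 0) G,
      forall y, slice_dom y ->
        (data_of 0 (slice 0 G)).1 y = U.1 y /\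
        (data_of 0 (slice 0 G)).2 y = U.2 y &
      forall (w : seq 'I_4) i j k p, leaf 0 p ->
        pds w (d2 G i j k) p = 0 /\ pds w (d2 (hodge G) i j k) p = 0].

Definition measurable_data (U : data) : Prop :=
  forall i, measurable_fun ext_sph (fun q => U.1 (sph q) 0 i) /\
            measurable_fun ext_sph (fun q => U.2 (sph q) 0 i).

Definition data_ae_eq (U V : data) : Prop :=
  {ae mu3, forall q, ext_sph q ->
     U.1 (sph q) = V.1 (sph q) /\ U.2 (sph q) = V.2 (sph q)}.

Definition energy_cauchy (e : nat -> nat -> \bar R) : Prop :=
  forall eps : R, 0 < eps ->
    exists n0 : nat, forall m n, (n0 <= m)%N -> (n0 <= n)%N -> (e m n <= eps%:E)%E.

(* Elements of the completions are represented by measurable data modulo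
   almost everywhere equality: Us, with prolongations Gs, is a sequence of
   smooth constrained data of finite energy that is Cauchy for the energy of
   order k and converges to U in the energy of order 0. *)
Definition approximates (k : nat) (U : data) (Us : nat -> data)
    (Gs : nat -> pt -> 'M[R]_4) : Prop :=
  [/\ forall n, smooth_data (Us n) /\ prolongs (Us n) (Gs n),
      forall n, (energy k 0 (Gs n) < +oo)%E,
      energy_cauchy (fun m n => energy k 0 (fun p => Gs m p - Gs n p)%R) &
      (fun n => energy0 0 (field_of 0 (sub_data (Us n) U))) @ \oo --> 0%E].

Definition neutral (U : data) : Prop :=
  chargeE 0 (field_of 0 U) = 0 /\ chargeB 0 (field_of 0 U) = 0.

Definition H0space (k : nat) (U : data) : Prop :=
  measurable_data U /\
  exists Us Gs, approximates k U Us Gs /\ forall n, neutral (Us n).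

(* The norm of the completion, the limit of the norms along an approximating
   sequence. *)
Definition H0norm (k : nat) (U : data) : R :=
  inf [set nu : R | 0 <= nu /\ exists Us Gs,
    [/\ approximates k U Us Gs, forall n, neutral (Us n) &
        (fun n => energy k 0 (Gs n)) @ \oo --> (nu ^+ 2)%:E]].

Definition Ue : data := data_of 0 (slice 0 Fe).
Definition Um : data := data_of 0 (slice 0 Fm).
Definition stat_data (qe qb : R) : data :=
  add_data (scale_data qe Ue) (scale_data qb Um).
Definition stat_span (U : data) : Prop :=
  exists qe qb : R, data_ae_eq U (stat_data qe qb).

Definition Hspace (k : nat) (U : data) : Prop :=
  measurable_data U /\ exists (qe qb : R) (U0 : data),
    H0space k U0 /\ data_ae_eq U (add_data (stat_data qe qb) U0).

(* Charges of finite-energy data: the extension by continuity, in the energy of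
   order 0, of the charges of smooth data. *)
Definition extends_charge (q : data -> R) (U : data) (c : R) : Prop :=
  exists Us Gs, approximates 0 U Us Gs /\ (fun n => q (Us n)) @ \oo --> c.
Definition qE (U : data) : R :=
  get [set c | extends_charge (fun V => chargeE 0 (field_of 0 V)) U c].
Definition qB (U : data) : R :=
  get [set c | extends_charge (fun V => chargeB 0 (field_of 0 V)) U c].

Definition Pi_stat (U : data) : data := stat_data (qE U) (qB U).
Definition Pi_0 (U : data) : data := sub_data U (Pi_stat U).

Definition admissible_norm (k : nat) (nu : data -> R) : Prop :=
  [/\ forall U V, Hspace k U -> Hspace k V ->
        nu (add_data U V) <= nu U + nu V,
      forall c U, Hspace k U -> nu (scale_data c U) = `|c| * nu U &
      exists c C : R, [/\ 0 < c, 0 < C &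
        forall (qe qb : R) (U0 U : data), H0space k U0 -> measurable_data U ->
          data_ae_eq U (add_data (stat_data qe qb) U0) ->
          let n := Num.sqrt (qe ^+ 2 + qb ^+ 2 + H0norm k U0 ^+ 2) in
          c * n <= nu U <= C * n]].

(* Finite-energy solutions, in the future {tau >= 0} of Sigma_0. *)

Definition slab (t : R) : set pt := [set p | exterior p /\ 0 <= tau B p <= t].

Definition field_ae_eq (F G : pt -> 'M[R]_4) : Prop :=
  forall s, 0 <= s -> {ae mu3, forall q, ext_sph q ->
     slice s F (sph q) = slice s G (sph q)}.

Definition finite_energy_maxwell (k : nat) (F : pt -> 'M[R]_4) : Prop :=
  [/\ two_form F,
      forall s i j, 0 <= s ->
        measurable_fun ext_sph (fun q => slice s F (sph q) i j),
      Hspace k (data_of 0 (slice 0 F)) &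
      forall t : R, 0 < t -> exists Fs : nat -> pt -> 'M[R]_4,
        [/\ forall n, [/\ two_form (Fs n), smooth_mx_near (slab t) (Fs n)
                        & maxwell_on (slab t) (Fs n)],
            forall eps : R, 0 < eps ->
              exists n0 : nat, forall m n s, (n0 <= m)%N -> (n0 <= n)%N ->
                0 <= s <= t ->
                (energy k s (fun p => Fs m p - Fs n p)%R <= eps%:E)%E &
            forall eps : R, 0 < eps ->
              exists n0 : nat, forall n s, (n0 <= n)%N -> 0 <= s <= t ->
                (energy0 s (slice s (fun p => Fs n p - F p)%R) <= eps%:E)%E]].

(* The charges are conserved; they are read off on Sigma_0. *)
Definition qE_field (F : pt -> 'M[R]_4) : R := qE (data_of 0 (slice 0 F)).
Definition qB_field (F : pt -> 'M[R]_4) : R := qB (data_of 0 (slice 0 F)).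

(* Local L^2 norms on Sigma_s, K a set of radii. *)

Definition local_density (s : R) (U : data) (y : 'rV[R]_3) : R :=
  let hi := invmx (ind_metric s y) in
  (U.1 y *m hi *m (U.1 y)^T) 0 0 + (U.2 y *m hi *m (U.2 y)^T) 0 0.

Definition local_L2 (K : set R) (s : R) (U : data) : R :=
  Num.sqrt (fine (leaf_integral s K (local_density s U))).

Definition local_norm_equiv (K : set R) (nu : R -> data -> R) : Prop :=
  exists c C : R, [/\ 0 < c, 0 < C &
    forall s U, measurable_data U ->
      (leaf_integral s K (local_density s U) < +oo)%E ->
      c * local_L2 K s U <= nu s U <= C * local_L2 K s U].

Definition decays_locally (nu : R -> data -> R) (F : pt -> 'M[R]_4) : Prop :=
  nu s (data_of s (slice s F)) @[s --> +oo%R] --> (0 : R).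

End kerr_newman.

(* Comparison with Boyer-Lindquist coordinates. *)
Section boyer_lindquist.
Context {R : realType} (B : setting R).
Local Notation M := (mass B).
Local Notation a := (spin B).
Local Notation Q := (chg B).

(* The vector vt d_t~ + vr d_r + vth d_theta + vph d_phi~ at sph q. *)
Definition sph_vec (q : R * R * R) (vt vr vth vph : R) : 'rV[R]_4 :=
  ev vt (vr *: sph (1, q.1.2, q.2) + vth *: sph_th q + vph *: sph_ph q).

Lemma sp_ev (t : R) y : sp (ev t y) = y.
Proof. by apply/rowP => j; rewrite !mxE liftK. Qed.

Lemma dot_ev (s t : R) x y :
  (ev s x *m (ev t y)^T) 0 0 = s * t + \sum_i x 0 i * y 0 i.
Proof.
rewrite mxE big_ord_recl; congr (_ + _); first by rewrite !mxE unlift_none.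
by apply: eq_bigr => i _; rewrite !mxE liftK.
Qed.

Lemma pair_outer (u v : 'rV[R]_4) :
  pair (u^T *m u) v v = ((u *m v^T) 0 0) ^+ 2.
Proof.
rewrite /pair !mulmxA -mulmxA.
have -> : v *m u^T = (u *m v^T)^T by rewrite trmx_mul trmxK.
by rewrite mxE big_ord1 mxE expr2.
Qed.

Lemma pairD (g h : 'M[R]_4) u v : pair (g + h) u v = pair g u v + pair h u v.
Proof. by rewrite /pair mulmxDr mulmxDl mxE. Qed.
Lemma pairN (g : 'M[R]_4) u v : pair (- g) u v = - pair g u v.
Proof. by rewrite /pair mulmxN mulNmx mxE. Qed.
Lemma pairZ c (g : 'M[R]_4) u v : pair (c *: g) u v = c * pair g u v.
Proof. by rewrite /pair -scalemxAr -scalemxAl mxE. Qed.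

Lemma addE (A C : 'M[R]_1) : (A + C) 0 0 = A 0 0 + C 0 0.
Proof. by rewrite mxE. Qed.
Lemma subZE (A C : 'M[R]_1) c : (A - c *: C) 0 0 = A 0 0 - c * C 0 0.
Proof. by rewrite !mxE. Qed.

Lemma sum3 (f : 'I_3 -> R) : \sum_i f i = f 0 + f 1 + f 2.
Proof.
rewrite !big_ord_recr big_ord0 /= add0r.
by congr (f _ + f _ + f _); apply: val_inj.
Qed.

Lemma radius_sph (r th ph : R) : 0 <= r -> radius (sph (r, th, ph)) = r.
Proof.
move=> r0; rewrite /radius sum3 !mxE /=.
have -> : (r * sin th * cos ph) ^+ 2 + (r * sin th * sin ph) ^+ 2
          + (r * cos th) ^+ 2 = r ^+ 2.
  have c2 : cos th ^+ 2 = 1 - sin th ^+ 2 by rewrite cos2sin2.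
  have d2 : cos ph ^+ 2 = 1 - sin ph ^+ 2 by rewrite cos2sin2.
  by rewrite !exprMn c2 d2; ring.
by rewrite sqrtr_sqr ger0_norm.
Qed.

Section at_point.
Variables (t r th ph vt vr vth vph : R).
Hypotheses (r_gt0 : 0 < r) (Delta_neq0 : Delta B r != 0).
Let p := ev t (sph (r, th, ph)).
Let v := sph_vec (r, th, ph) vt vr vth vph.
Let S := r ^+ 2 + a ^+ 2 * cos th ^+ 2.
Let dt := vt - (2 * M * r - Q ^+ 2) / Delta B r * vr.
Let dphi := vph - a / Delta B r * vr.

Let c2 : cos th ^+ 2 = 1 - sin th ^+ 2. Proof. by rewrite cos2sin2. Qed.
Let d2 : cos ph ^+ 2 = 1 - sin ph ^+ 2. Proof. by rewrite cos2sin2. Qed.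

Let SE : SigmaKN B (sp p) = S.
Proof.
rewrite /SigmaKN sp_ev radius_sph ?ltW// /S !mxE /=.
by rewrite [r * _]mulrC mulfK ?gt_eqF.
Qed.

Let S_neq0 : S != 0.
Proof.
by rewrite gt_eqF// /S ltr_pwDl ?exprn_gt0// mulr_ge0 ?sqr_ge0.
Qed.

Let dtv : (cov_dt *m v^T) 0 0 = vt.
Proof. by rewrite /cov_dt dot_ev sum3 !mxE; ring. Qed.

Let drv : (cov_dr p *m v^T) 0 0 = vr.
Proof.
rewrite /cov_dr sp_ev dot_ev radius_sph ?ltW// sum3 !mxE /=.
have r0 : r != 0 by rewrite gt_eqF.
transitivity (vr * (sin th ^+ 2 * (cos ph ^+ 2 + sin ph ^+ 2) + cos th ^+ 2)
  + r * vth * (cos th * sin th * (cos ph ^+ 2 + sin ph ^+ 2 - 1))).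
  by field.
by rewrite c2 d2; ring.
Qed.

Let phv : (cov_phi p *m v^T) 0 0 = sin th ^+ 2 * vph.
Proof.
rewrite /cov_phi sp_ev dot_ev radius_sph ?ltW// sum3 !mxE /=.
have r0 : r != 0 by rewrite gt_eqF.
transitivity (sin th ^+ 2 * (cos ph ^+ 2 + sin ph ^+ 2) * vph).
  by field.
by rewrite d2; ring.
Qed.

Let flatv : pair flat3 v v
  = vr ^+ 2 + r ^+ 2 * vth ^+ 2 + r ^+ 2 * sin th ^+ 2 * vph ^+ 2.
Proof.
rewrite /flat3 pairD pairN pair_outer dtv /pair mulmx1 dot_ev sum3 !mxE /=.
transitivity (sin th ^+ 2 * (cos ph ^+ 2 + sin ph ^+ 2)
      * (vr ^+ 2 + r ^+ 2 * vph ^+ 2) + cos th ^+ 2 * vr ^+ 2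
    + r ^+ 2 * vth ^+ 2 * (cos th ^+ 2 * (cos ph ^+ 2 + sin ph ^+ 2)
                           + sin th ^+ 2)
    + 2 * r * vr * vth * sin th * cos th * (cos ph ^+ 2 + sin ph ^+ 2 - 1)).
  by ring.
by rewrite c2 d2; ring.
Qed.

Let lv : (cov_l B p *m v^T) 0 0 = vt + vr - a * (sin th ^+ 2 * vph).
Proof.
by rewrite /cov_l mulmxBl mulmxDl -scalemxAl subZE addE dtv drv phv.
Qed.

Let uv : ((cov_dr p - a *: cov_phi p) *m v^T) 0 0 = vr - a * (sin th ^+ 2 * vph).
Proof. by rewrite mulmxBl -scalemxAl subZE drv phv. Qed.

Lemma kn_metric_BL : pair (kn_metric B p) v v =
  - ((Delta B r - a ^+ 2 * sin th ^+ 2) / S) * dt ^+ 2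
  - 2 * a * sin th ^+ 2 * (r ^+ 2 + a ^+ 2 - Delta B r) / S * (dt * dphi)
  + ((r ^+ 2 + a ^+ 2) ^+ 2 - a ^+ 2 * Delta B r * sin th ^+ 2) / S
      * sin th ^+ 2 * dphi ^+ 2
  + S / Delta B r * vr ^+ 2 + S * vth ^+ 2.
Proof.
rewrite /kn_metric SE; have := flatv; move: flat3 => f fE.
rewrite !pairD !pairN !pairZ !pairD !pairN !pair_outer.
rewrite dtv drv uv lv fE sp_ev radius_sph ?ltW// /dt /dphi.
have r0 : r != 0 by rewrite gt_eqF.
have := S_neq0; have := Delta_neq0; rewrite /S /Delta c2 => D0 S0.
by field; rewrite ?r0 ?D0 ?S0.
Qed.

Lemma potential_BL : (potential B p *m v^T) 0 0 =
  - (r / S) * (dt - a * sin th ^+ 2 * dphi) - r / Delta B r * vr.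
Proof.
rewrite /potential SE -scalemxAl mxE lv sp_ev radius_sph ?ltW// /dt /dphi.
have := S_neq0; have := Delta_neq0; rewrite /S /Delta c2 => D0 S0.
by field; rewrite ?D0 ?S0.
Qed.

End at_point.
End boyer_lindquist.

(* Main.v *)
(**
  A stationary field is a constant combination of F_e and its Hodge dual, written here in
  horizon-penetrating Kerr-Schild coordinates, where both are smooth up to and across the
  horizon. The charges are fluxes of closed two-forms through spheres. By Gauss's law such a
  flux does not depend on the radius, so it equals its average over a compact shell, and the
  Cauchy-Schwarz inequality bounds it by the energy of order 0. Hence the charges are continuous
  for the energy norm: they vanish on the completion of the zero-charge data, are additive
  along approximating sequences, and separate the two summands. The stationary fields belong to
  the space because their energy density is O(r^-4) against the volume r^2 dr.

  For the absence of decay, E.E - B.B and E.B do not depend on the observer, and for a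
  stationary field (E.E - B.B)^2 + 4 (E.B)^2 = (qe^2 + qb^2)^2 / Sigma^4. Therefore
  E.E + B.B >= (qe^2 + qb^2) / Sigma^2 on every leaf, a bound independent of time.
*)
From HB Require Import structures.
From mathcomp Require Import all_boot all_order all_algebra.
From mathcomp Require Import perm ring lra zify.
From mathcomp Require Import all_classical all_reals all_analysis measurable_realfun.
Require Import Defs.
Import Order.TTheory GRing.Theory Num.Theory.
Import numFieldNormedType.Exports.
Set Implicit Arguments.
Unset Strict Implicit.
Unset Printing Implicit Defensive.
Local Open Scope classical_set_scope.
Local Open Scope ring_scope.

(** * Rules for partial derivatives *)

Section partial_derivatives.
Context {R : realType} {n : nat}.
Implicit Types (f g : 'rV[R]_n.+1 -> R) (p : 'rV[R]_n.+1) (i : 'I_n.+1).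

(** The energy controls only square integrals over a leaf, whereas a charge is an integral over one
    sphere, on which an element of the completion has no trace; this is why the flux must be turned
    into a volume integral. Such an element is a class of measurable data, so [qE] and [qB] choose a
    limit along some approximating sequence and mean something only once that limit is unique. They
    are read off in order 0 for every [k]: adding a stationary field to an approximating sequence
    leaves its differences unchanged, and only the order-0 energy of the stationary field has to be
    finite. Passing from order [k] to order 0 requires every commuted term of the energy to be
    nonnegative, hence the dominant energy condition at each point of a leaf and antisymmetry of all
    Lie derivatives. The exterior is closed. Identities known only there cannot be differentiated at
    the horizon; they are proved in the interior and carried to the boundary by continuity. The
    stationary fields themselves are smooth and closed wherever [radius] is positive. *)

Lemma pd_cst i (c : R) p : pd i (fun=> c) p = 0.
Proof. exact: derive_cst. Qed.

Lemma pd_eq i f g p : (\near p, f p = g p) -> pd i f p = pd i g p.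
Proof. exact: near_eq_derive. Qed.

Lemma pdD i f g p : differentiable f p -> differentiable g p ->
  pd i (fun q => f q + g q) p = pd i f p + pd i g p.
Proof. by move=> df dg; apply: deriveD; apply: diff_derivable. Qed.

Lemma pdN i f p : differentiable f p -> pd i (fun q => - f q) p = - pd i f p.
Proof. by move=> df; apply: deriveN; apply: diff_derivable. Qed.

Lemma pdB i f g p : differentiable f p -> differentiable g p ->
  pd i (fun q => f q - g q) p = pd i f p - pd i g p.
Proof. by move=> df dg; apply: deriveB; apply: diff_derivable. Qed.

Lemma pdM i f g p : differentiable f p -> differentiable g p ->
  pd i (fun q => f q * g q) p = pd i f p * g p + f p * pd i g p.
Proof.
move=> df dg; rewrite /pd (deriveM (diff_derivable df) (diff_derivable dg)).
by rewrite addrC /GRing.scale /= [g p * _]mulrC.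
Qed.

Lemma pdV i f p : f p != 0 -> differentiable f p ->
  pd i (fun q => (f q)^-1) p = - pd i f p * ((f p)^-1 * (f p)^-1).
Proof.
move=> f0 df; rewrite /pd (deriveV f0 (diff_derivable df)).
by rewrite /GRing.scale /= -expr2 exprVn mulNr mulNr mulrC.
Qed.

Lemma pd_coord i j p : pd i (fun q => q 0 j) p = (i == j)%:R.
Proof.
rewrite /pd; have /= := @derive_mx R _ 1 n.+1 id p (delta_mx 0 i) (@derivable_id _ _ _ _).
by rewrite derive_id => /matrixP/(_ 0 j); rewrite !mxE eqxx /= eq_sym.
Qed.

Lemma differentiable_mx (V : normedModType R) (k l : nat) (G : V -> 'M[R]_(k, l)) (p : V) :
  (forall (i : 'I_k) j, differentiable (fun q => G q i j) p) -> differentiable G p.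
Proof.
move=> dG.
have -> : G = \sum_(i < k) \sum_(j < l) (fun q => G q i j *: delta_mx i j).
  apply/funext => q; rewrite {1}(matrix_sum_delta (G q)) fct_sumE.
  by apply: eq_bigr => i _; rewrite fct_sumE.
by apply: differentiable_sum => i; apply: differentiable_sum => j; apply: differentiableZl.
Qed.

Lemma derive_sum_pd f p (v : 'rV[R]_n.+1) : differentiable f p ->
  'D_v f p = \sum_i v 0 i * pd i f p.
Proof.
move=> df; rewrite deriveE// {1}[v]row_sum_delta linear_sum.
apply: eq_bigr => i _; rewrite linearZ /= /pd deriveE//.
Qed.

Lemma differentiable_sqrt f p : 0 < f p -> differentiable f p ->
  differentiable (fun q => Num.sqrt (f q)) p.
Proof.
move=> f0 df; apply: (@differentiable_comp _ _ _ _ f Num.sqrt) => //.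
apply/derivable1_diffP; have [] := is_derive1_sqrt f0 => //.
Qed.

Lemma pd_sqrt i f p : 0 < f p -> differentiable f p ->
  pd i (fun q => Num.sqrt (f q)) p = 2^-1 * (Num.sqrt (f p))^-1 * pd i f p.
Proof.
move=> f0 df.
have ds : differentiable Num.sqrt (f p).
  by apply/derivable1_diffP; have [] := is_derive1_sqrt f0 => //.
rewrite /pd deriveE; last exact: differentiable_sqrt.
rewrite (_ : (fun q => Num.sqrt (f q)) = Num.sqrt \o f)// diff_comp//=.
have := @deriveE _ _ _ Num.sqrt (f p) 1 ds.
rewrite derive_sqrt// => e1.
rewrite (_ : 'd f p (delta_mx 0 i) = ('D_(delta_mx 0 i) f p) *: 1); last first.
  by rewrite -deriveE// /GRing.scale /= mulr1.
by rewrite linearZ /= -e1 /GRing.scale /= mulrC invfM.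
Qed.

End partial_derivatives.

Lemma pd_comp {R : realType} {n m : nat} (f : 'rV[R]_m.+1 -> R)
  (G : 'rV[R]_n.+1 -> 'rV[R]_m.+1) p i :
  (forall j, differentiable (fun q => G q 0 j) p) -> differentiable f (G p) ->
  pd i (fun q => f (G q)) p = \sum_j pd i (fun q => G q 0 j) p * pd j f (G p).
Proof.
move=> dG df.
have dG' : differentiable G p.
  by apply: differentiable_mx => i0 j; rewrite (ord1 i0).
rewrite {1}/pd deriveE; last exact: (@differentiable_comp _ _ _ _ G f).
rewrite (_ : (fun q => f (G q)) = f \o G)// diff_comp//=.
rewrite -(deriveE _ df) derive_sum_pd//; apply: eq_bigr => j _; congr (_ * _).
rewrite -(deriveE _ dG') derive_mx ?mxE//; exact: diff_derivable.
Qed.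

(** A function that vanishes near a point has differential 0 there, its remainder being eventually
    0. Added to a differentiable function, it allows a change away from a neighbourhood; this is all
    that [near_eq_differentiable] uses. *)
Lemma near0_differentiable {R : numFieldType} {V W : normedModType R} (h : V -> W) (x : V) :
  (\near x, h x = 0) -> differentiable h x.
Proof.
move=> h0.
have E : h \o shift x = cst (h x) + (\0 : V -> W) +o_ 0 id.
  apply/eqaddoP => _/posnumP[eps].
  have hx0 : h x = 0 by exact: (nbhs_singleton h0).
  have := h0; rewrite (near_shift 0 x) subr0 /= => h0'.
  near=> y; rewrite /= !fctE /= hx0 addr0 subr0.
  have -> : h (y + x) = 0 by near: y.
  by rewrite normr0 mulr_ge0.
have e0 : 'd h x = 0 :> (V -> W) by apply/diff_unique; [exact: cst_continuous|exact: E].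
by apply/diff_locallyP; rewrite e0; split=> //; exact: cst_continuous.
Unshelve. all: by end_near. Qed.

Lemma near_eq_differentiable {R : numFieldType} {V W : normedModType R} (f g : V -> W) (x : V) :
  (\near x, f x = g x) -> differentiable f x -> differentiable g x.
Proof.
move=> fg df; rewrite (_ : g = f + (g - f)); last first.
  by apply/funext => y; rewrite !fctE addrC subrK.
apply: differentiableD => //; apply: near0_differentiable.
near=> y; rewrite !fctE; apply/eqP; rewrite subr_eq0 eq_sym; apply/eqP.
by near: y.
Unshelve. all: by end_near. Qed.

(** * Smoothness near a set and its closure properties *)

Section smooth.
Context {R : realType}.

(** [pds] adds derivatives on the outside; here they are peeled off from the inside, so that one
    product or quotient rule exposes functions of lower order and induction on [k] applies. The
    condition at level [k] is differentiability of every derivative of order at most [k]. *)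
Fixpoint Ck {n : nat} (U : set 'rV[R]_n.+1) (k : nat) (f : 'rV[R]_n.+1 -> R) : Prop :=
  if k is k'.+1 then (forall p, U p -> differentiable f p) /\ forall i, Ck U k' (pd i f)
  else forall p, U p -> differentiable f p.

Section one_domain.
Context {n : nat}.
Variable U : set 'rV[R]_n.+1.
Hypothesis oU : open U.
Implicit Types (f g : 'rV[R]_n.+1 -> R) (p : 'rV[R]_n.+1) (i : 'I_n.+1).

Lemma pds_rcons s i f : pds (rcons s i) f = pds s (pd i f).
Proof. by rewrite /pds foldr_rcons. Qed.

Lemma pds_CkP f :
  (forall (s : seq 'I_n.+1) p, U p -> differentiable (pds s f) p) <-> forall k, Ck U k f.
Proof.
split=> [sf k|].
  elim: k f sf => [|k IH] f sf /=; first exact: (sf [::]).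
  split; first exact: (sf [::]).
  by move=> i; apply: IH => s p Up; rewrite -pds_rcons; exact: sf.
move=> cf s; elim/last_ind: s f cf => [|s i IH] f cf p Up; first exact: (cf 0%N).
rewrite pds_rcons; apply: IH => //; move=> k; have [_ H] := cf k.+1; exact: H.
Qed.

Lemma Ck_diff k f p : Ck U k f -> U p -> differentiable f p.
Proof. by case: k => [|k] /= => [H|[H _]]; exact: H. Qed.

Lemma CkW k f : Ck U k.+1 f -> Ck U k f.
Proof.
elim: k f => [|k IH] f [df cf] //; split=> // i; apply: IH; exact: cf.
Qed.

Lemma near_on f g p : (forall p, U p -> f p = g p) -> U p -> \near p, f p = g p.
Proof.
by move=> fg Up; near=> q; apply: fg; near: q; exact: open_nbhs_nbhs.
Unshelve. all: by end_near. Qed.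

Lemma Ck_eq k f g : (forall p, U p -> f p = g p) -> Ck U k f -> Ck U k g.
Proof.
elim: k f g => [|k IH] f g fg /=.
  by move=> df p Up; apply: near_eq_differentiable (near_on fg Up) (df _ Up).
move=> [df cf]; split.
  by move=> p Up; apply: near_eq_differentiable (near_on fg Up) (df _ Up).
move=> i; apply: (IH (pd i f)) => // p Up; exact: pd_eq (near_on fg Up).
Qed.

Lemma Ck_cst k (c : R) : Ck U k (fun=> c).
Proof.
elim: k c => [|k IH] c /=; first by move=> p _; exact: differentiable_cst.
split=> [p _|i]; first exact: differentiable_cst.
by apply: Ck_eq (IH 0) => p _; rewrite pd_cst.
Qed.

Lemma Ck_coord k j : Ck U k (fun p => p 0 j).
Proof.
case: k => [|k] /=; first by move=> p _; exact: differentiable_coord.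
split=> [p _|i]; first exact: differentiable_coord.
by apply: Ck_eq (Ck_cst k (i == j)%:R) => p _; rewrite pd_coord.
Qed.

Lemma CkD k f g : Ck U k f -> Ck U k g -> Ck U k (fun p => f p + g p).
Proof.
elim: k f g => [|k IH] f g /=.
  by move=> df dg p Up; apply: differentiableD; [exact: df|exact: dg].
move=> [df cf] [dg cg]; split.
  by move=> p Up; apply: differentiableD; [exact: df|exact: dg].
move=> i; apply: Ck_eq (IH _ _ (cf i) (cg i)) => p Up.
by rewrite pdD//; [exact: df|exact: dg].
Qed.

Lemma CkM k f g : Ck U k f -> Ck U k g -> Ck U k (fun p => f p * g p).
Proof.
elim: k f g => [|k IH] f g.
  by move=> /= df dg p Up; apply: differentiableM; [exact: df|exact: dg].
move=> Cf Cg; have [df cf] := Cf; have [dg cg] := Cg; split.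
  by move=> p Up; apply: differentiableM; [exact: df|exact: dg].
move=> i; apply: Ck_eq (CkD (IH _ _ (cf i) (CkW Cg)) (IH _ _ (CkW Cf) (cg i))) => p Up.
by rewrite pdM//; [exact: df|exact: dg].
Qed.

Lemma CkN k f : Ck U k f -> Ck U k (fun p => - f p).
Proof.
move=> cf; apply: Ck_eq (CkM (Ck_cst k (-1)) cf) => p _; exact: mulN1r.
Qed.

(** The derivative of [1/f] is [- f' / f^2], a product in which [1/f] occurs one order lower, so the
    induction closes. The square root below works the same way, with [1 / sqrt f] supplied by this
    lemma. *)
Lemma CkV k f : (forall p, U p -> f p != 0) -> Ck U k f -> Ck U k (fun p => (f p)^-1).
Proof.
move=> f0; elim: k => [|k IH].
  by move=> /= df p Up; apply: differentiableV; [exact: df|exact: f0].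
move=> Cf; have [df cf] := Cf; split.
  by move=> p Up; apply: differentiableV; [exact: df|exact: f0].
have CV := IH (CkW Cf).
move=> i; apply: Ck_eq (CkM (CkN (cf i)) (CkM CV CV)) => p Up.
by rewrite pdV//; [exact: f0|exact: df].
Qed.

Lemma Ck_sqrt k f : (forall p, U p -> 0 < f p) -> Ck U k f ->
  Ck U k (fun p => Num.sqrt (f p)).
Proof.
move=> f0; elim: k => [|k IH].
  by move=> /= df p Up; apply: differentiable_sqrt; [exact: f0|exact: df].
move=> Cf; have [df cf] := Cf; split.
  by move=> p Up; apply: differentiable_sqrt; [exact: f0|exact: df].
have CV : Ck U k (fun p => (Num.sqrt (f p))^-1).
  by apply: CkV (IH (CkW Cf)) => p Up; rewrite gt_eqF// sqrtr_gt0 f0.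
move=> i; apply: Ck_eq (CkM (CkM (Ck_cst k 2^-1) CV) (cf i)) => p Up.
by rewrite pd_sqrt//; [exact: f0|exact: df].
Qed.

Lemma Ck_sum k (I : Type) (r : seq I) (P : pred I) (F : I -> 'rV[R]_n.+1 -> R) :
  (forall x : I, Ck U k (F x)) -> Ck U k (fun p => \sum_(i <- r | P i) F i p).
Proof.
move=> cF; elim: r => [|x r IH].
  by apply: Ck_eq (Ck_cst k 0) => p _; rewrite big_nil.
case Px: (P x); last by apply: Ck_eq IH => p _; rewrite big_cons Px.
by apply: Ck_eq (CkD (cF x) IH) => p _; rewrite big_cons Px.
Qed.

End one_domain.

Lemma Ck_sub {n} (U V : set 'rV[R]_n.+1) k f : U `<=` V -> Ck V k f -> Ck U k f.
Proof.
move=> UV; elim: k f => [|k IH] f /=; first by move=> df p /UV; exact: df.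
by move=> [df cf]; split=> [p /UV|i]; [exact: df|apply: IH; exact: cf].
Qed.

Lemma Ck_comp {n m} (U : set 'rV[R]_n.+1) (V : set 'rV[R]_m.+1) k f
  (G : 'rV[R]_n.+1 -> 'rV[R]_m.+1) : open U ->
  (forall p, U p -> V (G p)) -> (forall j, Ck U k (fun p => G p 0 j)) ->
  Ck V k f -> Ck U k (fun p => f (G p)).
Proof.
move=> oU GUV; elim: k f => [|k IH] f.
  move=> /= dG df p Up; apply: (@differentiable_comp _ _ _ _ G f).
    by apply: differentiable_mx => i j; rewrite (ord1 i); exact: dG.
  by apply: df; exact: GUV.
move=> CG [df cf]; split.
  move=> p Up; apply: (@differentiable_comp _ _ _ _ G f).
    by apply: differentiable_mx => i j; rewrite (ord1 i); exact: (CG j).1.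
  by apply: df; exact: GUV.
move=> i.
have CG' j : Ck U k (fun p => G p 0 j) by apply: CkW; exact: CG.
have H j := CkM oU ((CG j).2 i) (IH _ CG' (cf j)).
apply: Ck_eq (Ck_sum oU (index_enum 'I_m.+1) predT H) => // p Up.
rewrite pd_comp// => [j|]; first exact: (CG j).1.
by apply: df; exact: GUV.
Qed.

Section smooth_near.
Context {n : nat}.
Variable A : set 'rV[R]_n.+1.
Implicit Types (f g : 'rV[R]_n.+1 -> R).

Lemma smooth_nearP f : smooth_near A f <->
  exists U, [/\ open U, A `<=` U & forall k, Ck U k f].
Proof.
by split=> -[U [oU AU H]]; exists U; split=> //; apply/pds_CkP.
Qed.

Lemma smooth_near_eq (W : set 'rV[R]_n.+1) f g : open W -> A `<=` W ->
  (forall p, W p -> f p = g p) -> smooth_near A f -> smooth_near A g.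
Proof.
move=> oW AW fg /smooth_nearP[U [oU AU H]]; apply/smooth_nearP.
exists (U `&` W); split; first exact: openI.
  by move=> p Ap; split; [exact: AU|exact: AW].
move=> k; apply: (@Ck_eq _ _ (openI oU oW) _ f) => [p [_ /fg]//|].
by apply: Ck_sub (H k) => p [].
Qed.

Lemma smooth_near_ext f g : f =1 g -> smooth_near A f -> smooth_near A g.
Proof. by move=> /funext ->. Qed.

Lemma smooth_near_cst (c : R) : smooth_near A (fun=> c).
Proof. by apply/smooth_nearP; exists setT; split=> // [|k]; [exact: openT|exact: Ck_cst openT _ _]. Qed.

Lemma smooth_near_coord j : smooth_near A (fun p => p 0 j).
Proof. by apply/smooth_nearP; exists setT; split=> // [|k]; [exact: openT|exact: Ck_coord openT _ _]. Qed.

Lemma smooth_near2 (h : (('rV[R]_n.+1 -> R)) -> ('rV[R]_n.+1 -> R) -> ('rV[R]_n.+1 -> R)) f g :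
  (forall U k, open U -> Ck U k f -> Ck U k g -> Ck U k (h f g)) ->
  smooth_near A f -> smooth_near A g -> smooth_near A (h f g).
Proof.
move=> H /smooth_nearP[U [oU AU HU]] /smooth_nearP[V [oV AV HV]]; apply/smooth_nearP.
exists (U `&` V); split; first exact: openI.
  by move=> p Ap; split; [exact: AU|exact: AV].
move=> k; apply: H; first exact: openI.
  by apply: Ck_sub (HU k) => p [].
by apply: Ck_sub (HV k) => p [].
Qed.

Lemma smooth_nearD f g : smooth_near A f -> smooth_near A g ->
  smooth_near A (fun p => f p + g p).
Proof. by apply: (smooth_near2 (h := fun f g p => f p + g p)) => U k oU; exact: CkD. Qed.

Lemma smooth_nearM f g : smooth_near A f -> smooth_near A g ->
  smooth_near A (fun p => f p * g p).
Proof. by apply: (smooth_near2 (h := fun f g p => f p * g p)) => U k oU; exact: CkM. Qed.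

Lemma smooth_nearN f : smooth_near A f -> smooth_near A (fun p => - f p).
Proof.
by move=> sf; apply: (smooth_near2 (h := fun f g p => - f p) _ sf sf) => U k oU cf _; exact: CkN.
Qed.

Lemma smooth_nearB f g : smooth_near A f -> smooth_near A g ->
  smooth_near A (fun p => f p - g p).
Proof. by move=> sf sg; apply: smooth_nearD => //; exact: smooth_nearN. Qed.

Lemma smooth_nearX f k : smooth_near A f -> smooth_near A (fun p => f p ^+ k).
Proof.
move=> sf; elim: k => [|k IH]; first exact: smooth_near_cst.
by apply: smooth_near_ext (smooth_nearM sf IH) => p; rewrite exprS.
Qed.

Lemma smooth_near_sum (I : Type) (r : seq I) (P : pred I) (F : I -> 'rV[R]_n.+1 -> R) :
  (forall i, smooth_near A (F i)) -> smooth_near A (fun p => \sum_(i <- r | P i) F i p).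
Proof.
move=> cF; elim: r => [|x r IH].
  by apply: smooth_near_ext (smooth_near_cst 0) => p; rewrite big_nil.
case Px: (P x); last by apply: smooth_near_ext IH => p; rewrite big_cons Px.
by apply: smooth_near_ext (smooth_nearD (cF x) IH) => p; rewrite big_cons Px.
Qed.

Lemma smooth_near_prod (I : Type) (r : seq I) (P : pred I) (F : I -> 'rV[R]_n.+1 -> R) :
  (forall i, smooth_near A (F i)) -> smooth_near A (fun p => \prod_(i <- r | P i) F i p).
Proof.
move=> cF; elim: r => [|x r IH].
  by apply: smooth_near_ext (smooth_near_cst 1) => p; rewrite big_nil.
case Px: (P x); last by apply: smooth_near_ext IH => p; rewrite big_cons Px.
by apply: smooth_near_ext (smooth_nearM (cF x) IH) => p; rewrite big_cons Px.
Qed.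

Lemma open_preimage_on m (U : set 'rV[R]_n.+1) (V : set 'rV[R]_m) G : open U -> open V ->
  (forall p, U p -> {for p, continuous G}) -> open (U `&` G @^-1` V).
Proof.
move=> oU oV cG; rewrite openE => p [Up Vp]; apply: filterI.
  exact: open_nbhs_nbhs.
by apply: (cG _ Up); exact: open_nbhs_nbhs.
Qed.

Lemma open_preimage_fun (U : set 'rV[R]_n.+1) (V : set R) f : open U -> open V ->
  (forall p, U p -> {for p, continuous f}) -> open (U `&` f @^-1` V).
Proof.
move=> oU oV cG; rewrite openE => p [Up Vp]; apply: filterI.
  exact: open_nbhs_nbhs.
by apply: (cG _ Up); exact: open_nbhs_nbhs.
Qed.

(** Smoothness near [A] needs an open set, but a condition such as being nonzero or positive is
    known only on [A]. An open condition persists on a smaller neighbourhood, which serves inverses,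
    square roots and inverse matrices. *)
Lemma smooth_near_shrink f (V : set R) : open V -> (forall p, A p -> V (f p)) ->
  smooth_near A f -> exists U, [/\ open U, A `<=` U, forall p, U p -> V (f p) & forall k, Ck U k f].
Proof.
move=> oV AV /smooth_nearP[U [oU AU H]]; exists (U `&` f @^-1` V); split.
- apply: open_preimage_fun => // p Up.
  by apply: differentiable_continuous; exact: (H 0%N).
- by move=> p Ap; split; [exact: AU|exact: AV].
- by move=> p [].
- by move=> k; apply: Ck_sub (H k) => p [].
Qed.

Lemma smooth_nearV f : (forall p, A p -> f p != 0) -> smooth_near A f ->
  smooth_near A (fun p => (f p)^-1).
Proof.
move=> f0 /(smooth_near_shrink (V := [set x | x != 0]))[].
- exact: open_neq.
- exact: f0.
move=> U [oU AU Uf H]; apply/smooth_nearP; exists U; split=> // k.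
exact: CkV.
Qed.

Lemma smooth_near_sqrt f : (forall p, A p -> 0 < f p) -> smooth_near A f ->
  smooth_near A (fun p => Num.sqrt (f p)).
Proof.
move=> f0 /(smooth_near_shrink (V := [set x | 0 < x]))[].
- exact: open_gt.
- exact: f0.
move=> U [oU AU Uf H]; apply/smooth_nearP; exists U; split=> // k.
exact: Ck_sqrt.
Qed.

Lemma smooth_near_pd i f : smooth_near A f -> smooth_near A (pd i f).
Proof.
move=> /smooth_nearP[U [oU AU H]]; apply/smooth_nearP; exists U; split=> // k.
have [_ H'] := H k.+1; exact: H'.
Qed.

Lemma smooth_near_diff f p : smooth_near A f -> A p -> differentiable f p.
Proof. by move=> /smooth_nearP[U [oU AU H]] /AU; exact: (H 0%N). Qed.

Lemma smooth_near_cont f p : smooth_near A f -> A p -> {for p, continuous f}.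
Proof. by move=> sf Ap; apply: differentiable_continuous; exact: smooth_near_diff. Qed.

Lemma smooth_near_sub (A' : set 'rV[R]_n.+1) f : A' `<=` A -> smooth_near A f -> smooth_near A' f.
Proof.
by move=> AA [U [oU AU H]]; exists U; split=> //; exact: subset_trans AU.
Qed.

End smooth_near.

(** Each coordinate of [G] comes with its own open set. There are finitely many, so the intersection
    is open, and it is cut down to the preimage of the domain of [f]. *)
Lemma smooth_near_comp {n m} (A : set 'rV[R]_n.+1) (A' : set 'rV[R]_m.+1) f
  (G : 'rV[R]_n.+1 -> 'rV[R]_m.+1) :
  (forall p, A p -> A' (G p)) -> smooth_mx_near A G ->
  smooth_near A' f -> smooth_near A (fun p => f (G p)).
Proof.
move=> AA' sG /smooth_nearP[V [oV AV HV]].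
have [U [oU AU HU]] : exists U, [/\ open U, A `<=` U & forall j k, Ck U k (fun p => G p 0 j)].
  have H j : exists U, [/\ open U, A `<=` U & forall k, Ck U k (fun p => G p 0 j)].
    by apply/smooth_nearP; exact: sG.
  pose W j := projT1 (cid (H j)).
  have HW j : [/\ open (W j), A `<=` W j & forall k, Ck (W j) k (fun p => G p 0 j)].
    by rewrite /W; case: (cid (H j)).
  exists [set p | forall j, W j p]; split.
  - rewrite openE => p Wp; have H' j : nbhs p (W j).
      by apply: open_nbhs_nbhs; split; [have [] := HW j|exact: Wp].
    exact: filter_forall H'.
  - by move=> p Ap j; have [_ AW _] := HW j; exact: AW.
  - move=> j k; have [_ _ /(_ k)] := HW j; apply: Ck_sub => p; exact.
apply/smooth_nearP; exists (U `&` G @^-1` V).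
have o : open (U `&` G @^-1` V).
  apply: open_preimage_on => // p Up; apply: differentiable_continuous.
  by apply: differentiable_mx => i j; rewrite (ord1 i); exact: (HU j 0%N).
split=> //.
  by move=> p Ap; split; [exact: AU|apply: AV; exact: AA'].
move=> k; apply: (Ck_comp o) (HV k) => [p []//|j].
by apply: Ck_sub (HU j k) => p [].
Qed.

End smooth.

(** * Symmetry of second derivatives *)

Section symmetry_of_second_derivatives.
Context {R : realType} {n : nat}.
Implicit Types (f : 'rV[R]_n.+1 -> R) (p u v : 'rV[R]_n.+1).

Lemma is_derive_line f (q u : 'rV[R]_n.+1) (x : R) : differentiable f (q + x *: u) ->
  is_derive x 1 (fun s => f (q + s *: u)) ('D_u f (q + x *: u)).
Proof.
move=> df.
have dl : is_diff x (fun s : R => q + s *: u) (fun s : R => s *: u).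
  have H : is_diff x (cst q + *:%R^~ u) (0 + *:%R^~ u) by exact: is_diffD.
  by apply: is_diff_eq H _; apply/funext => s; rewrite !fctE add0r.
have dc : differentiable (f \o (fun s : R => q + s *: u)) x by exact: differentiable_comp.
apply: DeriveDef; first exact: diff_derivable.
rewrite deriveE//= diff_comp//= diff_val scale1r deriveE//.
Qed.

(** The mean value theorem is applied twice: to the increment of [f] in direction [v] as a function
    of the [u] parameter, then to the derivative along [u] as a function of the [v] parameter. *)
Lemma second_difference f p (u v : 'rV[R]_n.+1) (r : R) : 0 < r ->
  (forall s t : R, 0 <= s <= r -> 0 <= t <= r ->
     differentiable f (p + s *: u + t *: v) /\
     differentiable ('D_u f) (p + s *: u + t *: v)) ->
  exists s t, [/\ 0 <= s <= r, 0 <= t <= r &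
    f (p + r *: u + r *: v) - f (p + r *: u) - f (p + r *: v) + f p
    = r ^+ 2 * 'D_v ('D_u f) (p + s *: u + t *: v)].
Proof.
move=> r0 H.
have rr : 0 <= r <= r by rewrite lexx ltW.
have z0 : 0 <= (0:R) <= r by rewrite lexx ltW.
pose h s := f (p + s *: u + r *: v) - f (p + s *: u).
pose dh s := 'D_u f (p + s *: u + r *: v) - 'D_u f (p + s *: u).
have Hh x : 0 <= x <= r -> is_derive x 1 h (dh x).
  move=> xr; have [d1 _] := H x r xr rr; have [d2 _] := H x 0 xr z0.
  rewrite scale0r addr0 in d2; apply: is_deriveB; last exact: is_derive_line.
  have E s : p + s *: u + r *: v = p + r *: v + s *: u by rewrite addrAC.
  rewrite E; under eq_fun do rewrite E.
  by apply: is_derive_line; rewrite -E.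
have ch : {within `[0, r], continuous h}.
  apply: derivable_within_continuous => x; rewrite in_itv /= => xr.
  by have [] := Hh x xr.
have [s sI hs] := @MVT R h dh 0 r r0 (fun x xi => Hh x (subset_itv_oo_cc xi)) ch.
have sr : 0 <= s <= r by move: sI; rewrite in_itv /= => /andP[/ltW -> /ltW ->].
pose k t := 'D_u f (p + s *: u + t *: v).
pose dk t := 'D_v ('D_u f) (p + s *: u + t *: v).
have Hk x : 0 <= x <= r -> is_derive x 1 k (dk x).
  by move=> xr; have [_ d1] := H s x sr xr; exact: is_derive_line.
have ck : {within `[0, r], continuous k}.
  apply: derivable_within_continuous => x; rewrite in_itv /= => xr.
  by have [] := Hk x xr.
have [t tI kt] := @MVT R k dk 0 r r0 (fun x xi => Hk x (subset_itv_oo_cc xi)) ck.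
have tr : 0 <= t <= r by move: tI; rewrite in_itv /= => /andP[/ltW -> /ltW ->].
exists s, t; split=> //.
move: hs kt; rewrite /h /k /dh /dk !scale0r !addr0 !subr0 => hs kt.
have -> : f (p + r *: u + r *: v) - f (p + r *: u) - f (p + r *: v) + f p
  = f (p + r *: u + r *: v) - f (p + r *: u) - (f (p + r *: v) - f p) by ring.
by rewrite hs kt; ring.
Qed.

(** The second difference is symmetric in [u] and [v], so the two mixed derivatives take a common
    value at points arbitrarily close to [p]; continuity at [p] does the rest. *)
Lemma second_derivative_swap f p u v (U : set 'rV[R]_n.+1) : open U -> U p ->
  (forall q, U q -> differentiable f q /\ differentiable ('D_u f) q
                 /\ differentiable ('D_v f) q) ->
  {for p, continuous ('D_v ('D_u f))} -> {for p, continuous ('D_u ('D_v f))} ->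
  'D_v ('D_u f) p = 'D_u ('D_v f) p.
Proof.
move=> oU Up H c1 c2.
apply/eqP; rewrite -subr_eq0 -normr_le0; apply/ler_addgt0Pl => e e0; rewrite addr0.
have e20 : 0 < e / 2 by rewrite divr_gt0.
have N1 : nbhs p (fun q => U q /\ `|'D_v ('D_u f) p - 'D_v ('D_u f) q| <= e / 2
    /\ `|'D_u ('D_v f) p - 'D_u ('D_v f) q| <= e / 2).
  apply: filterI; first exact: open_nbhs_nbhs.
  by apply: filterI; [exact: (cvgrPdist_le _ _).1 c1 _ e20|exact: (cvgrPdist_le _ _).1 c2 _ e20].
have [d /= d0 Hd] := (nbhs_ballP _ _).1 N1.
have [r rp rB] : exists2 r, 0 < r & forall s t, 0 <= s <= r -> 0 <= t <= r ->
    ball p d (p + s *: u + t *: v).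
  (* With this side the parallelogram stays within distance [d / 2] of [p]; the summand 1 keeps the
     denominator positive when [u] and [v] vanish. *)
  exists (d / (1 + `|u| + `|v|) / 2).
    by rewrite !divr_gt0// -addrA ltr_wpDr// addr_ge0.
  move=> s t /andP[s0 sr] /andP[t0 tr].
  rewrite -ball_normE /ball_ /= -addrA opprD addNKr normrN.
  have D : 0 < 1 + `|u| + `|v| by rewrite -addrA ltr_wpDr// addr_ge0.
  set r := d / _ / 2 in sr tr.
  apply: (@le_lt_trans _ _ (r * (1 + `|u| + `|v|))).
    rewrite (le_trans (ler_normD _ _))// !normrZ !ger0_norm//.
    have r0 : 0 <= r by exact: le_trans sr.
    rewrite -addrA mulrDr mulr1 mulrDr -[leLHS]add0r lerD// lerD// ler_wpM2r//.
  by rewrite /r mulrAC divfK ?gt_eqF// ltr_pdivrMr// ltr_pMr// ltr1n.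
have [|s [t [sr tr E1]]] := @second_difference f p u v r rp.
  by move=> s t sr tr; have [Us _] := Hd _ (rB s t sr tr); have [? [? _]] := H _ Us.
have [|s' [t' [sr' tr' E2]]] := @second_difference f p v u r rp.
  move=> s' t' sr' tr'; rewrite addrAC.
  by have [Us _] := Hd _ (rB _ _ tr' sr'); have [? [_ ?]] := H _ Us.
have E : 'D_v ('D_u f) (p + s *: u + t *: v) = 'D_u ('D_v f) (p + s' *: v + t' *: u).
  have r2 : r ^+ 2 != 0 by rewrite gt_eqF// exprn_gt0.
  move: E1 E2; rewrite (addrAC p (r *: v) (r *: u)).
  move: ('D_v _ (p + _ + _)) ('D_u _ (p + _ + _)) => X Y E1 E2.
  apply: (mulfI r2); rewrite -{}E1 -{}E2; congr (_ + _); exact: addrAC.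
have [_ [/ler_normlP[b1 b1'] _]] := Hd _ (rB _ _ sr tr).
have Hb : ball p d (p + s' *: v + t' *: u) by rewrite addrAC; exact: rB.
have [_ [_ /ler_normlP[b2 b2']]] := Hd _ Hb.
rewrite -{}E in b2 b2'.
move: b1 b1' b2 b2'; move: ('D_v _ (_ + _ + _)) ('D_v _ p) ('D_u _ p) => x y z h1 h2 h3 h4.
by clear -h1 h2 h3 h4; apply/ler_normlP; split; lra.
Qed.

Lemma pd_swap (A : set 'rV[R]_n.+1) f p i j : smooth_near A f -> A p ->
  pd i (pd j f) p = pd j (pd i f) p.
Proof.
move=> sf Ap; have [U [oU AU HU]] := (smooth_nearP A f).1 sf.
apply: (@second_derivative_swap f p (delta_mx 0 j) (delta_mx 0 i) U) => //.
- exact: AU.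
- move=> q Uq; split; first exact: (HU 0%N).
  by split; [exact: ((HU 1%N).2 j)|exact: ((HU 1%N).2 i)].
- by apply: smooth_near_cont Ap; apply/smooth_near_pd/smooth_near_pd.
- by apply: smooth_near_cont Ap; apply/smooth_near_pd/smooth_near_pd.
Qed.

End symmetry_of_second_derivatives.

(** * Smooth matrix-valued functions *)

Section smooth_matrices.
Context {R : realType} {n : nat}.
Variable A : set 'rV[R]_n.+1.

Lemma smooth_mx_cst k l (M : 'M[R]_(k, l)) : smooth_mx_near A (fun=> M).
Proof. by move=> i j; exact: smooth_near_cst. Qed.

Lemma smooth_mxD k l (F G : 'rV[R]_n.+1 -> 'M[R]_(k, l)) :
  smooth_mx_near A F -> smooth_mx_near A G -> smooth_mx_near A (fun p => F p + G p).
Proof.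
by move=> sF sG i j; apply: smooth_near_ext (smooth_nearD (sF i j) (sG i j)) => p; rewrite mxE.
Qed.

Lemma smooth_mxN k l (F : 'rV[R]_n.+1 -> 'M[R]_(k, l)) :
  smooth_mx_near A F -> smooth_mx_near A (fun p => - F p).
Proof.
by move=> sF i j; apply: smooth_near_ext (smooth_nearN (sF i j)) => p; rewrite mxE.
Qed.

Lemma smooth_mxB k l (F G : 'rV[R]_n.+1 -> 'M[R]_(k, l)) :
  smooth_mx_near A F -> smooth_mx_near A G -> smooth_mx_near A (fun p => F p - G p).
Proof. by move=> sF sG; apply: smooth_mxD => //; exact: smooth_mxN. Qed.

Lemma smooth_mxZ k l c (F : 'rV[R]_n.+1 -> 'M[R]_(k, l)) :
  smooth_near A c -> smooth_mx_near A F -> smooth_mx_near A (fun p => c p *: F p).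
Proof.
by move=> sc sF i j; apply: smooth_near_ext (smooth_nearM sc (sF i j)) => p; rewrite mxE.
Qed.

Lemma smooth_mxM k l m (F : 'rV[R]_n.+1 -> 'M[R]_(k, l)) (G : 'rV[R]_n.+1 -> 'M[R]_(l, m)) :
  smooth_mx_near A F -> smooth_mx_near A G -> smooth_mx_near A (fun p => F p *m G p).
Proof.
move=> sF sG i j.
apply: (smooth_near_ext (f := fun p => \sum_k F p i k * G p k j)) => [p|]; first by rewrite mxE.
by apply: smooth_near_sum => x; exact: smooth_nearM.
Qed.

Lemma smooth_mx_tr k l (F : 'rV[R]_n.+1 -> 'M[R]_(k, l)) :
  smooth_mx_near A F -> smooth_mx_near A (fun p => (F p)^T).
Proof. by move=> sF i j; apply: smooth_near_ext (sF j i) => p; rewrite mxE. Qed.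

Lemma smooth_det k (F : 'rV[R]_n.+1 -> 'M[R]_k) :
  smooth_mx_near A F -> smooth_near A (fun p => \det (F p)).
Proof.
move=> sF; apply: smooth_near_sum => s; apply: smooth_nearM; first exact: smooth_near_cst.
by apply: smooth_near_prod => x; exact: sF.
Qed.

Lemma smooth_invmx k (F : 'rV[R]_n.+1 -> 'M[R]_k) :
  (forall p, A p -> \det (F p) != 0) ->
  smooth_mx_near A F -> smooth_mx_near A (fun p => invmx (F p)).
Proof.
move=> F0 sF i j.
have sdet := smooth_det sF.
have [U [oU AU UF HU]] := smooth_near_shrink (@open_neq _ 0) F0 sdet.
(* [invmx] returns a singular matrix unchanged, so the cofactor formula is used only on the open set
   where the determinant is nonzero. *)
apply: (smooth_near_eq (f := fun p => (\det (F p))^-1 * \adj (F p) i j) oU AU).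
  by move=> p /UF d0; rewrite /invmx unitmxE unitfE d0 [RHS]mxE.
apply: smooth_nearM; first exact: smooth_nearV.
apply: (smooth_near_ext (f := fun p => (-1) ^+ (j + i) * \det (row' j (col' i (F p))))).
  by move=> p; rewrite mxE.
apply: smooth_nearM; first exact: smooth_near_cst.
by apply: smooth_det => x y; apply: smooth_near_ext (sF (lift j x) (lift i y)) => p; rewrite !mxE.
Qed.

Lemma smooth_mx_sub (A' : set 'rV[R]_n.+1) k l (F : 'rV[R]_n.+1 -> 'M[R]_(k, l)) :
  A' `<=` A -> smooth_mx_near A F -> smooth_mx_near A' F.
Proof. by move=> AA sF i j; exact: smooth_near_sub (sF i j). Qed.

Lemma smooth_mx_eq (W : set 'rV[R]_n.+1) k l (F G : 'rV[R]_n.+1 -> 'M[R]_(k, l)) :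
  open W -> A `<=` W -> (forall p, W p -> F p = G p) ->
  smooth_mx_near A F -> smooth_mx_near A G.
Proof.
move=> oW AW FG sF i j; apply: (smooth_near_eq oW AW _ (sF i j)) => p Wp.
by rewrite FG.
Qed.

Lemma smooth_pair (g : 'rV[R]_n.+1 -> 'M[R]_4) u v :
  smooth_mx_near A g -> smooth_mx_near A u -> smooth_mx_near A v ->
  smooth_near A (fun p => pair (g p) (u p) (v p)).
Proof.
move=> sg su sv; rewrite /pair.
exact: (smooth_mxM (smooth_mxM su sg) (smooth_mx_tr sv) 0 0).
Qed.

End smooth_matrices.

(** * Explicit determinants up to size four *)

Section small_determinants.
Context {R : comNzRingType}.

Lemma sum4 (f : 'I_4 -> R) : \sum_i f i = f 0 + f 1 + f 2 + f 3.
Proof.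
rewrite !big_ord_recr big_ord0 /= add0r.
by congr (f _ + f _ + f _ + f _); apply: val_inj.
Qed.

Lemma sum3_ring (f : 'I_3 -> R) : \sum_i f i = f 0 + f 1 + f 2.
Proof.
rewrite !big_ord_recr big_ord0 /= add0r.
by congr (f _ + f _ + f _); apply: val_inj.
Qed.

Lemma det2 (A : 'M[R]_2) : \det A = A 0 0 * A 1 1 - A 0 1 * A 1 0.
Proof.
rewrite (expand_det_row _ 0) !big_ord_recl big_ord0 /cofactor !det_mx11 !mxE /=.
rewrite (_ : lift 0 0 = 1); last exact: val_inj.
rewrite (_ : lift 1 0 = 0); last exact: val_inj.
by rewrite /= expr0 expr1; ring.
Qed.

Lemma det3 (A : 'M[R]_3) : \det A =
  A 0 0 * (A 1 1 * A 2 2 - A 1 2 * A 2 1)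
  - A 0 1 * (A 1 0 * A 2 2 - A 1 2 * A 2 0)
  + A 0 2 * (A 1 0 * A 2 1 - A 1 1 * A 2 0).
Proof.
rewrite (expand_det_row _ 0) sum3_ring /cofactor !det2 !mxE /=.
have E (B : 'M[R]_3) i j i' j' : val i = val i' -> val j = val j' -> B i j = B i' j'.
  by move=> /val_inj -> /val_inj ->.
rewrite (E A (lift 0 0) (lift 0 0) 1 1)// (E A (lift 0 1) (lift 0 1) 2 2)//.
rewrite (E A (lift 0 0) (lift 0 1) 1 2)// (E A (lift 0 1) (lift 0 0) 2 1)//.
rewrite (E A (lift 0 0) (lift 1 0) 1 0)// (E A (lift 0 1) (lift 1 1) 2 2)//.
rewrite (E A (lift 0 0) (lift 1 1) 1 2)// (E A (lift 0 1) (lift 1 0) 2 0)//.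
rewrite (E A (lift 0 0) (lift 2 0) 1 0)// (E A (lift 0 1) (lift 2 1) 2 1)//.
rewrite (E A (lift 0 0) (lift 2 1) 1 1)// (E A (lift 0 1) (lift 2 0) 2 0)//.
by rewrite /= !addn0 !expr0 !expr1 !add0n; ring.
Qed.

Lemma det4 (A : 'M[R]_4) : \det A =
  let d i j k := A 1 i * (A 2 j * A 3 k - A 2 k * A 3 j)
               - A 1 j * (A 2 i * A 3 k - A 2 k * A 3 i)
               + A 1 k * (A 2 i * A 3 j - A 2 j * A 3 i) in
  A 0 0 * d 1 2 3 - A 0 1 * d 0 2 3 + A 0 2 * d 0 1 3 - A 0 3 * d 0 1 2.
Proof.
rewrite (expand_det_row _ 0) sum4 /cofactor !det3 !mxE /=.
have L (i : 'I_4) (j : 'I_3) (k : 'I_4) : bump i j = k -> lift i j = k.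
  by move=> e; apply: val_inj.
rewrite (L 0 0 1)// (L 0 1 2)// (L 0 2 3)// (L 1 0 0)// (L 1 1 2)// (L 1 2 3)//.
rewrite (L 2 0 0)// (L 2 1 1)// (L 2 2 3)// (L 3 0 0)// (L 3 1 1)// (L 3 2 2)//.
by rewrite /= !add0n expr0 expr1; ring.
Qed.

End small_determinants.

(** * The Levi-Civita symbol and the metric-free dual *)

Section matrix4.
Context {R : realType}.
Implicit Types (F G g P X : 'M[R]_4).

Lemma prod4 (f : 'I_4 -> R) : \prod_i f i = f 0 * f 1 * f 2 * f 3.
Proof.
rewrite !big_ord_recr big_ord0 /= mul1r.
by congr (f _ * f _ * f _ * f _); apply: val_inj.
Qed.

Lemma ord3P (Q : 'I_3 -> Prop) : Q 0 -> Q 1 -> Q 2 -> forall i, Q i.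
Proof.
move=> q0 q1 q2 [[|[|[|//]]] lt].
- by rewrite (_ : Ordinal lt = 0)//; exact: val_inj.
- by rewrite (_ : Ordinal lt = 1)//; exact: val_inj.
- by rewrite (_ : Ordinal lt = 2)//; exact: val_inj.
Qed.

Lemma ord4P (Q : 'I_4 -> Prop) : Q 0 -> Q 1 -> Q 2 -> Q 3 -> forall i, Q i.
Proof.
move=> q0 q1 q2 q3 [[|[|[|[|//]]]] lt].
- by rewrite (_ : Ordinal lt = 0)//; exact: val_inj.
- by rewrite (_ : Ordinal lt = 1)//; exact: val_inj.
- by rewrite (_ : Ordinal lt = 2)//; exact: val_inj.
- by rewrite (_ : Ordinal lt = 3)//; exact: val_inj.
Qed.

Let sel (i j k l : 'I_4) (x : 'I_4) : 'I_4 := nth 0 [:: i; j; k; l] x.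

(** In the Leibniz sum of this Kronecker matrix a term survives exactly when its permutation takes
    the values [i, j, k, l], which is the selection made in [levi_civita]. *)
Lemma levi_civita_det i j k l :
  levi_civita i j k l = \det (\matrix_(x, y) ((sel i j k l x == y)%:R : R)).
Proof.
rewrite /levi_civita /determinant big_mkcond /=; apply: eq_bigr => s _.
rewrite prod4 !mxE.
rewrite /sel /= (eq_sym i) (eq_sym j) (eq_sym k) (eq_sym l).
by do 4![case: eqP => _ /=; rewrite ?(mul0r,mulr0,mulr1,mul1r)//].
Qed.

(* The determinant of Kronecker symbols, over the integers so that it computes. *)
Let lcz (i j k l : 'I_4) : int :=
  let A x y : int := nat_of_bool (sel i j k l x == y) in
  let d i j k := A 1 i * (A 2 j * A 3 k - A 2 k * A 3 j)
               - A 1 j * (A 2 i * A 3 k - A 2 k * A 3 i)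
               + A 1 k * (A 2 i * A 3 j - A 2 j * A 3 i) in
  A 0 0 * d 1 2 3 - A 0 1 * d 0 2 3 + A 0 2 * d 0 1 3 - A 0 3 * d 0 1 2.

Let lcE i j k l : levi_civita i j k l = (lcz i j k l)%:~R :> R.
Proof.
rewrite levi_civita_det.
rewrite (_ : \matrix_(x, y) _ = map_mx intr (\matrix_(x, y) (nat_of_bool (sel i j k l x == y) : int))).
  by rewrite det_map_mx det4 /= !mxE.
by apply/matrixP => x y; rewrite !mxE; case: (_ == _).
Qed.

(** Both sides are the determinant of the matrix whose rows are the columns [i, j, m, n] of [P]. The
    fourfold sum sorts its Leibniz terms by the values of the permutation at 0, 1, 2, 3; on the
    right that matrix factors as a Kronecker matrix times the transpose of [P]. *)
Lemma levi_civita_cong P i j m n :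
  \sum_a \sum_b \sum_k \sum_l levi_civita a b k l * (P a i * P b j * P k m * P l n)
  = \det P * levi_civita i j m n.
Proof.
have -> : \det P * levi_civita i j m n
    = \det (\matrix_(x, y) P y (sel i j m n x)).
  rewrite mulrC levi_civita_det -[X in _ * X]det_tr -det_mulmx.
  congr (\det _); apply/matrixP => x y; rewrite !mxE.
  rewrite (bigD1 (sel i j m n x))//= big1 => [|z zN].
    by rewrite !mxE eqxx mul1r addr0.
  by rewrite !mxE eq_sym (negbTE zN) mul0r.
rewrite /determinant.
transitivity (\sum_a \sum_b \sum_k \sum_l \sum_(s : 'S_4 | [&& s 0 == a, s 1 == b, s 2 == k & s 3 == l])
     (-1) ^+ odd_perm s * (P (s 0) i * P (s 1) j * P (s 2) m * P (s 3) n)).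
  do 4![apply: eq_bigr => ? _]; rewrite /levi_civita mulr_suml; apply: eq_bigr => s.
  by move=> /and4P[/eqP -> /eqP -> /eqP -> /eqP ->].
transitivity (\sum_(s : 'S_4) (-1) ^+ odd_perm s * (P (s 0) i * P (s 1) j * P (s 2) m * P (s 3) n)); last first.
  by apply: eq_bigr => s _; congr (_ * _); rewrite prod4 !mxE /sel.
rewrite [RHS](partition_big (fun s : 'S_4 => s 0) predT)//=; apply: eq_bigr => a _.
rewrite [RHS](partition_big (fun s : 'S_4 => s 1) predT)//=; apply: eq_bigr => b _.
rewrite [RHS](partition_big (fun s : 'S_4 => s 2) predT)//=; apply: eq_bigr => k _.
rewrite [RHS](partition_big (fun s : 'S_4 => s 3) predT)//=; apply: eq_bigr => l _.
by apply: eq_bigl => s; rewrite -!andbA.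
Qed.

(** The Hodge dual stripped of the metric: a bivector density built from epsilon alone. [star] is
    this operation composed with raising or lowering indices and multiplied by a power of the volume
    factor. *)
Definition hat F : 'M[R]_4 :=
  \matrix_(i, j) (2^-1 * \sum_k \sum_l levi_civita i j k l * F k l).

(** Each index of epsilon receives one factor [P], and the four factors collapse to the determinant.
    All changes of basis of the Hodge star below go through this identity. *)
Lemma hat_cong P F : P^T *m hat (P *m F *m P^T) *m P = \det P *: hat F.
Proof.
apply/matrixP => i j; rewrite [RHS]mxE [hat F i j]mxE mulrCA.
transitivity (2^-1 * \sum_m \sum_n
   (\sum_a \sum_b \sum_k \sum_l levi_civita a b k l * (P a i * P b j * P k m * P l n)) * F m n).
  2: by congr (_ * _); rewrite mulr_sumr; apply: eq_bigr => m _; rewrite mulr_sumr;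
     apply: eq_bigr => n _; rewrite levi_civita_cong mulrA.
transitivity (\sum_b \sum_a P a i * (2^-1 * \sum_k \sum_l levi_civita a b k l *
    (\sum_m \sum_n P k m * F m n * P l n)) * P b j).
  rewrite mxE; apply: eq_bigr => b _; rewrite mxE mulr_suml; apply: eq_bigr => a _.
  rewrite !mxE; do 2![congr (_ * _)]; congr (_ * _).
  apply: eq_bigr => k _; apply: eq_bigr => l _; congr (_ * _).
  rewrite mxE exchange_big /=; apply: eq_bigr => n _; rewrite !mxE mulr_suml.
  by apply: eq_bigr => m _.
rewrite exchange_big /= mulr_sumr.
under [RHS]eq_bigr do (rewrite mulr_sumr; under eq_bigr do rewrite !mulr_suml mulr_sumr).
under [RHS]eq_bigr do rewrite exchange_big.
rewrite [RHS]exchange_big /=; apply: eq_bigr => a _.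
under [RHS]eq_bigr do (under eq_bigr do rewrite mulr_suml mulr_sumr).
under [RHS]eq_bigr do rewrite exchange_big.
rewrite [RHS]exchange_big /=; apply: eq_bigr => b _.
under [RHS]eq_bigr do (under eq_bigr do rewrite mulr_suml mulr_sumr).
under [RHS]eq_bigr do rewrite exchange_big.
rewrite [RHS]exchange_big /=.
rewrite mulr_sumr mulr_sumr mulr_suml; apply: eq_bigr => k _.
under [RHS]eq_bigr do (under eq_bigr do rewrite mulr_suml mulr_sumr).
under [RHS]eq_bigr do rewrite exchange_big.
rewrite [RHS]exchange_big /=.
rewrite mulr_sumr mulr_sumr mulr_suml; apply: eq_bigr => l _.
rewrite !mulr_sumr mulr_suml; apply: eq_bigr => m _.
rewrite !mulr_sumr mulr_suml; apply: eq_bigr => n _.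
by ring.
Qed.

(** The six coordinates of a two-form in the order 01, 02, 03, 12, 13, 23; identities between
    two-forms become polynomial identities in them. *)
Definition asym4 (a b c d e f : R) : 'M[R]_4 := \matrix_(i < 4, j < 4)
  (nth [::] [:: [:: 0; a; b; c]; [:: - a; 0; d; e]; [:: - b; - d; 0; f]; [:: - c; - e; - f; 0]] i)`_j.

Lemma asym4E F : F^T = - F ->
  F = asym4 (F 0 1) (F 0 2) (F 0 3) (F 1 2) (F 1 3) (F 2 3).
Proof.
move=> /matrixP aF.
have N i j : F i j = - F j i by have := aF j i; rewrite !mxE.
have D i : F i i = 0 by have := N i i => ?; lra.
apply/matrixP; apply: ord4P; apply: ord4P; rewrite !mxE ?D//=; 
by rewrite N.
Qed.

Lemma hat_asym4 a b c d e f :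
  hat (asym4 a b c d e f) = asym4 f (- e) d c (- b) a.
Proof.
apply/matrixP; apply: ord4P; apply: ord4P; rewrite !mxE !sum4 !lcE !mxE /= ?mulr0;
  repeat match goal with |- context [intmul 1 (lcz ?i ?j ?k ?l)] =>
    let w := eval vm_compute in (lcz i j k l) in
    rewrite (_ : lcz i j k l = w); [|by vm_compute] end;
  rewrite ?mulr0z ?mulr1z ?mulrN1z; lra.
Qed.

End matrix4.

Lemma trmxD {R : nmodType} k l (A B : 'M[R]_(k, l)) : (A + B)^T = A^T + B^T.
Proof. by apply/matrixP => i j; rewrite !mxE. Qed.

Lemma trmxN {R : zmodType} k l (A : 'M[R]_(k, l)) : (- A)^T = - A^T.
Proof. by apply/matrixP => i j; rewrite !mxE. Qed.

(** * The Hodge star of a Lorentzian metric *)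

Section hodge_star.
Context {R : realType}.
Implicit Types (F G g P X : 'M[R]_4).

Lemma hatD F G : hat (F + G) = hat F + hat G.
Proof.
apply/matrixP => i j; rewrite !mxE -mulrDr -big_split /=; congr (_ * _).
by apply: eq_bigr => k _; rewrite -big_split /=; apply: eq_bigr => l _; rewrite mxE mulrDr.
Qed.

Lemma hatZ c F : hat (c *: F) = c *: hat F.
Proof.
apply/matrixP => i j; rewrite !mxE mulrCA; congr (_ * _); rewrite mulr_sumr.
by apply: eq_bigr => k _; rewrite mulr_sumr; apply: eq_bigr => l _; rewrite mxE mulrCA.
Qed.

Lemma asym4_tr (a b c d e f : R) : (asym4 a b c d e f)^T = - asym4 a b c d e f.
Proof.
by apply/matrixP; apply: ord4P; apply: ord4P; rewrite !mxE /= ?oppr0 ?opprK.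
Qed.

Lemma hat_tr F : F^T = - F -> (hat F)^T = - hat F.
Proof. by move/asym4E ->; rewrite hat_asym4 asym4_tr. Qed.

Lemma hatK F : F^T = - F -> hat (hat F) = F.
Proof. by move/asym4E ->; rewrite !hat_asym4 !opprK. Qed.

Lemma starE g F :
  star g F = Num.sqrt (- \det g) *: hat (invmx g *m F *m invmx g).
Proof. by apply/matrixP => i j; rewrite !mxE mulrA [2^-1 * _]mulrC. Qed.

Lemma starD g F G : star g (F + G) = star g F + star g G.
Proof. by rewrite !starE mulmxDr mulmxDl hatD scalerDr. Qed.

Lemma starZ g c F : star g (c *: F) = c *: star g F.
Proof. by rewrite !starE -scalemxAr -scalemxAl hatZ !scalerA mulrC. Qed.

Lemma starN g F : star g (- F) = - star g F.
Proof. by rewrite -scaleN1r starZ scaleN1r. Qed.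

Lemma starB g F G : star g (F - G) = star g F - star g G.
Proof. by rewrite starD starN. Qed.

Lemma hat_basis X G : X \in unitmx ->
  hat G = (\det X)^-1 *: (X^T *m hat (X *m G *m X^T) *m X).
Proof.
move=> uX; rewrite hat_cong scalerA mulVf ?scale1r//.
by rewrite -unitfE -unitmxE.
Qed.

Lemma det_unit g : \det g != 0 -> g \in unitmx.
Proof. by rewrite unitmxE unitfE. Qed.

Section lorentzian.
Variable g : 'M[R]_4.
Hypotheses (g_sym : g^T = g) (g_det : \det g < 0).

Let g0 : \det g != 0. Proof. by rewrite lt_eqF. Qed.
Let ug : g \in unitmx. Proof. exact: det_unit. Qed.
Let s0 : 0 < Num.sqrt (- \det g). Proof. by rewrite sqrtr_gt0 oppr_gt0. Qed.
Let s2 : Num.sqrt (- \det g) ^+ 2 = - \det g.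
Proof. by rewrite sqr_sqrtr// oppr_ge0 ltW. Qed.

Lemma invmx_sym : (invmx g)^T = invmx g.
Proof. by rewrite trmx_inv g_sym. Qed.

(** Instead of raising the indices of [F] before dualising, the dual is taken first and lowered
    afterwards; [hat_cong] with the inverse metric exchanges the two at the price of [det g]. In
    this form the inverse metric disappears. *)
Lemma star_hat F : star g F = - (Num.sqrt (- \det g))^-1 *: (g *m hat F *m g).
Proof.
rewrite starE.
have := hat_cong (invmx g) F; rewrite invmx_sym => H.
have -> : hat (invmx g *m F *m invmx g) = (\det g)^-1 *: (g *m hat F *m g).
  have := congr1 (fun Z => g *m Z *m g) H.
  rewrite /= !mulmxA mulmxV// mul1mx -mulmxA mulVmx// mulmx1 => ->.
  by rewrite -scalemxAr -scalemxAl det_inv.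
rewrite scalerA; congr (_ *: _).
have -> : \det g = - Num.sqrt (- \det g) ^+ 2 by rewrite s2 opprK.
by rewrite opprK sqrtr_sqr gtr0_norm//; field; rewrite gt_eqF.
Qed.

Lemma star_tr F : F^T = - F -> (star g F)^T = - star g F.
Proof.
move=> aF; rewrite star_hat linearZ /= !trmx_mul g_sym hat_tr//.
by rewrite mulNmx mulmxN scalerN mulmxA.
Qed.

(** Two lowered forms compose by [hat_cong] to the factor [det g / |det g|], so the minus sign is
    that of the Lorentzian signature. *)
Lemma starK F : F^T = - F -> star g (star g F) = - F.
Proof.
move=> aF; rewrite [star g F]star_hat starZ star_hat scalerA.
have := hat_cong g (hat F); rewrite g_sym hatK// => ->.
rewrite scalerA (_ : _ * \det g = -1) ?scaleN1r//.
have -> : \det g = - Num.sqrt (- \det g) ^+ 2 by rewrite s2 opprK.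
by rewrite opprK sqrtr_sqr gtr0_norm//; field; rewrite gt_eqF.
Qed.

(** Components in the basis formed by the rows of [X]. The sign of [det X] records the orientation
    of that basis. *)
Lemma star_basis X G : X \in unitmx ->
  X *m star g G *m X^T = - (Num.sqrt (- \det g) * \det X)^-1 *:
    ((X *m g *m X^T) *m hat (X *m G *m X^T) *m (X *m g *m X^T)).
Proof.
move=> uX; rewrite star_hat {1}(hat_basis G uX).
rewrite -!(scalemxAr, scalemxAl) scalerA invfM mulNr !mulmxA.
by rewrite [_^-1 * _]mulrC.
Qed.

End lorentzian.

Lemma pair_cong X G a b : (X *m G *m X^T) a b = pair G (row a X) (row b X).
Proof. by rewrite /pair -row_mul tr_row !mxE; apply: eq_bigr => j _; rewrite !mxE. Qed.

Lemma pairDl g (u v w : 'rV[R]_4) : pair g (u + v) w = pair g u w + pair g v w.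
Proof. by rewrite /pair !mulmxDl mxE. Qed.
Lemma pairDr g (u v w : 'rV[R]_4) : pair g w (u + v) = pair g w u + pair g w v.
Proof. by rewrite /pair linearD /= mulmxDr mxE. Qed.
Lemma pairZl g c (u v : 'rV[R]_4) : pair g (c *: u) v = c * pair g u v.
Proof. by rewrite /pair -!scalemxAl mxE. Qed.
Lemma pairZr g c (u v : 'rV[R]_4) : pair g u (c *: v) = c * pair g u v.
Proof. by rewrite /pair linearZ /= -!scalemxAr mxE. Qed.
Lemma pair_tr g (u v : 'rV[R]_4) : pair g^T u v = pair g v u.
Proof.
rewrite /pair (_ : u *m g^T *m v^T = (v *m g *m u^T)^T) ?mxE//.
by rewrite !trmx_mul trmxK mulmxA.
Qed.
Lemma pair_asym G u v : G^T = - G -> pair G u v = - pair G v u.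
Proof. by move=> aG; rewrite -[pair G v u]pair_tr aG pairN opprK. Qed.
Lemma pair_wedge (u v x y : 'rV[R]_4) : pair (wedge u v) x y =
  (x *m u^T) 0 0 * (y *m v^T) 0 0 - (x *m v^T) 0 0 * (y *m u^T) 0 0.
Proof.
rewrite /pair /wedge mulmxBr mulmxBl !mulmxA mxE [X in _ + X = _]mxE.
rewrite -![_ *m _ *m _ *m _]mulmxA !mxE !big_ord1 !mxE.
by congr (_ * _ - _ * _); apply: eq_bigr => i _; rewrite !mxE mulrC.
Qed.

Lemma wedge_tr (u v : 'rV[R]_4) : (wedge u v)^T = - wedge u v.
Proof. by rewrite /wedge linearB /= !trmx_mul !trmxK opprB. Qed.

(** * Electric and magnetic parts of a two-form on a spacelike leaf *)

Section leaf_algebra.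
Variables (g : 'M[R]_4) (om n : 'rV[R]_4) (fr : 'I_3 -> 'rV[R]_4) (chi : 'I_3 -> R).
Hypotheses (g_sym : g^T = g) (g_det : \det g < 0).
Hypotheses (om_time : pair (invmx g) om om < 0) (om0 : 0 < om 0 0).
Hypothesis nE : n = - (Num.sqrt (- pair (invmx g) om om))^-1 *: (om *m invmx g).
Hypothesis frE : forall i, fr i = ev (chi i) (delta_mx 0 i).
Hypothesis chiE : forall i, om 0 (lift ord0 i) + om 0 0 * chi i = 0.

(** The rows are the normal and the coordinate frame of the leaf, so [X *m G *m X^T] lists the
    components of a covariant tensor in the adapted basis. Among the hypotheses, [om] stands for
    [dtau] and [chi] for the slopes of the graph. *)
Definition basis_mx : 'M[R]_4 := \matrix_(a < 4) oapp fr n (unlift ord0 a).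
Let X := basis_mx.
Definition gram3 : 'M[R]_3 := \matrix_(i, j) pair g (fr i) (fr j).
Let h := gram3.
Let vol := Num.sqrt (\det h).
Let ug : g \in unitmx. Proof. by apply: det_unit; rewrite lt_eqF. Qed.
Let l := Num.sqrt (- pair (invmx g) om om).
Let l_gt0 : 0 < l. Proof. by rewrite sqrtr_gt0 oppr_gt0. Qed.

Lemma rowX0 : row 0 X = n.
Proof. by rewrite rowK unlift_none. Qed.
Lemma rowXS i : row (lift ord0 i) X = fr i.
Proof. by rewrite rowK liftK. Qed.

Lemma om_fr i : (om *m (fr i)^T) 0 0 = 0.
Proof.
rewrite mxE big_ord_recl !mxE frE !mxE unlift_none /=.
under eq_bigr do rewrite !mxE liftK /= mxE eqxx /=.
rewrite (bigD1 i)//= eqxx mulr1 big1 ?addr0 => [|j /negbTE ->]; last by rewrite mulr0.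
by rewrite addrC chiE.
Qed.

Lemma n_flat : n *m g = - l^-1 *: om.
Proof. by rewrite nE -scalemxAl -mulmxA mulVmx// mulmx1. Qed.

Lemma gn_fr i : pair g n (fr i) = 0.
Proof. by rewrite /pair n_flat -scalemxAl mxE om_fr mulr0. Qed.

Lemma gfr_n i : pair g (fr i) n = 0.
Proof. by rewrite -pair_tr g_sym gn_fr. Qed.

Lemma gnn : pair g n n = -1.
Proof.
rewrite /pair n_flat -scalemxAl mxE nE linearZ /= -scalemxAr mxE.
rewrite trmx_mul (invmx_sym g_sym) mulmxA -/(pair (invmx g) om om) -/l.
have -> : pair (invmx g) om om = - l ^+ 2.
  by rewrite sqr_sqrtr ?opprK// oppr_ge0 ltW.
by field; rewrite gt_eqF.
Qed.

Lemma om_n : (om *m n^T) 0 0 = l.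
Proof.
rewrite nE linearZ /= -scalemxAr mxE trmx_mul (invmx_sym g_sym) mulmxA -/(pair (invmx g) om om) -/l.
have -> : pair (invmx g) om om = - l ^+ 2.
  by rewrite sqr_sqrtr ?opprK// oppr_ge0 ltW.
by field; rewrite gt_eqF.
Qed.

(** The determinant is [n^0] minus the sum of [n^i chi_i]. Since [chi_i] is [- om_i / om_0], this is
    [om(n) / om_0], and [om(n)] is the normalising root [l]. *)
Lemma detX : \det X = l / om 0 0.
Proof.
have -> : \det X = n 0 0 - \sum_i n 0 (lift ord0 i) * chi i.
  have E (a : 'I_4) (i : 'I_3) : a = lift ord0 i -> forall j, X a j = fr i 0 j.
    by move=> -> j; rewrite -(rowXS i) [RHS]mxE.
  rewrite det4 /= !(E 1 0) ?(E 2 1) ?(E 3 2); try exact: val_inj.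
  have E0 j : X 0 j = n 0 j by rewrite -rowX0 [RHS]mxE.
  have F (a : 'I_4) (i j : 'I_3) : a = lift ord0 i -> fr j 0 a = (j == i)%:R.
    by move=> ->; rewrite frE mxE liftK /= mxE eqxx /= eq_sym.
  have F0 j : fr j 0 0 = chi j by rewrite frE mxE unlift_none.
  have L1 : 1 = lift ord0 0 :> 'I_4 by exact: val_inj.
  have L2 : 2 = lift ord0 1 :> 'I_4 by exact: val_inj.
  have L3 : 3 = lift ord0 2 :> 'I_4 by exact: val_inj.
  rewrite sum3 !E0 !F0 !(F _ _ _ L1) !(F _ _ _ L2) !(F _ _ _ L3) -L1 -L2 -L3 /=.
  by ring.
have := om_n; rewrite mxE big_ord_recl /= => <-.
have E i : om 0 (lift ord0 i) = - (om 0 0 * chi i).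
  by apply/eqP; rewrite -addr_eq0 chiE.
under [in RHS]eq_bigr do rewrite E mxE.
rewrite [n^T ord0 0]mxE; apply: (mulIf (x := om 0 0)); first by rewrite gt_eqF.
rewrite divfK ?gt_eqF// mulrBl mulrC; congr (_ + _).
by rewrite mulr_suml -sumrN; apply: eq_bigr => i _; ring.
Qed.

Lemma detX_gt0 : 0 < \det X.
Proof. by rewrite detX divr_gt0. Qed.

Let uX : X \in unitmx.
Proof. by apply: det_unit; rewrite gt_eqF// detX_gt0. Qed.

Lemma gX0i i : (X *m g *m X^T) 0 (lift ord0 i) = 0.
Proof. by rewrite pair_cong rowX0 rowXS gn_fr. Qed.
Lemma gXi0 i : (X *m g *m X^T) (lift ord0 i) 0 = 0.
Proof. by rewrite pair_cong rowX0 rowXS gfr_n. Qed.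
Lemma gX00 : (X *m g *m X^T) 0 0 = -1.
Proof. by rewrite pair_cong rowX0 gnn. Qed.
Lemma gXij i j : (X *m g *m X^T) (lift ord0 i) (lift ord0 j) = h i j.
Proof. by rewrite pair_cong !rowXS mxE. Qed.

(** In the adapted basis the metric is block diagonal with blocks [-1] and [h], so the determinants
    of [g] and [h] differ by the square of [det X] and a sign. *)
Lemma det_gram3 : \det h = (Num.sqrt (- \det g) * \det X) ^+ 2.
Proof.
have H : \det (X *m g *m X^T) = - \det h.
  rewrite (expand_det_row _ 0) big_ord_recl big1 => [|i _]; last by rewrite gX0i mul0r.
  rewrite gX00 /cofactor /= expr0 mul1r addr0 mulN1r; congr (- \det _).
  by apply/matrixP => i j; rewrite -gXij [LHS]mxE [LHS]mxE.
rewrite exprMn sqr_sqrtr ?oppr_ge0 1?ltW//.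
move: H; rewrite !det_mulmx det_tr => H; rewrite -[\det h]opprK -H; ring.
Qed.

Lemma volE : vol = Num.sqrt (- \det g) * \det X.
Proof. by rewrite /vol det_gram3 sqrtr_sqr ger0_norm// mulr_ge0 ?sqrtr_ge0// ltW// detX_gt0. Qed.

Lemma vol_gt0 : 0 < vol.
Proof. by rewrite volE mulr_gt0 ?detX_gt0// sqrtr_gt0 oppr_gt0. Qed.

Lemma gram3_unit : h \in unitmx.
Proof. by rewrite unitmxE unitfE det_gram3 -volE gt_eqF// exprn_gt0// vol_gt0. Qed.

Lemma gram3_sym : h^T = h.
Proof. by apply/matrixP => i j; rewrite !mxE -pair_tr g_sym. Qed.

(** The pull-back of [G] to the leaf, read as a vector density. Its coordinate divergence is the
    exterior derivative of the pull-back, and its radial part is the flux density through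
    spheres. *)
Definition dual3 G : 'rV[R]_3 :=
  row3 (pair G (fr 1) (fr 2)) (pair G (fr 2) (fr 0)) (pair G (fr 0) (fr 1)).

Lemma hat_basis0 G i : G^T = - G ->
  hat (X *m G *m X^T) 0 (lift ord0 i) = dual3 G 0 i.
Proof.
move=> aG.
have aX : (X *m G *m X^T)^T = - (X *m G *m X^T).
  by rewrite !trmx_mul trmxK aG mulNmx mulmxN mulmxA.
have L1 : 1 = lift ord0 0 :> 'I_4 by exact: val_inj.
have L2 : 2 = lift ord0 1 :> 'I_4 by exact: val_inj.
have L3 : 3 = lift ord0 2 :> 'I_4 by exact: val_inj.
rewrite (asym4E aX) hat_asym4; move: i; apply: ord3P.
- by rewrite -L1 [LHS]mxE [RHS]mxE /= L3 L2 pair_cong !rowXS.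
- by rewrite -L2 [LHS]mxE [RHS]mxE /= L3 L1 pair_cong !rowXS -pair_asym.
- by rewrite -L3 [LHS]mxE [RHS]mxE /= L2 L1 pair_cong !rowXS.
Qed.

Definition el G : 'rV[R]_3 := \row_i pair G (fr i) n.
Definition mg G : 'rV[R]_3 := \row_i - pair (star g G) (fr i) n.

(** By block diagonality the components of [star G] along a frame vector and the normal see only the
    spatial components of [G], lowered with the induced metric. This links the magnetic field to the
    flux of [G]. *)
Lemma mg_dual3 G : G^T = - G -> mg G = vol^-1 *: (dual3 G *m h).
Proof.
move=> aG; apply/rowP => i; rewrite !mxE -(rowXS i) -rowX0 -pair_cong.
rewrite star_basis// -volE mxE mulNr opprK; congr (_ * _).
have aH : (hat (X *m G *m X^T))^T = - hat (X *m G *m X^T).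
  by apply: hat_tr; rewrite !trmx_mul trmxK aG mulNmx mulmxN mulmxA.
set Y := X *m g *m X^T; set H := hat _ in aH *.
have HN a b : H a b = - H b a by move/matrixP: aH => /(_ b a); rewrite !mxE.
have H0 : H 0 0 = 0 by have := HN 0 0 => ?; lra.
rewrite mxE big_ord_recl big1 => [|j _]; last by rewrite gXi0 mulr0.
rewrite gX00 addr0 mulrN1 mxE big_ord_recl H0 mulr0 add0r -sumrN.
apply: eq_bigr => j _; rewrite gXij HN mulrN opprK hat_basis0// mulrC; congr (_ * _).
by have /matrixP/(_ j i) := gram3_sym; rewrite mxE.
Qed.

Lemma dual3_mg G : G^T = - G -> dual3 G = vol *: (mg G *m invmx h).
Proof.
move=> aG; rewrite mg_dual3// -scalemxAl scalerA divff ?gt_eqF ?vol_gt0// scale1r.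
by rewrite -mulmxA mulmxV ?gram3_unit// mulmx1.
Qed.

Lemma mg_star G : G^T = - G -> mg (star g G) = el G.
Proof. by move=> aG; apply/rowP => i; rewrite !mxE starK// pairN opprK. Qed.

Lemma el_star G : el (star g G) = - mg G.
Proof. by apply/rowP => i; rewrite !mxE opprK. Qed.

Lemma dual3_star G : G^T = - G -> dual3 (star g G) = vol *: (el G *m invmx h).
Proof. by move=> aG; rewrite dual3_mg ?star_tr// mg_star. Qed.

(** In the adapted basis [el] gives the components with one normal index and [mg], through [dual3],
    the purely tangential ones; together these are all six. *)
Lemma el_mg_inj G : G^T = - G -> el G = 0 -> mg G = 0 -> G = 0.
Proof.
move=> aG e0 m0; have d0 : dual3 G = 0 by rewrite dual3_mg// m0 mul0mx scaler0.
suff H : X *m G *m X^T = 0.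
  have := congr1 (fun Z => invmx X *m Z *m (invmx X)^T) H.
  rewrite /= mulmx0 mul0mx !mulmxA mulVmx// mul1mx -mulmxA -trmx_mul mulVmx//.
  by rewrite trmx1 mulmx1.
have aX : (X *m G *m X^T)^T = - (X *m G *m X^T).
  by rewrite !trmx_mul trmxK aG mulNmx mulmxN mulmxA.
have D i : dual3 G 0 i = 0 by rewrite d0 mxE.
have E i : pair G n (fr i) = 0.
  rewrite pair_asym//; have : el G 0 i = 0 by rewrite e0 mxE.
  by rewrite mxE => ->; rewrite oppr0.
have L1 : 1 = lift ord0 0 :> 'I_4 by exact: val_inj.
have L2 : 2 = lift ord0 1 :> 'I_4 by exact: val_inj.
have L3 : 3 = lift ord0 2 :> 'I_4 by exact: val_inj.
rewrite (asym4E aX) L3 L2 L1 !pair_cong !rowXS rowX0 !E.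
have := D 0; have := D 1; have := D 2; rewrite ![dual3 _ _ _]mxE /= => -> d1 ->.
rewrite (pair_asym (fr 0) (fr 2) aG) d1.
by apply/matrixP; apply: ord4P; apply: ord4P; rewrite !mxE /= ?oppr0.
Qed.

(** [ext3] and [join] are [ext_cov] and [field_of] with the base point forgotten; they agree by
    conversion, so that results proved here apply on a leaf directly. *)
Definition ext3 (e : 'rV[R]_3) : 'rV[R]_4 :=
  ev 0 e + (\sum_i e 0 i * n 0 (lift ord0 i)) *: (n *m g).
Definition join (e b : 'rV[R]_3) : 'M[R]_4 :=
  wedge (n *m g) (ext3 e) + star g (wedge (n *m g) (ext3 b)).

Lemma ext3_fr e i : (fr i *m (ext3 e)^T) 0 0 = e 0 i.
Proof.
rewrite /ext3 linearD /= mulmxDr mxE linearZ /= -scalemxAr [X in _ + X]mxE.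
have -> : (fr i *m (n *m g)^T) 0 0 = 0.
  by rewrite trmx_mul g_sym mulmxA; exact: gfr_n.
rewrite mulr0 addr0 frE dot_ev mulr0 add0r (bigD1 i)//= mxE !eqxx mul1r big1 ?addr0//.
by move=> j /negbTE jN; rewrite mxE eqxx jN mul0r.
Qed.

Lemma flat_fr i : (fr i *m (n *m g)^T) 0 0 = 0.
Proof. by rewrite trmx_mul g_sym mulmxA; exact: gfr_n. Qed.
Lemma flat_n : (n *m (n *m g)^T) 0 0 = -1.
Proof. by rewrite trmx_mul g_sym mulmxA; exact: gnn. Qed.

Lemma dual3_wedge e : dual3 (wedge (n *m g) (ext3 e)) = 0.
Proof.
by apply/rowP; apply: ord3P; rewrite !mxE /= pair_wedge !flat_fr !mul0r mulr0 subr0.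
Qed.

Lemma mg_wedge e : mg (wedge (n *m g) (ext3 e)) = 0.
Proof. by rewrite mg_dual3 ?wedge_tr// dual3_wedge mul0mx scaler0. Qed.

Lemma el_wedge e : el (wedge (n *m g) (ext3 e)) = e.
Proof.
apply/rowP => i; rewrite mxE pair_wedge flat_fr flat_n ext3_fr mul0r; ring.
Qed.

Lemma elD G G' : el (G + G') = el G + el G'.
Proof. by apply/rowP => i; rewrite !mxE pairD. Qed.
Lemma mgD G G' : mg (G + G') = mg G + mg G'.
Proof. by apply/rowP => i; rewrite !mxE starD pairD opprD. Qed.
Lemma elN G : el (- G) = - el G.
Proof. by apply/rowP => i; rewrite !mxE pairN. Qed.
Lemma mgN G : mg (- G) = - mg G.
Proof. by apply/rowP => i; rewrite !mxE starN pairN. Qed.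

Lemma join_tr e b : (join e b)^T = - join e b.
Proof.
have aW u v : (wedge u v)^T = - wedge u v :> 'M[R]_4 by exact: wedge_tr.
by rewrite /join trmxD aW (star_tr g_sym g_det (aW _ _)) -opprD.
Qed.

Lemma el_join e b : el (join e b) = e.
Proof. by rewrite /join elD el_wedge el_star mg_wedge oppr0 addr0. Qed.

Lemma mg_join e b : mg (join e b) = b.
Proof. by rewrite /join mgD mg_wedge mg_star ?wedge_tr// el_wedge add0r. Qed.

(** The difference of the two sides has vanishing electric and magnetic parts, so [el_mg_inj]
    applies. *)
Lemma join_el_mg G : G^T = - G -> join (el G) (mg G) = G.
Proof.
move=> aG; apply/eqP; rewrite -subr_eq0; apply/eqP; apply: el_mg_inj.
- by rewrite trmxD join_tr trmxN aG [RHS]opprD.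
- by rewrite elD elN el_join subrr.
- by rewrite mgD mgN mg_join subrr.
Qed.

End leaf_algebra.
End hodge_star.

(** * Lorentz algebra: orthonormal bases, energy condition, invariants *)

Section lorentz_algebra.
Context {R : realType}.
Implicit Types (F G g P X Y : 'M[R]_4) (n N : 'rV[R]_4).

Definition mat4 (s : seq (seq R)) : 'M[R]_4 := \matrix_(i < 4, j < 4) (nth [::] s i)`_j.
Definition eta : 'M[R]_4 :=
  mat4 [:: [:: -1; 0; 0; 0]; [:: 0; 1; 0; 0]; [:: 0; 0; 1; 0]; [:: 0; 0; 0; 1]].

Lemma eta_sym : eta^T = eta.
Proof. by apply/matrixP; apply: ord4P; apply: ord4P; rewrite !mxE. Qed.

Lemma etaK : eta *m eta = 1%:M.
Proof.
apply/matrixP; apply: ord4P; apply: ord4P; rewrite mxE sum4 !mxE /=; ring.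
Qed.

Lemma eta_unit : eta \in unitmx.
Proof. by case/mulmx1_unit: etaK. Qed.

Lemma eta_inv : invmx eta = eta.
Proof. by rewrite -[LHS]mulmx1 -etaK mulmxA mulVmx ?mul1mx// eta_unit. Qed.

Lemma det_eta : \det eta = -1.
Proof. by rewrite det4 /= !mxE /=; ring. Qed.

Lemma pair_eta (u v : 'rV[R]_4) : pair eta u v =
  - (u 0 0 * v 0 0) + u 0 1 * v 0 1 + u 0 2 * v 0 2 + u 0 3 * v 0 3.
Proof. by rewrite /pair mxE sum4 !mxE !sum4 !mxE /=; ring. Qed.

(* L is minus the reflection in the hyperplane orthogonal to m + e_0. *)
Lemma boost (m : 'rV[R]_4) : 0 < m 0 0 -> (m *m eta *m m^T) 0 0 = -1 ->
  exists L : 'M[R]_4, L^T *m eta *m L = eta /\ m *m L^T = delta_mx 0 0.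
Proof.
move=> m0 mm; pose e : 'rV[R]_4 := delta_mx 0 0; pose w := m + e.
pose c := (1 + m 0 0)^-1.
have M0 : 1 + m 0 0 != 0 by rewrite gt_eqF// addr_gt0.
have ee : (e *m eta *m e^T) 0 0 = -1 by rewrite mxE sum4 !mxE !sum4 !mxE /=; ring.
have me : (m *m eta *m e^T) 0 0 = - m 0 0 by rewrite mxE sum4 !mxE !sum4 !mxE /=; ring.
have em : (e *m eta *m m^T) 0 0 = - m 0 0 by rewrite mxE sum4 !mxE !sum4 !mxE /=; ring.
have scal (A : 'M[R]_1) x : A 0 0 = x -> A = x%:M by move=> <-; exact: mx11_scalar.
have mw : m *m eta *m w^T = (- (1 + m 0 0))%:M.
  apply: scal; rewrite /w trmxD mulmxDr mxE mm me; ring.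
have ww : w *m eta *m w^T = (- 2 * (1 + m 0 0))%:M.
  apply: scal; rewrite /w trmxD mulmxDr !mulmxDl !mxE.
  by move: mm me em ee; rewrite !mxE => -> -> -> ->; ring.
exists (- (1%:M + c *: (w^T *m w *m eta))); split.
  rewrite trmxN mulNmx mulmxN mulNmx opprK trmxD trmx1 linearZ /= !trmx_mul trmxK eta_sym.
  rewrite mulmxDl mul1mx mulmxDr mulmx1 mulmxDl.
  rewrite -!scalemxAl -!scalemxAr -addrA; apply/eqP; rewrite -[X in _ == X]addr0.
  rewrite (inj_eq (addrI _)); apply/eqP; rewrite !mulmxA.
  have -> : eta *m w^T *m w *m eta *m w^T *m w *m eta
    = (- 2 * (1 + m 0 0)) *: (eta *m w^T *m w *m eta).
    transitivity (eta *m w^T *m (w *m eta *m w^T) *m w *m eta); first by rewrite !mulmxA.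
    by rewrite ww mul_mx_scalar -!scalemxAl.
  rewrite ?scalerDr !scalerA -!scalerDl.
  rewrite (_ : _ + _ = 0) ?scale0r// /c; by field.
rewrite trmxN mulmxN trmxD trmx1 mulmxDr mulmx1 linearZ /= !trmx_mul trmxK eta_sym.
rewrite -scalemxAr !mulmxA mw mul_scalar_mx scalerA /c mulrN mulVf// scaleN1r.
by rewrite opprB /w addrC addKr.
Qed.

(** Sylvester's normal form taken as the definition: for Kerr-Newman the factor is explicit, and its
    inverse yields orthonormal bases. *)
Definition lorentzian g := exists2 P, P \in unitmx & g = P^T *m eta *m P.

(** The inverse of the factor of [g] is an orthonormal basis, and a Lorentz transformation moves its
    timelike member to the prescribed unit vector [n]. *)
Lemma orthonormal_basis g n : lorentzian g -> pair g n n = -1 ->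
  exists Y : 'M[R]_4, [/\ Y \in unitmx, Y *m g *m Y^T = eta & row 0 Y = n].
Proof.
move=> [P uP gE] nn.
(* [boost] asks for a positive time component. It is nonzero because [n] is timelike, and [- P]
   factors [g] as well as [P] does, so the sign can be chosen. *)
have [P' uP' [gE' m0]] : exists2 P', P' \in unitmx &
    g = P'^T *m eta *m P' /\ 0 < (n *m P'^T) 0 0.
  have H (Q : 'M[R]_4) : g = Q^T *m eta *m Q -> (n *m Q^T) 0 0 != 0.
    move=> E; apply/eqP => z; move: nn; rewrite /pair E !mulmxA.
    rewrite -(mulmxA _ Q) -{2}[Q]trmxK -trmx_mul -/(pair eta _ _) pair_eta z.
    move: ((n *m Q^T) 0 1) ((n *m Q^T) 0 2) ((n *m Q^T) 0 3) => a b c.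
    have := sqr_ge0 a; have := sqr_ge0 b; have := sqr_ge0 c; rewrite !expr2.
    by clear; move=> *; lra.
  have := H P gE; rewrite neq_lt => /orP[lt0|gt0]; last by exists P.
  exists (- P); first by rewrite -scaleN1r unitmxZ// unitrN1.
  rewrite trmxN mulNmx mulNmx mulmxN opprK; split=> //.
  by rewrite mulmxN mxE oppr_gt0.
have [|L [LE Lm]] := boost m0.
  by rewrite -nn /pair gE' !mulmxA trmx_mul trmxK !mulmxA.
have uL : L \in unitmx.
  have : \det (L^T *m eta *m L) = -1 by rewrite LE det_eta.
  rewrite !det_mulmx det_tr det_eta unitmxE unitfE => h.
  by apply/eqP => z; move: h; rewrite z mul0r mul0r => /eqP; rewrite eq_sym oppr_eq0 oner_eq0.
pose Q := L *m P'.
have uQ : Q \in unitmx by rewrite unitmx_mul uL.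
have QE : Q^T *m eta *m Q = g.
  by rewrite /Q trmx_mul !mulmxA -(mulmxA _ L^T) -(mulmxA _ (L^T *m eta)) LE gE'.
have nQ : n *m Q^T = delta_mx 0 0 by rewrite /Q trmx_mul mulmxA.
clearbody Q; exists (invmx Q)^T; split.
- by rewrite unitmx_tr unitmx_inv.
- rewrite trmxK -QE trmx_inv !mulmxA mulVmx ?unitmx_tr//. rewrite mul1mx -mulmxA mulmxV//.
  by rewrite mulmx1.
- by rewrite trmx_inv rowE -nQ -mulmxA mulmxV ?mulmx1// unitmx_tr.
Qed.

Section in_basis.
Variables (g : 'M[R]_4) (Y : 'M[R]_4).
Hypotheses (uY : Y \in unitmx) (YE : Y *m g *m Y^T = eta).

Lemma gE_basis : g = invmx Y *m eta *m (invmx Y)^T.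
Proof.
rewrite -YE !mulmxA mulVmx// mul1mx -mulmxA -trmx_mul mulVmx//.
by rewrite trmx1 mulmx1.
Qed.

Lemma basis_g_sym : g^T = g.
Proof. by rewrite gE_basis !trmx_mul trmxK eta_sym mulmxA. Qed.

Lemma basis_det : \det Y ^+ 2 * \det g = -1.
Proof. by rewrite -det_eta -YE !det_mulmx det_tr; ring. Qed.

Lemma basis_det_lt0 : \det g < 0.
Proof.
rewrite ltNge; apply/negP => g0; have := basis_det; apply/eqP.
by rewrite gt_eqF// (lt_le_trans (y := 0)) ?oppr_lt0// mulr_ge0// sqr_ge0.
Qed.

Lemma basis_inv : invmx g = Y^T *m eta *m Y.
Proof.
have ug : g \in unitmx by apply: det_unit; rewrite lt_eqF// basis_det_lt0.
apply: (can_inj (mulKmx ug)); rewrite mulmxV//.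
rewrite gE_basis !mulmxA -(mulmxA _ _ Y^T) -trmx_mul mulmxV//.
by rewrite trmx1 mulmx1 -(mulmxA _ eta eta) etaK mulmx1 mulVmx.
Qed.

Lemma basis_stress G : Y *m stress g G *m Y^T = stress eta (Y *m G *m Y^T).
Proof.
rewrite /stress eta_inv mulmxBr mulmxBl -scalemxAr -scalemxAl YE basis_inv.
rewrite !trmx_mul trmxK !mulmxA; congr (_ - (_ * _) *: _).
by rewrite -!(mulmxA Y) [RHS]mxtrace_mulC ?mulmxA.
Qed.

Lemma basis_pair G u v : pair G (u *m Y) (v *m Y) = pair (Y *m G *m Y^T) u v.
Proof. by rewrite /pair trmx_mul !mulmxA. Qed.

Lemma basis_asym G : G^T = - G -> (Y *m G *m Y^T)^T = - (Y *m G *m Y^T).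
Proof. by move=> aG; rewrite !trmx_mul trmxK aG mulNmx mulmxN mulmxA. Qed.

Lemma basis_inv_pair G u v :
  pair (invmx g) (u *m G) (v *m G) =
  pair eta (u *m G *m Y^T) (v *m G *m Y^T).
Proof. by rewrite /pair basis_inv !trmx_mul trmxK !mulmxA. Qed.

Lemma basis_row0 G b : row 0 Y *m G *m Y^T = row 0 (Y *m G *m Y^T) /\
   (row 0 Y *m G *m Y^T) 0 b = (Y *m G *m Y^T) 0 b.
Proof. by rewrite !row_mul; split=> //; rewrite -!row_mul mxE. Qed.

End in_basis.

(** With [a, b, c] the electric and [d, e, f] the magnetic components, these are the energy density
    and, up to sign conventions, the Poynting vector. *)
Lemma stress_eta_row (a b c d e f : R) :
  [/\ stress eta (asym4 a b c d e f) 0 0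
        = 2^-1 * (a ^+ 2 + b ^+ 2 + c ^+ 2 + d ^+ 2 + e ^+ 2 + f ^+ 2),
      stress eta (asym4 a b c d e f) 1 0 = d * b + e * c,
      stress eta (asym4 a b c d e f) 2 0 = f * c - d * a &
      stress eta (asym4 a b c d e f) 3 0 = - (e * a + f * b)].
Proof.
have S (A : 'M[R]_4) i j : (A *m eta *m A^T) i j =
    - (A i 0 * A j 0) + A i 1 * A j 1 + A i 2 * A j 2 + A i 3 * A j 3.
  by rewrite pair_cong pair_eta !mxE.
have tr (A : 'M[R]_4) : \tr (A *m eta) = - A 0 0 + A 1 1 + A 2 2 + A 3 3.
  by rewrite /mxtrace sum4 ![(A *m eta) _ _]mxE !sum4 !mxE /=; ring.
have E i j : stress eta (asym4 a b c d e f) i j =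
    (asym4 a b c d e f *m eta *m (asym4 a b c d e f)^T) i j -
    4^-1 * (2 * (d ^+ 2 + e ^+ 2 + f ^+ 2 - a ^+ 2 - b ^+ 2 - c ^+ 2)) * eta i j.
  rewrite /stress eta_inv !mxE tr !S; congr (_ - _ * _ * _).
  by rewrite !mxE /=; ring.
by split; rewrite E S !mxE /=; field.
Qed.

(** The Poynting vector is no longer than the energy density: the difference of squares is the sum
    of the squares of [E.B] and of half of [E.E - B.B]. Since [N] is timelike, Cauchy-Schwarz leaves
    a strictly positive remainder. *)
Lemma stress_pos (N0 N1 N2 N3 a b c d e f : R) : 0 < N0 ->
  N1 ^+ 2 + N2 ^+ 2 + N3 ^+ 2 < N0 ^+ 2 ->
  asym4 a b c d e f != 0 ->
  0 < N0 * (2^-1 * (a ^+ 2 + b ^+ 2 + c ^+ 2 + d ^+ 2 + e ^+ 2 + f ^+ 2))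
   + N1 * (d * b + e * c) + N2 * (f * c - d * a) + N3 * (- (e * a + f * b)).
Proof.
move=> N0_gt0 NN nz.
set T := 2^-1 * _; set s1 := d * b + e * c; set s2 := f * c - d * a; set s3 := - (e * a + f * b).
have T_gt0 : 0 < T.
  rewrite lt_neqAle; apply/andP; split; last by rewrite mulr_ge0 ?invr_ge0// !addr_ge0// sqr_ge0.
  rewrite eq_sym; apply: contra nz; rewrite mulf_eq0 invr_eq0 pnatr_eq0 /=.
  rewrite !paddr_eq0 ?addr_ge0 ?sqr_ge0// !sqrf_eq0.
  move=> /andP[/andP[/andP[/andP[/andP[/eqP -> /eqP ->] /eqP ->] /eqP ->] /eqP ->] /eqP ->].
  by apply/eqP/matrixP; apply: ord4P; apply: ord4P; rewrite !mxE /= ?oppr0.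
have S : s1 ^+ 2 + s2 ^+ 2 + s3 ^+ 2 <= T ^+ 2.
  rewrite -subr_ge0 (_ : _ - _ = (a * f - b * e + c * d) ^+ 2
     + (2^-1 * (a ^+ 2 + b ^+ 2 + c ^+ 2 - d ^+ 2 - e ^+ 2 - f ^+ 2)) ^+ 2).
    by rewrite addr_ge0 ?sqr_ge0.
  by rewrite /T /s1 /s2 /s3; field.
have C : (N1 * s1 + N2 * s2 + N3 * s3) ^+ 2 <=
    (N1 ^+ 2 + N2 ^+ 2 + N3 ^+ 2) * (s1 ^+ 2 + s2 ^+ 2 + s3 ^+ 2).
  rewrite -subr_ge0 (_ : _ - _ = (N1 * s2 - N2 * s1) ^+ 2
     + (N1 * s3 - N3 * s1) ^+ 2 + (N2 * s3 - N3 * s2) ^+ 2); last by ring.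
  by rewrite !addr_ge0 ?sqr_ge0.
have L : (N1 * s1 + N2 * s2 + N3 * s3) ^+ 2 < (N0 * T) ^+ 2.
  apply: le_lt_trans C _; rewrite exprMn.
  apply: (@le_lt_trans _ _ ((N1 ^+ 2 + N2 ^+ 2 + N3 ^+ 2) * T ^+ 2)).
    by rewrite ler_wpM2l// !addr_ge0// sqr_ge0.
  by rewrite ltr_pM2r// exprn_gt0.
have : `|N1 * s1 + N2 * s2 + N3 * s3| < N0 * T.
  have NT : 0 <= N0 * T by rewrite mulr_ge0 ?ltW.
  by move: L; rewrite -[X in X < _]real_normK ?num_real// ltr_pXn2r// nnegrE.
rewrite ltr_norml => /andP[+ _]; rewrite -subr_gt0 opprK => h.
by rewrite (_ : _ + _ = N1 * s1 + N2 * s2 + N3 * s3 + N0 * T)//; ring.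
Qed.

(** The dominant energy condition in strict form. The covector [om] only fixes a time orientation:
    positivity on both [n] and [N] says that they are future directed together. *)
Lemma energy_condition g n N om G : lorentzian g -> pair g n n = -1 ->
  pair g N N < 0 -> pair (invmx g) om om < 0 ->
  0 < (om *m n^T) 0 0 -> 0 < (om *m N^T) 0 0 ->
  G^T = - G -> G != 0 -> 0 < pair (stress g G) N n.
Proof.
move=> lg nn NN oo on oN aG nz.
have [Y [uY YE rY]] := orthonormal_basis lg nn.
have [M NE] : exists M, N = M *m Y by exists (N *m invmx Y); rewrite mulmxKV.
pose w := om *m Y^T.
have NN' : M 0 1 ^+ 2 + M 0 2 ^+ 2 + M 0 3 ^+ 2 < M 0 0 ^+ 2.
  by move: NN; rewrite NE basis_pair YE pair_eta !expr2; clear => h; lra.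
have ww : w 0 1 ^+ 2 + w 0 2 ^+ 2 + w 0 3 ^+ 2 < w 0 0 ^+ 2.
  have := oo; rewrite /pair (basis_inv uY YE) !mulmxA -/w.
  rewrite -mulmxA -{1}[Y]trmxK -trmx_mul -/w -/(pair eta w w) pair_eta !expr2.
  by clear => h; lra.
have w0 : 0 < w 0 0.
  move: on; rewrite -rY (_ : (om *m _) 0 0 = w 0 0)//.
  by rewrite /w !mxE; apply: eq_bigr => i _; rewrite !mxE.
(* If the time component of [N] were nonpositive, Cauchy-Schwarz for the spatial parts of the two
   timelike vectors would force [om(N)] to be nonpositive. *)
have M0 : 0 < M 0 0.
  move: oN; rewrite NE trmx_mul mulmxA -/w mxE sum4 ![M^T _ _]mxE => wM.
  rewrite ltNge; apply/negP => M0le.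
  have C : (w 0 1 * M 0 1 + w 0 2 * M 0 2 + w 0 3 * M 0 3) ^+ 2 <=
     (w 0 1 ^+ 2 + w 0 2 ^+ 2 + w 0 3 ^+ 2) * (M 0 1 ^+ 2 + M 0 2 ^+ 2 + M 0 3 ^+ 2).
    rewrite -subr_ge0 (_ : _ - _ = (w 0 1 * M 0 2 - w 0 2 * M 0 1) ^+ 2
       + (w 0 1 * M 0 3 - w 0 3 * M 0 1) ^+ 2 + (w 0 2 * M 0 3 - w 0 3 * M 0 2) ^+ 2); last by ring.
    by rewrite !addr_ge0 ?sqr_ge0.
  have D : (w 0 1 * M 0 1 + w 0 2 * M 0 2 + w 0 3 * M 0 3) ^+ 2 <= (w 0 0 * - M 0 0) ^+ 2.
    apply: le_trans C _; rewrite exprMn sqrrN.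
    by apply: ler_pM; rewrite ?addr_ge0 ?sqr_ge0//; exact: ltW.
  have : `|w 0 1 * M 0 1 + w 0 2 * M 0 2 + w 0 3 * M 0 3| <= w 0 0 * - M 0 0.
    have NT : 0 <= w 0 0 * - M 0 0 by apply: mulr_ge0; [exact: ltW|rewrite oppr_ge0].
    by move: D; rewrite -[X in X <= _]real_normK ?num_real// ler_pXn2r// nnegrE.
  rewrite ler_norml => /andP[_]; rewrite leNgt => /negP; apply.
  by rewrite -subr_gt0 mulrN opprK addrC !addrA; exact: wM.
have aH := basis_asym Y aG.
rewrite NE -rY (_ : row 0 Y = delta_mx 0 0 *m Y); last by rewrite rowE.
rewrite basis_pair (basis_stress uY YE) (asym4E aH).
set a := (_ *m Y^T) 0 1; set b := (_ *m Y^T) 0 2; set c := (_ *m Y^T) 0 3.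
set d := (_ *m Y^T) 1 2; set e := (_ *m Y^T) 1 3; set f := (_ *m Y^T) 2 3.
have [T0 T1 T2 T3] := stress_eta_row a b c d e f.
rewrite /pair trmx_delta -colE.
have -> : (M *m stress eta (asym4 a b c d e f)) = \row_j \sum_i M 0 i * stress eta (asym4 a b c d e f) i j.
  by apply/rowP => j; rewrite !mxE.
rewrite !mxE sum4 T0 T1 T2 T3; apply: stress_pos => //.
apply: contra nz => /eqP z; apply/eqP.
have : invmx Y *m (Y *m G *m Y^T) *m (invmx Y)^T = 0.
  by rewrite (asym4E aH) z mulmx0 mul0mx.
by rewrite !mulmxA mulVmx// mul1mx -mulmxA -trmx_mul mulVmx// trmx1 mulmx1.
Qed.

(* The invariants E.E - B.B and E.B, in a form that does not mention the frame. *)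
Definition inv1 G := \tr (G *m hat G).
Definition inv2 g G := \tr (star g G *m hat G).

Lemma tr_asym4_hat (a b c d e f a' b' c' d' e' f' : R) :
  \tr (asym4 a b c d e f *m hat (asym4 a' b' c' d' e' f')) =
  - 2 * (a * f' + a' * f - b * e' - b' * e + c * d' + c' * d).
Proof.
rewrite hat_asym4 /mxtrace sum4 ![(_ *m _) _ _]mxE !sum4 !mxE /=; ring.
Qed.

Lemma tr_hat_basis Y F G : \tr ((Y *m F *m Y^T) *m hat (Y *m G *m Y^T))
  = \det Y * \tr (F *m hat G).
Proof.
rewrite -mxtraceZ scalemxAr -hat_cong -!mulmxA [LHS]mxtrace_mulC !mulmxA.
by rewrite -!mulmxA.
Qed.

(** In an orthonormal frame containing [n] the left side is built from [E.B] and [E.E - B.B], and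
    the gap is a multiple of the square of the Poynting vector: [(E.E + B.B)^2 - (E.E - B.B)^2 - 4
    (E.B)^2 = 4 |E x B|^2]. *)
Lemma invariants_le g n G : lorentzian g -> pair g n n = -1 -> G^T = - G ->
  inv1 G ^+ 2 + inv2 g G ^+ 2 <= 4 * - \det g *
    (pair (invmx g) (n *m G) (n *m G) + pair (invmx g) (n *m star g G) (n *m star g G)) ^+ 2.
Proof.
move=> lg nn aG.
have [Y [uY YE rY]] := orthonormal_basis lg nn.
have g_sym := basis_g_sym uY YE; have g_det := basis_det_lt0 YE.
have dY2 := basis_det YE.
have dY0 : \det Y != 0 by rewrite -unitfE -unitmxE.
have aH := basis_asym Y aG.
have aS := basis_asym Y (star_tr g_sym g_det aG).
(* The orientation sign of the frame [Y]. The frame may have either orientation, but only the square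
   of [s] enters. *)
pose s := (Num.sqrt (- \det g) * \det Y)^-1.
have s2 : s ^+ 2 = 1.
  rewrite exprVn exprMn sqr_sqrtr ?oppr_ge0 1?ltW// mulrC mulrN dY2 opprK invr1 //.
have SE : Y *m star g G *m Y^T = - s *: (eta *m hat (Y *m G *m Y^T) *m eta).
  by rewrite (star_basis g_sym g_det)// YE.
have i1 : inv1 G = (\det Y)^-1 * \tr ((Y *m G *m Y^T) *m hat (Y *m G *m Y^T)).
  by rewrite tr_hat_basis mulKf.
have i2 : inv2 g G = (\det Y)^-1 * \tr ((Y *m star g G *m Y^T) *m hat (Y *m G *m Y^T)).
  by rewrite tr_hat_basis mulKf.
have R0 F b : (n *m F *m Y^T) 0 b = (Y *m F *m Y^T) 0 b.
  by rewrite -rY; have [] := basis_row0 Y F b.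
rewrite !(basis_inv_pair uY YE) !pair_eta !R0 {}i1 {}i2 SE.
move: aH; set H := Y *m G *m Y^T => aH.
rewrite (asym4E aH).
set a := H 0 1; set b := H 0 2; set c := H 0 3; set d := H 1 2; set e := H 1 3; set f := H 2 3.
have EE : eta *m hat (asym4 a b c d e f) *m eta = asym4 (- f) e (- d) c (- b) a.
  rewrite hat_asym4; apply/matrixP; apply: ord4P; apply: ord4P;
  by rewrite mxE sum4 ![(eta *m _) _ _]mxE !sum4 !mxE /=; ring.
have ZE (x a' b' c' d' e' f' : R) : x *: asym4 a' b' c' d' e' f' =
    asym4 (x * a') (x * b') (x * c') (x * d') (x * e') (x * f').
  by apply/matrixP; apply: ord4P; apply: ord4P; rewrite !mxE /= ?mulr0 ?mulrN.
rewrite EE ZE !tr_asym4_hat !mxE /=.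
have dg : - \det g = (\det Y)^-1 ^+ 2.
  apply: (mulfI (expf_neq0 2 dY0)); rewrite mulrN dY2 opprK -exprMn mulfV// expr1n.
  by [].
rewrite dg !exprMn -mulrDr -subr_ge0.
rewrite (_ : _ - _ = (\det Y)^-1 ^+ 2 * (4 * ((a ^+ 2 + b ^+ 2 + c ^+ 2 + s ^+ 2 * (d ^+ 2 + e ^+ 2 + f ^+ 2)) ^+ 2
   - 4 * (a * f - b * e + c * d) ^+ 2 - s ^+ 2 * (a ^+ 2 + b ^+ 2 + c ^+ 2 - d ^+ 2 - e ^+ 2 - f ^+ 2) ^+ 2))); last by ring.
rewrite s2 !mul1r mulr_ge0 ?sqr_ge0// mulr_ge0// (_ : _ - _ = 4 * ((a * e + b * f) ^+ 2
   + (a * d - c * f) ^+ 2 + (b * d + c * e) ^+ 2)); last by ring.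
by rewrite mulr_ge0// !addr_ge0 ?sqr_ge0.
Qed.

End lorentz_algebra.

Lemma trmxZ {R : pzRingType} k l c (A : 'M[R]_(k, l)) : (c *: A)^T = c *: A^T.
Proof. by apply/matrixP => i j; rewrite !mxE. Qed.

(** * Pointwise algebra of the Kerr-Newman metric *)

Section kerr_newman_point.
Context {R : realType} (B : setting R).
Local Notation M := (mass B).
Local Notation a := (spin B).
Local Notation Q := (chg B).
Implicit Types (p : 'rV[R]_4).

Definition row4 (t x y z : R) : 'rV[R]_4 := \row_(i < 4) [:: t; x; y; z]`_i.

Lemma row4E (t x y z : R) : ((row4 t x y z 0 0 = t) * (row4 t x y z 0 1 = x) *
  (row4 t x y z 0 2 = y) * (row4 t x y z 0 3 = z))%type.
Proof. by rewrite !mxE. Qed.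

Lemma row4P (u : 'rV[R]_4) : u = row4 (u 0 0) (u 0 1) (u 0 2) (u 0 3).
Proof. by apply/rowP; apply: ord4P; rewrite !mxE. Qed.

Lemma row3E (x y z : R) : ((row3 x y z 0 0 = x) * (row3 x y z 0 1 = y) * (row3 x y z 0 2 = z))%type.
Proof. by rewrite !mxE. Qed.

Lemma scaleE m (c : R) (v : 'rV[R]_m) i : (c *: v) 0 i = c * v 0 i.
Proof. exact: mxE. Qed.

Lemma lift0E : ((lift ord0 (0 : 'I_3) = 1 :> 'I_4) * (lift ord0 (1 : 'I_3) = 2 :> 'I_4)
  * (lift ord0 (2 : 'I_3) = 3 :> 'I_4))%type.
Proof. by split; [split|]; exact: val_inj. Qed.

Lemma evE (t : R) y : ((ev t y 0 0 = t) * (ev t y 0 1 = y 0 0) * (ev t y 0 2 = y 0 1)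
  * (ev t y 0 3 = y 0 2))%type.
Proof.
have E (i : 'I_3) : ev t y 0 (lift ord0 i) = y 0 i by rewrite mxE liftK.
split; [split; [split|]|]; first by rewrite mxE unlift_none.
- by rewrite -(E 0) lift0E.
- by rewrite -(E 1) lift0E.
- by rewrite -(E 2) lift0E.
Qed.

Lemma ev_row4 (t : R) y : ev t y = row4 t (y 0 0) (y 0 1) (y 0 2).
Proof. by rewrite [LHS]row4P !evE. Qed.

Lemma sqr_radius (y : 'rV[R]_3) : radius y ^+ 2 = y 0 0 ^+ 2 + y 0 1 ^+ 2 + y 0 2 ^+ 2.
Proof. by rewrite /radius sqr_sqrtr sum3// !addr_ge0// sqr_ge0. Qed.

(** A unit vector is completed to a positively oriented orthonormal triad. No continuous choice
    exists on the whole sphere, hence the case distinction; only pointwise consequences are used. *)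
Lemma triad (n1 n2 n3 : R) : n1 * n1 + n2 * n2 + n3 * n3 = 1 ->
  exists u1 u2 u3 v1 v2 v3 : R,
    [/\ u1 * u1 + v1 * v1 = 1 - n1 * n1, u2 * u2 + v2 * v2 = 1 - n2 * n2,
        u3 * u3 + v3 * v3 = 1 - n3 * n3, u1 * u2 + v1 * v2 = - (n1 * n2) &
     [/\ u1 * u3 + v1 * v3 = - (n1 * n3), u2 * u3 + v2 * v3 = - (n2 * n3),
        u2 * v3 - u3 * v2 = n1, u3 * v1 - u1 * v3 = n2 & u1 * v2 - u2 * v1 = n3]].
Proof.
move=> nn; pose q := Num.sqrt (n1 * n1 + n2 * n2).
have [z|nz] := eqVneq (n1 * n1 + n2 * n2) 0.
  have [n10 n20] : n1 = 0 /\ n2 = 0.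
    move: z => /eqP; rewrite -!expr2 paddr_eq0 ?sqr_ge0// !sqrf_eq0.
    by move=> /andP[/eqP -> /eqP ->].
  have n3n : n3 * n3 = 1 by move: nn; rewrite n10 n20; clear; lra.
  (* On the axis [n3] is 1 or -1, and putting it into the second vector keeps the orientation. *)
  exists 1, 0, 0, 0, n3, 0; rewrite n10 n20 n3n.
  by do ![split]; ring.
have q0 : q != 0.
  rewrite gt_eqF// sqrtr_gt0 lt_neqAle eq_sym nz /= -!expr2.
  by rewrite addr_ge0// sqr_ge0.
have q2 : q * q = n1 * n1 + n2 * n2.
  by rewrite -expr2 sqr_sqrtr// -!expr2 addr_ge0// sqr_ge0.
have n3n : n3 * n3 = 1 - q * q by rewrite q2 -nn; ring.
have qq (x y : R) : x * (q * q) = y * (q * q) -> x = y.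
  by apply: mulIf; rewrite mulf_neq0.
have n22 : n2 * n2 = q * q - n1 * n1 by rewrite q2; ring.
(* Off the axis these are the unit vectors in the theta and phi directions, with [q] equal to
   sin(theta). *)
exists (n1 * n3 / q), (n2 * n3 / q), (- q), (- n2 / q), (n1 / q), 0.
split; [| | | |split]; apply: qq.
- transitivity (n1 * n1 * (n3 * n3) + n2 * n2); first by field.
  by rewrite n3n n22; ring.
- transitivity (n2 * n2 * (n3 * n3) + n1 * n1); first by field.
  by rewrite n3n n22; ring.
- by rewrite n3n; ring.
- transitivity (n1 * n2 * (n3 * n3) - n1 * n2); first by field.
  by rewrite n3n; ring.
- by field.
- by field.
- by field.
- by field.
- transitivity (n1 * n1 * n3 + n2 * n2 * n3); first by field.
  by rewrite n22; ring.
Qed.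

(** The square root of a Kerr-Schild metric. With [l = dt + u], the covectors [e0 = dt - h l / 2]
    and [e1 = u + h l / 2] satisfy [- e0^2 + e1^2 = - dt^2 + u^2 + h l^2], the terms in [h^2]
    cancelling. *)
Lemma factor_mat4 (h w1 w2 m3 q u1 u2 u3 v1 v2 v3 e11 e22 e33 e12 e13 e23 : R) :
  u1 * u1 + v1 * v1 = e11 -> u2 * u2 + v2 * v2 = e22 -> u3 * u3 + v3 * v3 = e33 ->
  u1 * u2 + v1 * v2 = e12 -> u1 * u3 + v1 * v3 = e13 -> u2 * u3 + v2 * v3 = e23 ->
  exists2 P, - ((row4 1 0 0 0)^T *m row4 1 0 0 0) + (row4 0 w1 w2 m3)^T *m row4 0 w1 w2 m3
    + (q * q) *: mat4 [:: [:: 0; 0; 0; 0]; [:: 0; e11; e12; e13];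
        [:: 0; e12; e22; e23]; [:: 0; e13; e23; e33]]
    + h *: ((row4 1 w1 w2 m3)^T *m row4 1 w1 w2 m3) = P^T *m eta *m P &
  \det P = q * q * (w1 * (u2 * v3 - u3 * v2) + w2 * (u3 * v1 - u1 * v3) + m3 * (u1 * v2 - u2 * v1)).
Proof.
move=> <- <- <- <- <- <-.
pose P := mat4 [:: [:: 1 - h / 2; - (h / 2) * w1; - (h / 2) * w2; - (h / 2) * m3];
   [:: h / 2; (1 + h / 2) * w1; (1 + h / 2) * w2; (1 + h / 2) * m3];
   [:: 0; q * u1; q * u2; q * u3]; [:: 0; q * v1; q * v2; q * v3]].
have PE i j : (P^T *m eta *m P) i j = - (P 0 i * P 0 j) + P 1 i * P 1 j
   + P 2 i * P 2 j + P 3 i * P 3 j.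
  by rewrite -{2}[P]trmxK pair_cong pair_eta !mxE.
exists P; last by rewrite det4 /= !mxE /=; field.
apply/matrixP => i j; rewrite PE; move: i j.
by apply: ord4P; apply: ord4P; rewrite !mxE !big_ord1 !mxE /=; field.
Qed.

Lemma mat4_normal (m1 m2 m3 t k : R) : m1 * m1 + m2 * m2 + m3 * m3 = 1 ->
  row4 t (k * m1) (k * m2) (k * m3) *m
    (mat4 [:: [:: 0; 0; 0; 0]; [:: 0; 1 - m1 * m1; - (m1 * m2); - (m1 * m3)];
    [:: 0; - (m1 * m2); 1 - m2 * m2; - (m2 * m3)];
    [:: 0; - (m1 * m3); - (m2 * m3); 1 - m3 * m3]]) = 0.
Proof.
move=> nn; apply/rowP; apply: ord4P; rewrite !mxE sum4 !mxE /=.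
- by ring.
- by transitivity (k * m1 * (1 - (m1 * m1 + m2 * m2 + m3 * m3))); [ring|rewrite nn; ring].
- by transitivity (k * m2 * (1 - (m1 * m1 + m2 * m2 + m3 * m3))); [ring|rewrite nn; ring].
- by transitivity (k * m3 * (1 - (m1 * m1 + m2 * m2 + m3 * m3))); [ring|rewrite nn; ring].
Qed.

Section at_point.
Variable p : 'rV[R]_4.
Local Notation r := (radius (sp p)).
Hypothesis r_gt0 : 0 < r.
Local Notation S := (SigmaKN B (sp p)).
Local Notation n1 := (sp p 0 0 / r).
Local Notation n2 := (sp p 0 1 / r).
Local Notation n3 := (sp p 0 2 / r).
Local Notation H := ((2 * M * r - Q ^+ 2) / S).

Let r0 : r != 0. Proof. by rewrite gt_eqF. Qed.

Lemma unit_direction : n1 * n1 + n2 * n2 + n3 * n3 = 1.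
Proof.
transitivity ((sp p 0 0 ^+ 2 + sp p 0 1 ^+ 2 + sp p 0 2 ^+ 2) / r ^+ 2); first by field.
by rewrite -sqr_radius divff// expf_neq0.
Qed.

Lemma SigmaKN_gt0 : 0 < S.
Proof. by rewrite /SigmaKN ltr_pwDl ?exprn_gt0// mulr_ge0 ?sqr_ge0. Qed.
Let S0 : S != 0. Proof. by rewrite gt_eqF// SigmaKN_gt0. Qed.

Lemma cov_dtE : cov_dt = row4 1 0 0 0 :> 'rV[R]_4.
Proof. by rewrite /cov_dt ev_row4 !mxE. Qed.
Lemma cov_drE : cov_dr p = row4 0 n1 n2 n3.
Proof. by rewrite /cov_dr ev_row4 !scaleE ![r^-1 * _]mulrC. Qed.
Lemma cov_phiE : cov_phi p = row4 0 (- n2 / r) (n1 / r) 0.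
Proof.
rewrite /cov_phi ev_row4 !scaleE !row3E.
by congr row4; [field|field|rewrite mulr0].
Qed.
Lemma cov_uE : cov_dr p - a *: cov_phi p = row4 0 (n1 + a * n2 / r) (n2 - a * n1 / r) n3.
Proof.
rewrite cov_drE cov_phiE; apply/rowP; apply: ord4P; rewrite !mxE /=.
all: by ring.
Qed.
Lemma cov_lE : cov_l B p = row4 1 (n1 + a * n2 / r) (n2 - a * n1 / r) n3.
Proof.
rewrite /cov_l -addrA cov_uE cov_dtE; apply/rowP; apply: ord4P; rewrite !mxE /=; ring.
Qed.

Lemma flat3_dr : flat3 - (cov_dr p)^T *m cov_dr p =
  mat4 [:: [:: 0; 0; 0; 0]; [:: 0; 1 - n1 * n1; - (n1 * n2); - (n1 * n3)];
    [:: 0; - (n1 * n2); 1 - n2 * n2; - (n2 * n3)];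
    [:: 0; - (n1 * n3); - (n2 * n3); 1 - n3 * n3]].
Proof.
rewrite cov_drE /flat3 cov_dtE.
apply/matrixP; apply: ord4P; apply: ord4P; rewrite !mxE !big_ord1 !mxE /=; ring.
Qed.

(** The two vectors completing the radial direction to a triad give the angular rows, scaled by [q],
    whose square is the factor of the angular part. Symmetry, determinant and signature of the
    metric are all read off from this factorisation. *)
Lemma kn_factor : exists2 P, kn_metric B p = P^T *m eta *m P & \det P = S / r ^+ 2.
Proof.
have [u1 [u2 [u3 [v1 [v2 [v3 [e11 e22 e33 e12 [e13 e23 c1 c2 c3]]]]]]]] := triad unit_direction.
pose q := Num.sqrt S / r.
have q2 : q * q = S / r ^+ 2.
  by rewrite -expr2 exprMn sqr_sqrtr ?exprVn// ltW// SigmaKN_gt0.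
have [P PE dP] := factor_mat4 H (n1 + a * n2 / r) (n2 - a * n1 / r) n3 q e11 e22 e33 e12 e13 e23.
exists P; first by rewrite -PE /kn_metric flat3_dr -q2 cov_uE cov_lE cov_dtE.
rewrite dP q2 c1 c2 c3 -[RHS]mulr1 -unit_direction; congr (_ * _); by ring.
Qed.

Lemma kn_sym : (kn_metric B p)^T = kn_metric B p.
Proof.
by have [P -> _] := kn_factor; rewrite !trmx_mul trmxK eta_sym mulmxA.
Qed.

Lemma kn_det : \det (kn_metric B p) = - (S / r ^+ 2) ^+ 2.
Proof.
by have [P -> dP] := kn_factor; rewrite !det_mulmx det_tr det_eta dP; ring.
Qed.

Lemma kn_det_lt0 : \det (kn_metric B p) < 0.
Proof. by rewrite kn_det oppr_lt0 exprn_gt0// divr_gt0 ?SigmaKN_gt0// exprn_gt0. Qed.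

Lemma kn_sqrt_det : Num.sqrt (- \det (kn_metric B p)) = S / r ^+ 2.
Proof.
by rewrite kn_det opprK sqrtr_sqr ger0_norm// divr_ge0 ?sqr_ge0// ltW// SigmaKN_gt0.
Qed.

Lemma kn_lorentzian : lorentzian (kn_metric B p).
Proof.
have [P PE dP] := kn_factor; exists P => //; rewrite unitmxE unitfE dP.
by rewrite mulf_neq0 ?invr_eq0 ?expf_neq0.
Qed.

Lemma kn_unit : kn_metric B p \in unitmx.
Proof. by apply: det_unit; rewrite lt_eqF// kn_det_lt0. Qed.

Lemma kn_flat (v : 'rV[R]_4) : v *m kn_metric B p =
  - (v *m cov_dt^T) 0 0 *: cov_dt
  + (v *m (cov_dr p - a *: cov_phi p)^T) 0 0 *: (cov_dr p - a *: cov_phi p)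
  + (S / r ^+ 2) *: (v *m (flat3 - (cov_dr p)^T *m cov_dr p))
  + (H * (v *m (cov_l B p)^T) 0 0) *: cov_l B p.
Proof.
have E (u : 'rV[R]_4) : v *m (u^T *m u) = (v *m u^T) 0 0 *: u.
  by rewrite mulmxA {1}[v *m u^T]mx11_scalar mul_scalar_mx.
rewrite /kn_metric; cbv zeta.
move: (cov_dr p - _) (flat3 - _) (cov_l B p) => u fl l.
by rewrite !mulmxDr mulmxN -!scalemxAr !E scalerA scaleNr.
Qed.

Lemma kn_dt_timelike : 0 <= 2 * M * r - Q ^+ 2 ->
  pair (invmx (kn_metric B p)) cov_dt cov_dt < 0.
Proof.
(* [v] is [dt~] with its index raised, so its time component [- (1 + H)] is the squared norm of
   [dt~]. *)
move=> H0; pose v := row4 (- (1 + H)) (H * n1) (H * n2) (H * n3).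
have nn := unit_direction.
have E : v *m kn_metric B p = cov_dt.
  rewrite kn_flat cov_uE cov_lE cov_dtE flat3_dr.
  have d1 : (v *m (row4 1 0 0 0)^T) 0 0 = - (1 + H).
    by rewrite mxE sum4 ![_^T _ _]mxE !row4E; ring.
  have d2 : (v *m (row4 0 (n1 + a * n2 / r) (n2 - a * n1 / r) n3)^T) 0 0 = H.
    rewrite mxE sum4 ![_^T _ _]mxE !row4E.
    by transitivity (H * (n1 * n1 + n2 * n2 + n3 * n3)); [ring|rewrite nn mulr1].
  have d3 : (v *m (row4 1 (n1 + a * n2 / r) (n2 - a * n1 / r) n3)^T) 0 0 = -1.
    rewrite mxE sum4 ![_^T _ _]mxE !row4E.
    by transitivity (H * (n1 * n1 + n2 * n2 + n3 * n3) - (1 + H)); [ring|rewrite nn; ring].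
  have d4 : v *m (mat4 [:: [:: 0; 0; 0; 0]; [:: 0; 1 - n1 * n1; - (n1 * n2); - (n1 * n3)];
    [:: 0; - (n1 * n2); 1 - n2 * n2; - (n2 * n3)];
    [:: 0; - (n1 * n3); - (n2 * n3); 1 - n3 * n3]]) = 0.
    exact: mat4_normal.
  rewrite d1 d2 d3 d4 scaler0 addr0.
  by apply/rowP; apply: ord4P; rewrite !mxE /=; ring.
rewrite -{1}E /pair -!mulmxA (mulmxA _ (invmx _)) mulmxV ?kn_unit// mul1mx.
rewrite cov_dtE mxE sum4 !mxE /= !mulr0 !addr0 mulr1 oppr_lt0.
by rewrite ltr_wpDr// divr_ge0// ltW// SigmaKN_gt0.
Qed.

(* The two-forms l /\ dr and sin(theta) dtheta /\ ((r^2 + a^2) dphi - a (dt + dr)). *)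
Definition mono : 'M[R]_4 :=
  (r ^+ 2)^-1 *: asym4 0 0 0 n3 (- n2) n1.
Definition dcos : 'rV[R]_4 :=
  row4 0 (- (n3 * n1) / r) (- (n3 * n2) / r) ((1 - n3 * n3) / r).
Definition formA : 'M[R]_4 := wedge (cov_l B p) (cov_dr p).
Definition formW : 'M[R]_4 :=
  (r ^+ 2 + a ^+ 2) *: mono + a *: wedge dcos (cov_dt + cov_dr p).

(** The vectors whose wedge is, up to scale, the metric-free dual of [formW]. Lowered, they become
    [- l] and a multiple of [dr + H l]; the term in [H] drops out of the wedge, so the mass and
    charge drop out of the star of [formW]. *)
Definition vec1 : 'rV[R]_4 := row4 1 (- n1) (- n2) (- n3).
Definition vec2 : 'rV[R]_4 := row4 0 ((r ^+ 2 + a ^+ 2) * n1 - a * r * n2)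
  ((r ^+ 2 + a ^+ 2) * n2 + a * r * n1) ((r ^+ 2 + a ^+ 2) * n3).

Lemma wedge_row4 (t x y z t' x' y' z' : R) : wedge (row4 t x y z) (row4 t' x' y' z') =
  asym4 (t * x' - t' * x) (t * y' - t' * y) (t * z' - t' * z)
        (x * y' - x' * y) (x * z' - x' * z) (y * z' - y' * z).
Proof.
by apply/matrixP; apply: ord4P; apply: ord4P; rewrite !mxE !big_ord1 !mxE /=; ring.
Qed.

Lemma asym4D (x1 x2 x3 x4 x5 x6 y1 y2 y3 y4 y5 y6 : R) :
  asym4 x1 x2 x3 x4 x5 x6 + asym4 y1 y2 y3 y4 y5 y6 =
  asym4 (x1 + y1) (x2 + y2) (x3 + y3) (x4 + y4) (x5 + y5) (x6 + y6).
Proof.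
by apply/matrixP; apply: ord4P; apply: ord4P; rewrite !mxE /= ?opprD ?addr0.
Qed.

Lemma asym4Z (c x1 x2 x3 x4 x5 x6 : R) : c *: asym4 x1 x2 x3 x4 x5 x6 =
  asym4 (c * x1) (c * x2) (c * x3) (c * x4) (c * x5) (c * x6).
Proof.
by apply/matrixP; apply: ord4P; apply: ord4P; rewrite !mxE /= ?mulrN ?mulr0.
Qed.

Lemma row4D (x0 x1 x2 x3 y0 y1 y2 y3 : R) : row4 x0 x1 x2 x3 + row4 y0 y1 y2 y3 =
  row4 (x0 + y0) (x1 + y1) (x2 + y2) (x3 + y3).
Proof. by apply/rowP; apply: ord4P; rewrite !mxE. Qed.
Lemma row4Z (c y0 y1 y2 y3 : R) : c *: row4 y0 y1 y2 y3 =
  row4 (c * y0) (c * y1) (c * y2) (c * y3).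
Proof. by apply/rowP; apply: ord4P; rewrite !mxE. Qed.

Lemma hat_formW : hat formW = (r ^+ 2)^-1 *: wedge vec1 vec2.
Proof.
have nn : 1 - n3 * n3 = n1 * n1 + n2 * n2 by rewrite -unit_direction; ring.
rewrite /formW /mono /dcos cov_dtE cov_drE row4D wedge_row4 !asym4Z asym4D hat_asym4.
rewrite wedge_row4 asym4Z; move: nn; move: n1 n2 n3 => m1 m2 m3 nn.
move: r r0; clear -nn => s s0.
congr asym4; try by field.
by rewrite nn; field.
Qed.

Lemma wedgeNl (u v : 'rV[R]_4) : wedge (- u) v = - wedge u v.
Proof. by rewrite /wedge trmxN mulNmx mulmxN opprB addrC opprK. Qed.
Lemma wedgeDr (u v w : 'rV[R]_4) : wedge u (v + w) = wedge u v + wedge u w.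
Proof. by rewrite /wedge mulmxDr trmxD mulmxDl opprD addrACA. Qed.
Lemma wedgeZr c (u v : 'rV[R]_4) : wedge u (c *: v) = c *: wedge u v.
Proof. by rewrite /wedge trmxZ -scalemxAr -scalemxAl scalerBr. Qed.
Lemma wedgexx (u : 'rV[R]_4) : wedge u u = 0.
Proof. by rewrite /wedge subrr. Qed.

Lemma wedge_lower (g : 'M[R]_4) (u v : 'rV[R]_4) : g^T = g ->
  g *m wedge u v *m g = wedge (u *m g) (v *m g).
Proof.
by move=> gs; rewrite /wedge mulmxBr mulmxBl !trmx_mul gs !mulmxA.
Qed.

Lemma vec1_flat : vec1 *m kn_metric B p = - cov_l B p.
Proof.
have nn := unit_direction.
rewrite kn_flat cov_uE cov_lE cov_dtE flat3_dr /vec1.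
have d1 : (row4 1 (- n1) (- n2) (- n3) *m (row4 1 0 0 0)^T) 0 0 = 1.
  by rewrite mxE sum4 !mxE /=; ring.
have d2 : (row4 1 (- n1) (- n2) (- n3) *m (row4 0 (n1 + a * n2 / r) (n2 - a * n1 / r) n3)^T) 0 0 = -1.
  by rewrite mxE sum4 [in RHS](esym nn) ![_^T _ _]mxE !row4E; ring.
have d3 : (row4 1 (- n1) (- n2) (- n3) *m (row4 1 (n1 + a * n2 / r) (n2 - a * n1 / r) n3)^T) 0 0 = 0.
  rewrite mxE sum4 ![_^T _ _]mxE !row4E.
  by transitivity (1 - (n1 * n1 + n2 * n2 + n3 * n3)); [ring|rewrite nn subrr].
have d4 : row4 1 (- n1) (- n2) (- n3) *m
    (mat4 [:: [:: 0; 0; 0; 0]; [:: 0; 1 - n1 * n1; - (n1 * n2); - (n1 * n3)];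
    [:: 0; - (n1 * n2); 1 - n2 * n2; - (n2 * n3)];
    [:: 0; - (n1 * n3); - (n2 * n3); 1 - n3 * n3]]) = 0.
  by rewrite -[- n1]mulN1r -[- n2]mulN1r -[- n3]mulN1r mat4_normal.
rewrite d1 d2 d3 d4 scaler0 mulr0 scale0r !addr0.
by apply/rowP; apply: ord4P; rewrite !mxE /=; ring.
Qed.

Lemma vec2_flat : vec2 *m kn_metric B p = S *: (cov_dr p + H *: cov_l B p).
Proof.
have nn := unit_direction.
have SE : S = r ^+ 2 + a ^+ 2 * (n3 * n3) by rewrite /SigmaKN expr2 mulrA.
pose k := r ^+ 2 + a ^+ 2.
have kS : k - a ^+ 2 * (n1 * n1 + n2 * n2) = S.
  transitivity (r ^+ 2 + a ^+ 2 * (n1 * n1 + n2 * n2 + n3 * n3) - a ^+ 2 * (n1 * n1 + n2 * n2)).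
    by rewrite nn /k; ring.
  by rewrite SE; ring.
rewrite kn_flat cov_uE cov_lE cov_dtE flat3_dr.
have d1 : (vec2 *m (row4 1 0 0 0)^T) 0 0 = 0.
  by rewrite mxE sum4 ![_^T _ _]mxE !row4E; ring.
have d2 : (vec2 *m (row4 0 (n1 + a * n2 / r) (n2 - a * n1 / r) n3)^T) 0 0 = S.
  rewrite mxE sum4 ![_^T _ _]mxE !row4E.
  transitivity (k * (n1 * n1 + n2 * n2 + n3 * n3) - a ^+ 2 * (n1 * n1 + n2 * n2)).
    by rewrite /k; move: n1 n2 n3 => m1 m2 m3; field.
  by rewrite nn mulr1 kS.
have d3 : (vec2 *m (row4 1 (n1 + a * n2 / r) (n2 - a * n1 / r) n3)^T) 0 0 = S.
  by move: d2; rewrite !mxE !sum4 ![_^T _ _]mxE !row4E !mul0r.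
have d4 : vec2 *m (mat4 [:: [:: 0; 0; 0; 0]; [:: 0; 1 - n1 * n1; - (n1 * n2); - (n1 * n3)];
    [:: 0; - (n1 * n2); 1 - n2 * n2; - (n2 * n3)];
    [:: 0; - (n1 * n3); - (n2 * n3); 1 - n3 * n3]])
    = row4 0 (- (a * r * n2)) (a * r * n1) 0.
  have -> : vec2 = row4 0 (k * n1) (k * n2) (k * n3) + row4 0 (- (a * r * n2)) (a * r * n1) 0.
    by rewrite row4D /vec2 /k !addr0.
  rewrite mulmxDl mat4_normal// add0r; move: n1 n2 n3 => m1 m2 m3.
  by apply/rowP; apply: ord4P; rewrite !mxE sum4 !mxE /=; ring.
rewrite d1 d2 d3 d4 oppr0 scale0r add0r cov_drE !row4Z !row4D !row4Z.
move: S0; move: n1 n2 n3 (SigmaKN _ _) (2 * M * r - Q ^+ 2) => m1 m2 m3 s h s0.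
by congr row4; field; rewrite ?r0 ?s0.
Qed.

(** With [star_formA] this says that the star acts on the span of [formA] and [formW] as
    multiplication by a square root of -1, so on stationary fields duality is a rotation of two
    coefficients. *)
Lemma star_formW : star (kn_metric B p) formW = formA.
Proof.
rewrite (star_hat kn_sym kn_det_lt0) hat_formW -scalemxAr -scalemxAl.
rewrite (wedge_lower _ _ kn_sym) vec1_flat vec2_flat wedgeNl wedgeZr wedgeDr wedgeZr wedgexx.
rewrite scaler0 addr0 kn_sqrt_det -/formA scalerA -scalerN scalerA.
by rewrite (_ : _ * _ = -1) ?scaleN1r ?opprK//; field; rewrite r0 S0.
Qed.

Lemma formW_tr : formW^T = - formW.
Proof.
by rewrite /formW /mono trmxD !trmxZ asym4_tr wedge_tr !scalerN opprD.
Qed.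

Lemma star_formA : star (kn_metric B p) formA = - formW.
Proof. by rewrite -star_formW (starK kn_sym kn_det_lt0 formW_tr). Qed.

End at_point.
End kerr_newman_point.

(** * A calculus of gradients *)

Section gradients.
Context {R : realType} {n : nat}.
Implicit Types (f g : 'rV[R]_n.+1 -> R) (p u v : 'rV[R]_n.+1).

(** Differentiability and the full gradient travel together, so a gradient is obtained by composing
    rules and the side conditions of each rule are met automatically. *)
Definition has_grad f p u := differentiable f p /\ forall i, pd i f p = u 0 i.

Lemma hg_cst (c : R) p : has_grad (fun=> c) p 0.
Proof. by split=> [|i]; [exact: differentiable_cst|rewrite pd_cst mxE]. Qed.

Lemma hg_coord j p : has_grad (fun q => q 0 j) p (delta_mx 0 j).
Proof. by split=> [|i]; [exact: differentiable_coord|rewrite pd_coord mxE eqxx]. Qed.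

Lemma hgD f g p u v : has_grad f p u -> has_grad g p v ->
  has_grad (fun q => f q + g q) p (u + v).
Proof.
by move=> [df fE] [dg gE]; split=> [|i]; [exact: differentiableD|rewrite pdD// fE gE mxE].
Qed.

Lemma hgN f p u : has_grad f p u -> has_grad (fun q => - f q) p (- u).
Proof.
by move=> [df fE]; split=> [|i]; [exact: differentiableN|rewrite pdN// fE mxE].
Qed.

Lemma hgM f g p u v : has_grad f p u -> has_grad g p v ->
  has_grad (fun q => f q * g q) p (g p *: u + f p *: v).
Proof.
move=> [df fE] [dg gE]; split=> [|i]; first exact: differentiableM.
by rewrite pdM// fE gE !mxE mulrC.
Qed.

Lemma hgV f p u : f p != 0 -> has_grad f p u ->
  has_grad (fun q => (f q)^-1) p (- ((f p)^-1 * (f p)^-1) *: u).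
Proof.
move=> f0 [df fE]; split=> [|i]; first exact: differentiableV.
by rewrite pdV// fE !mxE mulrC mulrN mulNr.
Qed.

Lemma hg_sqrt f p u : 0 < f p -> has_grad f p u ->
  has_grad (fun q => Num.sqrt (f q)) p ((2^-1 * (Num.sqrt (f p))^-1) *: u).
Proof.
move=> f0 [df fE]; split=> [|i]; first exact: differentiable_sqrt.
by rewrite pd_sqrt// fE !mxE.
Qed.

Lemma hg_near f g p u : (\near p, f p = g p) -> has_grad f p u -> has_grad g p u.
Proof.
move=> fg [df fE]; split=> [|i]; first exact: near_eq_differentiable fg df.
by rewrite -(pd_eq i fg).
Qed.

Lemma hg_ext f g p u : f =1 g -> has_grad f p u -> has_grad g p u.
Proof. by move=> /funext ->. Qed.

Lemma hg_eq f p u v : has_grad f p u -> u = v -> has_grad f p v.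
Proof. by move=> + <-. Qed.

End gradients.

(** * The exterior derivative *)

Section exterior_derivative.
Context {R : realType}.

Lemma d1_grad (A : 'rV[R]_4 -> 'rV[R]_4) p (u : 'I_4 -> 'rV[R]_4) :
  (forall j, has_grad (fun q => A q 0 j) p (u j)) ->
  d1 A p = \matrix_(i, j) (u j 0 i - u i 0 j).
Proof.
by move=> uA; apply/matrixP => i j; rewrite !mxE (uA j).2 (uA i).2.
Qed.

Lemma d1_scale f (A : 'rV[R]_4 -> 'rV[R]_4) p u : has_grad f p u ->
  (forall j, differentiable (fun q => A q 0 j) p) ->
  d1 (fun q => f q *: A q) p = wedge u (A p) + f p *: d1 A p.
Proof.
move=> [df fE] dA; apply/matrixP => i j.
have E k l : pd k (fun q => (f q *: A q) 0 l) p = u 0 k * A p 0 l + f p * pd k (fun q => A q 0 l) p.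
  rewrite -fE -pdM//; congr (pd k _ p); apply/funext => q; exact: scaleE.
by rewrite !mxE !big_ord1 ![_^T _ _]mxE !E; ring.
Qed.

Lemma d2_near (F F' : 'rV[R]_4 -> 'M[R]_4) i j k p : (\near p, F p = F' p) ->
  d2 F i j k p = d2 F' i j k p.
Proof.
move=> FF; have E k' l l' : pd k' (fun q => F q l l') p = pd k' (fun q => F' q l l') p.
  by apply: pd_eq; near=> q; rewrite (near FF q).
by rewrite /d2 !E.
Unshelve. all: by end_near. Qed.

Lemma d2D (F G : 'rV[R]_4 -> 'M[R]_4) i j k p :
  (forall a b, differentiable (fun q => F q a b) p) ->
  (forall a b, differentiable (fun q => G q a b) p) ->
  d2 (fun q => F q + G q) i j k p = d2 F i j k p + d2 G i j k p.
Proof.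
move=> dF dG.
have E l a b : pd l (fun q => (F q + G q) a b) p = pd l (fun q => F q a b) p + pd l (fun q => G q a b) p.
  by rewrite -pdD//; congr (pd l _ p); apply/funext => q; rewrite mxE.
have sum (x1 x2 x3 y1 y2 y3 : R) :
  x1 + y1 + (x2 + y2) + (x3 + y3) = x1 + x2 + x3 + (y1 + y2 + y3) by ring.
rewrite /d2 !E; exact: sum.
Qed.

Lemma d2Z c (F : 'rV[R]_4 -> 'M[R]_4) i j k p :
  (forall a b, differentiable (fun q => F q a b) p) ->
  d2 (fun q => c *: F q) i j k p = c * d2 F i j k p.
Proof.
move=> dF.
have E l a b : pd l (fun q => (c *: F q) a b) p = c * pd l (fun q => F q a b) p.
  transitivity (pd l (fun q => c * F q a b) p).
    by congr (pd l _ p); apply/funext => q; rewrite mxE.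
  by rewrite (pdM _ (differentiable_cst c p)) ?pd_cst ?mul0r ?add0r.
by rewrite /d2 !E !mulrDr.
Qed.

(** In the cyclic sum the six second derivatives cancel in pairs by their symmetry. *)
Lemma d2_d1 (A : 'rV[R]_4 -> 'rV[R]_4) (U : set 'rV[R]_4) i j k p :
  smooth_mx_near U A -> U p -> d2 (d1 A) i j k p = 0.
Proof.
move=> sA Up.
have E l a b : pd l (fun q => d1 A q a b) p =
    pd l (pd a (fun q => A q 0 b)) p - pd l (pd b (fun q => A q 0 a)) p.
  have D x y : differentiable (pd x (fun q => A q 0 y)) p.
    exact: smooth_near_diff (smooth_near_pd _ (sA _ _)) Up.
  by rewrite -pdB//; congr (pd l _ p); apply/funext => q; rewrite mxE.
rewrite /d2 !E.
rewrite (pd_swap j k (sA 0 i) Up) (pd_swap k i (sA 0 j) Up) (pd_swap i j (sA 0 k) Up).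
have cyc (x y z : R) : x - y + (z - x) + (y - z) = 0 by ring.
exact: cyc.
Qed.

End exterior_derivative.

(** * Entries of linear combinations of matrices *)

Section entries.
Context {R : realType} {k l : nat}.
Implicit Types (A C : 'M[R]_(k, l)).
Lemma addmxE A C i j : (A + C) i j = A i j + C i j. Proof. exact: mxE. Qed.
Lemma oppmxE A i j : (- A) i j = - A i j. Proof. exact: mxE. Qed.
Lemma scalemxE c A i j : (c *: A) i j = c * A i j. Proof. exact: mxE. Qed.
Lemma zeromxE i j : (0 : 'M[R]_(k, l)) i j = 0. Proof. exact: mxE. Qed.
Definition mx_linE := (addmxE, oppmxE, scalemxE, zeromxE).
End entries.

(** * The stationary electric and magnetic fields *)

Section stationary_fields.
Context {R : realType} (B : setting R).
Local Notation a := (spin B).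
Implicit Types (p : 'rV[R]_4).
Local Notation r p := (radius (sp p)).
Local Notation S p := (SigmaKN B (sp p)).
Local Notation n1 p := (sp p 0 0 / radius (sp p)).
Local Notation n2 p := (sp p 0 1 / radius (sp p)).
Local Notation n3 p := (sp p 0 2 / radius (sp p)).

(** An open set containing the exterior on which the metric and the stationary fields are smooth.
    Identities proved here can be differentiated at the horizon without a boundary argument. *)
Definition away : set 'rV[R]_4 := [set p | 0 < r p].

Lemma sp0 p j : sp p 0 j = p 0 (lift ord0 j).
Proof. exact: mxE. Qed.

Lemma r_sqrtE p : r p = Num.sqrt (p 0 1 * p 0 1 + p 0 2 * p 0 2 + p 0 3 * p 0 3).
Proof. by rewrite /radius sum3 !sp0 !lift0E !expr2. Qed.

Lemma away_sum p : away p -> 0 < p 0 1 * p 0 1 + p 0 2 * p 0 2 + p 0 3 * p 0 3.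
Proof. by rewrite /away /= r_sqrtE sqrtr_gt0. Qed.

Lemma smooth_sp (A : set 'rV[R]_4) j : smooth_near A (fun p => sp p 0 j).
Proof. by apply: smooth_near_ext (smooth_near_coord _ (lift ord0 j)) => p; rewrite sp0. Qed.

Lemma smooth_r : smooth_near away (fun p => r p).
Proof.
pose f p : R := p 0 1 * p 0 1 + p 0 2 * p 0 2 + p 0 3 * p 0 3.
apply: (smooth_near_ext (f := fun p => Num.sqrt (f p))) => [p|]; first by rewrite r_sqrtE.
apply: smooth_near_sqrt; first exact: away_sum.
by do ![apply: smooth_nearD|apply: smooth_nearM|apply: smooth_near_coord].
Qed.

Lemma open_away : open away.
Proof.
have [U [oU AU HU]] := (smooth_nearP _ _).1 smooth_r.
have -> : away = U `&` (fun p => r p) @^-1` [set x | 0 < x].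
  by apply/seteqP; split=> [p Ap|p [_]//]; split=> //; exact: AU.
apply: (open_preimage_fun oU (open_gt (y := 0))) => p Up.
by apply: differentiable_continuous; exact: (HU 0%N).
Qed.

Lemma near_away p : away p -> \near p, away p.
Proof. by move=> Ap; apply: open_nbhs_nbhs; split=> //; exact: open_away. Qed.

Lemma r_neq0 p : away p -> r p != 0.
Proof. by move=> Ap; rewrite gt_eqF. Qed.
Lemma S_neq0 p : away p -> S p != 0.
Proof. by move=> Ap; rewrite gt_eqF// SigmaKN_gt0. Qed.

Lemma smooth_ev (A : set 'rV[R]_4) f (G : 'rV[R]_4 -> 'rV[R]_3) :
  smooth_near A f -> smooth_mx_near A G -> smooth_mx_near A (fun p => ev (f p) (G p)).
Proof.
move=> sf sG i j; rewrite (ord1 i).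
have [k ->|->] := unliftP ord0 j.
  by apply: smooth_near_ext (sG 0 k) => p; rewrite mxE liftK.
by apply: smooth_near_ext sf => p; rewrite mxE unlift_none.
Qed.

Lemma smooth_row3 (A : set 'rV[R]_4) f g h :
  smooth_near A f -> smooth_near A g -> smooth_near A h ->
  smooth_mx_near A (fun p => row3 (f p) (g p) (h p)).
Proof.
move=> sf sg sh i j; rewrite (ord1 i); move: j; apply: ord3P.
- by apply: smooth_near_ext sf => p; rewrite row3E.
- by apply: smooth_near_ext sg => p; rewrite row3E.
- by apply: smooth_near_ext sh => p; rewrite row3E.
Qed.

Lemma smooth_rV : smooth_near away (fun p => (r p)^-1).
Proof. by apply: smooth_nearV smooth_r => p; exact: r_neq0. Qed.

Lemma smooth_cov_dr : smooth_mx_near away (@cov_dr R).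
Proof.
apply: smooth_ev; first exact: smooth_near_cst.
apply: smooth_mxZ; first exact: smooth_rV.
by move=> i j; rewrite (ord1 i); exact: smooth_sp.
Qed.

Lemma smooth_cov_phi : smooth_mx_near away (@cov_phi R).
Proof.
apply: smooth_ev; first exact: smooth_near_cst.
apply: smooth_mxZ.
  apply: smooth_nearV; first by move=> p Ap; rewrite expf_neq0// r_neq0.
  exact: smooth_nearX smooth_r.
apply: smooth_row3; [apply: smooth_nearN| |exact: smooth_near_cst]; exact: smooth_sp.
Qed.

Lemma smooth_cov_u : smooth_mx_near away (fun p => cov_dr p - a *: cov_phi p).
Proof.
apply: smooth_mxB; first exact: smooth_cov_dr.
by apply: smooth_mxZ; [exact: smooth_near_cst|exact: smooth_cov_phi].
Qed.

Lemma smooth_cov_l : smooth_mx_near away (cov_l B).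
Proof.
rewrite /cov_l; apply: smooth_mxB.
  by apply: smooth_mxD; [exact: smooth_mx_cst|exact: smooth_cov_dr].
by apply: smooth_mxZ; [exact: smooth_near_cst|exact: smooth_cov_phi].
Qed.

Lemma smooth_n3 : smooth_near away (fun p => n3 p).
Proof. by apply: smooth_nearM smooth_rV; exact: smooth_sp. Qed.

Lemma smooth_S : smooth_near away (fun p => S p).
Proof.
rewrite /SigmaKN; apply: smooth_nearD; first exact: smooth_nearX smooth_r.
by apply: smooth_nearM; [exact: smooth_near_cst|exact: smooth_nearX smooth_n3].
Qed.

Lemma smooth_SV : smooth_near away (fun p => (S p)^-1).
Proof. by apply: smooth_nearV smooth_S => p; exact: S_neq0. Qed.

Lemma smooth_kn : smooth_mx_near away (kn_metric B).
Proof.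
have sq u : smooth_mx_near away u -> smooth_mx_near away (fun p => (u p)^T *m u p).
  by move=> su; apply: smooth_mxM => //; exact: smooth_mx_tr.
rewrite /kn_metric; cbv zeta.
apply: smooth_mxD; last first.
  apply: smooth_mxZ; last exact: sq smooth_cov_l.
  apply: smooth_nearM smooth_SV; apply: smooth_nearB; last exact: smooth_near_cst.
  by apply: smooth_nearM smooth_r; exact: smooth_near_cst.
apply: smooth_mxD; last first.
  apply: smooth_mxZ.
    apply: smooth_nearM; first exact: smooth_S.
    apply: smooth_nearV; first by move=> p Ap; rewrite expf_neq0// r_neq0.
    exact: smooth_nearX smooth_r.
  by apply: smooth_mxB; [exact: smooth_mx_cst|exact: sq smooth_cov_dr].
apply: smooth_mxD; last exact: sq smooth_cov_u.
exact: smooth_mx_cst.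
Qed.

Lemma smooth_potential : smooth_mx_near away (potential B).
Proof.
apply: smooth_mxZ; last exact: smooth_cov_l.
by apply: smooth_nearN; apply: smooth_nearM smooth_SV; exact: smooth_r.
Qed.

Lemma smooth_d1 (A : set 'rV[R]_4) th : smooth_mx_near A th -> smooth_mx_near A (d1 th).
Proof.
move=> sth i j.
apply: (smooth_near_ext (f := fun p => pd i (fun q => th q 0 j) p - pd j (fun q => th q 0 i) p)).
  by move=> p; rewrite mxE.
by apply: smooth_nearB; apply: smooth_near_pd; exact: sth.
Qed.

Lemma smooth_hat (A : set 'rV[R]_4) (F : 'rV[R]_4 -> 'M[R]_4) : smooth_mx_near A F ->
  smooth_mx_near A (fun p => hat (F p)).
Proof.
move=> sF i j; apply: (smooth_near_ext
  (f := fun p => 2^-1 * \sum_k \sum_l levi_civita i j k l * F p k l)).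
  by move=> p; rewrite mxE.
apply: smooth_nearM; first exact: smooth_near_cst.
do 2![apply: smooth_near_sum => ?]; apply: smooth_nearM; first exact: smooth_near_cst.
exact: sF.
Qed.

Lemma smooth_star (A : set 'rV[R]_4) (g F : 'rV[R]_4 -> 'M[R]_4) :
  (forall p, A p -> \det (g p) < 0) -> smooth_mx_near A g -> smooth_mx_near A F ->
  smooth_mx_near A (fun p => star (g p) (F p)).
Proof.
move=> g0 sg sF.
have si : smooth_mx_near A (fun p => invmx (g p)).
  by apply: smooth_invmx sg => p /g0 h; rewrite lt_eqF.
have E : (fun p => star (g p) (F p)) = fun p => Num.sqrt (- \det (g p)) *:
    hat (invmx (g p) *m F p *m invmx (g p)) by apply/funext => p; rewrite starE.
rewrite E; apply: smooth_mxZ.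
  apply: smooth_near_sqrt; first by move=> p /g0; rewrite oppr_gt0.
  by apply: smooth_nearN; exact: smooth_det.
by apply: smooth_hat; apply: smooth_mxM => //; exact: smooth_mxM.
Qed.

Lemma smooth_hodge F : smooth_mx_near away F -> smooth_mx_near away (hodge B F).
Proof. by apply: smooth_star => [p Ap|]; [exact: kn_det_lt0|exact: smooth_kn]. Qed.

Lemma hg_away f g p u : away p -> (forall q, away q -> f q = g q) ->
  has_grad f p u -> has_grad g p u.
Proof.
move=> Ap fg; apply: hg_near; near=> q; apply: fg; near: q; exact: near_away.
Unshelve. all: by end_near. Qed.

Lemma hg_r p : away p -> has_grad (fun q => r q) p (cov_dr p).
Proof.
move=> Ap; have r0 := r_neq0 Ap.
have Q j := hgM (hg_coord j p) (hg_coord j p).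
have H := @hg_sqrt R 3 (fun q => q 0 1 * q 0 1 + q 0 2 * q 0 2 + q 0 3 * q 0 3) p _
  (away_sum Ap) (hgD (hgD (Q 1) (Q 2)) (Q 3)).
apply: hg_eq (hg_ext _ H) _; first by move=> q; rewrite -r_sqrtE.
rewrite -r_sqrtE cov_drE//.
rewrite !sp0 !lift0E; move: r0; move: (radius _) => s s0.
by apply/rowP; apply: ord4P; rewrite !mxE /=; field.
Qed.

Lemma hg_rV p : away p ->
  has_grad (fun q => (r q)^-1) p (- ((r p)^-1 * (r p)^-1) *: cov_dr p).
Proof. by move=> Ap; exact: (hgV (f := fun q => r q) (r_neq0 Ap) (hg_r Ap)). Qed.

Lemma hg_SV p : away p -> forall u, has_grad (fun q => S q) p u ->
  has_grad (fun q => (S q)^-1) p (- ((S p)^-1 * (S p)^-1) *: u).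
Proof. by move=> Ap u; exact: (hgV (f := fun q => S q) (S_neq0 Ap)). Qed.

Lemma hg_n p (j : 'I_3) : away p -> has_grad (fun q => sp q 0 j / r q) p
  ((r p)^-1 *: delta_mx 0 (lift ord0 j) - (sp p 0 j / r p / r p) *: cov_dr p).
Proof.
move=> Ap; have r0 := r_neq0 Ap.
apply: hg_eq (hg_ext _ (hgM (hg_coord (lift ord0 j) p) (hg_rV Ap))) _.
  by move=> q /=; rewrite sp0.
rewrite /= scalerA sp0 -[in RHS]scaleNr; congr (_ + _); congr (_ *: _).
by move: r0; move: (radius _) (p 0 _) => s x s0; field.
Qed.

Lemma hg_n3 p : away p -> has_grad (fun q => n3 q) p (dcos p).
Proof.
move=> Ap; apply: hg_eq (hg_n 2 Ap) _; rewrite cov_drE// /dcos lift0E.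
have r0 := r_neq0 Ap; move: (n1 p) (n2 p) (n3 p) r0; move: (radius _) => s x y z s0.
by apply/rowP; apply: ord4P; rewrite !mxE /=; field.
Qed.

Lemma hg_S p : away p -> has_grad (fun q => S q) p
  ((2 * r p) *: cov_dr p + (2 * a ^+ 2 * n3 p) *: dcos p).
Proof.
move=> Ap; rewrite /SigmaKN.
apply: hg_eq (hgD (hgM (hg_r Ap) (hg_r Ap)) (hgM (hg_cst (a ^+ 2) p) (hgM (hg_n3 Ap) (hg_n3 Ap)))) _.
rewrite /= -!scalerDl scaler0 add0r scalerA.
by congr (_ *: _ + _ *: _); rewrite /GRing.scale /=; ring.
Qed.

Lemma diff_cov_l p j : away p -> differentiable (fun q => cov_l B q 0 j) p.
Proof. by move=> Ap; exact: smooth_near_diff (smooth_cov_l 0 j) Ap. Qed.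

(** Only the part [- a sin^2(theta) dphi~] of [l] fails to be closed; its derivative is
    [- 2 a cos(theta)] times the area form [mono] of the unit sphere. *)
Lemma d1_cov_l p : away p -> d1 (cov_l B) p = - (2 * a * n3 p) *: mono p.
Proof.
move=> Ap; have r0 := r_neq0 Ap.
have G1 := hg_n 0 Ap; have G2 := hg_n 1 Ap; have G3 := hg_n 2 Ap.
have GV := hg_rV Ap; have Ga := hg_cst a p.
have E1 := hgD G1 (hgM (hgM Ga G2) GV).
have E2 := hgD G2 (hgN (hgM (hgM Ga G1) GV)).
have L0 : has_grad (fun q => cov_l B q 0 0) p 0.
  by apply: (hg_away Ap _ (hg_cst 1 p)) => q Aq; rewrite cov_lE// row4E.
have L1 := hg_away (g := fun q => cov_l B q 0 1) Ap _ E1.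
have {}L1 := L1 (fun q Aq => esym (etrans (congr1 (fun v : 'rV[R]_4 => v 0 1) (cov_lE B Aq)) (mxE _ _ _ _))).
have L2 := hg_away (g := fun q => cov_l B q 0 2) Ap _ E2.
have {}L2 := L2 (fun q Aq => esym (etrans (congr1 (fun v : 'rV[R]_4 => v 0 2) (cov_lE B Aq)) (mxE _ _ _ _))).
have L3 := hg_away (g := fun q => cov_l B q 0 3) Ap _ G3.
have {}L3 := L3 (fun q Aq => esym (etrans (congr1 (fun v : 'rV[R]_4 => v 0 3) (cov_lE B Aq)) (mxE _ _ _ _))).
set u1 := (X in has_grad _ _ X) in L1; set u2 := (X in has_grad _ _ X) in L2.
set u3 := (X in has_grad _ _ X) in L3.
rewrite (@d1_grad _ (cov_l B) p (nth 0 [:: 0; u1; u2; u3])); last exact: ord4P.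
have nn := unit_direction Ap.
rewrite /mono asym4Z asym4Z /u1 /u2 /u3 cov_drE// !lift0E /=.
move: nn; move: (n1 p) (n2 p) (n3 p) => m1 m2 m3 nn.
move: r0; move: (r p) => s s0.
have nE : m3 * m3 = 1 - m1 * m1 - m2 * m2 by rewrite -nn; ring.
apply/matrixP; apply: ord4P; apply: ord4P; rewrite !mxE /= ?mxE /=.
all: try by field.
- transitivity (- (2 * a) * (s ^+ 2)^-1 * (m3 * m3)); last by field.
  by rewrite nE; field.
- transitivity (2 * a * (s ^+ 2)^-1 * (m3 * m3)); last by field.
  by rewrite nE; field.
Qed.

(** [alpha + i beta] is the complex function [(r - i a cos(theta))^-2], the Kerr-Newman form of the
    Coulomb factor [r^-2]. Its modulus is the inverse of [Sigma], which is [alpha_beta]. *)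
Definition alpha p : R := (r p ^+ 2 - a ^+ 2 * n3 p ^+ 2) / S p ^+ 2.
Definition beta p : R := 2 * a * r p * n3 p / S p ^+ 2.

Lemma SE p : S p = r p ^+ 2 + a ^+ 2 * n3 p ^+ 2. Proof. by []. Qed.

Lemma alpha_beta p : away p -> alpha p ^+ 2 + beta p ^+ 2 = (S p ^+ 2)^-1.
Proof.
move=> Ap; have S0 := S_neq0 Ap.
apply: (mulIf (expf_neq0 4 S0)); rewrite /alpha /beta.
transitivity ((r p ^+ 2 - a ^+ 2 * n3 p ^+ 2) ^+ 2 + (2 * a * r p * n3 p) ^+ 2).
  by move: S0; move: (n3 p) => x; move: (S p) (r p) => s y s0; field.
transitivity (S p ^+ 2); first by rewrite SE; move: (n3 p) => x; move: (r p) => y; ring.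
by move: S0; move: (S p) => s s0; field.
Qed.

Lemma wedge_dcos_phi p : away p -> wedge (dcos p) (cov_phi p) = - (1 - n3 p * n3 p) *: mono p.
Proof.
move=> Ap; have r0 := r_neq0 Ap; have nn := unit_direction Ap.
rewrite cov_phiE// /dcos /mono wedge_row4 !asym4Z.
move: nn r0; move: (n1 p) (n2 p) (n3 p) => m1 m2 m3 nn; move: (r p) => s s0.
have nE : 1 - m3 * m3 = m1 * m1 + m2 * m2 by rewrite -nn; ring.
congr asym4; try by field.
by rewrite nE; field.
Qed.

Lemma wedge_dcos_l p : away p -> wedge (dcos p) (cov_l B p) =
  wedge (dcos p) (cov_dt + cov_dr p) + (a * (1 - n3 p * n3 p)) *: mono p.
Proof.
move=> Ap; rewrite /cov_l -scaleNr wedgeDr wedgeZr wedge_dcos_phi// scalerA.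
by congr (_ + _ *: _); ring.
Qed.

Lemma wedgeC (u v : 'rV[R]_4) : wedge u v = - wedge v u.
Proof. by rewrite /wedge opprB. Qed.
Lemma wedgeDl (u v w : 'rV[R]_4) : wedge (u + v) w = wedge u w + wedge v w.
Proof. by rewrite wedgeC wedgeDr opprD -!wedgeC. Qed.
Lemma wedgeZl c (u v : 'rV[R]_4) : wedge (c *: u) v = c *: wedge u v.
Proof. by rewrite wedgeC wedgeZr -scalerN -wedgeC. Qed.

(** The function is the real part of [- 1 / (r - i a cos(theta))], whose differential is
    [(alpha + i beta) (dr - i a dcos(theta))]. [hg_dual] treats minus its imaginary part. *)
Lemma hg_potential p : away p -> has_grad (fun q => - (r q / S q)) p
  (alpha p *: cov_dr p + (a * beta p) *: dcos p).
Proof.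
move=> Ap; have S0 := S_neq0 Ap.
apply: hg_eq (hgN (hgM (hg_r Ap) (hg_SV Ap (hg_S Ap)))) _.
apply/rowP => i; rewrite /= !mx_linE; move: (dcos p 0 i) (cov_dr p 0 i) => x y.
rewrite /alpha /beta; apply: (mulIf (expf_neq0 2 S0)).
have SE' := SE p; move: S0 SE'; move: (n3 p) => n; move: (S p) (r p) => s t s0 sE.
transitivity (y * (2 * t ^+ 2 - s) + 2 * a ^+ 2 * t * n * x); first by field.
transitivity (y * (t ^+ 2 - a ^+ 2 * n ^+ 2) + 2 * a ^+ 2 * t * n * x); last by field.
by rewrite sE; ring.
Qed.

Lemma hg_dual p : away p -> has_grad (fun q => a * n3 q / S q) p
  ((a * alpha p) *: dcos p - beta p *: cov_dr p).
Proof.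
move=> Ap; have S0 := S_neq0 Ap.
apply: hg_eq (hgM (hgM (hg_cst a p) (hg_n3 Ap)) (hg_SV Ap (hg_S Ap))) _.
apply/rowP => i; rewrite /= !mx_linE; move: (dcos p 0 i) (cov_dr p 0 i) => x y.
rewrite /alpha /beta; apply: (mulIf (expf_neq0 2 S0)).
have SE' := SE p; move: S0 SE'; move: (n3 p) => n; move: (S p) (r p) => s t s0 sE.
transitivity (a * x * (s - 2 * a ^+ 2 * n ^+ 2) - 2 * a * t * n * y); first by field.
transitivity (a * x * (t ^+ 2 - a ^+ 2 * n ^+ 2) - 2 * a * t * n * y); last by field.
by rewrite sE; ring.
Qed.

(** In [d (f l) = df /\ l + f dl] the [dr] part of [df] produces [formA]; the [dcos] part and [dl]
    recombine into [formW]. *)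
Lemma d1_potential p : away p ->
  d1 (potential B) p = - alpha p *: formA B p + beta p *: formW B p.
Proof.
move=> Ap; have S0 := S_neq0 Ap.
rewrite (d1_scale (hg_potential Ap)); last by move=> j; exact: diff_cov_l.
rewrite d1_cov_l// wedgeDl !wedgeZl (wedgeC (cov_dr p)) -/(formA B p) wedge_dcos_l//.
rewrite /formW; move: (formA B p) (mono p) (wedge (dcos p) (_ + _)) => X Y Z.
apply/matrixP => i j; rewrite !mx_linE; move: (X i j) (Y i j) (Z i j) => x y z.
rewrite /alpha /beta; apply: (mulIf (expf_neq0 2 S0)).
have SE' := SE p; move: S0 SE'; move: (n3 p) => n; move: (S p) (r p) => s t s0 sE.
transitivity (- (t ^+ 2 - a ^+ 2 * n ^+ 2) * x + 2 * a ^+ 2 * t * n * z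
  + 2 * a * t * n * (s + a ^+ 2 * (1 - n * n)) * y); first by field.
transitivity (- (t ^+ 2 - a ^+ 2 * n ^+ 2) * x + 2 * a ^+ 2 * t * n * z
  + 2 * a * t * n * (t ^+ 2 + a ^+ 2) * y); last by field.
by rewrite sE; ring.
Qed.

(** A potential for the dual field up to [mono]. The area form carries the whole charge and has no
    potential on the sphere, so it is split off and its closedness is checked by hand. *)
Definition dual_potential p : 'rV[R]_4 := (a * n3 p / S p) *: cov_l B p.

Lemma smooth_dual_potential : smooth_mx_near away dual_potential.
Proof.
apply: smooth_mxZ; last exact: smooth_cov_l.
apply: smooth_nearM smooth_SV; apply: smooth_nearM smooth_n3; exact: smooth_near_cst.
Qed.

Lemma d1_dual p : away p ->
  d1 dual_potential p + mono p = beta p *: formA B p + alpha p *: formW B p.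
Proof.
move=> Ap; have S0 := S_neq0 Ap.
rewrite (d1_scale (hg_dual Ap)); last by move=> j; exact: diff_cov_l.
rewrite d1_cov_l// wedgeDl -scaleNr !wedgeZl (wedgeC (cov_dr p)) -/(formA B p) wedge_dcos_l//.
rewrite /formW; move: (formA B p) (mono p) (wedge (dcos p) (_ + _)) => X Y Z.
apply/matrixP => i j; rewrite !mx_linE; move: (X i j) (Y i j) (Z i j) => x y z.
rewrite /alpha /beta; apply: (mulIf (expf_neq0 2 S0)).
have SE' := SE p; move: S0 SE'; move: (n3 p) => n; move: (S p) (r p) => s t s0 sE.
transitivity (2 * a * t * n * x + (t ^+ 2 - a ^+ 2 * n ^+ 2) * a * z
  + ((t ^+ 2 - a ^+ 2 * n ^+ 2) * a ^+ 2 * (1 - n * n) + s * (s - 2 * a ^+ 2 * n ^+ 2)) * y); first by field.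
transitivity (2 * a * t * n * x + (t ^+ 2 - a ^+ 2 * n ^+ 2) * a * z
  + (t ^+ 2 - a ^+ 2 * n ^+ 2) * (t ^+ 2 + a ^+ 2) * y); last by field.
by rewrite sE; ring.
Qed.

Lemma hodge_d1_potential p : away p ->
  hodge B (d1 (potential B)) p = d1 dual_potential p + mono p.
Proof.
move=> Ap; rewrite /hodge d1_potential// d1_dual// starD !starZ star_formA// star_formW//.
by rewrite scalerN scaleNr opprK addrC.
Qed.

Lemma d1_potential_tr p : (d1 (potential B) p)^T = - d1 (potential B) p.
Proof. by apply/matrixP => i j; rewrite !mxE opprB. Qed.

Lemma hodge_hodge_potential p : away p ->
  hodge B (hodge B (d1 (potential B))) p = - d1 (potential B) p.
Proof.
by move=> Ap; rewrite /hodge starK ?d1_potential_tr//; [exact: kn_sym|exact: kn_det_lt0].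
Qed.

(** The coefficients of [mono] are the components of the vector field [y / r^3], and its closedness
    is the vanishing of the divergence of that field, the identity [D] below. *)
Lemma d2_mono p i j k : away p -> d2 (@mono R) i j k p = 0.
Proof.
move=> Ap; have r0 := r_neq0 Ap; have nn := unit_direction Ap.
pose G (l : 'I_3) : 'rV[R]_4 := (r p ^+ 2)^-1 *: ((r p)^-1 *: delta_mx 0 (lift ord0 l)
   - (3 * (sp p 0 l / r p / r p)) *: cov_dr p).
have HG l : has_grad (fun q => (r q ^+ 2)^-1 * (sp q 0 l / r q)) p (G l).
  apply: hg_eq (hg_ext _ (hgM (hgM (hg_rV Ap) (hg_rV Ap)) (hg_n l Ap))) _.
    by move=> q; rewrite /= -invfM -expr2.
  apply/rowP => m; rewrite /G /= !mx_linE.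
  move: (delta_mx _ _ _ _) (cov_dr p 0 m) (sp p 0 l) => x y z.
  by move: r0; move: (r p) => s s0; field.
have E x y : has_grad (fun q => mono q x y) p
   (nth 0 (nth [::] [:: [:: 0; 0; 0; 0]; [:: 0; 0; G 2; - G 1]; [:: 0; - G 2; 0; G 0];
      [:: 0; G 1; - G 0; 0]] x) y).
  have H0 (f : 'rV[R]_4 -> R) : f =1 (fun=> 0) -> has_grad f p 0.
    by move=> f0; apply: hg_ext (hg_cst 0 p) => q; rewrite f0.
  move: x y; apply: ord4P; apply: ord4P; rewrite /=.
  all: try by apply: H0 => q; rewrite !mxE /= ?oppr0 mulr0.
  - by apply: hg_ext (HG 2) => q; rewrite !mx_linE [asym4 _ _ _ _ _ _ _ _]mxE.
  - by apply: hg_ext (hgN (HG 1)) => q; rewrite !mx_linE [asym4 _ _ _ _ _ _ _ _]mxE /= mulrN.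
  - by apply: hg_ext (hgN (HG 2)) => q; rewrite !mx_linE [asym4 _ _ _ _ _ _ _ _]mxE /= mulrN.
  - by apply: hg_ext (HG 0) => q; rewrite !mx_linE [asym4 _ _ _ _ _ _ _ _]mxE.
  - by apply: hg_ext (HG 1) => q; rewrite !mx_linE [asym4 _ _ _ _ _ _ _ _]mxE /= opprK.
  - by apply: hg_ext (hgN (HG 0)) => q; rewrite !mx_linE [asym4 _ _ _ _ _ _ _ _]mxE /= mulrN.
rewrite /d2 (E j k).2 (E k i).2 (E i j).2.
have GE l m : G l 0 m = (r p ^+ 2)^-1 * ((r p)^-1 * (m == lift ord0 l)%:R
   - 3 * (sp p 0 l / r p / r p) * cov_dr p 0 m).
  by rewrite /G !mx_linE mxE eqxx.
have D : G 0 0 1 + G 1 0 2 + G 2 0 3 = 0.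
  rewrite !GE cov_drE// !row4E !lift0E /=.
  move: nn r0; move: (n1 p) (n2 p) (n3 p) => m1 m2 m3; move: (r p) => s nn s0.
  transitivity (3 * ((s ^+ 2)^-1 * s^-1 * (1 - (m1 * m1 + m2 * m2 + m3 * m3)))).
    by field.
  by rewrite nn subrr !mulr0.
have Z l : G l 0 0 = 0 by rewrite GE cov_drE// row4E eq_liftF /= !mulr0 subrr mulr0.
clearbody G; clear HG E GE.
move: i j k; apply: ord4P; apply: ord4P; apply: ord4P; rewrite /= ?mx_linE ?Z; move: D;
move: (G 0 0 1) (G 0 0 2) (G 0 0 3) (G 1 0 1) (G 1 0 2) (G 1 0 3) (G 2 0 1) (G 2 0 2) (G 2 0 3);
clear; move=> *; lra.
Qed.

Definition Fel : 'rV[R]_4 -> 'M[R]_4 := d1 (potential B).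
Definition Fma : 'rV[R]_4 -> 'M[R]_4 := hodge B Fel.

Lemma smooth_Fel : smooth_mx_near away Fel.
Proof. exact: smooth_d1 smooth_potential. Qed.
Lemma smooth_Fma : smooth_mx_near away Fma.
Proof. exact: smooth_hodge smooth_Fel. Qed.

Lemma Fel_tr p : (Fel p)^T = - Fel p. Proof. exact: d1_potential_tr. Qed.

(** Antisymmetry comes from epsilon alone, by reindexing with the transposition of 0 and 1. It holds
    without any condition on [g], so [two_form] is available at every point of the coordinate
    space. *)
Lemma star_tr_any (g F : 'M[R]_4) : (star g F)^T = - star g F.
Proof.
apply/matrixP => i j; rewrite !mxE -mulrN; congr (_ * _).
rewrite -sumrN; apply: eq_bigr => k _; rewrite -sumrN; apply: eq_bigr => l _.
rewrite -mulNr; congr (_ * _); rewrite /levi_civita -sumrN.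
rewrite (reindex_inj (mulgI (tperm (0 : 'I_4) 1))) /=.
have E (s : 'S_4) : (-1) ^+ odd_perm (tperm (0 : 'I_4) 1%R * s)%g = - (-1) ^+ odd_perm s :> R.
  rewrite odd_permM odd_tperm.
  by case: (odd_perm s); rewrite /= ?expr0 ?expr1 ?opprK.
apply: eq_big => s; last by rewrite E.
rewrite !permM tpermL tpermR !tpermD// andbA [X in X && _]andbC -andbA.
by [].
Qed.

Lemma Fma_tr p : (Fma p)^T = - Fma p. Proof. exact: star_tr_any. Qed.

Lemma FelE p : away p -> Fel p = - alpha p *: formA B p + beta p *: formW B p.
Proof. exact: d1_potential. Qed.
Lemma FmaE p : away p -> Fma p = beta p *: formA B p + alpha p *: formW B p.
Proof. by move=> Ap; rewrite /Fma hodge_d1_potential// d1_dual. Qed.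

Lemma hodge_Fma p : away p -> hodge B Fma p = - Fel p.
Proof. exact: hodge_hodge_potential. Qed.

Lemma d2_Fel p i j k : away p -> d2 Fel i j k p = 0.
Proof. exact: d2_d1 smooth_potential. Qed.

Lemma smooth_mono : smooth_mx_near away (@mono R).
Proof.
have sn l : smooth_near away (fun q => sp q 0 l / r q).
  by apply: smooth_nearM smooth_rV; exact: smooth_sp.
apply: smooth_mxZ.
  apply: smooth_nearV; first by move=> p Ap; rewrite expf_neq0// r_neq0.
  exact: smooth_nearX smooth_r.
have H0 : smooth_near away (fun=> 0 : R) by exact: smooth_near_cst.
have H0' : smooth_near away (fun=> - 0 : R) by exact: smooth_near_cst.
apply: ord4P; apply: ord4P.
all: try by apply: smooth_near_ext H0 => q; rewrite [RHS]mxE.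
all: try by apply: smooth_near_ext H0' => q; rewrite [RHS]mxE.
all: try by apply: smooth_near_ext (sn 0) => q; rewrite [RHS]mxE.
all: try by apply: smooth_near_ext (sn 1) => q; rewrite [RHS]mxE /= opprK.
all: try by apply: smooth_near_ext (sn 2) => q; rewrite [RHS]mxE.
all: try by apply: smooth_near_ext (smooth_nearN (sn 0)) => q; rewrite [RHS]mxE.
all: try by apply: smooth_near_ext (smooth_nearN (sn 1)) => q; rewrite [RHS]mxE.
all: try by apply: smooth_near_ext (smooth_nearN (sn 2)) => q; rewrite [RHS]mxE.
Qed.

Lemma d2_Fma p i j k : away p -> d2 Fma i j k p = 0.
Proof.
move=> Ap.
have s1 := smooth_d1 smooth_dual_potential.
rewrite (d2_near (F' := fun q => d1 dual_potential q + mono q)).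
  rewrite d2D; [|by move=> x y; exact: smooth_near_diff (s1 x y) Ap|].
    by rewrite d2_mono// (d2_d1 _ _ _ smooth_dual_potential)// addr0.
  by move=> x y; exact: smooth_near_diff (smooth_mono x y) Ap.
near=> q; apply: hodge_d1_potential; near: q; exact: near_away.
Unshelve. all: by end_near. Qed.

End stationary_fields.

(** * Geometry of the leaves of the foliation *)

Section leaves.
Context {R : realType} (B : setting R).
Hypotheses (hsub : subextremal B) (hfol : regular_foliation B).
Local Notation M := (mass B).
Local Notation a := (spin B).
Local Notation Q := (chg B).
Local Notation ext := (exterior B).
Local Notation sdom := (slice_dom B).
Local Notation rp := (rplus B).

Lemma rplus_ge_mass : M <= rp.
Proof. by rewrite /rplus lerDl sqrtr_ge0. Qed.

Lemma rplus_gt0 : 0 < rp.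
Proof. by have [M0 _] := hsub; exact: lt_le_trans rplus_ge_mass. Qed.

Lemma ext_away p : ext p -> away p.
Proof. by move=> ep; exact: lt_le_trans rplus_gt0 ep. Qed.

Lemma kerr_schild_ge0 r : rp <= r -> 0 <= 2 * M * r - Q ^+ 2.
Proof.
move=> rr; have [M0 aQ] := hsub; have a0 := sqr_ge0 a.
have Mr := le_trans rplus_ge_mass rr.
have MM : M * M <= M * r by rewrite ler_pM2l.
have M2 : 0 <= M ^+ 2 by exact: sqr_ge0.
by move: aQ MM a0 M2; rewrite !expr2; clear => *; lra.
Qed.

Lemma ext_ev t y : sdom y -> ext (ev t y).
Proof. by rewrite /ext /slice_dom /= sp_ev. Qed.

(** All leaves at once: [(s, y)] is sent to the point of the leaf [s] over [y]. As a map of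
    spacetime to itself it can be differentiated together with [tau], whose composite with it is the
    coordinate [s]. *)
Definition leaf_point (q : 'rV[R]_4) : 'rV[R]_4 := ev (hgt B q) (sp q).

Lemma embE s y : emb B s y = leaf_point (ev s y).
Proof. by rewrite /leaf_point sp_ev. Qed.

Lemma sp_leaf_point q : sp (leaf_point q) = sp q.
Proof. exact: sp_ev. Qed.

Lemma ext_leaf_point q : ext q -> ext (leaf_point q).
Proof. by rewrite /exterior /= sp_leaf_point. Qed.

Lemma ext_emb s y : sdom y -> ext (emb B s y).
Proof. exact: ext_ev. Qed.

Lemma smooth_tau : smooth_near ext (tau B). Proof. by have [] := hfol. Qed.
Lemma smooth_hgt : smooth_near ext (hgt B). Proof. by have [] := hfol. Qed.

Lemma smooth_leaf_point : smooth_mx_near ext leaf_point.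
Proof.
apply: smooth_ev; first exact: smooth_hgt.
by move=> i j; rewrite (ord1 i); exact: smooth_sp.
Qed.

Lemma smooth_ev3 (A : set 'rV[R]_3) f (G : 'rV[R]_3 -> 'rV[R]_3) :
  smooth_near A f -> smooth_mx_near A G -> smooth_mx_near A (fun y => ev (f y) (G y)).
Proof.
move=> sf sG i j; rewrite (ord1 i).
have [k ->|->] := unliftP ord0 j.
  by apply: smooth_near_ext (sG 0 k) => p; rewrite mxE liftK.
by apply: smooth_near_ext sf => p; rewrite mxE unlift_none.
Qed.

Lemma smooth_id3 (A : set 'rV[R]_3) : smooth_mx_near A id.
Proof. by move=> i j; rewrite (ord1 i); exact: smooth_near_coord. Qed.

Lemma smooth_evs s : smooth_mx_near sdom (ev s : 'rV[R]_3 -> 'rV[R]_4).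
Proof. by apply: smooth_ev3; [exact: smooth_near_cst|exact: smooth_id3]. Qed.

Lemma smooth_slice s f : smooth_near ext f -> smooth_near sdom (fun y => f (ev s y)).
Proof. by apply: smooth_near_comp (smooth_evs s) => y; exact: ext_ev. Qed.

Lemma smooth_emb s : smooth_mx_near sdom (emb B s).
Proof. by apply: smooth_ev3; [exact: smooth_slice smooth_hgt|exact: smooth_id3]. Qed.

Lemma smooth_at_emb s f : smooth_near ext f -> smooth_near sdom (fun y => f (emb B s y)).
Proof. by apply: smooth_near_comp (smooth_emb s) => y; exact: ext_emb. Qed.

Lemma smooth_mx_at_emb s k l (F : 'rV[R]_4 -> 'M[R]_(k, l)) : smooth_mx_near ext F ->
  smooth_mx_near sdom (fun y => F (emb B s y)).
Proof. by move=> sF i j; exact: (smooth_at_emb s (sF i j)). Qed.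

Definition interior4 : set 'rV[R]_4 := [set q | rp < radius (sp q)].

Lemma open_interior4 : open interior4.
Proof.
have -> : interior4 = away `&` (fun p => radius (sp p)) @^-1` [set x | rp < x].
  apply/seteqP; split=> [p rpp|p []//]; split=> //.
  exact: lt_trans rplus_gt0 rpp.
apply: (open_preimage_fun open_away (open_gt (y := rp))) => p Ap.
exact: smooth_near_cont smooth_r Ap.
Qed.

Lemma interior_ext q : interior4 q -> ext q. Proof. exact: ltW. Qed.

Lemma radiusZ c (y : 'rV[R]_3) : 0 <= c -> radius (c *: y) = c * radius y.
Proof.
move=> c0; rewrite /radius -[c in RHS](ger0_norm c0) -sqrtr_sqr -sqrtrM ?sqr_ge0//.
by congr Num.sqrt; rewrite mulr_sumr; apply: eq_bigr => i _; rewrite mxE exprMn.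
Qed.

(** A point of the horizon is approached along the ray through it, whose points beyond it lie in the
    interior. This transfers identities between derivatives, which are only available on an open
    set, to the closed exterior. *)
Lemma zero_to_boundary (f : 'rV[R]_4 -> R) : (forall q, ext q -> {for q, continuous f}) ->
  (forall q, interior4 q -> f q = 0) -> forall q, ext q -> f q = 0.
Proof.
move=> cf f0 q qe; apply/eqP; apply/negP => /negP fq.
have cl : {for (0 : R), continuous (fun t : R => ev (q 0 0) ((1 + t) *: sp q))}.
  apply: differentiable_continuous; apply: differentiable_mx => i j; rewrite (ord1 i).
  have [k ->|->] := unliftP ord0 j.
    rewrite (_ : (fun _ => _) = fun t : R => (1 + t) * sp q 0 k).
      by apply: differentiableM.
    by apply/funext => t; rewrite mxE liftK /= mxE.
  rewrite (_ : (fun _ => _) = fun t : R => q 0 0).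
    exact: differentiable_cst.
  by apply/funext => t; rewrite mxE unlift_none.
have e0 : ev (q 0 0) ((1 + 0) *: sp q) = q.
  rewrite addr0 scale1r; apply/rowP => j; rewrite mxE.
  by case: (unliftP ord0 j) => [k|] -> /=; rewrite ?mxE.
have cfl : {for (0 : R), continuous (f \o (fun t : R => ev (q 0 0) ((1 + t) *: sp q)))}.
  by apply: continuous_comp; rewrite ?e0//; exact: cf.
have N : \forall t \near (0 : R), f (ev (q 0 0) ((1 + t) *: sp q)) != 0.
  apply: (cfl [set x | x != 0]); apply: open_nbhs_nbhs; split; first exact: open_neq.
  by rewrite /= e0.
have [d /= d0 Hd] := (nbhs_ballP _ _).1 N.
have : f (ev (q 0 0) ((1 + d / 2) *: sp q)) != 0.
  apply: Hd; rewrite /ball /= sub0r normrN gtr0_norm ?divr_gt0//.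
  by rewrite ltr_pdivrMr// ltr_pMr// ltr1n.
rewrite f0 ?eqxx// /interior4 /= sp_ev radiusZ ?addr_ge0// ?divr_ge0// ?ltW//.
apply: (le_lt_trans qe); rewrite ltr_pMl ?ltrDl ?divr_gt0//.
by have : away q := ext_away qe.
Qed.

Lemma tau_leaf_point q : ext q -> tau B (leaf_point q) = q 0 0.
Proof.
move=> qe; have [_ _ H _ _] := hfol.
apply/(H _ _ (sp q) qe); congr (hgt B _).
apply/rowP => j; rewrite mxE.
by case: (unliftP ord0 j) => [k|] -> /=; rewrite ?mxE.
Qed.

Lemma pd_leaf_point q i j : ext q ->
  pd i (fun p => leaf_point p 0 j) q = if j == 0 then pd i (hgt B) q else (i == j)%:R.
Proof.
move=> qe; have [k ->|->] := unliftP ord0 j.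
  rewrite -(pd_coord i (lift ord0 k) q); congr (pd i _ q).
  by apply/funext => p; rewrite mxE liftK /= mxE.
by congr (pd i _ q); apply/funext => p; rewrite mxE unlift_none.
Qed.

Lemma chain_leaf_point f q i : smooth_near ext f -> ext q ->
  pd i (fun p => f (leaf_point p)) q = pd i (hgt B) q * pd 0 f (leaf_point q)
    + (i != 0)%:R * pd i f (leaf_point q).
Proof.
move=> sf qe; rewrite pd_comp.
- rewrite (bigD1 0)//= pd_leaf_point// eqxx; congr (_ + _).
  have [->|i0] := eqVneq i 0.
    rewrite big1 ?mul0r// => j j0; rewrite pd_leaf_point// (negbTE j0) eq_sym (negbTE j0).
    by rewrite mul0r.
  rewrite (bigD1 i)//= pd_leaf_point// (negbTE i0) eqxx big1 ?addr0// => j /andP[j0 ji].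
  by rewrite pd_leaf_point// (negbTE j0) eq_sym (negbTE ji) mul0r.
- by move=> j; exact: smooth_near_diff (smooth_leaf_point 0 j) qe.
- by apply: smooth_near_diff sf _; exact: ext_leaf_point.
Qed.

(** The derivative of the identity [tau (leaf_point q) = q^0]. Its spatial components say that the
    frame of a leaf is annihilated by [dtau]; its time component shows that [dtau] has nonzero time
    component. *)
Lemma chain_tau q i : ext q ->
  pd i (hgt B) q * dtau B (leaf_point q) 0 0 + (i != 0)%:R * dtau B (leaf_point q) 0 i
  = (i == 0)%:R.
Proof.
move=> qe; rewrite !mxE.
have sc (f : 'rV[R]_4 -> R) : smooth_near ext f -> smooth_near ext (fun p => f (leaf_point p)).
  by apply: smooth_near_comp smooth_leaf_point => p; exact: ext_leaf_point.
pose f q := pd i (hgt B) q * pd 0 (tau B) (leaf_point q)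
  + (i != 0)%:R * pd i (tau B) (leaf_point q) - (i == 0)%:R.
suff : f q = 0 by move/eqP; rewrite subr_eq0 => /eqP.
move: q qe; apply: zero_to_boundary => q qe.
  apply: (smooth_near_cont (A := ext)) qe; apply: smooth_nearB; last exact: smooth_near_cst.
  apply: smooth_nearD; apply: smooth_nearM.
  - exact: smooth_near_pd smooth_hgt.
  - by apply: (sc (pd 0 (tau B))); exact: smooth_near_pd smooth_tau.
  - exact: smooth_near_cst.
  - by apply: (sc (pd i (tau B))); exact: smooth_near_pd smooth_tau.
rewrite /f -chain_leaf_point; [|exact: smooth_tau|exact: interior_ext].
rewrite -(pd_coord i 0 q); apply/eqP; rewrite subr_eq0; apply/eqP/pd_eq.
near=> p; rewrite tau_leaf_point//; apply: interior_ext; near: p.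
by apply: open_nbhs_nbhs; split=> //; exact: open_interior4.
Unshelve. all: by end_near. Qed.

Lemma dtau0_neq0 q : ext q -> dtau B (leaf_point q) 0 0 != 0.
Proof.
move=> qe; apply/eqP => z; have := chain_tau 0 qe.
by rewrite z eqxx /= mulr0 mul0r addr0 => /eqP; rewrite eq_sym oner_eq0.
Qed.

Lemma far_tau : exists (R0 : R) (psi : R -> R) (C : R),
  [/\ rp < R0, forall p, R0 <= radius (sp p) -> tau B p = p 0 0 + psi (radius (sp p)) &
      forall r, R0 < r -> derivable psi r 1 /\ `|r * derive1 psi r| <= C].
Proof. by have [_ _ _ _ [_]] := hfol. Qed.

Lemma far_dtau0 : exists2 R0, rp < R0 & forall p, R0 < radius (sp p) -> dtau B p 0 0 = 1.
Proof.
have [R0 [psi [C [R0p tE dpsi]]]] := far_tau; exists R0 => // p rp'.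
have Ap : away p by apply: lt_trans rp'; exact: lt_trans rplus_gt0 R0p.
rewrite mxE.
have dr : differentiable (fun q : 'rV[R]_4 => radius (sp q)) p.
  exact: smooth_near_diff smooth_r Ap.
have dpsi' : differentiable psi (radius (sp p)).
  by apply/derivable1_diffP; have [] := dpsi _ rp'.
have dps : differentiable (fun q => psi (radius (sp q))) p.
  exact: (@differentiable_comp _ _ _ _ (fun q => radius (sp q)) psi).
have oF : open (away `&` (fun p => radius (sp p)) @^-1` [set x : R | R0 < x]).
  apply: (open_preimage_fun open_away (open_gt (y := R0))) => q Aq.
  exact: smooth_near_cont smooth_r Aq.
rewrite (@pd_eq _ _ 0 _ (fun q => q 0 0 + psi (radius (sp q)))); last first.
  near=> q; rewrite tE//; apply: ltW; near: q.
  have := open_nbhs_nbhs (conj oF (conj Ap rp')); apply: filterS => q [_ h]; exact: h.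
rewrite pdD//; last exact: differentiable_coord.
rewrite pd_coord eqxx -[RHS]addr0; congr (_ + _).
rewrite /pd deriveE// (_ : (fun q => psi (radius (sp q))) = psi \o (fun q => radius (sp q)))//.
rewrite (diff_comp dr dpsi') /= -(deriveE _ dr).
have := (hg_r Ap).2 0; rewrite /pd => ->.
by rewrite cov_drE// row4E linear0.
Unshelve. all: by end_near. Qed.

(** The time component of [dtau] never vanishes on a leaf and equals 1 far out, so by the
    intermediate value theorem along the ray through [y] it is positive everywhere. This orients the
    adapted bases. *)
Lemma dtau0_gt0 s y : sdom y -> 0 < dtau B (emb B s y) 0 0.
Proof.
move=> ys; have [R0 R0p far] := far_dtau0.
have y0 : 0 < radius y by exact: lt_le_trans rplus_gt0 ys.
pose f c := dtau B (emb B s (c *: y)) 0 0.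
have sc c : 1 <= c -> sdom (c *: y).
  move=> c1; rewrite /slice_dom /= radiusZ; last exact: le_trans c1.
  by apply: le_trans ys _; rewrite ler_peMl// ltW.
have fn c : 1 <= c -> f c != 0.
  by move=> c1; rewrite /f embE; apply: dtau0_neq0; apply: ext_ev; exact: sc.
have cf c : 1 <= c -> {for c, continuous f}.
  move=> c1.
  apply: (continuous_comp (f := fun c : R => c *: y) (g := fun z => dtau B (emb B s z) 0 0)).
    exact: scalel_continuous.
  apply: (smooth_near_cont (A := sdom)); last exact: sc.
  apply: smooth_near_ext (smooth_at_emb s (smooth_near_pd 0 smooth_tau)) => z.
  by rewrite mxE.
(* Scaling by [c1] adds [R0 + 1] to the radius and lands in the far region. *)
pose c1 := 1 + (R0 + 1) / radius y.
have R00 : 0 < R0 + 1 by rewrite addr_gt0// (lt_trans rplus_gt0).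
have c11 : 1 <= c1 by rewrite lerDl divr_ge0// ltW.
have f1 : f c1 = 1.
  apply: far; rewrite embE sp_leaf_point sp_ev radiusZ; last exact: le_trans c11.
  rewrite mulrDl mul1r divfK ?gt_eqF//.
  by rewrite ltr_wpDl ?ltrDl// ltW.
rewrite -[y]scale1r -/(f 1) ltNge; apply/negP => fle.
have flt : f 1 < 0 by rewrite lt_neqAle fle fn.
have [||c cI fc] := @IVT R f 1 c1 0 c11.
- apply: continuous_in_subspaceT => c; rewrite inE /= in_itv /= => /andP[c1' _].
  exact: cf.
- by rewrite f1 ge_min le_max fle ler01 orbT.
by have := fn c; rewrite fc eqxx => /(_ _)/negP; apply=> //; move: cI; rewrite in_itv /= => /andP[].
Qed.

Lemma smooth_dtau : smooth_mx_near ext (dtau B).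
Proof.
move=> i j; apply: smooth_near_ext (smooth_near_pd j smooth_tau) => p; by rewrite mxE.
Qed.

Lemma dtau_timelike p : ext p -> pair (invmx (kn_metric B p)) (dtau B p) (dtau B p) < 0.
Proof. by move=> ep; have [_ _ _ /(_ p ep)[]] := hfol. Qed.

Lemma smooth_kn_ext : smooth_mx_near ext (kn_metric B).
Proof. exact: smooth_mx_sub ext_away (smooth_kn B). Qed.

Lemma smooth_inv_kn : smooth_mx_near ext (fun p => invmx (kn_metric B p)).
Proof.
apply: smooth_invmx smooth_kn_ext => p /ext_away Ap; rewrite lt_eqF//.
exact: kn_det_lt0.
Qed.

Lemma smooth_normal : smooth_mx_near ext (normal B).
Proof.
rewrite /normal; apply: smooth_mxZ; last first.
  by apply: smooth_mxM; [exact: smooth_dtau|exact: smooth_inv_kn].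
apply: smooth_nearN; apply: smooth_nearV.
  by move=> p ep; rewrite gt_eqF// sqrtr_gt0 oppr_gt0 dtau_timelike.
apply: smooth_near_sqrt; first by move=> p ep; rewrite oppr_gt0 dtau_timelike.
apply: smooth_nearN.
by apply: smooth_pair; [exact: smooth_inv_kn|exact: smooth_dtau|exact: smooth_dtau].
Qed.

Definition slope s y (i : 'I_3) : R := pd (lift ord0 i) (hgt B) (ev s y).

Lemma frameE s y i : frame B s y i = ev (slope s y i) (delta_mx 0 i).
Proof.
rewrite /frame /lift_vec; congr ev; rewrite (bigD1 i)//= mxE !eqxx mul1r big1 ?addr0//.
by move=> j /negbTE ji; rewrite mxE ji andbF mul0r.
Qed.

Lemma lift_vecE s y v : lift_vec B s y v = \sum_i v 0 i *: frame B s y i.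
Proof.
apply/rowP => j; rewrite summxE.
have [k ->|->] := unliftP ord0 j.
  rewrite mxE liftK /= (bigD1 k)//= mxE frameE mxE liftK /= mxE !eqxx mulr1 big1 ?addr0//.
  by move=> i /negbTE ik; rewrite mxE frameE mxE liftK /= mxE eq_sym ik andbF mulr0.
rewrite mxE unlift_none /=; apply: eq_bigr => i _.
by rewrite mxE frameE mxE unlift_none.
Qed.

Lemma smooth_slope s i : smooth_near sdom (slope s ^~ i).
Proof. exact: smooth_slice (smooth_near_pd _ smooth_hgt). Qed.

Lemma smooth_frame s i : smooth_mx_near sdom (fun y => frame B s y i).
Proof.
have -> : (fun y => frame B s y i) = fun y => ev (slope s y i) (delta_mx 0 i).
  by apply/funext => y; rewrite frameE.
by apply: smooth_ev3; [exact: smooth_slope|exact: smooth_mx_cst].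
Qed.

Section at_leaf_point.
Variables (s : R) (y : 'rV[R]_3).
Hypothesis ys : sdom y.
Let p := emb B s y.
Let ep : ext p := ext_emb s ys.
Let Ap : away p := ext_away ep.
Let g := kn_metric B p.

Let g_sym : g^T = g. Proof. exact: kn_sym. Qed.
Let g_det : \det g < 0. Proof. exact: kn_det_lt0. Qed.
Let ot : pair (invmx g) (dtau B p) (dtau B p) < 0. Proof. exact: dtau_timelike. Qed.
Let o0 : 0 < dtau B p 0 0. Proof. exact: dtau0_gt0. Qed.
Let nE : normal B p = - (Num.sqrt (- pair (invmx g) (dtau B p) (dtau B p)))^-1
  *: (dtau B p *m invmx g).
Proof. by []. Qed.
Let sE i : dtau B p 0 (lift ord0 i) + dtau B p 0 0 * slope s y i = 0.
Proof.
have := chain_tau (lift ord0 i) (ext_ev s ys).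
have L : (lift ord0 i == 0 :> 'I_4) = false by [].
by rewrite -embE L /= mul1r mulrC addrC.
Qed.

Lemma vol_density_gt0 : 0 < vol_density B s y.
Proof. exact: (vol_gt0 g_sym g_det ot o0 nE (frameE s y) sE). Qed.

Lemma ind_metric_unit : ind_metric B s y \in unitmx.
Proof. exact: (gram3_unit g_sym g_det ot o0 nE (frameE s y) sE). Qed.

Lemma normal_unit : pair g (normal B p) (normal B p) = -1.
Proof. exact: (gnn g_sym g_det ot nE). Qed.

(** The root that normalises [n] also occurs in the volume density and cancels. The product is free
    of it, so far out it can be bounded without a lower bound on the norm of [dtau]. *)
Lemma vol_density_normal :
  vol_density B s y *: normal B p = - (Num.sqrt (- \det g) / dtau B p 0 0) *: (dtau B p *m invmx g).
Proof.
have V : vol_density B s y = Num.sqrt (- \det g) * \det (basis_mx (normal B p) (frame B s y)).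
  exact: (volE g_sym g_det ot o0 nE (frameE s y) sE).
have D := detX g_sym ot o0 nE (frameE s y) sE.
rewrite V D nE scalerA; congr (_ *: _).
have l0 : 0 < Num.sqrt (- pair (invmx g) (dtau B p) (dtau B p)) by rewrite sqrtr_gt0 oppr_gt0.
by move: o0 l0; move: (Num.sqrt (- pair _ _ _)) (dtau B p 0 0) => l x x0 l0; field; rewrite !gt_eqF.
Qed.

Lemma field_of_data_of (G : 'rV[R]_3 -> 'M[R]_4) : (G y)^T = - G y ->
  field_of B s (data_of B s G) y = G y.
Proof. by move=> aG; exact: (join_el_mg g_sym g_det ot o0 nE (frameE s y) sE aG). Qed.

Lemma field_of_tr U : (field_of B s U y)^T = - field_of B s U y.
Proof. exact: (join_tr _ g_sym g_det). Qed.

Lemma data_of_field_of U : (data_of B s (field_of B s U)).1 y = U.1 y /\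
  (data_of B s (field_of B s U)).2 y = U.2 y.
Proof.
split.
- exact: (el_join g_sym g_det ot o0 nE (frameE s y) sE).
- exact: (mg_join g_sym g_det ot o0 nE (frameE s y) sE).
Qed.

Lemma dual3_data (G : 'rV[R]_3 -> 'M[R]_4) : (G y)^T = - G y ->
  dual3 (frame B s y) (G y) =
    vol_density B s y *: ((data_of B s G).2 y *m invmx (ind_metric B s y)).
Proof. by move=> aG; exact: (dual3_mg g_sym g_det ot o0 nE (frameE s y) sE aG). Qed.

Lemma dual3_star_data (G : 'rV[R]_3 -> 'M[R]_4) : (G y)^T = - G y ->
  dual3 (frame B s y) (star g (G y)) =
    vol_density B s y *: ((data_of B s G).1 y *m invmx (ind_metric B s y)).
Proof. by move=> aG; exact: (dual3_star g_sym g_det ot o0 nE (frameE s y) sE aG). Qed.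

End at_leaf_point.
End leaves.

(** * Fubini and Tonelli on products of sets *)

Section box_integrals.
Local Open Scope ereal_scope.
Context {d1 d2} {T1 : measurableType d1} {T2 : measurableType d2} {R : realType}.
Variables (m1 : {sigma_finite_measure set T1 -> \bar R}) (m2 : {sigma_finite_measure set T2 -> \bar R}).
Variables (D1 : set T1) (D2 : set T2) (f : T1 * T2 -> \bar R).
Hypotheses (mD1 : measurable D1) (mD2 : measurable D2).

Let section12 x : \int[m2]_y (f \_ (D1 `*` D2)) (x, y) =
  ((fun x => \int[m2]_(y in D2) f (x, y)) \_ D1) x.
Proof.
rewrite [RHS]patchE; case: ifPn => xD.
  rewrite [RHS]integral_mkcond; apply: eq_integral => y _.
  rewrite !patchE; congr (if _ then _ else _); apply/idP/idP; rewrite !inE.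
    by move=> [].
  by move=> yD; split=> //; rewrite inE in xD.
rewrite [RHS](_ : _ = \int[m2]_y (cst 0) y); last by rewrite integral0.
apply: eq_integral => y _; rewrite patchE ifF//; apply/negbTE; apply: contra xD.
by rewrite !inE => -[].
Qed.

Let section21 y : \int[m1]_x (f \_ (D1 `*` D2)) (x, y) =
  ((fun y => \int[m1]_(x in D1) f (x, y)) \_ D2) y.
Proof.
rewrite [RHS]patchE; case: ifPn => yD.
  rewrite [RHS]integral_mkcond; apply: eq_integral => x _.
  rewrite !patchE; congr (if _ then _ else _); apply/idP/idP; rewrite !inE.
    by move=> [].
  by move=> xD; split=> //; rewrite inE in yD.
rewrite [RHS](_ : _ = \int[m1]_x (cst 0) x); last by rewrite integral0.
apply: eq_integral => x _; rewrite patchE ifF//; apply/negbTE; apply: contra yD.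
by rewrite !inE => -[].
Qed.

Let mD : measurable (D1 `*` D2). Proof. exact: measurableX. Qed.

Lemma box_integral12 : (m1 \x m2).-integrable (D1 `*` D2) f ->
  \int[m1 \x m2]_(z in D1 `*` D2) f z = \int[m1]_(x in D1) \int[m2]_(y in D2) f (x, y).
Proof.
move=> /(integrable_mkcond _ mD) fi.
rewrite integral_mkcond -(integral12_prod_meas1 fi) [RHS]integral_mkcond.
by apply: eq_integral => x _; exact: section12.
Qed.

Lemma box_integral21 : (m1 \x m2).-integrable (D1 `*` D2) f ->
  \int[m1 \x m2]_(z in D1 `*` D2) f z = \int[m2]_(y in D2) \int[m1]_(x in D1) f (x, y).
Proof.
move=> /(integrable_mkcond _ mD) fi.
rewrite integral_mkcond -(integral21_prod_meas1 fi) [RHS]integral_mkcond.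
by apply: eq_integral => x _; exact: section21.
Qed.

Lemma box_tonelli12 : measurable_fun (D1 `*` D2) f -> (forall z, (D1 `*` D2) z -> 0 <= f z) ->
  \int[m1 \x m2]_(z in D1 `*` D2) f z = \int[m1]_(x in D1) \int[m2]_(y in D2) f (x, y).
Proof.
move=> mf0 f0.
have mf : measurable_fun setT (f \_ (D1 `*` D2)) by exact/(measurable_restrictT _ _).1.
have f0' x : 0 <= (f \_ (D1 `*` D2)) x by exact: erestrict_ge0.
rewrite integral_mkcond (fubini_tonelli1 _ mf f0') [RHS]integral_mkcond.
by apply: eq_integral => x _; exact: section12.
Qed.

End box_integrals.

(** * Borel sets, compactness and integrability on boxes *)

Section borel_products.
Context {R : realType}.

Definition countable_base {T : topologicalType} (b : nat -> set T) :=
  forall (U : set T) x, open U -> U x -> exists n, b n x /\ b n `<=` U.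

(** An open set is the countable union of the base elements contained in it. The product
    sigma-algebra is generated by rectangles, so measurability of open sets in the plane and in
    space is obtained this way, from rational intervals. *)
Lemma base_measurable {T : topologicalType} (mT : set (set T)) (b : nat -> set T) :
  sigma_algebra setT mT -> (forall n, mT (b n)) -> countable_base b ->
  forall U : set T, open U -> mT U.
Proof.
move=> sT mb cb U oU.
have -> : U = \bigcup_n (if `[< b n `<=` U >] then b n else set0).
  apply/seteqP; split=> [x Ux|x [n _]].
    have [n [bx bU]] := cb U x oU Ux; exists n => //.
    by rewrite asboolT.
  by case: ifPn => // /asboolP; exact.
have [s0 _ sU] := sT; apply: sU => n; case: ifPn => _ //.
Qed.

Definition rat_itv (n : nat) : set R :=
  if unpickle n is Some (a, b) then `](ratr (a : rat)), (ratr (b : rat))[%classic else set0.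

Lemma rat_itv_base : countable_base rat_itv.
Proof.
move=> U x oU Ux.
have [e /= e0 He] := (nbhs_ballP _ _).1 (open_nbhs_nbhs (conj oU Ux)).
have xe : x - e < x by rewrite ltrBlDr ltrDl.
have ex : x < x + e by rewrite ltrDl.
have [a aI] := rat_in_itvoo xe; have [b bI] := rat_in_itvoo ex.
move: aI bI; rewrite !in_itv /= => /andP[ax xa] /andP[bx xb].
exists (pickle (a, b)); rewrite /rat_itv pickleK /=; split.
  by apply/andP.
move=> y; rewrite /= in_itv /= => /andP[ay yb]; apply: He.
by rewrite /ball /= ltr_distlC; apply/andP; split;
   [exact: lt_trans ay|exact: lt_trans yb _].
Qed.

Lemma rat_itv_measurable n : measurable (rat_itv n).
Proof. by rewrite /rat_itv; case: unpickle => [[a b]|]; [exact: measurable_itv|exact: measurable0]. Qed.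

Definition prod_base {T1 T2 : Type} (b1 : nat -> set T1) (b2 : nat -> set T2) n : set (T1 * T2) :=
  if unpickle n is Some (i, j) then b1 i `*` b2 j else set0.

Lemma prod_base_base {T1 T2 : topologicalType} (b1 : nat -> set T1) (b2 : nat -> set T2) :
  countable_base b1 -> countable_base b2 -> countable_base (prod_base b1 b2).
Proof.
move=> B1 B2 U [x y] oU Ux.
have [[V W] /= [nV nW] VW] : nbhs (x, y) U by exact: open_nbhs_nbhs.
have [i [bx bV]] := B1 _ x (open_interior V) nV.
have [j [by_ bW]] := B2 _ y (open_interior W) nW.
exists (pickle (i, j)); rewrite /prod_base pickleK; split=> //.
move=> [x' y'] [/= /bV hx /bW hy]; apply: VW; split=> /=.
  exact: (@interior_subset _ V).
exact: (@interior_subset _ W).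
Qed.

Lemma prod_base_measurable {d1 d2} {T1 : measurableType d1} {T2 : measurableType d2} b1 b2 :
  (forall n, measurable (b1 n : set T1)) -> (forall n, measurable (b2 n : set T2)) ->
  forall n, measurable (prod_base b1 b2 n).
Proof.
move=> m1 m2 n; rewrite /prod_base; case: unpickle => [[i j]|]; last exact: measurable0.
exact: measurableX.
Qed.

Lemma open_measurable2 (U : set (R * R)) : open U -> measurable U.
Proof.
apply: (@base_measurable _ _ (prod_base rat_itv rat_itv)) => //.
- by split; [exact: measurable0|move=> A mA; rewrite setTD; exact: measurableC|exact: bigcupT_measurable].
- apply: prod_base_measurable; exact: rat_itv_measurable.
- apply: prod_base_base; exact: rat_itv_base.
Qed.

Lemma open_measurable3 (U : set (R * R * R)) : open U -> measurable U.
Proof.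
apply: (@base_measurable _ _ (prod_base (prod_base rat_itv rat_itv) rat_itv)) => //.
- by split; [exact: measurable0|move=> A mA; rewrite setTD; exact: measurableC|exact: bigcupT_measurable].
- apply: prod_base_measurable; last exact: rat_itv_measurable.
  apply: prod_base_measurable; exact: rat_itv_measurable.
- apply: prod_base_base; last exact: rat_itv_base.
  apply: prod_base_base; exact: rat_itv_base.
Qed.

Lemma continuous_on_measurable2 (D U : set (R * R)) f : open U -> D `<=` U -> measurable D ->
  (forall q, U q -> {for q, continuous f}) -> measurable_fun D (f : R * R -> R).
Proof.
move=> oU DU mD cf; apply: (measurability _ (RGenOInfty.measurableE R)).
move=> _ [_ [a ->] <-].
have -> : D `&` f @^-1` `]a, +oo[ = D `&` (U `&` f @^-1` [set x | a < x]).
  apply/seteqP; split=> q /= [Dq]; rewrite in_itv /= andbT; first by split=> //; split=> //; exact: DU.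
  by move=> [_].
apply: measurableI => //; apply: open_measurable2.
rewrite openE => q [Uq fq]; apply: filterI; first exact: open_nbhs_nbhs.
by apply: (cf _ Uq); apply: open_nbhs_nbhs; split=> //; exact: open_gt.
Qed.

Lemma continuous_on_measurable3 (D U : set (R * R * R)) f : open U -> D `<=` U -> measurable D ->
  (forall q, U q -> {for q, continuous f}) -> measurable_fun D (f : R * R * R -> R).
Proof.
move=> oU DU mD cf; apply: (measurability _ (RGenOInfty.measurableE R)).
move=> _ [_ [a ->] <-].
have -> : D `&` f @^-1` `]a, +oo[ = D `&` (U `&` f @^-1` [set x | a < x]).
  apply/seteqP; split=> q /= [Dq]; rewrite in_itv /= andbT; first by split=> //; split=> //; exact: DU.
  by move=> [_].
apply: measurableI => //; apply: open_measurable3.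
rewrite openE => q [Uq fq]; apply: filterI; first exact: open_nbhs_nbhs.
by apply: (cf _ Uq); apply: open_nbhs_nbhs; split=> //; exact: open_gt.
Qed.

Lemma continuous_on_compact_bound {T : topologicalType} (K : set T) (f : T -> R) : compact K ->
  (forall q, K q -> {for q, continuous f}) -> exists2 C, 0 <= C & forall q, K q -> `|f q| <= C.
Proof.
move=> cK cf.
have cw : {within K, continuous f}.
  by apply: continuous_in_subspaceT => q /set_mem; exact: cf.
have /compact_bounded[C [Cr HC]] := continuous_compact cw cK.
exists (`|C| + 1); first by rewrite addr_ge0.
by move=> q Kq; apply: HC; [rewrite ltr_pwDr// ler_norm|exists q].
Qed.

Lemma continuous_on_compact_min {T : topologicalType} (K : set T) (f : T -> R) : compact K ->
  (forall q, K q -> {for q, continuous f}) -> (forall q, K q -> 0 < f q) ->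
  exists2 c, 0 < c & forall q, K q -> c <= f q.
Proof.
move=> cK cf f0.
have [K0|/set0P K0] := eqVneq K set0; first by exists 1; rewrite ?K0.
have cw : {within K, continuous f}.
  by apply: continuous_in_subspaceT => q /set_mem; exact: cf.
have [c cK' Hc] := compact_EVT_min K0 cK cw.
by exists (f c); [exact: f0 (set_mem cK')|move=> q Kq; apply: Hc; exact: mem_set].
Qed.

Definition box2 (x0 x1 y0 y1 : R) : set (R * R) := `[x0, x1] `*` `[y0, y1].
Definition box3 (x0 x1 y0 y1 z0 z1 : R) : set (R * R * R) := box2 x0 x1 y0 y1 `*` `[z0, z1].

Lemma box2_compact x0 x1 y0 y1 : compact (box2 x0 x1 y0 y1).
Proof. by apply: compact_setX; exact: segment_compact. Qed.
Lemma box3_compact x0 x1 y0 y1 z0 z1 : compact (box3 x0 x1 y0 y1 z0 z1).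
Proof. by apply: compact_setX; [exact: box2_compact|exact: segment_compact]. Qed.
Lemma box2_measurable x0 x1 y0 y1 : measurable (box2 x0 x1 y0 y1).
Proof. by apply: measurableX; exact: measurable_itv. Qed.
Lemma box3_measurable x0 x1 y0 y1 z0 z1 : measurable (box3 x0 x1 y0 y1 z0 z1).
Proof. by apply: measurableX; [exact: box2_measurable|exact: measurable_itv]. Qed.

Local Notation leb := (@lebesgue_measure R).

Lemma itv_finite (x0 x1 : R) : (leb `[x0, x1] < +oo)%E.
Proof. by rewrite lebesgue_measure_itv /=; case: ifP => // _; rewrite -EFinB ltry. Qed.
Lemma box2_finite x0 x1 y0 y1 : ((leb \x leb)%E (box2 x0 x1 y0 y1) < +oo)%E.
Proof.
rewrite product_measure1E; [|exact: measurable_itv|exact: measurable_itv].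
by rewrite lte_mul_pinfty// ?itv_finite// ge0_fin_numE// itv_finite.
Qed.
Lemma box3_finite x0 x1 y0 y1 z0 z1 :
  (((leb \x leb) \x leb)%E (box3 x0 x1 y0 y1 z0 z1) < +oo)%E.
Proof.
rewrite product_measure1E; [|exact: box2_measurable|exact: measurable_itv].
by rewrite lte_mul_pinfty// ?itv_finite// ge0_fin_numE// box2_finite.
Qed.

Lemma bounded_integrable {d} {T : measurableType d} (mu : {measure set T -> \bar R})
    (D : set T) (f : T -> R) C : measurable D -> (mu D < +oo)%E -> measurable_fun D f ->
  (forall q, D q -> `|f q| <= C) -> mu.-integrable D (EFin \o f).
Proof.
move=> mD fD mf fC; apply: measurable_bounded_integrable => //.
exists C; split; first exact: num_real.
by move=> x Cx y Dy; apply: le_trans (fC _ Dy) _; exact: ltW.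
Qed.

Lemma box2_integrable x0 x1 y0 y1 U (f : R * R -> R) : open U -> box2 x0 x1 y0 y1 `<=` U ->
  (forall q, U q -> {for q, continuous f}) ->
  (leb \x leb)%E.-integrable (box2 x0 x1 y0 y1) (EFin \o f).
Proof.
move=> oU KU cf.
have [C _ HC] := continuous_on_compact_bound (@box2_compact x0 x1 y0 y1) (fun q Kq => cf q (KU q Kq)).
apply: (bounded_integrable (C := C)) => //; [exact: box2_measurable|exact: box2_finite|].
exact: continuous_on_measurable2 oU KU (box2_measurable _ _ _ _) cf.
Qed.

Lemma box3_integrable x0 x1 y0 y1 z0 z1 U (f : R * R * R -> R) : open U ->
  box3 x0 x1 y0 y1 z0 z1 `<=` U -> (forall q, U q -> {for q, continuous f}) ->
  ((leb \x leb) \x leb)%E.-integrable (box3 x0 x1 y0 y1 z0 z1) (EFin \o f).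
Proof.
move=> oU KU cf.
have [C _ HC] := continuous_on_compact_bound (@box3_compact x0 x1 y0 y1 z0 z1) (fun q Kq => cf q (KU q Kq)).
apply: (bounded_integrable (C := C)) => //; [exact: box3_measurable|exact: box3_finite|].
exact: continuous_on_measurable3 oU KU (box3_measurable _ _ _ _ _ _) cf.
Qed.

Lemma integral_derive (f F : R -> R) (a b : R) : a <= b ->
  (forall x : R, a <= x <= b -> is_derive x 1 F (f x)) ->
  (forall x : R, a <= x <= b -> {for x, continuous f}) ->
  (\int[leb]_(x in `[a, b]) (f x)%:E = (F b - F a)%:E)%E.
Proof.
rewrite le_eqVlt => /predU1P[<- _ _|ab dF cf].
  by rewrite set_itv1 integral_set1 subrr.
have cF x : a <= x <= b -> {for x, continuous F}.
  by move=> xab; apply: differentiable_continuous; apply/derivable1_diffP; have [] := dF x xab.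
have lexx' : a <= a <= b by rewrite lexx ltW.
have lebb : a <= b <= b by rewrite lexx ltW.
rewrite (continuous_FTC2 (F := F) ab) ?EFinB//.
- by apply: continuous_in_subspaceT => x; rewrite inE /= in_itv /=; exact: cf.
- split.
  + by move=> x; rewrite in_itv /= => /andP[/ltW ax /ltW xb]; have [|] := dF x; rewrite ?ax ?xb.
  + by apply: cvg_at_right_filter; exact: cF.
  + by apply: cvg_at_left_filter; exact: cF.
- move=> x; rewrite in_itv /= => /andP[/ltW ax /ltW xb].
  by rewrite derive1E; have := dF x; rewrite ax xb => /(_ isT) h; exact: derive_val.
Qed.

End borel_products.

(** * Continuity at a point *)

Section pointwise_continuity.
Context {R : realType} {T : topologicalType}.
Implicit Types (f g : T -> R) (q : T).

Definition cont (q : T) (f : T -> R) : Prop := {for q, continuous f}.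

Lemma cont_ext f g q : f =1 g -> cont q f -> cont q g.
Proof. by move=> /funext ->. Qed.
Lemma cont_cst (c : R) q : cont q (fun=> c). Proof. exact: cvg_cst. Qed.
Lemma contD f g q : cont q f -> cont q g -> cont q (fun x => f x + g x).
Proof. exact: continuousD. Qed.
Lemma contN f q : cont q f -> cont q (fun x => - f x).
Proof. exact: continuousN. Qed.
Lemma contB f g q : cont q f -> cont q g -> cont q (fun x => f x - g x).
Proof. by move=> cf cg; apply: contD => //; exact: contN. Qed.
Lemma contM f g q : cont q f -> cont q g -> cont q (fun x => f x * g x).
Proof. exact: continuousM. Qed.
Lemma contX f k q : cont q f -> cont q (fun x => f x ^+ k).
Proof.
move=> cf; elim: k => [|k IH]; first exact: cont_cst.
by apply: cont_ext (contM cf IH) => x; rewrite exprS.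
Qed.
Lemma cont_sum (I : Type) (s : seq I) (P : pred I) (F : I -> T -> R) q :
  (forall i, cont q (F i)) -> cont q (fun x => \sum_(i <- s | P i) F i x).
Proof.
move=> cF; elim: s => [|i s IH]; first by apply: (cont_ext (f := fun=> 0)) => [x|]; [by rewrite big_nil|exact: cont_cst].
case Pi : (P i).
  by apply: cont_ext (contD (cF i) IH) => x; rewrite big_cons Pi.
by apply: cont_ext IH => x; rewrite big_cons Pi.
Qed.
Lemma cont_comp1 (h : R -> R) f q : cont q f -> {for f q, continuous h} -> cont q (fun x => h (f x)).
Proof. by move=> cf ch; exact: (continuous_comp cf). Qed.
Lemma cont_sin f q : cont q f -> cont q (fun x => sin (f x)).
Proof. by move=> cf; apply: cont_comp1 cf _; exact: continuous_sin. Qed.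
Lemma cont_cos f q : cont q f -> cont q (fun x => cos (f x)).
Proof. by move=> cf; apply: cont_comp1 cf _; exact: continuous_cos. Qed.

Lemma cont_mx k l (G : T -> 'M[R]_(k, l)) q : (forall i j, cont q (fun x => G x i j)) ->
  {for q, continuous G}.
Proof.
move=> cG.
have -> : G = fun x => \sum_(i < k) \sum_(j < l) (G x i j *: delta_mx i j).
  by apply/funext => x; exact: matrix_sum_delta.
have H (I : Type) (s : seq I) (F : I -> T -> 'M[R]_(k, l)) :
    (forall i, {for q, continuous (F i)}) -> {for q, continuous (fun x => \sum_(i <- s) F i x)}.
  move=> cF; elim: s => [|i s IH].
    rewrite (_ : (fun _ => _) = cst 0); first exact: cvg_cst.
    by apply/funext => x; rewrite big_nil.
  rewrite (_ : (fun _ => _) = fun x => F i x + \sum_(j <- s) F j x).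
    exact: (continuousD (cF i) IH).
  by apply/funext => x; rewrite big_cons.
apply: (H) => i; apply: (H) => j; apply: continuousZ; first exact: cG.
exact: cvg_cst.
Qed.

Lemma cont_comp_mx k l (f : 'M[R]_(k, l) -> R) (G : T -> 'M[R]_(k, l)) q :
  (forall i j, cont q (fun x => G x i j)) -> {for G q, continuous f} -> cont q (fun x => f (G x)).
Proof. by move=> /cont_mx cG cf; exact: (continuous_comp cG). Qed.

End pointwise_continuity.

(** * Sigma-finiteness of product measures *)

Section product_sigma_finite.
Context {d1 d2} {T1 : measurableType d1} {T2 : measurableType d2} {R : realType}.
Variables (m1 : {sigma_finite_measure set T1 -> \bar R}).
Variables (m2 : {sigma_finite_measure set T2 -> \bar R}).

(* The library has this instance, but inference finds the one for
   subprobabilities first. *)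
Definition product_sf : set (T1 * T2)%type -> \bar R := product_measure1 m1 m2.
HB.instance Definition _ := Measure.on product_sf.

Lemma product_sf_sigma_finite : sigma_finite setT product_sf.
Proof.
have /sigma_finiteP[F [TF ndF Foo]] := sigma_finiteT m1.
have /sigma_finiteP[G [TG ndG Goo]] := sigma_finiteT m2.
exists (fun n => F n `*` G n).
  rewrite -setXTT TF TG predeqE => -[x y]; split=> [[/= [n _ Fnx] [k _ Gky]]|].
    exists (maxn n k) => //; split; first by move: x Fnx; exact/subsetPset/ndF/leq_maxl.
    by move: y Gky; exact/subsetPset/ndG/leq_maxr.
  by move=> [n _ []/= ? ?]; split; exists n.
move=> k; have [? ?] := Foo k; have [? ?] := Goo k; split; first exact: measurableX.
by rewrite /product_sf product_measure1E// lte_mul_pinfty// ge0_fin_numE.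
Qed.

HB.instance Definition _ := Measure_isSigmaFinite.Build _ _ _ product_sf product_sf_sigma_finite.
End product_sigma_finite.

(** * The divergence theorem on a box *)

Section divergence_on_a_box.
Context {R : realType}.
Local Notation leb := (@lebesgue_measure R).

Section fubini_boxes.
Variables (x0 x1 y0 y1 z0 z1 : R).
Local Open Scope ereal_scope.

Lemma box3_integral12 (f : R * R * R -> R) :
  ((leb \x leb) \x leb).-integrable (box3 x0 x1 y0 y1 z0 z1) (fun q => (f q)%:E) ->
  \int[(leb \x leb) \x leb]_(q in box3 x0 x1 y0 y1 z0 z1) (f q)%:E =
  \int[leb \x leb]_(q in box2 x0 x1 y0 y1) \int[leb]_(z in `[z0, z1]) (f (q, z))%:E.
Proof.
exact: (@box_integral12 _ _ _ _ _ (product_sf leb leb) leb (box2 x0 x1 y0 y1) `[z0, z1]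
  (fun q => (f q)%:E) (box2_measurable _ _ _ _) (measurable_itv _)).
Qed.

Lemma box3_integral21 (f : R * R * R -> R) :
  ((leb \x leb) \x leb).-integrable (box3 x0 x1 y0 y1 z0 z1) (fun q => (f q)%:E) ->
  \int[(leb \x leb) \x leb]_(q in box3 x0 x1 y0 y1 z0 z1) (f q)%:E =
  \int[leb]_(z in `[z0, z1]) \int[leb \x leb]_(q in box2 x0 x1 y0 y1) (f (q, z))%:E.
Proof.
exact: (@box_integral21 _ _ _ _ _ (product_sf leb leb) leb (box2 x0 x1 y0 y1) `[z0, z1]
  (fun q => (f q)%:E) (box2_measurable _ _ _ _) (measurable_itv _)).
Qed.

Lemma box2_integral12 (f : R * R -> R) :
  (leb \x leb).-integrable (box2 x0 x1 y0 y1) (fun q => (f q)%:E) ->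
  \int[leb \x leb]_(q in box2 x0 x1 y0 y1) (f q)%:E =
  \int[leb]_(x in `[x0, x1]) \int[leb]_(y in `[y0, y1]) (f (x, y))%:E.
Proof.
exact: (@box_integral12 _ _ _ _ _ leb leb `[x0, x1] `[y0, y1]
  (fun q => (f q)%:E) (measurable_itv _) (measurable_itv _)).
Qed.

Lemma box2_integral21 (f : R * R -> R) :
  (leb \x leb).-integrable (box2 x0 x1 y0 y1) (fun q => (f q)%:E) ->
  \int[leb \x leb]_(q in box2 x0 x1 y0 y1) (f q)%:E =
  \int[leb]_(y in `[y0, y1]) \int[leb]_(x in `[x0, x1]) (f (x, y))%:E.
Proof.
exact: (@box_integral21 _ _ _ _ _ leb leb `[x0, x1] `[y0, y1]
  (fun q => (f q)%:E) (measurable_itv _) (measurable_itv _)).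
Qed.
End fubini_boxes.

Lemma cont_1 (q : R * R * R) : cont q (fun q => q.1.1).
Proof. by apply: (continuous_comp (f := fst) (g := fst)); exact: cvg_fst. Qed.
Lemma cont_2 (q : R * R * R) : cont q (fun q => q.1.2).
Proof. by apply: (continuous_comp (f := fst) (g := snd)); [exact: cvg_fst|exact: cvg_snd]. Qed.
Lemma cont_3 (q : R * R * R) : cont q (fun q => q.2).
Proof. exact: cvg_snd. Qed.

Section slices.
Variable (V : set (R * R * R)).
Hypothesis oV : open V.

Lemma pair_continuous {T U W : topologicalType} (f : T -> U) (g : T -> W) :
  continuous f -> continuous g -> continuous (fun q => (f q, g q)).
Proof. by move=> cf cg q; apply: cvg_pair; [exact: cf|exact: cg]. Qed.
Lemma slice3_continuous (z : R) : continuous (fun q : R * R => (q, z)).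
Proof. by apply: pair_continuous => q; [exact: cvg_id|exact: cvg_cst]. Qed.
Lemma slice1_continuous (x : R) : continuous (fun q : R * R => (x, q.1, q.2)).
Proof.
apply: pair_continuous; last by move=> q; exact: cvg_snd.
by apply: pair_continuous => q; [exact: cvg_cst|exact: cvg_fst].
Qed.
Lemma line1_continuous (y z : R) : continuous (fun x : R => (x, y, z)).
Proof.
apply: pair_continuous; last by move=> q; exact: cvg_cst.
by apply: pair_continuous => q; [exact: cvg_id|exact: cvg_cst].
Qed.
Lemma line2_continuous (x z : R) : continuous (fun y : R => (x, y, z)).
Proof.
apply: pair_continuous; last by move=> q; exact: cvg_cst.
by apply: pair_continuous => q; [exact: cvg_cst|exact: cvg_id].
Qed.
Lemma line3_continuous (x y : R) : continuous (fun z : R => (x, y, z)).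
Proof. by apply: pair_continuous => q; [exact: cvg_cst|exact: cvg_id]. Qed.

Lemma open_pre {T : topologicalType} (h : T -> R * R * R) : continuous h -> open (h @^-1` V).
Proof. by move=> ch; apply: open_comp oV => x _; exact: ch. Qed.
End slices.

Variables (V : set (R * R * R)) (x0 x1 y0 y1 z0 z1 : R).
Hypotheses (oV : open V) (boxV : box3 x0 x1 y0 y1 z0 z1 `<=` V).
Hypotheses (x01 : x0 <= x1) (y01 : y0 <= y1) (z01 : z0 <= z1).
Variables (F1 F2 F3 f1 f2 f3 : R * R * R -> R).
Hypotheses (cF1 : forall q, V q -> cont q F1).
Hypotheses (c1 : forall q, V q -> cont q f1) (c2 : forall q, V q -> cont q f2)
  (c3 : forall q, V q -> cont q f3).
Hypothesis d1 : forall x y z : R, V (x, y, z) -> is_derive x 1 (fun x => F1 (x, y, z)) (f1 (x, y, z)).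
Hypothesis d2 : forall x y z : R, V (x, y, z) -> is_derive y 1 (fun y => F2 (x, y, z)) (f2 (x, y, z)).
Hypothesis d3 : forall x y z : R, V (x, y, z) -> is_derive z 1 (fun z => F3 (x, y, z)) (f3 (x, y, z)).
Hypothesis F2_eq : forall x z, F2 (x, y1, z) = F2 (x, y0, z).
Hypothesis F3_eq : forall x y, F3 (x, y, z1) = F3 (x, y, z0).

Let inV (x y z : R) : x0 <= x <= x1 -> y0 <= y <= y1 -> z0 <= z <= z1 -> V (x, y, z).
Proof. by move=> hx hy hz; apply: boxV; split; [split|]; rewrite /= in_itv. Qed.

Let I f : (forall q, V q -> cont q f) ->
  ((leb \x leb) \x leb)%E.-integrable (box3 x0 x1 y0 y1 z0 z1) (fun q => (f q)%:E).
Proof. exact: (box3_integrable (f := f) oV boxV). Qed.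

Let i3 : (\int[(leb \x leb) \x leb]_(q in box3 x0 x1 y0 y1 z0 z1) (f3 q)%:E = 0)%E.
Proof.
rewrite box3_integral12; last exact: I.
rewrite -(integral0 (leb \x leb)%E (box2 x0 x1 y0 y1)); apply: eq_integral => -[x y] /set_mem[/= ].
rewrite !in_itv /= => hx hy.
have D z : z0 <= z <= z1 -> is_derive z 1 (fun z => F3 (x, y, z)) (f3 (x, y, z)).
  by move=> hz; apply: d3; exact: inV.
rewrite (integral_derive z01 D); first by rewrite F3_eq subrr.
move=> z hz; apply: (continuous_comp (f := fun z => (x, y, z))); first exact: line3_continuous.
  by apply: c3; exact: inV.
Qed.

Let i2 : (\int[(leb \x leb) \x leb]_(q in box3 x0 x1 y0 y1 z0 z1) (f2 q)%:E = 0)%E.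
Proof.
rewrite box3_integral21; last exact: I.
rewrite -(integral0 leb `[z0, z1]%classic); apply: eq_integral => z /set_mem /=.
rewrite in_itv /= => hz.
rewrite box2_integral12.
- rewrite -(integral0 leb `[x0, x1]%classic); apply: eq_integral => x /set_mem /=.
  rewrite in_itv /= => hx.
  have D y : y0 <= y <= y1 -> is_derive y 1 (fun y => F2 (x, y, z)) (f2 (x, y, z)).
    by move=> hy; apply: d2; exact: inV.
  rewrite (integral_derive y01 D); first by rewrite F2_eq subrr.
  move=> y hy; apply: (continuous_comp (f := fun y => (x, y, z))); first exact: line2_continuous.
    by apply: c2; exact: inV.
- apply: (box2_integrable (U := (fun q => (q, z)) @^-1` V) (f := fun q => f2 (q, z))).
  + by apply: (open_pre oV); exact: slice3_continuous.
  + by move=> -[x y] [/=]; rewrite !in_itv /= => hx hy; exact: inV.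
  + move=> q Vq; apply: (continuous_comp (f := fun q => (q, z))); first exact: slice3_continuous.
    exact: c2.
Qed.

Let slice_integrable (x : R) : x0 <= x <= x1 ->
  (leb \x leb)%E.-integrable (box2 y0 y1 z0 z1) (fun q => (F1 (x, q.1, q.2))%:E).
Proof.
move=> hx; apply: (box2_integrable (U := (fun q => (x, q.1, q.2)) @^-1` V) (f := fun q => F1 (x, q.1, q.2))).
- by apply: (open_pre oV); exact: slice1_continuous.
- by move=> -[y z] [/=]; rewrite !in_itv /= => hy hz; exact: inV.
- move=> q Vq; apply: (continuous_comp (f := fun q => (x, q.1, q.2))); first exact: slice1_continuous.
  exact: cF1.
Qed.

Let hx0 : x0 <= x0 <= x1. Proof. by rewrite lexx. Qed.
Let hx1 : x0 <= x1 <= x1. Proof. by rewrite lexx andbT. Qed.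

Let i1 : (\int[(leb \x leb) \x leb]_(q in box3 x0 x1 y0 y1 z0 z1) (f1 q)%:E =
  \int[leb \x leb]_(q in box2 y0 y1 z0 z1) (F1 (x1, q.1, q.2) - F1 (x0, q.1, q.2))%:E)%E.
Proof.
rewrite box3_integral21; last exact: I.
rewrite [RHS]box2_integral21.
- apply: eq_integral => z /set_mem /=; rewrite in_itv /= => hz.
  rewrite box2_integral21.
  + apply: eq_integral => y /set_mem /=; rewrite in_itv /= => hy.
    have D x : x0 <= x <= x1 -> is_derive x 1 (fun x => F1 (x, y, z)) (f1 (x, y, z)).
      by move=> hx; apply: d1; exact: inV.
    rewrite (integral_derive x01 D)//.
    move=> x hx; apply: (continuous_comp (f := fun x => (x, y, z))); first exact: line1_continuous.
      by apply: c1; exact: inV.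
  + apply: (box2_integrable (U := (fun q => (q, z)) @^-1` V) (f := fun q => f1 (q, z))).
    * by apply: (open_pre oV); exact: slice3_continuous.
    * by move=> -[x y] [/=]; rewrite !in_itv /= => hx hy; exact: inV.
    * move=> q Vq; apply: (continuous_comp (f := fun q => (q, z))); first exact: slice3_continuous.
      exact: c1.
- have -> : (fun q : R * R => (F1 (x1, q.1, q.2) - F1 (x0, q.1, q.2))%:E) =
     (fun q => (F1 (x1, q.1, q.2))%:E - (F1 (x0, q.1, q.2))%:E)%E by [].
  by apply: integrableB; [exact: box2_measurable|exact: slice_integrable|exact: slice_integrable].
Qed.

(** Each term is integrated first in its own variable. The functions [F2] and [F3] agree on opposite
    faces and contribute nothing, which is the situation of the two angles; only the radial faces
    remain. *)
Lemma box_divergence :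
  \int[((leb \x leb) \x leb)%E]_(q in box3 x0 x1 y0 y1 z0 z1) (f1 q + f2 q + f3 q) =
  \int[(leb \x leb)%E]_(q in box2 y0 y1 z0 z1) F1 (x1, q.1, q.2) -
  \int[(leb \x leb)%E]_(q in box2 y0 y1 z0 z1) F1 (x0, q.1, q.2).
Proof.
have I1 := I c1; have I2 := I c2; have I3 := I c3.
have mb := box3_measurable x0 x1 y0 y1 z0 z1.
rewrite {1}/Rintegral integralD_EFin//; last first.
  rewrite (_ : _ \o _ = (fun q => (f1 q)%:E + (f2 q)%:E)%E)//; exact: integrableD.
rewrite integralD_EFin// i2 i3 !adde0 i1.
have fin x : x0 <= x <= x1 -> (\int[(leb \x leb)%E]_(q in box2 y0 y1 z0 z1) (F1 (x, q.1, q.2))%:E)%E \is a fin_num.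
  by move=> hx; apply: integrable_fin_num; [exact: box2_measurable|exact: slice_integrable].
rewrite integralB_EFin; [|exact: box2_measurable|exact: slice_integrable|exact: slice_integrable].
by rewrite fineB ?fin.
Qed.
End divergence_on_a_box.

(** Descends through sums, products, powers, sine and cosine; [base] closes the subterms that are
    neither coordinates nor constants. *)
Ltac cont_poly base :=
  lazymatch goal with
  | |- cont _ (fun q => GRing.add (@?f q) (@?g q)) =>
    apply: (@contD _ _ f g); cont_poly base
  | |- cont _ (fun q => GRing.mul (@?f q) (@?g q)) =>
    apply: (@contM _ _ f g); cont_poly base
  | |- cont _ (fun q => GRing.opp (@?f q)) => apply: (@contN _ _ f); cont_poly base
  | |- cont _ (fun q => GRing.exp (@?f q) _) => apply: (@contX _ _ f); cont_poly base
  | |- cont _ (fun q => sin (@?f q)) => apply: (@cont_sin _ _ f); cont_poly base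
  | |- cont _ (fun q => cos (@?f q)) => apply: (@cont_cos _ _ f); cont_poly base
  | |- cont _ (fun q => fst (fst q)) => exact: cont_1
  | |- cont _ (fun q => snd (fst q)) => exact: cont_2
  | |- cont _ (fun q => snd q) => exact: cont_3
  | |- _ => first [base | exact: cont_cst]
  end.

(** * The divergence theorem on a spherical shell *)

Section gauss.
Context {R : realType}.
Implicit Types (w : 'rV[R]_3 -> 'rV[R]_3).

Lemma sphE (q : R * R * R) : (((sph q 0 0 = q.1.1 * sin q.1.2 * cos q.2)%R *
  (sph q 0 1 = q.1.1 * sin q.1.2 * sin q.2)%R) * (sph q 0 2 = q.1.1 * cos q.1.2)%R)%type.
Proof. by case: q => -[r th] ph; rewrite /sph !row3E. Qed.

Lemma cont_sph (q : R * R * R) (i : 'I_1) j : cont q (fun q => sph q i j).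
Proof.
have c1 := @cont_1 R q; have c2 := @cont_2 R q; have c3 := @cont_3 R q; rewrite (ord1 i).
move: j; apply: ord3P.
- apply: (cont_ext (f := fun q : (R * R * R) => (q.1.1 * sin q.1.2 * cos q.2)%R)) => [x|]; first by rewrite sphE.
  apply: contM; [apply: contM => //|]; [exact: cont_sin|exact: cont_cos].
- apply: (cont_ext (f := fun q : (R * R * R) => (q.1.1 * sin q.1.2 * sin q.2)%R)) => [x|]; first by rewrite sphE.
  apply: contM; [apply: contM => //|]; exact: cont_sin.
- apply: (cont_ext (f := fun q : (R * R * R) => (q.1.1 * cos q.1.2)%R)) => [x|]; first by rewrite sphE.
  by apply: contM => //; exact: cont_cos.
Qed.

Lemma sph_continuous : continuous (@sph R).
Proof. move=> q; apply: cont_mx => i j; exact: cont_sph. Qed.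

Lemma is_derive_curve (f : 'rV[R]_3 -> R) (c : R -> 'rV[R]_3) (v : 'rV[R]_3) (x : R) :
  (forall j, is_derive x 1 (fun x => c x 0 j) (v 0 j)) -> differentiable f (c x) ->
  is_derive x 1 (fun x => f (c x)) (\sum_j v 0 j * pd j f (c x)).
Proof.
move=> dc df.
have dc' : differentiable c x.
  apply: differentiable_mx => i j; rewrite (ord1 i); apply/derivable1_diffP.
  by have [] := dc j.
have vE : 'D_1 c x = v.
  by rewrite derive_mx; [apply/rowP => j; rewrite mxE; have [_ ->] := dc j|exact: diff_derivable].
have dfc : differentiable (f \o c) x by exact: differentiable_comp.
apply: DeriveDef; first exact/derivable1_diffP.
have E1 : 'd c x 1 = v by rewrite -vE deriveE.
rewrite deriveE// diff_comp//= E1 -deriveE//.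
exact: derive_sum_pd.
Qed.

Section flux.
Variables (A : set 'rV[R]_3) (w : 'rV[R]_3 -> 'rV[R]_3).
Hypotheses (sw : smooth_mx_near A w).

(** The weight is [r sin(theta)] rather than [r^2 sin(theta)] because [w] is paired with the
    position vector instead of the unit normal. *)
Definition flux_density (q : R * R * R) : R :=
  q.1.1 * sin q.1.2 * \sum_i w (sph q) 0 i * sph q 0 i.

Let W i y := w y 0 i.

Lemma flux_domain : exists U, [/\ open U, A `<=` U & forall i k, Ck U k (W i)].
Proof.
have [U0 [opn0 A0 H0]] := (smooth_nearP _ _).1 (sw 0 0).
have [U1 [opn1 A1 H1]] := (smooth_nearP _ _).1 (sw 0 1).
have [U2 [opn2 A2 H2]] := (smooth_nearP _ _).1 (sw 0 2).
exists (U0 `&` U1 `&` U2); split; first by apply: openI => //; exact: openI.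
  by move=> y Ay; split; [split; [exact: A0|exact: A1]|exact: A2].
apply: ord3P => k.
- by apply: Ck_sub (H0 k) => y [[? ?] ?].
- by apply: Ck_sub (H1 k) => y [[? ?] ?].
- by apply: Ck_sub (H2 k) => y [? ?].
Qed.

Definition sphere_flux r : R :=
  \int[(lebesgue_measure \x lebesgue_measure)%E]_(q in box2 0 pi 0 (2 * pi)) flux_density (r, q.1, q.2).

(** Spherical coordinates turn the shell into a box. The angular faces cancel: the theta component
    carries a factor sin(theta), which vanishes at the poles, and the phi component is periodic.
    Thus the coordinate singularity on the axis never enters. *)
Lemma flux_diff r1 r2 : 0 <= r1 -> r1 <= r2 -> (forall y, r1 <= radius y <= r2 -> A y) ->
  sphere_flux r2 - sphere_flux r1 =
  \int[((lebesgue_measure \x lebesgue_measure) \x lebesgue_measure)%E]_(q in box3 r1 r2 0 pi 0 (2 * pi))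
    (q.1.1 ^+ 2 * sin q.1.2 * \sum_i pd i (fun z => w z 0 i) (sph q)).
Proof.
move=> r10 r12 shellA.
have [U [ oU AU HU]] := flux_domain.
pose V : set (R * R * R) := sph @^-1` U.
have oV : open V by apply: open_comp oU => x _; exact: sph_continuous.
have boxA : forall q, box3 r1 r2 0 pi 0 (2 * pi) q -> A (sph q).
  move=> -[[r th] ph] [[/= +] _ _]; rewrite !in_itv /= => hr; apply: shellA.
  by rewrite radius_sph//; apply: le_trans r10 _; case/andP: hr.
have boxV : box3 r1 r2 0 pi 0 (2 * pi) `<=` V by move=> q /boxA; exact: AU.
pose D i j q := pd j (W i) (sph q).
pose w0 i q := W i (sph q).
have dW i y : U y -> differentiable (W i) y by move=> Uy; exact: (Ck_diff (HU i 0%N)).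
have cw q i : V q -> cont q (w0 i).
  move=> Vq; apply: cont_comp_mx; first by move=> k j; exact: cont_sph.
  by apply: differentiable_continuous; exact: dW.
have cD q i j : V q -> cont q (D i j).
  move=> Vq; apply: (cont_comp_mx (f := pd j (W i))); first by move=> k l; exact: cont_sph.
  by apply: differentiable_continuous; exact: ((HU i 1%N).2 j _ Vq).
(* [F1], [F2], [F3] are [r^2 sin(theta)] times the contravariant components of [w] in spherical
   coordinates, and [f1], [f2], [f3] their derivatives in the respective variables. *)
pose F1 q : R := q.1.1 * sin q.1.2 * (w0 0 q * (q.1.1 * sin q.1.2 * cos q.2)
  + w0 1 q * (q.1.1 * sin q.1.2 * sin q.2) + w0 2 q * (q.1.1 * cos q.1.2)).
pose F2 q : R := sin q.1.2 * (w0 0 q * (q.1.1 * cos q.1.2 * cos q.2)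
  + w0 1 q * (q.1.1 * cos q.1.2 * sin q.2) + w0 2 q * (- (q.1.1 * sin q.1.2))).
pose F3 q : R := q.1.1 * (w0 0 q * - sin q.2 + w0 1 q * cos q.2).
pose dr i q : R := sin q.1.2 * cos q.2 * D i 0 q + sin q.1.2 * sin q.2 * D i 1 q + cos q.1.2 * D i 2 q.
pose dt i q : R := q.1.1 * cos q.1.2 * cos q.2 * D i 0 q + q.1.1 * cos q.1.2 * sin q.2 * D i 1 q
  - q.1.1 * sin q.1.2 * D i 2 q.
pose dp i q : R := - (q.1.1 * sin q.1.2 * sin q.2) * D i 0 q + q.1.1 * sin q.1.2 * cos q.2 * D i 1 q.
pose f1 q : R := 2 * q.1.1 * sin q.1.2 * (w0 0 q * (sin q.1.2 * cos q.2)
    + w0 1 q * (sin q.1.2 * sin q.2) + w0 2 q * cos q.1.2)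
  + q.1.1 ^+ 2 * sin q.1.2 * (dr 0 q * (sin q.1.2 * cos q.2)
    + dr 1 q * (sin q.1.2 * sin q.2) + dr 2 q * cos q.1.2).
pose f2 q : R := cos q.1.2 * (w0 0 q * (q.1.1 * cos q.1.2 * cos q.2)
    + w0 1 q * (q.1.1 * cos q.1.2 * sin q.2) + w0 2 q * (- (q.1.1 * sin q.1.2)))
  + sin q.1.2 * (dt 0 q * (q.1.1 * cos q.1.2 * cos q.2)
    + dt 1 q * (q.1.1 * cos q.1.2 * sin q.2) + dt 2 q * (- (q.1.1 * sin q.1.2)))
  - sin q.1.2 * (w0 0 q * (q.1.1 * sin q.1.2 * cos q.2)
    + w0 1 q * (q.1.1 * sin q.1.2 * sin q.2) + w0 2 q * (q.1.1 * cos q.1.2)).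
pose f3 q : R := q.1.1 * (dp 0 q * - sin q.2 + dp 1 q * cos q.2
  - w0 0 q * cos q.2 - w0 1 q * sin q.2).
have F1E q : flux_density q = F1 q.
  by rewrite /flux_density sum3_ring !sphE.
rewrite /sphere_flux; under eq_Rintegral => q _ do rewrite F1E.
under [in X in _ - X]eq_Rintegral => q _ do rewrite F1E.
have W1 i x y z : V (x, y, z) -> is_derive x 1 (fun x => w0 i (x, y, z)) (dr i (x, y, z)).
  move=> Vq; have := @is_derive_curve (W i) (fun x => sph (x, y, z))
    (row3 (sin y * cos z) (sin y * sin z) (cos y)) x _ (dW i _ Vq).
  rewrite sum3_ring !row3E; apply; apply: ord3P => //=.
  - rewrite row3E (_ : (fun _ => _) = fun x => x * sin y * cos z); last by apply/funext => t; rewrite row3E.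
    by apply: is_derive_eq; rewrite ?scaler0 ?add0r ?addr0 /GRing.scale /=; ring.
  - rewrite row3E (_ : (fun _ => _) = fun x => x * sin y * sin z); last by apply/funext => t; rewrite row3E.
    by apply: is_derive_eq; rewrite ?scaler0 ?add0r ?addr0 /GRing.scale /=; ring.
  - rewrite row3E (_ : (fun _ => _) = fun x => x * cos y); last by apply/funext => t; rewrite row3E.
    by apply: is_derive_eq; rewrite ?scaler0 ?add0r ?addr0 /GRing.scale /=; ring.
have W2 i x y z : V (x, y, z) -> is_derive y 1 (fun y => w0 i (x, y, z)) (dt i (x, y, z)).
  move=> Vq; have := @is_derive_curve (W i) (fun y => sph (x, y, z))
    (row3 (x * cos y * cos z) (x * cos y * sin z) (- (x * sin y))) y _ (dW i _ Vq).
  rewrite sum3_ring !row3E mulNr; apply; apply: ord3P => //=.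
  - rewrite row3E (_ : (fun _ => _) = fun y => x * sin y * cos z); last by apply/funext => t; rewrite row3E.
    by apply: is_derive_eq; rewrite ?scaler0 ?add0r ?addr0 /GRing.scale /=; ring.
  - rewrite row3E (_ : (fun _ => _) = fun y => x * sin y * sin z); last by apply/funext => t; rewrite row3E.
    by apply: is_derive_eq; rewrite ?scaler0 ?add0r ?addr0 /GRing.scale /=; ring.
  - rewrite row3E (_ : (fun _ => _) = fun y => x * cos y); last by apply/funext => t; rewrite row3E.
    by apply: is_derive_eq; rewrite ?scaler0 ?add0r ?addr0 /GRing.scale /=; ring.
have W3 i x y z : V (x, y, z) -> is_derive z 1 (fun z => w0 i (x, y, z)) (dp i (x, y, z)).
  move=> Vq; have := @is_derive_curve (W i) (fun z => sph (x, y, z))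
    (row3 (- (x * sin y * sin z)) (x * sin y * cos z) 0) z _ (dW i _ Vq).
  rewrite sum3_ring !row3E mul0r addr0; apply; apply: ord3P => //=.
  - rewrite row3E (_ : (fun _ => _) = fun z => x * sin y * cos z); last by apply/funext => t; rewrite row3E.
    by apply: is_derive_eq; rewrite ?scaler0 ?add0r ?addr0 /GRing.scale /=; ring.
  - rewrite row3E (_ : (fun _ => _) = fun z => x * sin y * sin z); last by apply/funext => t; rewrite row3E.
    by apply: is_derive_eq; rewrite ?scaler0 ?add0r ?addr0 /GRing.scale /=; ring.
  - rewrite row3E (_ : (fun _ => _) = fun z => x * cos y); last by apply/funext => t; rewrite row3E.
    exact: is_derive_cst.
have ct1 := @cont_1 R; have ct2 := @cont_2 R; have ct3 := @cont_3 R.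
transitivity (\int[((lebesgue_measure \x lebesgue_measure) \x lebesgue_measure)%E]_(q in
  box3 r1 r2 0 pi 0 (2 * pi)) (f1 q + f2 q + f3 q)); last first.
  apply: eq_Rintegral => q _; rewrite sum3_ring -!/(W _) -!/(D _ _ q).
  have k0 : sin q.1.2 * sin q.1.2 + cos q.1.2 * cos q.1.2 - 1 = 0 by rewrite -!expr2 [sin _ ^+ 2 + _]addrC cos2Dsin2 subrr.
  have l0 : sin q.2 * sin q.2 + cos q.2 * cos q.2 - 1 = 0 by rewrite -!expr2 [sin _ ^+ 2 + _]addrC cos2Dsin2 subrr.
  move: k0 l0; rewrite /f1 /f2 /f3 /dr /dt /dp /D; clear.
  move: (pd 0 (W 0) _) (pd 1 (W 0) _) (pd 2 (W 0) _) (pd 0 (W 1) _) (pd 1 (W 1) _) (pd 2 (W 1) _)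
    (pd 0 (W 2) _) (pd 1 (W 2) _) (pd 2 (W 2) _) => D00 D01 D02 D10 D11 D12 D20 D21 D22.
  move: (w0 0 q) (w0 1 q) (w0 2 q) q.1.1 (sin q.1.2) (cos q.1.2) (sin q.2) (cos q.2).
  move=> m0 m1 m2 r s c S C k0 l0.
  (* The difference from the Cartesian divergence is made an explicit combination of
     [sin^2 + cos^2 - 1] for the two angles. *)
  transitivity (r ^+ 2 * s * (D00 + D11 + D22)
    + (s * s + c * c - 1) * (r ^+ 2 * s * (C * C * D00 + S * S * D11 + D22 + C * S * (D01 + D10))
      + r * C * m0 + r * S * m1)
    + (S * S + C * C - 1) * (r ^+ 2 * s * (D00 + D11))); first by ring.
  by rewrite k0 l0; ring.
apply/esym; apply: (box_divergence oV boxV r12 (pi_ge0 R) _ (F1 := F1) (F2 := F2) (F3 := F3) (f1 := f1) (f2 := f2) (f3 := f3)).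
- by rewrite mulr_ge0// pi_ge0.
- by move=> q Vq; have cwq i := cw q i Vq; rewrite /F1; cont_poly ltac:(exact: cwq).
- by move=> q Vq; have cwq i := cw q i Vq; have cDq i j := cD q i j Vq; rewrite /f1 /dr; cont_poly ltac:(first [exact: cwq|exact: cDq]).
- by move=> q Vq; have cwq i := cw q i Vq; have cDq i j := cD q i j Vq; rewrite /f2 /dt; cont_poly ltac:(first [exact: cwq|exact: cDq]).
- by move=> q Vq; have cwq i := cw q i Vq; have cDq i j := cD q i j Vq; rewrite /f3 /dp; cont_poly ltac:(first [exact: cwq|exact: cDq]).
- move=> x y z Vq; have V0 := W1 0 _ _ _ Vq; have V1 := W1 1 _ _ _ Vq; have V2 := W1 2 _ _ _ Vq.
  rewrite /F1 /f1 /=; apply: is_derive_eq; rewrite ?scaler0 ?add0r ?addr0 /GRing.scale /=.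
  by clear; move: (w0 0 _) (w0 1 _) (w0 2 _) (dr 0 _) (dr 1 _) (dr 2 _) => *; ring.
- move=> x y z Vq; have V0 := W2 0 _ _ _ Vq; have V1 := W2 1 _ _ _ Vq; have V2 := W2 2 _ _ _ Vq.
  rewrite /F2 /f2 /=; apply: is_derive_eq; rewrite ?scaler0 ?add0r ?addr0 /GRing.scale /=.
  by clear; move: (w0 0 _) (w0 1 _) (w0 2 _) (dt 0 _) (dt 1 _) (dt 2 _) => *; ring.
- move=> x y z Vq; have V0 := W3 0 _ _ _ Vq; have V1 := W3 1 _ _ _ Vq; have V2 := W3 2 _ _ _ Vq.
  rewrite /F3 /f3 /=; apply: is_derive_eq; rewrite ?scaler0 ?add0r ?addr0 /GRing.scale /=.
  by clear; move: (w0 0 _) (w0 1 _) (dp 0 _) (dp 1 _) => *; ring.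
- by move=> x z; rewrite /F2 /= sinpi sin0 !mul0r.
- move=> x y; rewrite /F3 /= [2 * pi]mulrC mulr_natr sin2pi cos2pi sin0 cos0.
  have e : sph (x, y, pi *+ 2) = sph (x, y, 0).
    by apply/rowP; apply: ord3P; rewrite !sphE /= ?sin2pi ?cos2pi ?sin0 ?cos0.
  by rewrite /w0 e.
Qed.
End flux.
End gauss.

(** * Charges as fluxes and as shell averages *)

Section fluxes_of_two_forms.
Context {R : realType} (B : setting R).
Hypotheses (hsub : subextremal B) (hfol : regular_foliation B).
Local Notation sdom := (slice_dom B).
Local Notation rp := (rplus B).
Local Notation leb := (@lebesgue_measure R).

(** On a three-dimensional leaf a two-form is a vector density paired with a cross product; with the
    tangent vectors of the coordinate spheres this cross product is radial, by [sph_cross]. *)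
Lemma lift_vec_flux s (y u v : 'rV[R]_3) (G : 'M[R]_4) : G^T = - G ->
  pair G (lift_vec B s y u) (lift_vec B s y v) =
  dual3 (frame B s y) G 0 0 * (u 0 1 * v 0 2 - u 0 2 * v 0 1)
  + dual3 (frame B s y) G 0 1 * (u 0 2 * v 0 0 - u 0 0 * v 0 2)
  + dual3 (frame B s y) G 0 2 * (u 0 0 * v 0 1 - u 0 1 * v 0 0).
Proof.
move=> aG; rewrite !lift_vecE.
have S3 (f : 'I_3 -> 'rV[R]_4) : \sum_i f i = f 0 + f 1 + f 2.
  by rewrite !big_ord_recr big_ord0 /= add0r; congr (f _ + f _ + f _); apply: val_inj.
rewrite !S3 !row3E.
rewrite !(pairDl, pairDr, pairZl, pairZr).
have z i : pair G (frame B s y i) (frame B s y i) = 0.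
  by apply/eqP; rewrite -[_ == 0](@mulrn_eq0 _ _ 2) mulr2n {1}pair_asym// addrC subrr.
rewrite !z (pair_asym (frame B s y 1) (frame B s y 0) aG) (pair_asym (frame B s y 2) (frame B s y 1) aG)
  (pair_asym (frame B s y 0) (frame B s y 2) aG).
by clear; move: (pair G _ _) (pair G _ _) (pair G _ _) => x1 x2 x3; ring.
Qed.

Lemma sph_cross (q : R * R * R) (d : 'rV[R]_3) :
  d 0 0 * (sph_th q 0 1 * sph_ph q 0 2 - sph_th q 0 2 * sph_ph q 0 1)
  + d 0 1 * (sph_th q 0 2 * sph_ph q 0 0 - sph_th q 0 0 * sph_ph q 0 2)
  + d 0 2 * (sph_th q 0 0 * sph_ph q 0 1 - sph_th q 0 1 * sph_ph q 0 0)
  = q.1.1 * sin q.1.2 * \sum_i d 0 i * sph q 0 i.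
Proof.
rewrite sum3_ring !sphE; case: q => -[r th] ph; rewrite /sph_th /sph_ph !row3E /=.
have l0 : sin ph * sin ph + cos ph * cos ph - 1 = 0.
  by rewrite -!expr2 [sin _ ^+ 2 + _]addrC cos2Dsin2 subrr.
move: l0; clear; move: (d 0 0) (d 0 1) (d 0 2) (sin th) (cos th) (sin ph) (cos ph).
move=> d0 d1 d2 s c S C l0.
transitivity (r * s * (d0 * (r * s * C) + d1 * (r * s * S) + d2 * (r * c))
  + (S * S + C * C - 1) * (d2 * r ^+ 2 * s * c)); first by ring.
by rewrite l0; ring.
Qed.

Lemma sphere_boxE : [set q : R * R | 0 <= q.1 <= pi /\ 0 <= q.2 <= 2 * pi] = box2 0 pi 0 (2 * pi).
Proof. by apply/seteqP; split=> -[x y] []; rewrite /= ?in_itv. Qed.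

Lemma fluxE s (G : 'rV[R]_3 -> 'M[R]_4) r : 0 <= r -> (forall y, radius y = r -> (G y)^T = - G y) ->
  flux B s G r = sphere_flux (fun y => dual3 (frame B s y) (G y)) r.
Proof.
move=> r0 aG; rewrite /flux sphere_boxE; apply: eq_Rintegral => q _.
by rewrite lift_vec_flux ?sph_cross// aG// radius_sph.
Qed.

Lemma eq_sphere_flux (w w' : 'rV[R]_3 -> 'rV[R]_3) r : 0 <= r ->
  (forall y, radius y = r -> w y = w' y) -> sphere_flux w r = sphere_flux w' r.
Proof.
move=> r0 ww; apply: eq_Rintegral => q _; rewrite /flux_density; congr (_ * _).
by apply: eq_bigr => i _; rewrite ww// radius_sph.
Qed.

Lemma rp_ge0 : 0 <= rp. Proof. exact: ltW (rplus_gt0 hsub). Qed.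

Lemma sphere_flux_const w r : smooth_mx_near sdom w ->
  (forall y, sdom y -> \sum_i pd i (fun z => w z 0 i) y = 0) -> rp <= r ->
  sphere_flux w r = sphere_flux w rp.
Proof.
move=> sw dw rr; apply/eqP; rewrite -subr_eq0; apply/eqP.
rewrite (flux_diff sw rp_ge0 rr); last by move=> y /andP[].
rewrite (@eq_Rintegral _ _ _ _ _ (cst 0)); first by rewrite /Rintegral integral0.
move=> q; rewrite inE => -[[/=]]; rewrite !in_itv /= => /andP[h _] _ _.
rewrite dw ?mulr0//; case: q h => -[x y] z /= h.
by rewrite /slice_dom /= radius_sph// (le_trans rp_ge0).
Qed.

Definition shell_box : set (R * R * R) := box3 rp (rp + 1) 0 pi 0 (2 * pi).

Lemma sdom_shell q : shell_box q -> sdom (sph q).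
Proof.
move=> [[/=]]; rewrite !in_itv /= => /andP[h _] _ _; case: q h => -[x y] z /= h.
by rewrite /slice_dom /= radius_sph// (le_trans rp_ge0).
Qed.

Definition sdom_smooth_r : smooth_near sdom (@radius R).
Proof.
apply: smooth_near_sqrt; last first.
  by apply: smooth_near_sum => i; apply: smooth_nearX; exact: smooth_near_coord.
move=> y ys; have : 0 < radius y by exact: lt_le_trans (rplus_gt0 hsub) ys.
by rewrite /radius sqrtr_gt0.
Qed.

Lemma pd_radius (y : 'rV[R]_3) i : sdom y -> pd i (@radius R) y = y 0 i / radius y.
Proof.
move=> ys; have r0 : 0 < radius y by exact: lt_le_trans (rplus_gt0 hsub) ys.
have s0 : 0 < \sum_j y 0 j ^+ 2 by move: r0; rewrite /radius sqrtr_gt0.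
have D j : differentiable (fun z : 'rV[R]_3 => z 0 j) y by exact: differentiable_coord.
have E : pd i (fun z : 'rV[R]_3 => \sum_j z 0 j ^+ 2) y = 2 * y 0 i.
  rewrite (_ : (fun _ => _) = fun z : 'rV[R]_3 => z 0 0 * z 0 0 + z 0 1 * z 0 1 + z 0 2 * z 0 2); last first.
    by apply/funext => z; rewrite sum3_ring !expr2.
  have DM j : differentiable (fun z : 'rV[R]_3 => z 0 j * z 0 j) y by exact: differentiableM.
  rewrite !pdD//; last by apply: differentiableD.
  rewrite !pdM// !pd_coord; move: i; apply: ord3P; rewrite /= ?(mulr1, mul1r, mulr0, mul0r, addr0, add0r);
    by rewrite mulr_natl mulr2n.
rewrite /radius pd_sqrt//; last first.
  rewrite (_ : (fun _ => _) = fun z : 'rV[R]_3 => z 0 0 * z 0 0 + z 0 1 * z 0 1 + z 0 2 * z 0 2); last first.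
    by apply/funext => z; rewrite sum3_ring !expr2.
  by apply: differentiableD; [apply: differentiableD|]; apply: differentiableM.
rewrite E -!/(radius _); move: r0; move: (radius y) (y 0 i) => r x r0.
by field; rewrite gt_eqF.
Qed.

(* The flux of (radius - r_+) w through the unit shell: its divergence is the
   radial component of w. *)
Lemma mean_flux w : smooth_mx_near sdom w ->
  (forall y, sdom y -> \sum_i pd i (fun z => w z 0 i) y = 0) ->
  sphere_flux w rp = \int[((leb \x leb) \x leb)%E]_(q in shell_box) flux_density w q.
Proof.
move=> sw dw; pose w' y := (radius y - rp) *: w y.
have sw' : smooth_mx_near sdom w'.
  apply: smooth_mxZ => //; apply: smooth_nearB; first exact: sdom_smooth_r.
  exact: smooth_near_cst.
have rr : rp <= rp + 1 by rewrite lerDl.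
have := flux_diff sw' rp_ge0 rr; rewrite -/shell_box.
rewrite (@eq_sphere_flux w' w (rp + 1)); [|by rewrite addr_ge0 ?rp_ge0|]; last first.
  by move=> y ry; rewrite /w' ry [rp + 1]addrC addrK scale1r.
rewrite (@eq_sphere_flux w' (fun=> 0) rp) ?rp_ge0//; last first.
  by move=> y ry; rewrite /w' ry subrr scale0r.
rewrite (sphere_flux_const sw dw rr).
have z0 : sphere_flux (fun=> 0) rp = 0 :> R.
  rewrite /sphere_flux (@eq_Rintegral _ _ _ _ _ (cst 0)) ?/Rintegral ?integral0//.
  by move=> q _; rewrite /flux_density big1 ?mulr0// => i _; rewrite mxE mul0r.
rewrite z0 subr0 => -> //; last by move=> y /andP[].
apply: eq_Rintegral => q; rewrite inE => qs; have ys := sdom_shell qs.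
have -> : \sum_i pd i (fun z => w' z 0 i) (sph q) = (radius (sph q))^-1 * \sum_i w (sph q) 0 i * sph q 0 i.
  transitivity ((radius (sph q))^-1 * (\sum_i w (sph q) 0 i * sph q 0 i)
    + (radius (sph q) - rp) * \sum_i pd i (fun z => w z 0 i) (sph q)); last by rewrite dw// mulr0 addr0.
  rewrite !mulr_sumr -big_split /=; apply: eq_bigr => i _.
  rewrite (_ : (fun z => w' z 0 i) = fun z => (radius z - rp) * w z 0 i); last first.
    by apply/funext => z; rewrite scaleE.
  have Dr : differentiable (@radius R) (sph q) by exact: smooth_near_diff sdom_smooth_r ys.
  rewrite pdM; [|by apply: differentiableB|exact: smooth_near_diff (sw 0 i) ys].
  rewrite pdB// pd_cst subr0 pd_radius//; congr (_ + _).
  by move: (w _ _ _) (sph q 0 i) (radius _)^-1 => x1 x2 x3; ring.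
rewrite /flux_density; case: q ys qs => -[x y] z /= ys [[/=]]; rewrite !in_itv /= => /andP[h _] _ _.
have x0 : 0 < x by exact: lt_le_trans (rplus_gt0 hsub) h.
by rewrite radius_sph ?ltW// expr2; move: (\sum_i _) => S; field; rewrite gt_eqF.
Qed.

Lemma smooth_ind_metric s : smooth_mx_near sdom (ind_metric B s).
Proof.
move=> i j; apply: (smooth_near_ext (f := fun y => pair (kn_metric B (emb B s y)) (frame B s y i) (frame B s y j))).
  by move=> y; rewrite mxE.
apply: smooth_pair; [|exact: smooth_frame|exact: smooth_frame].
apply: smooth_mx_at_emb => //; exact: smooth_kn_ext.
Qed.

Lemma det_ind_metric_gt0 s y : sdom y -> 0 < \det (ind_metric B s y).
Proof. by move=> ys; have := vol_density_gt0 hsub hfol s ys; rewrite /vol_density sqrtr_gt0. Qed.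

Lemma smooth_vol_density s : smooth_near sdom (vol_density B s).
Proof.
apply: smooth_near_sqrt; first by move=> y ys; exact: det_ind_metric_gt0.
exact: smooth_det (smooth_ind_metric s).
Qed.

Lemma smooth_inv_ind_metric s : smooth_mx_near sdom (fun y => invmx (ind_metric B s y)).
Proof.
apply: smooth_invmx (smooth_ind_metric s) => y ys.
by rewrite gt_eqF// det_ind_metric_gt0.
Qed.

(** The vector density of a one-form: in these terms the Riemannian divergence becomes the
    coordinate divergence, and the divergence theorem of flat space applies. *)
Definition densitized s (e : 'rV[R]_3 -> 'rV[R]_3) y : 'rV[R]_3 :=
  vol_density B s y *: (e y *m invmx (ind_metric B s y)).

Lemma smooth_densitized s e : smooth_mx_near sdom e -> smooth_mx_near sdom (densitized s e).
Proof.
move=> se; apply: smooth_mxZ; first exact: smooth_vol_density.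
by apply: smooth_mxM => //; exact: smooth_inv_ind_metric.
Qed.

Lemma div_densitized s e y : sdom y -> divergence B s e y = 0 ->
  \sum_i pd i (fun z => densitized s e z 0 i) y = 0.
Proof.
move=> ys /eqP; rewrite /divergence mulf_eq0 invr_eq0 gt_eqF ?vol_density_gt0//= => /eqP d0.
rewrite -[RHS]d0; apply: eq_bigr => i _; congr (pd i _ y).
by apply/funext => z; rewrite scaleE.
Qed.

Definition mean_charge s e : R :=
  (4 * pi)^-1 * \int[((leb \x leb) \x leb)%E]_(q in shell_box) flux_density (densitized s e) q.

(** Stated for any two-form whose pull-back is the density of [e], it serves the magnetic charge
    with [G] itself and the electric charge with its dual. The limit over radii is that of an
    eventually constant function. *)
Lemma charge_dual3 s G e : (forall y, sdom y -> (G y)^T = - G y) ->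
  (forall y, sdom y -> dual3 (frame B s y) (G y) = densitized s e y) ->
  smooth_mx_near sdom e -> (forall y, sdom y -> divergence B s e y = 0) ->
  chargeB B s G = mean_charge s e.
Proof.
move=> aG GE se de; rewrite /chargeB /mean_charge; congr (_ * _).
have sd := smooth_densitized s se.
have dd y : sdom y -> \sum_i pd i (fun z => densitized s e z 0 i) y = 0.
  by move=> ys; apply: div_densitized => //; exact: de.
rewrite -(mean_flux sd dd); apply/cvg_lim => //.
apply: cvg_near_cst; near=> r.
have rr : rp <= r by near: r; apply: nbhs_pinfty_ge; exact: num_real.
have r0 := le_trans rp_ge0 rr.
have rs y : radius y = r -> sdom y by rewrite /slice_dom /= => ->.
rewrite fluxE// => [|y /rs]; last exact: aG.
rewrite (@eq_sphere_flux _ (densitized s e))//; first exact: sphere_flux_const.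
by move=> y /rs; exact: GE.
Unshelve. all: by end_near. Qed.

Lemma chargeB_data U : smooth_data B U -> chargeB B 0 (field_of B 0 U) = mean_charge 0 U.2.
Proof.
move=> [sE sB dU].
have aG y : sdom y -> (field_of B 0 U y)^T = - field_of B 0 U y by move=> ys; exact: (field_of_tr hsub 0 ys U).
apply: charge_dual3 => // y ys; last by have [] := dU y ys.
by rewrite (dual3_data hsub hfol 0 ys (aG y ys)) /densitized (data_of_field_of hsub hfol 0 ys U).2.
Qed.

Lemma chargeE_data U : smooth_data B U -> chargeE B 0 (field_of B 0 U) = mean_charge 0 U.1.
Proof.
move=> [sE sB dU]; rewrite /chargeE.
have aG y : sdom y -> (field_of B 0 U y)^T = - field_of B 0 U y by move=> ys; exact: (field_of_tr hsub 0 ys U).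
apply: charge_dual3 => // y ys.
- have Ap : away (emb B 0 y) by exact: ext_away (ext_emb 0 ys).
  by apply: star_tr; [exact: kn_sym|exact: kn_det_lt0|exact: aG].
- by rewrite (dual3_star_data hsub hfol 0 ys (aG y ys)) /densitized (data_of_field_of hsub hfol 0 ys U).1.
- by have [] := dU y ys.
Qed.

End fluxes_of_two_forms.

(** * Algebras of functions containing the tensor components *)

Section function_algebra.
Context {R : realType} (B : setting R) {T : Type}.
Hypotheses (hsub : subextremal B) (hfol : regular_foliation B).
Variables (P : (T -> R) -> Prop) (y : T -> 'rV[R]_3).
Hypotheses (P_cst : forall c, P (fun=> c)) (P_add : forall f g, P f -> P g -> P (fun q => f q + g q)).
Hypothesis P_mul : forall f g, P f -> P g -> P (fun q => f q * g q).
Hypothesis P_smooth : forall f, smooth_near (slice_dom B) f -> P (fun q => f (y q)).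

Lemma P_ext f g : f =1 g -> P f -> P g. Proof. by move=> /funext ->. Qed.

Lemma P_opp f : P f -> P (fun q => - f q).
Proof. by move=> Pf; apply: P_ext (P_mul (P_cst (-1)) Pf) => q; rewrite mulN1r. Qed.

Lemma P_sum (I : Type) (s : seq I) (F : I -> T -> R) :
  (forall i, P (F i)) -> P (fun q => \sum_(i <- s) F i q).
Proof.
move=> PF; elim: s => [|i s IH]; first by apply: P_ext (P_cst 0) => q; rewrite big_nil.
by apply: P_ext (P_add (PF i) IH) => q; rewrite big_cons.
Qed.

(** One closure argument serves several classes [P]: functions continuous at a point, functions
    measurable on the exterior and, for the purely algebraic part, functions bounded far out.
    Inverses and square roots are not algebra operations; for the metric they enter as smooth
    functions of the base point. *)
Definition Pmx k l (F : T -> 'M[R]_(k, l)) := forall i j, P (fun q => F q i j).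

Lemma PmxD k l (F G : T -> 'M[R]_(k, l)) : Pmx F -> Pmx G -> Pmx (fun q => F q + G q).
Proof. by move=> PF PG i j; apply: P_ext (P_add (PF i j) (PG i j)) => q; rewrite [RHS]mxE. Qed.
Lemma PmxZ k l f (F : T -> 'M[R]_(k, l)) : P f -> Pmx F -> Pmx (fun q => f q *: F q).
Proof. by move=> Pf PF i j; apply: P_ext (P_mul Pf (PF i j)) => q; rewrite [RHS]mxE. Qed.
Lemma PmxN k l (F : T -> 'M[R]_(k, l)) : Pmx F -> Pmx (fun q => - F q).
Proof. by move=> PF i j; apply: P_ext (P_opp (PF i j)) => q; rewrite [RHS]mxE. Qed.
Lemma PmxB k l (F G : T -> 'M[R]_(k, l)) : Pmx F -> Pmx G -> Pmx (fun q => F q - G q).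
Proof. by move=> PF PG; apply: PmxD => //; exact: PmxN. Qed.
Lemma PmxT k l (F : T -> 'M[R]_(k, l)) : Pmx F -> Pmx (fun q => (F q)^T).
Proof. by move=> PF i j; apply: P_ext (PF j i) => q; rewrite [RHS]mxE. Qed.
Lemma PmxM k l m (F : T -> 'M[R]_(k, l)) (G : T -> 'M[R]_(l, m)) : Pmx F -> Pmx G ->
  Pmx (fun q => F q *m G q).
Proof.
move=> PF PG i j; apply: (P_ext (f := fun q => \sum_k F q i k * G q k j)).
  by move=> q; rewrite [RHS]mxE.
by apply: P_sum => c; exact: P_mul.
Qed.
Lemma P_pair g u v : Pmx g -> Pmx u -> Pmx v -> P (fun q => pair (g q) (u q) (v q)).
Proof. by move=> Pg Pu Pv; apply: PmxM; [exact: PmxM|exact: PmxT]. Qed.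
Lemma P_tr k (F : T -> 'M[R]_k) : Pmx F -> P (fun q => \tr (F q)).
Proof. by move=> PF; apply: P_sum => i; exact: PF. Qed.
Lemma P_stress g G : Pmx g -> Pmx (fun q => invmx (g q)) -> Pmx G -> Pmx (fun q => stress (g q) (G q)).
Proof.
move=> Pg Pi PG.
have P1 : Pmx (fun q => G q *m invmx (g q) *m (G q)^T) by apply: PmxM; [exact: PmxM|exact: PmxT].
apply: PmxB => //; apply: PmxZ => //; apply: P_mul => //; apply: P_tr; exact: PmxM.
Qed.
Lemma P_hat F : Pmx F -> Pmx (fun q => hat (F q)).
Proof.
move=> PF i j; apply: (P_ext (f := fun q => 2^-1 * \sum_k \sum_l levi_civita i j k l * F q k l)).
  by move=> q; rewrite [RHS]mxE.
by apply: P_mul => //; apply: P_sum => k; apply: P_sum => l; apply: P_mul.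
Qed.

Lemma P_smooth_mx k l (F : 'rV[R]_3 -> 'M[R]_(k, l)) : smooth_mx_near (slice_dom B) F ->
  Pmx (fun q => F (y q)).
Proof. by move=> sF i j; exact: (P_smooth (sF i j)). Qed.

Variable s : R.
Local Notation em := (fun q => emb B s (y q)).

Lemma P_kn : Pmx (fun q => kn_metric B (em q)).
Proof. exact: P_smooth_mx (smooth_mx_at_emb hfol s (smooth_kn_ext hsub)). Qed.
Lemma P_inv_kn : Pmx (fun q => invmx (kn_metric B (em q))).
Proof. exact: P_smooth_mx (smooth_mx_at_emb hfol s (smooth_inv_kn hsub)). Qed.
Lemma P_normal : Pmx (fun q => normal B (em q)).
Proof. exact: P_smooth_mx (smooth_mx_at_emb hfol s (smooth_normal hsub hfol)). Qed.
Lemma P_frame i : Pmx (fun q => frame B s (y q) i).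
Proof. exact: P_smooth_mx (smooth_frame hfol s i). Qed.
Lemma P_star G : Pmx G -> Pmx (fun q => star (kn_metric B (em q)) (G q)).
Proof.
move=> PG.
have -> : (fun q => star (kn_metric B (em q)) (G q)) =
  fun q => Num.sqrt (- \det (kn_metric B (em q))) *: hat (invmx (kn_metric B (em q)) *m G q *m invmx (kn_metric B (em q))).
  by apply/funext => q; rewrite starE.
apply: PmxZ; last first.
  by apply: P_hat; apply: PmxM; [apply: PmxM|]; [exact: P_inv_kn|exact: PG|exact: P_inv_kn].
apply: (P_smooth (f := fun y => Num.sqrt (- \det (kn_metric B (emb B s y))))).
have sk := smooth_mx_at_emb hfol s (smooth_kn_ext hsub).
apply: smooth_near_sqrt; last by apply: smooth_nearN; exact: smooth_det.
move=> z zs; rewrite oppr_gt0; apply: kn_det_lt0; exact: (ext_away hsub (ext_emb s zs)).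
Qed.

Lemma P_dual3 G : Pmx G -> Pmx (fun q => dual3 (frame B s (y q)) (G q)).
Proof.
move=> PG i; rewrite (ord1 i); have H a b := P_pair PG (P_frame a) (P_frame b).
apply: ord3P.
- by apply: P_ext (H 1 2) => q; rewrite row3E.
- by apply: P_ext (H 2 0) => q; rewrite row3E.
- by apply: P_ext (H 0 1) => q; rewrite row3E.
Qed.

Lemma P_field_of (U : data R) : Pmx (fun q => U.1 (y q)) -> Pmx (fun q => U.2 (y q)) ->
  Pmx (fun q => field_of B s U (y q)).
Proof.
move=> P1 P2; rewrite /field_of.
have Pn : Pmx (fun q => normal B (em q) *m kn_metric B (em q)) by apply: PmxM; [exact: P_normal|exact: P_kn].
have Pw u v : Pmx u -> Pmx v -> Pmx (fun q => wedge (u q) (v q)).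
  by move=> Pu Pv; apply: PmxB; (apply: PmxM; [exact: PmxT|]).
have Pe e : Pmx (fun q => e (y q)) -> Pmx (fun q => ext_cov B s (y q) (e (y q))).
  move=> Pe; apply: PmxD; last first.
    apply: PmxZ => //; apply: P_sum => i; apply: P_mul; first exact: Pe.
    exact: P_normal.
  move=> i j; rewrite (ord1 i); have [k ->|->] := unliftP ord0 j.
    by apply: P_ext (Pe 0 k) => q; rewrite mxE liftK.
  by apply: P_ext (P_cst 0) => q; rewrite mxE unlift_none.
by apply: PmxD; [|apply: P_star]; apply: Pw => //; exact: Pe.
Qed.

Hypothesis hmult : redshift_multiplier B.

Lemma P_mult : Pmx (fun q => mult B (em q)).
Proof. by have [sm _ _ _] := hmult; exact: P_smooth_mx (smooth_mx_at_emb hfol s sm). Qed.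

Lemma P_energy G : Pmx G ->
  P (fun q => pair (stress (kn_metric B (em q)) (G q)) (mult B (em q)) (normal B (em q))).
Proof.
move=> PG; apply: P_pair; [|exact: P_mult|exact: P_normal].
by apply: P_stress => //; [exact: P_kn|exact: P_inv_kn].
Qed.

End function_algebra.

(** * Measurability on the exterior in spherical coordinates *)

Section exterior_measurability.
Context {R : realType} (B : setting R).
Hypotheses (hsub : subextremal B).
Local Notation sdom := (slice_dom B).

Lemma sph_dom_prod (K : set R) : sph_dom K = (K `*` `[0, pi]%classic) `*` `[0, 2 * pi]%classic.
Proof.
apply/seteqP; split=> -[[x y] z].
  by move=> [/= Kx hy hz]; split; [split|]; rewrite //= in_itv.
by move=> [[/= Kx hy] hz]; split=> //=; rewrite ?in_itv in hy hz *.
Qed.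

Lemma sph_dom_measurable (K : set R) : measurable K -> measurable (sph_dom K).
Proof.
move=> mK; rewrite sph_dom_prod; apply: measurableX; last exact: measurable_itv.
by apply: measurableX => //; exact: measurable_itv.
Qed.

Lemma ext_sph_measurable : measurable (ext_sph B).
Proof.
apply: sph_dom_measurable.
by rewrite (_ : [set r | _] = `[rplus B, +oo[%classic) //; apply/seteqP; split=> r /=; rewrite in_itv /= andbT.
Qed.

Lemma sdom_ext_sph q : ext_sph B q -> sdom (sph q).
Proof.
case: q => -[x y] z [/= h _ _]; rewrite /slice_dom /= radius_sph//.
exact: le_trans (ltW (rplus_gt0 hsub)) h.
Qed.

Lemma smooth_measurable f : smooth_near sdom f -> measurable_fun (ext_sph B) (fun q => f (sph q)).
Proof.
move=> /smooth_nearP[U [opU AU HU]].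
apply: (continuous_on_measurable3 (U := sph @^-1` U)).
- by apply: open_comp opU => x _; exact: sph_continuous.
- by move=> q /sdom_ext_sph; exact: AU.
- exact: ext_sph_measurable.
- move=> q Uq; apply: cont_comp_mx; first by move=> k j; exact: cont_sph.
  by apply: differentiable_continuous; exact: (HU 0%N).
Qed.

Lemma smooth_cont_sph f q : smooth_near sdom f -> sdom (sph q) -> cont q (fun q => f (sph q)).
Proof.
move=> sf qs; apply: cont_comp_mx; first by move=> k j; exact: cont_sph.
exact: smooth_near_cont sf qs.
Qed.

End exterior_measurability.

(** * Positivity of the energy density *)

Section energy_positivity.
Context {R : realType} (B : setting R).
Hypotheses (hsub : subextremal B) (hfol : regular_foliation B) (hmult : redshift_multiplier B).
Local Notation sdom := (slice_dom B).

Definition energy_density s (y : 'rV[R]_3) (G : 'M[R]_4) : R :=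
  pair (stress (kn_metric B (emb B s y)) G) (mult B (emb B s y)) (normal B (emb B s y)).

(** [dt~] provides the common time orientation: it is timelike because [2 M r - Q^2] is nonnegative
    on the exterior, and it is positive on both the multiplier and the normal. *)
Lemma energy_density_gt0 s y G : sdom y -> G^T = - G -> G != 0 -> 0 < energy_density s y G.
Proof.
move=> ys aG G0; have ep := ext_emb s ys; have Ap := ext_away hsub ep.
have [_ /(_ _ ep)[N1 N0] _ _] := hmult.
have [_ _ _ /(_ _ ep)[ot od] _] := hfol.
apply: (energy_condition (om := cov_dt) (kn_lorentzian B Ap) (normal_unit hsub hfol s ys) N1) => //.
- apply: kn_dt_timelike => //; exact: (kerr_schild_ge0 hsub ep).
- have -> : (cov_dt *m (normal B (emb B s y))^T) 0 0 = (normal B (emb B s y) *m cov_dt^T) 0 0.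
    rewrite [LHS]mxE [RHS]mxE; apply: eq_bigr => i _.
    by rewrite [X in _ * X]mxE [X in _ = _ * X]mxE mulrC.
  rewrite /normal -scalemxAl scaleE mulNr oppr_gt0 pmulr_rlt0//.
  by rewrite invr_gt0 sqrtr_gt0 oppr_gt0.
- have -> : (cov_dt *m (mult B (emb B s y))^T) 0 0 = mult B (emb B s y) 0 0; last by [].
  by rewrite [LHS]mxE sum4 cov_dtE !row4E !mul0r !addr0 mul1r mxE.
Qed.

Lemma energy_density_ge0 s y G : sdom y -> G^T = - G -> 0 <= energy_density s y G.
Proof.
move=> ys aG; have [->|G0] := eqVneq G 0; last exact/ltW/energy_density_gt0.
by rewrite /energy_density /stress !mul0mx mxtrace0 mulr0 scale0r subrr /pair mulmx0 mul0mx mxE.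
Qed.

Lemma energy_densityZ s y c G : energy_density s y (c *: G) = c ^+ 2 * energy_density s y G.
Proof.
rewrite /energy_density -pairZ; congr (pair _ _ _); rewrite /stress.
set g := kn_metric _ _.
have -> : (c *: G) *m invmx g *m (c *: G)^T = c ^+ 2 *: (G *m invmx g *m G^T).
  by rewrite trmxZ -scalemxAl -scalemxAl -scalemxAr scalerA expr2.
by rewrite -scalemxAl mxtraceZ scalerBr scalerA mulrCA.
Qed.

End energy_positivity.

(** * Bounding fluxes by the energy *)

Section charge_bound.
Context {R : realType} (B : setting R).
Hypotheses (hsub : subextremal B) (hfol : regular_foliation B) (hmult : redshift_multiplier B).
Local Notation sdom := (slice_dom B).
Local Notation rp := (rplus B).
Local Notation leb := (@lebesgue_measure R).

(** Two-forms parametrised by a normed space of dimension six, so that those of unit norm form a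
    compact set. *)
Definition form6 (v : 'rV[R]_6) : 'M[R]_4 :=
  asym4 (v 0 0) (v 0 1) (v 0 2) (v 0 3) (v 0 4) (v 0 5).

Lemma form6Z c v : form6 (c *: v) = c *: form6 v.
Proof. by rewrite /form6 asym4Z !scaleE. Qed.

Lemma form6_tr v : (form6 v)^T = - form6 v. Proof. exact: asym4_tr. Qed.

Lemma ord6P (S : 'I_6 -> Prop) : S 0 -> S 1 -> S 2 -> S 3 -> S 4 -> S 5 -> forall i, S i.
Proof.
move=> h0 h1 h2 h3 h4 h5 [[|[|[|[|[|[|//]]]]]] lt].
- by rewrite (_ : Ordinal lt = 0)//; exact: val_inj.
- by rewrite (_ : Ordinal lt = 1)//; exact: val_inj.
- by rewrite (_ : Ordinal lt = 2)//; exact: val_inj.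
- by rewrite (_ : Ordinal lt = 3)//; exact: val_inj.
- by rewrite (_ : Ordinal lt = 4)//; exact: val_inj.
- by rewrite (_ : Ordinal lt = 5)//; exact: val_inj.
Qed.

Lemma form6_eq0 v : form6 v = 0 -> v = 0.
Proof.
move=> v0; have E i j : form6 v i j = 0 by rewrite v0 mxE.
apply/rowP => i; rewrite [RHS]mxE; move: i; apply: ord6P.
- by rewrite -(E 0 1) mxE.
- by rewrite -(E 0 2) mxE.
- by rewrite -(E 0 3) mxE.
- by rewrite -(E 1 2) mxE.
- by rewrite -(E 1 3) mxE.
- by rewrite -(E 2 3) mxE.
Qed.

Lemma form6_surj (G : 'M[R]_4) : G^T = - G -> exists v, G = form6 v.
Proof.
move=> aG; exists (\row_i [:: G 0 1; G 0 2; G 0 3; G 1 2; G 1 3; G 2 3]`_i).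
by rewrite {1}(asym4E aG) /form6 !mxE.
Qed.

Definition radial_flux s (G : 'M[R]_4) (y : 'rV[R]_3) : R :=
  \sum_i dual3 (frame B s y) G 0 i * y 0 i.

Lemma dual3Z s y c (G : 'M[R]_4) : dual3 (frame B s y) (c *: G) = c *: dual3 (frame B s y) G.
Proof. by apply/rowP; apply: ord3P; rewrite scaleE !row3E pairZ. Qed.

Lemma radial_fluxZ s c G y : radial_flux s (c *: G) y = c * radial_flux s G y.
Proof.
rewrite /radial_flux mulr_sumr; apply: eq_bigr => i _.
by rewrite dual3Z scaleE mulrA.
Qed.

Lemma sphere_compact n : compact [set v : 'rV[R]_n.+1 | `|v| = 1].
Proof.
apply: bounded_closed_compact.
  by exists 1; split; [exact: num_real|move=> x x1 v /= ->; exact: ltW].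
rewrite (_ : [set v | _] = (fun v : 'rV[R]_n.+1 => `|v|) @^-1` [set 1])//.
by apply: preimage_closed; [move=> v _; exact: norm_continuous|exact: closed_eq].
Qed.

(** The unit two-forms over the shell of radii between [r_+] and [r_+ + 1], a compact space on which
    the energy density is continuous and positive. *)
Definition KS : set ((R * R * R) * 'rV[R]_6) := shell_box B `*` [set v | `|v| = 1].

Lemma KS_compact : compact KS.
Proof. by apply: compact_setX; [exact: box3_compact|exact: sphere_compact]. Qed.

Section at_point.
Variables (s : R) (x : (R * R * R) * 'rV[R]_6).
Hypothesis xK : KS x.
Let P := @cont R _ x.
Let y (x : (R * R * R) * 'rV[R]_6) := sph x.1.

Let P_smooth f : smooth_near sdom f -> P (fun q => f (y q)).
Proof.
move=> sf; apply: (continuous_comp (f := fst) (g := fun q => f (sph q))); first exact: cvg_fst.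
apply: smooth_cont_sph sf _; case: xK => h _; exact: (sdom_shell hsub h).
Qed.

Let P_form6 : Pmx P (fun q => form6 q.2).
Proof.
have c i : P (fun q => q.2 0 i).
  apply: (continuous_comp (f := snd) (g := fun v : 'rV[R]_6 => v 0 i)); first exact: cvg_snd.
  exact: coord_continuous.
have c0 : P (fun q => 0) by exact: cont_cst.
move=> i j; rewrite (_ : (fun q => form6 q.2 i j) = fun q => (nth [::] [:: [:: 0; q.2 0 0; q.2 0 1; q.2 0 2];
  [:: - q.2 0 0; 0; q.2 0 3; q.2 0 4]; [:: - q.2 0 1; - q.2 0 3; 0; q.2 0 5];
  [:: - q.2 0 2; - q.2 0 4; - q.2 0 5; 0]] i)`_j); last by apply/funext => q; rewrite [LHS]mxE.
by move: i j; apply: ord4P; apply: ord4P => //=; try exact: c; apply: contN; exact: c.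
Qed.

Lemma cont_energy6 : cont x (fun q => energy_density B s (sph q.1) (form6 q.2)).
Proof.
exact: (P_energy hsub hfol (P := P) (@cont_cst _ _ ^~ x) (fun f g => @contD _ _ f g x)
  (fun f g => @contM _ _ f g x) P_smooth s hmult P_form6).
Qed.

Lemma cont_vol6 : cont x (fun q => vol_density B s (sph q.1)).
Proof. exact: (P_smooth (smooth_vol_density hsub hfol s)). Qed.

Let cont_rad (G : (R * R * R) * 'rV[R]_6 -> 'M[R]_4) : Pmx P G -> cont x (fun q => radial_flux s (G q) (sph q.1)).
Proof.
move=> PG; apply: cont_sum => i; apply: contM; last by exact: (P_smooth (smooth_near_coord _ i)).
exact: (P_dual3 (P := P) hfol (@cont_cst _ _ ^~ x) (fun f g => @contD _ _ f g x)
  (fun f g => @contM _ _ f g x) P_smooth s PG).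
Qed.

Lemma cont_radial6 : cont x (fun q => radial_flux s (form6 q.2) (sph q.1)).
Proof. exact: cont_rad. Qed.

Lemma cont_radial_star6 :
  cont x (fun q => radial_flux s (star (kn_metric B (emb B s (sph q.1))) (form6 q.2)) (sph q.1)).
Proof.
apply: cont_rad; exact: (P_star hsub hfol (P := P) (@cont_cst _ _ ^~ x) (fun f g => @contD _ _ f g x)
  (fun f g => @contM _ _ f g x) P_smooth s P_form6).
Qed.
End at_point.

(** A bound by the root of the energy, written with a free parameter: the right side is affine in
    the energy density, so it can be integrated term by term, and choosing [e] at the end replaces
    the Cauchy-Schwarz inequality. *)
Definition radial_bound (D : 'M[R]_4 -> 'rV[R]_3 -> R) C := forall q G e,
  shell_box B q -> G^T = - G -> 0 < e ->
  `|D G (sph q)| <= C * (e + e^-1 * (vol_density B 0 (sph q) * energy_density B 0 (sph q) G)).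

(** On unit two-forms [D] is bounded above and the weighted energy below, by compactness.
    Homogeneity, of degree 1 for [D] and of degree 2 for the energy, extends the comparison to all
    two-forms. *)
Lemma radial_bound_exists (D : 'M[R]_4 -> 'rV[R]_3 -> R) :
  (forall c G y, D (c *: G) y = c * D G y) ->
  (forall x, KS x -> cont x (fun q => D (form6 q.2) (sph q.1))) ->
  exists2 C, 0 <= C & radial_bound D C.
Proof.
move=> DZ cD.
have [C1 C10 HC1] := continuous_on_compact_bound KS_compact cD.
pose E q := vol_density B 0 (sph q.1) * energy_density B 0 (sph q.1) (form6 q.2).
have [c c0 Hc] : exists2 c, 0 < c & forall q, KS q -> c <= E q.
  apply: (continuous_on_compact_min KS_compact) => q Kq.
    exact: (contM (@cont_vol6 0 _ Kq) (@cont_energy6 0 _ Kq)).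
  have ys : sdom (sph q.1) by case: Kq => h _; exact: (sdom_shell hsub h).
  apply: mulr_gt0; first exact: vol_density_gt0.
  apply: energy_density_gt0 => //; first exact: form6_tr.
  by apply/eqP => /form6_eq0 v0; case: Kq => _ /=; rewrite v0 normr0 => /eqP; rewrite eq_sym oner_eq0.
(* [C1] bounds [D] and [c] minorises the energy on unit two-forms; the summand 1 absorbs the term
   [e]. *)
exists (C1 * (1 + c^-1)); first by rewrite mulr_ge0// addr_ge0// invr_ge0 ltW.
move=> q G e Kq aG e0; have ys := sdom_shell hsub Kq.
have [v ->] := form6_surj aG.
have E0 : 0 <= vol_density B 0 (sph q) * energy_density B 0 (sph q) (form6 v).
  apply: mulr_ge0; first exact/ltW/vol_density_gt0.
  by apply: energy_density_ge0 => //; exact: form6_tr.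
have ei0 : 0 < e^-1 by rewrite invr_gt0.
have [->|v0] := eqVneq v 0.
  have -> : form6 0 = 0 *: form6 0 by rewrite -form6Z scale0r.
  rewrite DZ mul0r normr0 energy_densityZ expr0n !mul0r !mulr0 addr0.
  by apply: mulr_ge0; [apply: mulr_ge0 => //; rewrite addr_ge0// invr_ge0 ltW|exact: ltW].
have n0 : 0 < `|v| by rewrite normr_gt0.
pose u := `|v|^-1 *: v.
have u1 : `|u| = 1 by rewrite normrZ normfV normr_id mulVf// gt_eqF.
have vE : v = `|v| *: u by rewrite scalerA mulfV ?gt_eqF// scale1r.
have Ku : KS (q, u) by [].
have := HC1 _ Ku; have := Hc _ Ku; rewrite /E /= => h1 h2.
rewrite vE form6Z DZ normrM normr_id energy_densityZ [X in e^-1 * X]mulrCA.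
move: h1 h2; move: (vol_density _ _ _ * _) (D _ _) => X Y h1 h2.
(* If the norm exceeds [e] then it is at most its square divided by [e]; otherwise the first term
   suffices. *)
have h3 : `|v| <= e + e^-1 * `|v| ^+ 2.
  have [h|h] := lerP `|v| e; first by apply: ler_wpDr => //; apply: mulr_ge0; [exact: ltW|exact: sqr_ge0].
  apply: ler_wpDl; first exact: ltW.
  rewrite expr2 mulrA; apply: ler_peMl; first exact: ltW.
  by rewrite mulrC ler_pdivlMr// mul1r ltW.
have h4 : e + e^-1 * `|v| ^+ 2 <= (1 + c^-1) * (e + e^-1 * (`|v| ^+ 2 * X)).
  have k : 1 <= c^-1 * X by rewrite mulrC ler_pdivlMr ?mul1r.
  have k0 : 0 <= e^-1 * `|v| ^+ 2 by apply: mulr_ge0; [exact: ltW|exact: sqr_ge0].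
  have := ler_wpM2l k0 k; rewrite mulr1 => k1.
  have X0 : 0 <= X by exact: le_trans (ltW c0) h1.
  have k2 : 0 <= c^-1 * e by apply: mulr_ge0; [rewrite invr_ge0 ltW|exact: ltW].
  have k3 : 0 <= e^-1 * (`|v| ^+ 2 * X) by apply: mulr_ge0; [exact: ltW|apply: mulr_ge0 => //; exact: sqr_ge0].
  move: k1 k2 k3; clear; move: (c^-1) (e^-1) (`|v| ^+ 2) => ci ei v2; nra.
apply: (le_trans (ler_wpM2l (ltW n0) h2)).
rewrite mulrC -mulrA; apply: ler_wpM2l => //.
exact: le_trans h3 h4.
Qed.

Definition energy_integrand (G : 'rV[R]_3 -> 'M[R]_4) (q : R * R * R) : R :=
  energy_density B 0 (sph q) (G (sph q)) * (vol_density B 0 (sph q) * q.1.1 ^+ 2 * sin q.1.2).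

Lemma energy0E (G : 'rV[R]_3 -> 'M[R]_4) : (energy0 B 0 G = \int[mu3]_(q in ext_sph B) (energy_integrand G q)%:E)%E.
Proof. by []. Qed.

Lemma ext_sphP q : ext_sph B q -> [/\ 0 < q.1.1, rp <= q.1.1, 0 <= sin q.1.2 & sdom (sph q)].
Proof.
move=> qe; have ys := sdom_ext_sph hsub qe; case: q qe ys => -[x y] z [/= h hy hz] ys.
by split=> //; [exact: lt_le_trans (rplus_gt0 hsub) h|exact: sin_ge0_pi].
Qed.

Lemma energy_integrand_ge0 (G : 'rV[R]_3 -> 'M[R]_4) q : ext_sph B q -> (G (sph q))^T = - G (sph q) ->
  0 <= energy_integrand G q.
Proof.
move=> /ext_sphP[r0 _ s0 ys] aG; apply: mulr_ge0; first exact: energy_density_ge0.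
by rewrite !mulr_ge0// ?sqr_ge0// ltW// vol_density_gt0.
Qed.

Lemma measurable_energy_integrand (G : 'rV[R]_3 -> 'M[R]_4) :
  (forall i j, measurable_fun (ext_sph B) (fun q => G (sph q) i j)) ->
  measurable_fun (ext_sph B) (energy_integrand G).
Proof.
move=> mG.
pose P := fun f : R * R * R -> R => measurable_fun (ext_sph B) f.
have Pc c : P (fun=> c) by exact: measurable_cst.
have PD f g : P f -> P g -> P (fun q => f q + g q) by exact: measurable_funD.
have PM f g : P f -> P g -> P (fun q => f q * g q) by exact: measurable_funM.
have Ps f : smooth_near sdom f -> P (fun q => f (sph q)) by exact: smooth_measurable.
apply: (PM); first exact: (P_energy hsub hfol Pc PD PM Ps 0 hmult mG).
have cont_meas f : (forall q, cont q f) -> P f.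
  move=> cf; apply: (continuous_on_measurable3 (U := setT)); [exact: openT|by []|exact: ext_sph_measurable|move=> q _; exact: cf].
apply: (PM); last by apply: cont_meas => q; apply: cont_sin; exact: cont_2.
apply: (PM); first exact: Ps (smooth_vol_density hsub hfol 0).
by apply: cont_meas => q; apply: contX; exact: cont_1.
Qed.

Lemma measurable_field_of U : measurable_data B U ->
  forall i j, measurable_fun (ext_sph B) (fun q => field_of B 0 U (sph q) i j).
Proof.
move=> mU.
pose P := fun f : R * R * R -> R => measurable_fun (ext_sph B) f.
have Pc c : P (fun=> c) by exact: measurable_cst.
have PD f g : P f -> P g -> P (fun q => f q + g q) by exact: measurable_funD.
have PM f g : P f -> P g -> P (fun q => f q * g q) by exact: measurable_funM.
have Ps f : smooth_near sdom f -> P (fun q => f (sph q)) by exact: smooth_measurable.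
apply: (P_field_of hsub hfol Pc PD PM Ps 0).
- by move=> i j; rewrite (ord1 i); have [] := mU j.
- by move=> i j; rewrite (ord1 i); have [] := mU j.
Qed.

Lemma smooth_measurable_data U : smooth_data B U -> measurable_data B U.
Proof. by move=> [s1 s2 _] i; split; [apply: (smooth_measurable hsub (s1 0 i))|apply: (smooth_measurable hsub (s2 0 i))]. Qed.

Lemma shell_box_ext : shell_box B `<=` ext_sph B.
Proof. by move=> -[[x y] z] [[/=]]; rewrite !in_itv /= => /andP[]. Qed.

(** [D] stands for the radial flux of [G] or of its dual, so the same estimate covers both charges.
    The energy over the shell is bounded by the energy over the whole leaf because the integrand is
    nonnegative. *)
Lemma mean_flux_bound (D : 'M[R]_4 -> 'rV[R]_3 -> R) C (w : 'rV[R]_3 -> 'rV[R]_3)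
    (G : 'rV[R]_3 -> 'M[R]_4) : 0 <= C -> radial_bound D C -> smooth_mx_near sdom w ->
  (forall y, sdom y -> (G y)^T = - G y) ->
  (forall i j, measurable_fun (ext_sph B) (fun q => G (sph q) i j)) ->
  (forall y, sdom y -> \sum_i w y 0 i * y 0 i = D (G y) y) ->
  forall e x : R, 0 < e -> (energy0 B 0 G <= x%:E)%E ->
  `|\int[((leb \x leb) \x leb)%E]_(q in shell_box B) flux_density w q| <=
    C * ((rp + 1) * fine (mu3 (shell_box B)) + rp^-1) * (e + e^-1 * x).
Proof.
move=> C0 bD sw aG mG wD e x e0 Ex.
have r0 := rplus_gt0 hsub; have ei0 : 0 < e^-1 by rewrite invr_gt0.
have rV0 : 0 <= rp^-1 by rewrite invr_ge0 ltW.
have mb : measurable (shell_box B) by exact: box3_measurable.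
have me := ext_sph_measurable B.
have mF : measurable_fun (shell_box B) (flux_density w).
  apply: (measurable_funS me shell_box_ext).
  pose P := fun f : R * R * R -> R => measurable_fun (ext_sph B) f.
  have cont_meas f : (forall q, cont q f) -> P f.
    by move=> cf; apply: (continuous_on_measurable3 (U := setT)); [exact: openT|by []|exact: me|move=> q _; exact: cf].
  apply: measurable_funM; first by apply: cont_meas => q; apply: contM; [exact: cont_1|apply: cont_sin; exact: cont_2].
  apply: measurable_sum => i; apply: measurable_funM; first exact: (smooth_measurable hsub (sw 0 i)).
  by apply: cont_meas => q; exact: cont_sph.
have mI : measurable_fun (shell_box B) (energy_integrand G).
  by apply: (measurable_funS me shell_box_ext); exact: measurable_energy_integrand.
have I0 q : ext_sph B q -> 0 <= energy_integrand G q.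
  by move=> qe; apply: energy_integrand_ge0 => //; apply: aG; have [] := ext_sphP qe.
(* In [K1] the weight [r sin(theta)] is bounded by [r_+ + 1] on the shell. In [K2] the factor
   [1 / r_+] compensates for the flux carrying the weight [r] where the energy carries [r^2]. *)
pose K1 := C * (rp + 1) * e; pose K2 := C * rp^-1 * e^-1.
have rp10 : 0 <= rp + 1 by apply: addr_ge0 => //; exact: ltW.
have K10 : 0 <= K1 by apply: mulr_ge0; [exact: mulr_ge0|exact: ltW].
have K20 : 0 <= K2 by apply: mulr_ge0; [exact: mulr_ge0|exact: ltW].
have ptw q : shell_box B q -> `|flux_density w q| <= K1 + K2 * energy_integrand G q.
  move=> qb; have qe := shell_box_ext qb; have [x0 rx s0 ys] := ext_sphP qe.
  have x1 : q.1.1 <= rp + 1 by case: qb => -[/=]; rewrite in_itv /= => /andP[].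
  rewrite /flux_density wD// normrM ger0_norm; last by rewrite mulr_ge0// ltW.
  apply: (le_trans (ler_wpM2l _ (bD q _ e qb (aG _ ys) e0))); first by rewrite mulr_ge0// ltW.
  have E0 := energy_density_ge0 hsub hfol hmult 0 ys (aG _ ys).
  have V0 := vol_density_gt0 hsub hfol 0 ys.
  rewrite /K1 /K2 /energy_integrand; move: (energy_density _ _ _ _) (vol_density _ _ _) E0 V0 => E V E0 V0.
  have s1 := sin_le1 q.1.2; move: q.1.1 (sin q.1.2) x0 rx s0 x1 s1 => r s x0 rx s0 x1 s1.
  (* The energy integrand, with its weight [r^2 sin(theta)], is exposed at the price of a division
     by [r]. *)
  have -> : r * s * (C * (e + e^-1 * (V * E))) = C * (r * s) * e + C * (E * (V * r ^+ 2 * s)) / r * e^-1.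
    by move: (e^-1) => ei; field; rewrite gt_eqF.
  have -> : C * rp^-1 * e^-1 * (E * (V * r ^+ 2 * s)) = C * (E * (V * r ^+ 2 * s)) / rp * e^-1.
    by move: (rp^-1) (e^-1) => ri ei; ring.
  have Z0 : 0 <= C * (E * (V * r ^+ 2 * s)).
    by rewrite !mulr_ge0// ?sqr_ge0// ltW.
  apply: lerD.
    apply: ler_wpM2r; [exact: ltW|apply: ler_wpM2l => //].
    by rewrite -[leRHS]mulr1; apply: ler_pM => //; exact: ltW.
  apply: ler_wpM2r; [exact: ltW|apply: ler_wpM2l => //].
  by rewrite lef_pV2 ?posrE.
have L : (`|\int[(leb \x leb) \x leb]_(q in shell_box B) (flux_density w q)%:E| <=
    (K1 * fine (mu3 (shell_box B)) + K2 * x)%:E)%E.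
  have mF' : measurable_fun (shell_box B) (EFin \o flux_density w) by exact/measurable_EFinP.
  have LA := @le_abse_integral _ _ R ((leb \x leb) \x leb)%E _ _ mb mF'.
  apply: (le_trans LA).
  have mI' : measurable_fun (shell_box B) (fun q => (energy_integrand G q)%:E) by exact/measurable_EFinP.
  have mKI : measurable_fun (shell_box B) (fun q => (K2%:E * (energy_integrand G q)%:E)%E).
    exact: measurable_funeM.
  have I0' q : shell_box B q -> (0 <= (energy_integrand G q)%:E)%E.
    by move=> /shell_box_ext qe; rewrite lee_fin I0.
  apply: (@le_trans _ _ (\int[(leb \x leb) \x leb]_(q in shell_box B)
    ((cst K1%:E q) + K2%:E * (energy_integrand G q)%:E))%E).
    apply: ge0_le_integral.
    - exact: mb.
    - by move=> q _; exact: abse_ge0.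
    - exact: measurableT_comp.
    - by apply: emeasurable_funD => //; exact: measurable_cst.
    - by move=> q qb; rewrite /= -EFinM -EFinD lee_fin ptw.
  rewrite ge0_integralD//.
  2: by move=> q qb; rewrite mule_ge0//; exact: I0'.
  rewrite integral_cst// ge0_integralZl_EFin// EFinD !EFinM; apply: leeD.
    by rewrite fineK// ge0_fin_numE//; exact: box3_finite.
  apply: lee_wpmul2l; first by rewrite lee_fin.
  apply: le_trans Ex; rewrite energy0E.
  apply: ge0_subset_integral => //; [|exact: shell_box_ext].
  by apply/measurable_EFinP; exact: measurable_energy_integrand.
have x0 : 0 <= x.
  by rewrite -lee_fin; apply: le_trans Ex; rewrite energy0E; apply: integral_ge0 => q qe; rewrite lee_fin I0.
have mu0 : 0 <= fine (mu3 (shell_box B)) by rewrite fine_ge0.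
have fin_le (z : \bar R) K : (`|z| <= K%:E)%E -> `|fine z| <= K.
  by case: z => [z| |] //=.
apply: (le_trans (fin_le _ _ L)); rewrite /K1 /K2.
have y0 : 0 <= e^-1 * x by rewrite mulr_ge0// ltW.
have a0 : 0 <= (rp + 1) * fine (mu3 (shell_box B)) by rewrite mulr_ge0// addr_ge0// ltW.
rewrite -[_ * (e + _)]mulrA [C * (rp + 1) * e]mulrAC -!mulrA -mulrDr; apply: ler_wpM2l => //.
have e00 := ltW e0; move: (e^-1 * x) y0 a0 rV0 e00 => y y0.
rewrite [e * _]mulrC; move: ((rp + 1) * _) (rp^-1) => u v u0 v0 e00.
by clear -y0 u0 v0 e00; nra.
Qed.

End charge_bound.

(** * Energy of data and uniqueness of extended charges *)

Section data_energy.
Context {R : realType} (B : setting R).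
Hypotheses (hsub : subextremal B) (hfol : regular_foliation B) (hmult : redshift_multiplier B).
Local Notation sdom := (slice_dom B).
Local Notation rp := (rplus B).
Local Notation leb := (@lebesgue_measure R).
Local Notation field2 := ('rV[R]_3 -> 'M[R]_4).

Definition asym_field (G : field2) := forall y, sdom y -> (G y)^T = - G y.
Definition meas_field (G : field2) :=
  forall i j, measurable_fun (ext_sph B) (fun q => G (sph q) i j).

(** The parallelogram identity: the stress tensor is a linear map applied to a quadratic expression
    in the field. *)
Lemma stress_polarization (g G H : 'M[R]_4) :
  stress g (G + H) + stress g (G - H) = 2 *: stress g G + 2 *: stress g H.
Proof.
pose Q (X : 'M[R]_4) := X *m invmx g *m X^T.
pose L (X : 'M[R]_4) := X - (4^-1 * \tr (X *m invmx g)) *: g.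
have LD X Y : L (X + Y) = L X + L Y.
  rewrite /L mulmxDl raddfD /= mulrDr scalerDl opprD !addrA; congr (_ + _).
  by rewrite -!addrA; congr (_ + _); rewrite addrC.
have sE X : stress g X = L (Q X) by [].
rewrite !sE -LD.
have -> : Q (G + H) + Q (G - H) = (Q G + Q H) + (Q G + Q H).
  rewrite /Q !trmxD trmxN !mulmxDl !mulmxDr !mulNmx !mulmxN opprK.
  move: (G *m _ *m G^T) (G *m _ *m H^T) (H *m _ *m G^T) (H *m _ *m H^T) => a b c d.
  by apply/matrixP => i j; rewrite !mxE; ring.
by rewrite !LD !scaler_nat !mulr2n addrACA.
Qed.

Lemma energy_density_sub s y (G H : 'M[R]_4) : sdom y -> G^T = - G -> H^T = - H ->
  energy_density B s y (G - H) <= 2 * energy_density B s y G + 2 * energy_density B s y H.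
Proof.
move=> ys aG aH.
have : 0 <= energy_density B s y (G + H).
  by apply: energy_density_ge0 => //; rewrite trmxD aG aH opprD.
have E : energy_density B s y (G + H) + energy_density B s y (G - H)
    = 2 * energy_density B s y G + 2 * energy_density B s y H.
  by rewrite /energy_density -!pairZ -!pairD stress_polarization.
by rewrite -E lerDr.
Qed.

Lemma energy0_ge0 G : asym_field G -> (0 <= energy0 B 0 G)%E.
Proof.
move=> aG; rewrite energy0E; apply: integral_ge0 => q qe; rewrite lee_fin.
by apply: energy_integrand_ge0 => //; apply: aG; have [] := ext_sphP hsub qe.
Qed.

(** The triangle inequality for the energy norm, squared and with constant 2: the parallelogram
    identity is used with the nonnegative term of the sum dropped. No square root of an extended
    real occurs. *)
Lemma energy0_sub G H : asym_field G -> asym_field H -> meas_field G -> meas_field H ->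
  (energy0 B 0 (fun y => G y - H y)%R <= 2%:E * energy0 B 0 G + 2%:E * energy0 B 0 H)%E.
Proof.
move=> aG aH mG mH; rewrite !energy0E.
have me := ext_sph_measurable B.
have I0 F : asym_field F -> forall q, ext_sph B q -> (0 <= (energy_integrand B F q)%:E)%E.
  move=> aF q qe; rewrite lee_fin.
  by apply: energy_integrand_ge0 => //; apply: aF; have [] := ext_sphP hsub qe.
have mI F : meas_field F -> measurable_fun (ext_sph B) (fun q => (energy_integrand B F q)%:E).
  by move=> mF; apply/measurable_EFinP; exact: measurable_energy_integrand.
have mZ F : meas_field F -> measurable_fun (ext_sph B) (fun q => (2%:E * (energy_integrand B F q)%:E)%E).
  by move=> mF; apply: measurable_funeM; exact: mI.
have Z0 F : asym_field F -> forall q, ext_sph B q -> (0 <= 2%:E * (energy_integrand B F q)%:E)%E.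
  by move=> aF q qe; apply: mule_ge0; [rewrite lee_fin|exact: I0].
have aGH : asym_field (fun y => G y - H y).
  by move=> y ys; rewrite trmxD trmxN aG// aH// opprB opprK addrC.
have mGH : meas_field (fun y => G y - H y).
  move=> i j; rewrite (_ : (fun q => _) = fun q => G (sph q) i j - H (sph q) i j).
    exact: measurable_funB.
  by apply/funext => q; rewrite [LHS]mxE [X in _ + X]mxE.
have ZE F : asym_field F -> meas_field F -> (\int[mu3]_(q in ext_sph B) (2%:E * (energy_integrand B F q)%:E) =
    2%:E * \int[mu3]_(q in ext_sph B) (energy_integrand B F q)%:E)%E.
  by move=> aF mF; rewrite ge0_integralZl_EFin//; [exact: I0|exact: mI].
have DE : (\int[mu3]_(q in ext_sph B) (2%:E * (energy_integrand B G q)%:E + 2%:E * (energy_integrand B H q)%:E) =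
    \int[mu3]_(q in ext_sph B) (2%:E * (energy_integrand B G q)%:E) +
    \int[mu3]_(q in ext_sph B) (2%:E * (energy_integrand B H q)%:E))%E.
  exact: (@ge0_integralD _ _ R ((leb \x leb) \x leb)%E _ me _ _ (Z0 G aG) (mZ G mG) (Z0 H aH) (mZ H mH)).
have L : (\int[mu3]_(q in ext_sph B) (energy_integrand B (fun y => G y - H y) q)%:E <=
    \int[mu3]_(q in ext_sph B) (2%:E * (energy_integrand B G q)%:E + 2%:E * (energy_integrand B H q)%:E))%E.
  apply: ge0_le_integral.
  - exact: me.
  - exact: I0.
  - exact: mI.
  - by apply: emeasurable_funD; exact: mZ.
  move=> q qe; rewrite -!EFinM -EFinD lee_fin /energy_integrand.
  have [r0 _ s0 ys] := ext_sphP hsub qe.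
  have W0 : 0 <= vol_density B 0 (sph q) * q.1.1 ^+ 2 * sin q.1.2.
    by rewrite !mulr_ge0// ?sqr_ge0// ltW// vol_density_gt0.
  move: (vol_density B 0 (sph q) * q.1.1 ^+ 2 * sin q.1.2) W0 => W W0.
  rewrite [2 * (_ * W)]mulrA [2 * (_ * W)]mulrA -mulrDl; apply: ler_wpM2r => //.
  by apply: energy_density_sub; rewrite // (aG, aH).
have E := etrans DE (f_equal2 adde (ZE G aG mG) (ZE H aH mH)).
exact: (eq_ind _ (fun z => is_true (_ <= z)%E) L _ E).
Qed.

Lemma ae_mu3_filter : Filter (almost_everywhere (@mu3 R)).
Proof. exact: (@ae_filter_ringOfSetsType _ _ _ ((leb \x leb) \x leb)%E). Qed.

Lemma ae_mu3S (P S : R * R * R -> Prop) : (forall q, P q -> S q) ->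
  {ae @mu3 R, forall q, P q} -> {ae @mu3 R, forall q, S q}.
Proof. by move=> PS; apply: (@filterS _ _ ae_mu3_filter). Qed.

Lemma ae_mu3I (P S : R * R * R -> Prop) : {ae @mu3 R, forall q, P q} ->
  {ae @mu3 R, forall q, S q} -> {ae @mu3 R, forall q, P q /\ S q}.
Proof. exact: (@filterI _ _ ae_mu3_filter). Qed.

Lemma ae_mu3T (P : R * R * R -> Prop) : (forall q, P q) -> {ae @mu3 R, forall q, P q}.
Proof. by move=> h; apply: (@filterE _ _ ae_mu3_filter). Qed.

Lemma energy0_ae G H : meas_field G -> meas_field H ->
  {ae mu3, forall q, ext_sph B q -> G (sph q) = H (sph q)} ->
  energy0 B 0 G = energy0 B 0 H.
Proof.
move=> mG mH GH; rewrite !energy0E.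
apply: ae_eq_integral; first exact: ext_sph_measurable.
- by apply/measurable_EFinP; exact: measurable_energy_integrand.
- by apply/measurable_EFinP; exact: measurable_energy_integrand.
- by apply: ae_mu3S GH => q h qe; rewrite /energy_integrand h.
Qed.

Lemma field_of_add s U V y :
  field_of B s (add_data U V) y = field_of B s U y + field_of B s V y.
Proof.
rewrite /field_of; have extD u v : ext_cov B s y (u + v) = ext_cov B s y u + ext_cov B s y v.
  rewrite /ext_cov -[RHS]addrACA -scalerDl -big_split /=; congr (_ + _ *: _).
    apply/rowP => j; have [k ->|->] := unliftP ord0 j; rewrite [RHS]mxE.
      by rewrite !mxE liftK /= mxE.
    by rewrite !mxE unlift_none /= addr0.
  by apply: eq_bigr => i _; rewrite [in LHS]mxE mulrDl.
by rewrite /= !extD !wedgeDr starD addrACA.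
Qed.

Lemma field_of_scale s c U y : field_of B s (scale_data c U) y = c *: field_of B s U y.
Proof.
rewrite /field_of; have extZ u : ext_cov B s y (c *: u) = c *: ext_cov B s y u.
  rewrite /ext_cov scalerDr scalerA mulr_sumr; congr (_ + _ *: _).
    apply/rowP => j; have [k ->|->] := unliftP ord0 j; rewrite [RHS]mxE.
      by rewrite !mxE liftK /= mxE.
    by rewrite !mxE unlift_none /= mulr0.
  by apply: eq_bigr => i _; rewrite [in LHS]mxE mulrA.
by rewrite /= !extZ !wedgeZr starZ -scalerDr.
Qed.

Lemma field_of_sub s U V y : field_of B s (sub_data U V) y = field_of B s U y - field_of B s V y.
Proof. by rewrite field_of_add field_of_scale scaleN1r. Qed.

Lemma measurable_data_add U V : measurable_data B U -> measurable_data B V ->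
  measurable_data B (add_data U V).
Proof.
move=> mU mV i; have [U1 U2] := mU i; have [V1 V2] := mV i; split.
  rewrite (_ : (fun q => _) = fun q => U.1 (sph q) 0 i + V.1 (sph q) 0 i); first exact: measurable_funD.
  by apply/funext => q; rewrite [LHS]mxE.
rewrite (_ : (fun q => _) = fun q => U.2 (sph q) 0 i + V.2 (sph q) 0 i); first exact: measurable_funD.
by apply/funext => q; rewrite [LHS]mxE.
Qed.

Lemma measurable_data_scale c U : measurable_data B U -> measurable_data B (scale_data c U).
Proof.
move=> mU i; have [U1 U2] := mU i; split.
  rewrite (_ : (fun q => _) = fun q => c * U.1 (sph q) 0 i); last by apply/funext => q; rewrite [LHS]mxE.
  by apply: measurable_funM => //; exact: measurable_cst.
rewrite (_ : (fun q => _) = fun q => c * U.2 (sph q) 0 i); last by apply/funext => q; rewrite [LHS]mxE.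
by apply: measurable_funM => //; exact: measurable_cst.
Qed.

Lemma measurable_data_sub U V : measurable_data B U -> measurable_data B V ->
  measurable_data B (sub_data U V).
Proof. by move=> mU mV; apply: measurable_data_add => //; exact: measurable_data_scale. Qed.

Lemma div_densitizedP e y : sdom y ->
  divergence B 0 e y = 0 <-> \sum_i pd i (fun z => densitized B 0 e z 0 i) y = 0.
Proof.
move=> ys; split; first exact: div_densitized.
move=> d0; rewrite /divergence; apply/eqP; rewrite mulf_eq0; apply/orP; right; apply/eqP.
rewrite -[RHS]d0; apply: eq_bigr => i _; congr (pd i _ y).
by apply/funext => z; rewrite scaleE.
Qed.

Lemma densitized_add e f y : densitized B 0 (fun y => e y + f y) y = densitized B 0 e y + densitized B 0 f y.
Proof. by rewrite /densitized mulmxDl scalerDr. Qed.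

Lemma densitized_scale c e y : densitized B 0 (fun y => c *: e y) y = c *: densitized B 0 e y.
Proof. by rewrite /densitized -scalemxAl !scalerA mulrC. Qed.

Lemma divergence_add e f y : smooth_mx_near sdom e -> smooth_mx_near sdom f -> sdom y ->
  divergence B 0 e y = 0 -> divergence B 0 f y = 0 -> divergence B 0 (fun y => e y + f y) y = 0.
Proof.
move=> se sf ys /(div_densitizedP _ ys) de /(div_densitizedP _ ys) df; apply/(div_densitizedP _ ys).
transitivity (\sum_i pd i (fun z => densitized B 0 e z 0 i) y + \sum_i pd i (fun z => densitized B 0 f z 0 i) y).
  2: by rewrite de df addr0.
rewrite -big_split; apply: eq_bigr => i _ /=.
rewrite -pdD; first by congr (pd i _ y); apply/funext => z; rewrite densitized_add [LHS]mxE.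
  exact: smooth_near_diff (smooth_densitized hsub hfol 0 se 0 i) ys.
exact: smooth_near_diff (smooth_densitized hsub hfol 0 sf 0 i) ys.
Qed.

Lemma divergence_scale c e y : smooth_mx_near sdom e -> sdom y ->
  divergence B 0 e y = 0 -> divergence B 0 (fun y => c *: e y) y = 0.
Proof.
move=> se ys /(div_densitizedP _ ys) de; apply/(div_densitizedP _ ys).
transitivity (c * \sum_i pd i (fun z => densitized B 0 e z 0 i) y); last by rewrite de mulr0.
rewrite mulr_sumr; apply: eq_bigr => i _ /=.
transitivity (pd i (fun z => c * densitized B 0 e z 0 i) y).
  by congr (pd i _ y); apply/funext => z; rewrite densitized_scale scaleE.
rewrite (pdM i (f := fun=> c)) ?pd_cst ?mul0r ?add0r//.
exact: smooth_near_diff (smooth_densitized hsub hfol 0 se 0 i) ys.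
Qed.

Lemma smooth_data_add U V : smooth_data B U -> smooth_data B V -> smooth_data B (add_data U V).
Proof.
move=> [U1 U2 dU] [V1 V2 dV]; split; [exact: smooth_mxD|exact: smooth_mxD|].
move=> y ys; have [dU1 dU2] := dU y ys; have [dV1 dV2] := dV y ys.
by split; exact: divergence_add.
Qed.

Lemma smooth_data_scale c U : smooth_data B U -> smooth_data B (scale_data c U).
Proof.
move=> [U1 U2 dU]; split.
- by apply: smooth_mxZ => //; exact: smooth_near_cst.
- by apply: smooth_mxZ => //; exact: smooth_near_cst.
- by move=> y ys; have [dU1 dU2] := dU y ys; split; exact: divergence_scale.
Qed.

Lemma smooth_data_sub U V : smooth_data B U -> smooth_data B V -> smooth_data B (sub_data U V).
Proof. by move=> sU sV; apply: smooth_data_add => //; exact: smooth_data_scale. Qed.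

Lemma flux_integrable w : smooth_mx_near sdom w ->
  ((leb \x leb) \x leb)%E.-integrable (shell_box B) (EFin \o flux_density w).
Proof.
move=> sw; have [U [opU AU HU]] := flux_domain sw.
apply: (box3_integrable (U := sph @^-1` U)).
- by apply: open_comp opU => x _; exact: sph_continuous.
- by move=> q qs; apply: AU; exact: (sdom_shell hsub qs).
- move=> q Uq; suff : cont q (fun q => q.1.1 * sin q.1.2 * \sum_i w (sph q) 0 i * sph q 0 i) by [].
  apply: contM; first by apply: contM; [exact: cont_1|apply: cont_sin; exact: cont_2].
  apply: cont_sum => i; apply: contM; last exact: cont_sph.
  apply: (cont_comp_mx (f := fun y => w y 0 i)); first by move=> k j; exact: cont_sph.
  by apply: differentiable_continuous; exact: (HU i 0%N).
Qed.

Lemma mean_charge_add e f : smooth_mx_near sdom e -> smooth_mx_near sdom f ->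
  mean_charge B 0 (fun y => e y + f y) = mean_charge B 0 e + mean_charge B 0 f.
Proof.
move=> se sf; rewrite /mean_charge -mulrDr; congr (_ * _).
rewrite -RintegralD; [|exact: box3_measurable|exact: flux_integrable (smooth_densitized hsub hfol 0 se)
  |exact: flux_integrable (smooth_densitized hsub hfol 0 sf)].
apply: eq_Rintegral => q _; rewrite /flux_density -mulrDr -big_split; congr (_ * _).
by apply: eq_bigr => i _; rewrite densitized_add [in LHS]mxE mulrDl.
Qed.

Lemma mean_charge_scale c e : smooth_mx_near sdom e ->
  mean_charge B 0 (fun y => c *: e y) = c * mean_charge B 0 e.
Proof.
move=> se; rewrite /mean_charge mulrCA; congr (_ * _).
rewrite -RintegralZl; [|exact: box3_measurable|exact: flux_integrable (smooth_densitized hsub hfol 0 se)].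
apply: eq_Rintegral => q _; rewrite /flux_density [RHS]mulrCA; congr (_ * _); rewrite mulr_sumr.
by apply: eq_bigr => i _; rewrite densitized_scale scaleE mulrA.
Qed.

Definition cE (U : data R) : R := chargeE B 0 (field_of B 0 U).
Definition cB (U : data R) : R := chargeB B 0 (field_of B 0 U).

Lemma cE_add U V : smooth_data B U -> smooth_data B V -> cE (add_data U V) = cE U + cE V.
Proof.
move=> sU sV; rewrite /cE !chargeE_data//; last exact: smooth_data_add.
by have [U1 _ _] := sU; have [V1 _ _] := sV; exact: mean_charge_add.
Qed.

Lemma cB_add U V : smooth_data B U -> smooth_data B V -> cB (add_data U V) = cB U + cB V.
Proof.
move=> sU sV; rewrite /cB !chargeB_data//; last exact: smooth_data_add.
by have [_ U1 _] := sU; have [_ V1 _] := sV; exact: mean_charge_add.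
Qed.

Lemma cE_scale c U : smooth_data B U -> cE (scale_data c U) = c * cE U.
Proof.
move=> sU; rewrite /cE !chargeE_data//; last exact: smooth_data_scale.
by have [U1 _ _] := sU; exact: mean_charge_scale.
Qed.

Lemma cB_scale c U : smooth_data B U -> cB (scale_data c U) = c * cB U.
Proof.
move=> sU; rewrite /cB !chargeB_data//; last exact: smooth_data_scale.
by have [_ U1 _] := sU; exact: mean_charge_scale.
Qed.

(** Continuity of a charge at 0 for the energy norm. For energy at most [e^2] the bound becomes
    [2 C e]. *)
Definition energy_bounds (c : data R -> R) := exists2 C, 0 <= C &
  forall U (e x : R), smooth_data B U -> 0 < e -> (energy0 B 0 (field_of B 0 U) <= x%:E)%E ->
    `|c U| <= C * (e + e^-1 * x).

Lemma asym_field_of U : asym_field (field_of B 0 U).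
Proof. by move=> y ys; exact: (field_of_tr hsub 0 ys U). Qed.

Lemma meas_field_of U : measurable_data B U -> meas_field (field_of B 0 U).
Proof. by move=> mU; exact: measurable_field_of. Qed.

Lemma inv4pi_ge0 : 0 <= (4 * pi)^-1 :> R.
Proof. by rewrite invr_ge0 mulr_ge0// pi_ge0. Qed.

Lemma energy_bounds_cB : energy_bounds cB.
Proof.
have [C C0 bC] : exists2 C, 0 <= C & radial_bound B (radial_flux B 0) C.
  apply: radial_bound_exists => //; last by move=> x Kx; exact: cont_radial6.
  by move=> c G y; exact: radial_fluxZ.
exists ((4 * pi)^-1 * (C * ((rp + 1) * fine (mu3 (shell_box B)) + rp^-1))).
  rewrite !mulr_ge0 ?inv4pi_ge0// addr_ge0 ?invr_ge0 ?rp_ge0// mulr_ge0 ?fine_ge0//.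
  by rewrite addr_ge0 ?rp_ge0.
move=> U e x sU e0 Ux; rewrite /cB chargeB_data// /mean_charge normrM ger0_norm ?inv4pi_ge0//.
rewrite -[leRHS]mulrA; apply: ler_wpM2l; first exact: inv4pi_ge0.
have [sE sB dU] := sU.
apply: (mean_flux_bound hsub hfol hmult (D := radial_flux B 0) (G := field_of B 0 U)) => //.
- exact: smooth_densitized.
- exact: asym_field_of.
- by apply: meas_field_of; exact: smooth_measurable_data.
- move=> y ys; rewrite /radial_flux (dual3_data hsub hfol 0 ys (asym_field_of U ys)).
  by rewrite /densitized (data_of_field_of hsub hfol 0 ys U).2.
Qed.

Lemma energy_bounds_cE : energy_bounds cE.
Proof.
pose D (G : 'M[R]_4) y := radial_flux B 0 (star (kn_metric B (emb B 0 y)) G) y.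
have [C C0 bC] : exists2 C, 0 <= C & radial_bound B D C.
  apply: radial_bound_exists => //; last by move=> x Kx; exact: cont_radial_star6.
  by move=> c G y; rewrite /D starZ radial_fluxZ.
exists ((4 * pi)^-1 * (C * ((rp + 1) * fine (mu3 (shell_box B)) + rp^-1))).
  rewrite !mulr_ge0 ?inv4pi_ge0// addr_ge0 ?invr_ge0 ?rp_ge0// mulr_ge0 ?fine_ge0//.
  by rewrite addr_ge0 ?rp_ge0.
move=> U e x sU e0 Ux; rewrite /cE chargeE_data// /mean_charge normrM ger0_norm ?inv4pi_ge0//.
rewrite -[leRHS]mulrA; apply: ler_wpM2l; first exact: inv4pi_ge0.
have [sE sB dU] := sU.
apply: (mean_flux_bound hsub hfol hmult (D := D) (G := field_of B 0 U)) => //.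
- exact: smooth_densitized.
- exact: asym_field_of.
- by apply: meas_field_of; exact: smooth_measurable_data.
- move=> y ys; rewrite /D /radial_flux (dual3_star_data hsub hfol 0 ys (asym_field_of U ys)).
  by rewrite /densitized (data_of_field_of hsub hfol 0 ys U).1.
Qed.

Definition additive_charge (c : data R -> R) := forall U V, smooth_data B U -> smooth_data B V ->
  c (sub_data U V) = c U - c V.

Lemma additive_cE : additive_charge cE.
Proof.
move=> U V sU sV; rewrite /sub_data cE_add//; last exact: smooth_data_scale.
by rewrite cE_scale// mulN1r.
Qed.

Lemma additive_cB : additive_charge cB.
Proof.
move=> U V sU sV; rewrite /sub_data cB_add//; last exact: smooth_data_scale.
by rewrite cB_scale// mulN1r.
Qed.

Lemma cvg_energy_small (e : nat -> \bar R) (d : R) : e @ \oo --> 0%E -> 0 < d ->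
  \forall n \near \oo, (e n <= d%:E)%E.
Proof.
move=> ce d0; have H : nbhs (0%E : \bar R) [set x | (x < d%:E)%E].
  by apply: open_nbhs_nbhs; split; [exact: open_ereal_lt_ereal|rewrite /= lte_fin].
have h : \forall n \near \oo, (e n < d%:E)%E by exact: (ce _ H).
by near=> n; apply: ltW; near: n.
Unshelve. all: by end_near.
Qed.

(** Two sequences approximating the same data differ by smooth data whose energy tends to 0, and
    additivity with the energy bound makes the charges of the differences tend to 0. This gives
    meaning to the [get] in the charges of finite-energy data. *)
Lemma extends_charge_unique (c : data R -> R) U x x' : energy_bounds c -> additive_charge c ->
  measurable_data B U -> extends_charge B c U x -> extends_charge B c U x' -> x = x'.
Proof.
move=> [C C0 bC] ac mU [Us [Gs [[sU _ _ eU] cU]]] [Vs [Hs [[sV _ _ eV] cV]]].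
apply/eqP; rewrite -subr_eq0; apply/eqP.
have cD : (fun n => c (Us n) - c (Vs n)) @ \oo --> x - x' by exact: cvgB.
apply: (cvg_unique _ cD) => //; apply/cvgr0Pnorm_le => d d0.
have C1 : 0 < C + 1 by rewrite ltr_wpDl.
(* The final bound is [2 C e], which must not exceed [d]; [C + 1] replaces [C] because [C] may be
   0. *)
pose e := d / (2 * (C + 1)).
have e0 : 0 < e by rewrite divr_gt0// mulr_gt0.
(* [energy0_sub] doubles each energy, so twice [e^2 / 4] from each sequence adds up to [e^2]. *)
have e2 : 0 < e ^+ 2 / 4 by rewrite divr_gt0// exprn_gt0.
have hU := cvg_energy_small eU e2; have hV := cvg_energy_small eV e2.
near=> n; rewrite -ac; [|exact: (sU n).1|exact: (sV n).1].
have sD := smooth_data_sub (sU n).1 (sV n).1.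
have En : (energy0 B 0 (field_of B 0 (sub_data (Us n) (Vs n))) <= (e ^+ 2)%:E)%E.
  have -> : field_of B 0 (sub_data (Us n) (Vs n)) =
      fun y => field_of B 0 (sub_data (Us n) U) y - field_of B 0 (sub_data (Vs n) U) y.
    by apply/funext => y; rewrite !field_of_sub opprB addrA subrK.
  have m1 := measurable_data_sub (smooth_measurable_data hsub (sU n).1) mU.
  have m2 := measurable_data_sub (smooth_measurable_data hsub (sV n).1) mU.
  apply: (le_trans (energy0_sub (asym_field_of (sub_data (Us n) U)) (asym_field_of (sub_data (Vs n) U))
    (meas_field_of m1) (meas_field_of m2))).
  have -> : (e ^+ 2)%:E = (2%:E * (e ^+ 2 / 4)%:E + 2%:E * (e ^+ 2 / 4)%:E)%E.
    by rewrite -!EFinM -EFinD; congr (_%:E); field.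
  apply: leeD; (apply: lee_wpmul2l; first by rewrite lee_fin).
    exact: (near hU n).
  exact: (near hV n).
apply: (le_trans (bC _ e (e ^+ 2) sD e0 En)).
rewrite expr2 mulrA mulVf ?gt_eqF// mul1r.
rewrite (_ : e + e = d / (C + 1)); last by rewrite /e; field; rewrite gt_eqF.
rewrite mulrA ler_pdivrMr// mulrC ler_wpM2l ?ltW//.
by rewrite ltrDl.
Unshelve. all: by end_near. Qed.

End data_energy.

(** * Charges of the stationary fields *)

Section stationary_charges.
Context {R : realType} (B : setting R).
Hypotheses (hsub : subextremal B) (hfol : regular_foliation B) (hmult : redshift_multiplier B).
Local Notation a := (spin B).
Local Notation sdom := (slice_dom B).
Local Notation rp := (rplus B).
Local Notation leb := (@lebesgue_measure R).

Lemma far_dtau : exists R0 C : R, [/\ rp < R0, 0 <= C & forall p, R0 < radius (sp p) ->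
  exists2 k : R, dtau B p = cov_dt + k *: cov_dr p & `|k| <= C].
Proof.
have [R0 [psi [C [R0p tE dpsi]]]] := far_tau hfol.
have R00 : 0 < R0 by exact: lt_trans (rplus_gt0 hsub) R0p.
have C0 : 0 <= C.
  have [] := dpsi (R0 + 1); first by rewrite ltrDl.
  by move=> _; apply: le_trans; exact: normr_ge0.
(* [C] bounds [r psi'], so [C / R0] bounds [psi'] beyond [R0]. *)
exists R0, (C / R0); split => //; first by rewrite divr_ge0// ltW.
move=> p rp'; have Ap : away p by apply: lt_trans rp'; exact: lt_trans (rplus_gt0 hsub) R0p.
exists ('D_1 psi (radius (sp p))); last first.
  have [_] := dpsi _ rp'; rewrite derive1E normrM gtr0_norm// => h.
  have r0 : 0 < radius (sp p) by exact: lt_trans R00 rp'.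
  rewrite ler_pdivlMr// mulrC; apply: le_trans h.
  by apply: ler_wpM2r => //; exact: ltW.
apply/rowP => i; rewrite [LHS]mxE.
have dr : differentiable (fun q : 'rV[R]_4 => radius (sp q)) p by exact: smooth_near_diff smooth_r Ap.
have dpsi' : differentiable psi (radius (sp p)).
  by apply/derivable1_diffP; have [] := dpsi _ rp'.
have dps : differentiable (fun q => psi (radius (sp q))) p.
  exact: (@differentiable_comp _ _ _ _ (fun q => radius (sp q)) psi).
have oF : open (away `&` (fun p => radius (sp p)) @^-1` [set x : R | R0 < x]).
  apply: (open_preimage_fun open_away (open_gt (y := R0))) => q Aq.
  exact: smooth_near_cont smooth_r Aq.
rewrite (@pd_eq _ _ i _ (fun q => q 0 0 + psi (radius (sp q)))); last first.
  near=> q; rewrite tE//; apply: ltW; near: q.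
  have := open_nbhs_nbhs (conj oF (conj Ap rp')); apply: filterS => q [_ h]; exact: h.
rewrite pdD//; last exact: differentiable_coord.
rewrite pd_coord [RHS]mxE; congr (_ + _).
  rewrite cov_dtE; move: i; apply: ord4P; by rewrite row4E.
rewrite /pd deriveE// (_ : (fun q => psi (radius (sp q))) = psi \o (fun q => radius (sp q)))//.
rewrite (diff_comp dr dpsi') /= -(deriveE _ dr).
have := (hg_r Ap).2 i; rewrite /pd => ->; rewrite scaleE.
rewrite -[X in 'd psi _ X]mulr1 -[X in 'd psi _ X]/(_ *: _) linearZ /= -deriveE//.
by rewrite mulrC.
Unshelve. all: by end_near. Qed.

(** Far out [tau] is [t~] plus a function of the radius, so the slope of the leaf is radial. Vectors
    tangent to a coordinate sphere then lift without a time component, and the fluxes there can be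
    computed explicitly. *)
Lemma far_slope : exists2 R0 : R, rp < R0 & forall y, R0 < radius y -> exists k : R,
  forall i, slope B 0 y i = k * y 0 i.
Proof.
have [R0 [C [R0p _ far]]] := far_dtau; exists R0 => // y yr.
have ys : sdom y by rewrite /slice_dom /= ltW// (lt_trans R0p).
have py : R0 < radius (sp (emb B 0 y)) by rewrite sp_ev.
have [k kE _] := far _ py.
exists (- k / radius y) => i.
have := chain_tau hsub hfol (lift ord0 i) (ext_ev 0 ys).
rewrite -embE kE; have -> : (lift ord0 i == 0 :> 'I_4) = false by [].
rewrite -/(slope B 0 y i) /= mul1r.
have c0 : cov_dr (emb B 0 y) 0 0 = 0 by rewrite /cov_dr evE.
have ci : cov_dr (emb B 0 y) 0 (lift ord0 i) = y 0 i / radius y.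
  by rewrite /cov_dr sp_ev mxE liftK /= scaleE mulrC.
have t0 : cov_dt 0 0 = 1 :> R by rewrite cov_dtE row4E.
have ti : cov_dt 0 (lift ord0 i) = 0 :> R by rewrite /cov_dt mxE liftK /= mxE.
rewrite !mx_linE c0 ci t0 ti mulr0 addr0 mulr1 add0r.
move=> /eqP; rewrite addr_eq0 => /eqP ->.
by move: (radius y)^-1 (y 0 i) => ri yi; ring.
Qed.

Lemma lift_vec_tangent y (v : 'rV[R]_3) (k : R) : (forall i, slope B 0 y i = k * y 0 i) ->
  \sum_i v 0 i * y 0 i = 0 -> lift_vec B 0 y v = ev 0 v.
Proof.
move=> kE v0; rewrite /lift_vec; congr (ev _ v).
transitivity (\sum_i v 0 i * (k * y 0 i)); first by apply: eq_bigr => i _; rewrite -kE.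
transitivity (k * \sum_i v 0 i * y 0 i); last by rewrite v0 mulr0.
by rewrite mulr_sumr; apply: eq_bigr => i _; rewrite mulrCA.
Qed.

Lemma sph_th_tangent (q : R * R * R) : \sum_i sph_th q 0 i * sph q 0 i = 0.
Proof.
case: q => -[r th] ph; rewrite sum3_ring !sphE /sph_th !row3E /=.
have d2 : cos ph * cos ph = 1 - sin ph * sin ph by rewrite -!expr2 cos2sin2.
transitivity (r * r * sin th * cos th * (cos ph * cos ph + sin ph * sin ph - 1)); first by ring.
by rewrite d2; ring.
Qed.

Lemma sph_ph_tangent (q : R * R * R) : \sum_i sph_ph q 0 i * sph q 0 i = 0.
Proof. by case: q => -[r th] ph; rewrite sum3_ring !sphE /sph_ph !row3E /=; ring. Qed.

Lemma pair_formA_tangent p (u v : 'rV[R]_3) : away p ->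
  \sum_i u 0 i * sp p 0 i = 0 -> \sum_i v 0 i * sp p 0 i = 0 ->
  pair (formA B p) (ev 0 u) (ev 0 v) = 0.
Proof.
move=> Ap u0 v0; rewrite /formA pair_wedge.
have H (w : 'rV[R]_3) : \sum_i w 0 i * sp p 0 i = 0 -> (ev 0 w *m (cov_dr p)^T) 0 0 = 0.
  move=> w0; rewrite /cov_dr dot_ev mul0r add0r.
  transitivity ((radius (sp p))^-1 * \sum_i w 0 i * sp p 0 i); last by rewrite w0 mulr0.
  rewrite mulr_sumr; by apply: eq_bigr => i _; rewrite scaleE mulrCA.
by rewrite !H// mulr0 mul0r subrr.
Qed.

Lemma pair_asym4 (b c d e f g : R) (u v : 'rV[R]_4) : pair (asym4 b c d e f g) u v =
  b * (u 0 0 * v 0 1 - u 0 1 * v 0 0) + c * (u 0 0 * v 0 2 - u 0 2 * v 0 0)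
  + d * (u 0 0 * v 0 3 - u 0 3 * v 0 0) + e * (u 0 1 * v 0 2 - u 0 2 * v 0 1)
  + f * (u 0 1 * v 0 3 - u 0 3 * v 0 1) + g * (u 0 2 * v 0 3 - u 0 3 * v 0 2).
Proof.
rewrite /pair [LHS]mxE sum4 ![(_ *m asym4 _ _ _ _ _ _) _ _]mxE !sum4 ![v^T _ _]mxE.
by rewrite ![asym4 _ _ _ _ _ _ _ _]mxE /=; ring.
Qed.

(** On vectors tangent to the sphere and without time component [dt~ + dr] vanishes, so only the
    [mono] part of [formW] survives. [formA], which contains [dr], contributes nothing. *)
Lemma pair_formW_tangent p (u v : 'rV[R]_3) : away p ->
  \sum_i u 0 i * sp p 0 i = 0 -> \sum_i v 0 i * sp p 0 i = 0 ->
  pair (formW B p) (ev 0 u) (ev 0 v) = (radius (sp p) ^+ 2 + a ^+ 2) / radius (sp p) ^+ 3 *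
   (sp p 0 0 * (u 0 1 * v 0 2 - u 0 2 * v 0 1) + sp p 0 1 * (u 0 2 * v 0 0 - u 0 0 * v 0 2)
    + sp p 0 2 * (u 0 0 * v 0 1 - u 0 1 * v 0 0)).
Proof.
move=> Ap u0 v0; have r0 : radius (sp p) != 0 by rewrite gt_eqF.
rewrite /formW pairD !pairZ pair_wedge.
have H (w : 'rV[R]_3) : \sum_i w 0 i * sp p 0 i = 0 -> (ev 0 w *m (cov_dt + cov_dr p)^T) 0 0 = 0.
  move=> w0; rewrite trmxD mulmxDr [LHS]mxE /cov_dt /cov_dr !dot_ev mul0r !add0r.
  rewrite big1 ?add0r => [|i _]; last by rewrite mxE mulr0.
  rewrite mul0r add0r.
  transitivity ((radius (sp p))^-1 * \sum_i w 0 i * sp p 0 i); last by rewrite w0 mulr0.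
  rewrite mulr_sumr; by apply: eq_bigr => i _; rewrite scaleE mulrCA.
rewrite !H// mulr0 mul0r subrr mulr0 addr0.
have -> : pair (asym4 0 0 0 (sp p 0 2 / radius (sp p)) (- (sp p 0 1 / radius (sp p))) (sp p 0 0 / radius (sp p)))
    (ev 0 u) (ev 0 v) = (radius (sp p))^-1 *
   (sp p 0 0 * (u 0 1 * v 0 2 - u 0 2 * v 0 1) + sp p 0 1 * (u 0 2 * v 0 0 - u 0 0 * v 0 2)
    + sp p 0 2 * (u 0 0 * v 0 1 - u 0 1 * v 0 0)).
  rewrite pair_asym4 !evE.
  move: (radius (sp p))^-1 => ri; move: (sp p 0 0) (sp p 0 1) (sp p 0 2) => x y z; ring.
by move: (_ + _ + _) => X; field.
Qed.

Lemma pair_comb (x y c d c' d' : R) (A W : 'M[R]_4) u v :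
  pair (x *: (c *: A + d *: W) + y *: (c' *: A + d' *: W)) u v =
  x * (c * pair A u v + d * pair W u v) + y * (c' * pair A u v + d' * pair W u v).
Proof. by rewrite !(pairD, pairZ). Qed.

Section far_fluxes.
Variables (x y : R).
Local Notation F := (fun p => x *: Fel B p + y *: Fma B p).

Definition far_density r (t : R) : R := (x * (2 * a * r * cos t / (r ^+ 2 + a ^+ 2 * cos t ^+ 2) ^+ 2)
   + y * ((r ^+ 2 - a ^+ 2 * cos t ^+ 2) / (r ^+ 2 + a ^+ 2 * cos t ^+ 2) ^+ 2))
    * ((r ^+ 2 + a ^+ 2) * sin t).

Lemma far_flux_density : exists2 R0 : R, rp < R0 & forall r, R0 < r -> forall q : R * R,
  let X := (r, q.1, q.2) in
  pair (F (emb B 0 (sph X))) (lift_vec B 0 (sph X) (sph_th X)) (lift_vec B 0 (sph X) (sph_ph X)) =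
  far_density r q.1.
Proof.
have [R0 R0p far] := far_slope; exists R0 => // r rR q X.
have r0 : 0 < r by exact: lt_trans (lt_trans (rplus_gt0 hsub) R0p) rR.
have Xr : radius (sph X) = r by rewrite radius_sph// ltW.
have [k kE] := far (sph X) ltac:(by rewrite Xr).
rewrite !(lift_vec_tangent kE) ?sph_th_tangent ?sph_ph_tangent//.
set p := emb B 0 (sph X); have spp : sp p = sph X by exact: sp_ev.
have Ap : away p by rewrite /away /= spp Xr.
have tth : \sum_i sph_th X 0 i * sp p 0 i = 0 by rewrite spp sph_th_tangent.
have tph : \sum_i sph_ph X 0 i * sp p 0 i = 0 by rewrite spp sph_ph_tangent.
rewrite FelE// FmaE// pair_comb pair_formA_tangent// pair_formW_tangent// spp Xr.
rewrite sph_cross /far_density /alpha /beta /SigmaKN spp Xr sum3_ring.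
have sr : sph X 0 0 * sph X 0 0 + sph X 0 1 * sph X 0 1 + sph X 0 2 * sph X 0 2 = r ^+ 2.
  by rewrite -Xr sqr_radius !expr2.
rewrite sr !sphE /= !mulr0 !add0r.
have -> : r * cos q.1 / r = cos q.1 by rewrite mulrAC mulfV ?mul1r// gt_eqF.
have S0 : r ^+ 2 + a ^+ 2 * cos q.1 ^+ 2 != 0.
  by rewrite gt_eqF// ltr_pwDl ?exprn_gt0// mulr_ge0 ?sqr_ge0.
have rn : r != 0 by rewrite gt_eqF.
clearbody X; clear -S0 rn.
move: (r ^+ 2 + a ^+ 2 * cos q.1 ^+ 2) S0 => s s0.
by field; rewrite ?s0 ?rn.
Qed.

Lemma far_density_cont {T : topologicalType} (f : T -> R) r q : 0 < r -> cont q f ->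
  cont q (fun q => far_density r (f q)).
Proof.
move=> r0 c1; have cc := cont_cos c1; have cs := cont_sin c1.
pose S (q : T) := r ^+ 2 + a ^+ 2 * cos (f q) ^+ 2.
have S0 t : S t != 0 by rewrite gt_eqF// ltr_pwDl ?exprn_gt0// mulr_ge0 ?sqr_ge0.
have cS : cont q S by apply: contD; [exact: cont_cst|apply: contM; [exact: cont_cst|exact: contX]].
have cSV : cont q (fun t => (S t ^+ 2)^-1).
  by apply: (@continuousV _ _ (fun t => S t ^+ 2)); [rewrite expf_neq0|exact: contX].
apply: contM; last by apply: contM => //; exact: cont_cst.
apply: contD; apply: contM; try exact: cont_cst; apply: contM => //.
  by apply: contM => //; exact: cont_cst.
by apply: contB; [exact: cont_cst|apply: contM; [exact: cont_cst|exact: contX]].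
Qed.

(** The primitive takes values at the poles that do not depend on [r] or on the spin: the
    coefficient of [x] carries sin(theta) squared, and [Sigma] equals [r^2 + a^2] there. *)
Lemma far_flux_theta r : 0 < r ->
  (\int[leb]_(t in `[0%R, pi]) (far_density r t)%:E)%E = (2 * y)%:E.
Proof.
move=> r0; pose S t := r ^+ 2 + a ^+ 2 * cos t ^+ 2.
have S0 t : S t != 0 by rewrite gt_eqF// ltr_pwDl ?exprn_gt0// mulr_ge0 ?sqr_ge0.
(* The dphi components of the potentials on the sphere: [potential] gives [a r sin^2 / S], and
   [dual_potential] together with the primitive [- cos] of [mono] gives [- (r^2 + a^2) cos / S]. *)
pose P t := (x * a * r * (sin t * sin t) - y * (r ^+ 2 + a ^+ 2) * cos t) * (S t)^-1.
have dS (t : R) : is_derive t 1 S (- (2 * a ^+ 2 * cos t * sin t)).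
  by rewrite /S; apply: is_derive_eq; rewrite /GRing.scale /= ?expr1; ring.
have dSV (t : R) : is_derive t 1 (fun t => (S t)^-1) (2 * a ^+ 2 * cos t * sin t / S t ^+ 2).
  by have := is_deriveV (S0 t) (dS t); rewrite /GRing.scale /= => h; apply: is_derive_eq; field.
have dP (t : R) : 0 <= t <= pi -> is_derive t 1 P (far_density r t).
  move=> _; have d := dSV t; rewrite /P /far_density -!/(S t); apply: is_derive_eq; rewrite /GRing.scale /=.
  have s2 : sin t ^+ 2 = 1 - cos t ^+ 2 by rewrite sin2cos2.
  have h : S t = r ^+ 2 + a ^+ 2 * cos t ^+ 2 by [].
  move: (S t) (S0 t) h => s s0 h.
  transitivity ((x * a * r * (2 * sin t * cos t) * s + y * (r ^+ 2 + a ^+ 2) * sin t * s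
    + (x * a * r * sin t ^+ 2 - y * (r ^+ 2 + a ^+ 2) * cos t) * (2 * a ^+ 2 * cos t * sin t)) / s ^+ 2).
    by field.
  transitivity ((x * (2 * a * r * cos t) + y * (r ^+ 2 - a ^+ 2 * cos t ^+ 2)) * ((r ^+ 2 + a ^+ 2) * sin t) / s ^+ 2).
    by congr (_ / _); rewrite h s2; ring.
  by move: (cos t ^+ 2) => cc; field.
rewrite (integral_derive (pi_ge0 R) dP).
  rewrite /P /S sinpi cospi sin0 cos0; congr (_%:E).
  have k0 : r ^+ 2 + a ^+ 2 != 0 by have := S0 0; rewrite /S cos0 expr1n mulr1.
  rewrite !sqrrN !expr1n !mulr1.
  by move: (r ^+ 2 + a ^+ 2) k0 => k k0; field.
by move=> t _; apply: (far_density_cont (f := id) r0); exact: cvg_id.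
Qed.

Lemma chargeB_stationary (G : 'rV[R]_3 -> 'M[R]_4) :
  (forall y, sdom y -> G y = F (emb B 0 y)) -> chargeB B 0 G = y.
Proof.
move=> GF; have [R0 R0p far] := far_flux_density.
have pi0 : (0 : R) < pi by exact: pi_gt0.
suff H : flux B 0 G r @[r --> +oo%R] --> 4 * pi * y.
  by rewrite /chargeB (cvg_lim _ H)// mulrA mulVf ?mul1r// gt_eqF// mulr_gt0.
apply: cvg_near_cst; near=> r.
have rR : R0 < r by near: r; apply: nbhs_pinfty_gt; exact: num_real.
have r0 : 0 < r by exact: lt_trans (lt_trans (rplus_gt0 hsub) R0p) rR.
rewrite /flux sphere_boxE.
transitivity (\int[(leb \x leb)%E]_(q in box2 0 pi 0 (2 * pi)) far_density r q.1).
  apply: eq_Rintegral => q _ /=; rewrite GF ?far//.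
  by rewrite /slice_dom /= radius_sph ltW// (lt_trans R0p).
rewrite /Rintegral box2_integral21; last first.
  apply: (box2_integrable (U := setT)); [exact: openT|by []|move=> q _; apply: (far_density_cont (f := fst) r0); exact: cvg_fst].
rewrite (eq_integral (cst (2 * y)%:E)); last by move=> z _; exact: far_flux_theta.
rewrite integral_cst//= lebesgue_measure_itv /= lte_fin mulr_gt0// -EFinD -EFinM /=.
by rewrite subr0; ring.
Unshelve. all: by end_near. Qed.

End far_fluxes.

Lemma away_emb s y : sdom y -> away (emb B s y).
Proof. by move=> ys; exact: (ext_away hsub (ext_emb s ys)). Qed.

(** With the orientation chosen for the star this flux is already positive, so the sign in the
    definition of [Fe] is 1; the same computation for the dual field settles the sign of [Fm]. *)
Lemma chargeE_Fel : chargeE B 0 (slice B 0 (Fel B)) = 1.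
Proof. by apply: (@chargeB_stationary 0 1) => z _; rewrite scale1r scale0r add0r. Qed.

Lemma FeE : Fe B = Fel B.
Proof. by apply/funext => p; rewrite /Fe chargeE_Fel sgr1 scale1r. Qed.

Lemma FmE : Fm B = Fma B.
Proof.
apply/funext => p; rewrite /Fm FeE.
have -> : chargeB B 0 (slice B 0 (hodge B (Fel B))) = 1.
  by apply: (@chargeB_stationary 0 1) => z _; rewrite scale1r scale0r add0r.
by rewrite sgr1 scale1r.
Qed.

Lemma FstatE qe qb p : Fstat B qe qb p = qe *: Fel B p + qb *: Fma B p.
Proof. by rewrite /Fstat FeE FmE. Qed.

(** Duality rotates the pair of charges by a right angle. It reduces every statement about the
    electric charge of a stationary field to the magnetic charge of another one. *)
Lemma hodge_Fstat qe qb p : away p ->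
  hodge B (Fstat B qe qb) p = (- qb) *: Fel B p + qe *: Fma B p.
Proof.
move=> Ap; rewrite /hodge FstatE starD !starZ addrC.
by rewrite -/(hodge B (Fel B) p) -/(hodge B (Fma B) p) hodge_Fma// scalerN scaleNr.
Qed.

Lemma chargeB_Fstat qe qb (G : 'rV[R]_3 -> 'M[R]_4) :
  (forall y, sdom y -> G y = Fstat B qe qb (emb B 0 y)) -> chargeB B 0 G = qb.
Proof. by move=> GF; apply: (@chargeB_stationary qe qb) => z zs; rewrite GF// FstatE. Qed.

Lemma chargeE_Fstat qe qb (G : 'rV[R]_3 -> 'M[R]_4) :
  (forall y, sdom y -> G y = Fstat B qe qb (emb B 0 y)) -> chargeE B 0 G = qe.
Proof.
move=> GF; apply: (@chargeB_stationary (- qb) qe) => z zs; rewrite GF//.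
by rewrite -hodge_Fstat//; exact: away_emb.
Qed.

End stationary_charges.

(** * Stationary fields as smooth constrained data *)

Section stationary_data.
Context {R : realType} (B : setting R).
Hypotheses (hsub : subextremal B) (hfol : regular_foliation B) (hmult : redshift_multiplier B).
Local Notation a := (spin B).
Local Notation M := (mass B).
Local Notation Q := (chg B).
Local Notation sdom := (slice_dom B).
Local Notation ext := (exterior B).
Local Notation rp := (rplus B).
Local Notation leb := (@lebesgue_measure R).

Lemma pd_ev (s : R) f (y : 'rV[R]_3) i : differentiable f (ev s y) ->
  pd i (fun y => f (ev s y)) y = pd (lift ord0 i) f (ev s y).
Proof.
move=> df; have E j (z : 'rV[R]_3) : ev s z 0 j = oapp (fun k => z 0 k) s (unlift ord0 j) by rewrite mxE.
have D j : differentiable (fun z : 'rV[R]_3 => ev s z 0 j) y.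
  have [k ->|->] := unliftP ord0 j.
    rewrite (_ : (fun _ => _) = fun z : 'rV[R]_3 => z 0 k); first exact: differentiable_coord.
    by apply/funext => z; rewrite mxE liftK.
  rewrite (_ : (fun _ => _) = fun z : 'rV[R]_3 => s); first exact: differentiable_cst.
  by apply/funext => z; rewrite mxE unlift_none.
rewrite (pd_comp (G := fun y => ev s y))// big_ord_recl.
have -> : pd i (fun q : 'rV[R]_3 => ev s q 0 ord0) y = 0.
  rewrite (_ : (fun _ => _) = fun z : 'rV[R]_3 => s); first exact: pd_cst.
  by apply/funext => z; rewrite mxE unlift_none.
rewrite mul0r add0r (bigD1 i)//= big1 ?addr0 => [|j ji].
  rewrite (_ : (fun _ => _) = fun z : 'rV[R]_3 => z 0 i); first by rewrite pd_coord eqxx mul1r.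
  by apply/funext => z; rewrite mxE liftK.
rewrite (_ : (fun _ => _) = fun z : 'rV[R]_3 => z 0 j).
  by rewrite pd_coord eq_sym (negbTE ji) mul0r.
by apply/funext => z; rewrite mxE liftK.
Qed.

Lemma pd_emb s f (y : 'rV[R]_3) i : smooth_near ext f -> sdom y ->
  pd i (fun y => f (emb B s y)) y =
    slope B s y i * pd 0 f (emb B s y) + pd (lift ord0 i) f (emb B s y).
Proof.
move=> sf ys; have ee := ext_ev s ys.
have sfl : smooth_near ext (fun p => f (leaf_point B p)).
  by apply: smooth_near_comp (smooth_leaf_point hfol) sf => p; exact: ext_leaf_point.
transitivity (pd i (fun y => f (leaf_point B (ev s y))) y).
  by congr (pd i _ y); apply/funext => z; rewrite embE.
rewrite (pd_ev (f := fun p => f (leaf_point B p))); last exact: smooth_near_diff sfl ee.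
rewrite chain_leaf_point// -!embE; have -> : (lift ord0 i != 0 :> 'I_4) by [].
by rewrite mul1r.
Qed.

Lemma pd_slope_sym s (y : 'rV[R]_3) i j : sdom y ->
  pd i (fun y => slope B s y j) y = pd j (fun y => slope B s y i) y.
Proof.
move=> ys; have ee := ext_ev s ys; have sh := smooth_hgt hfol.
rewrite /slope !(pd_ev (f := pd _ (hgt B))); first exact: pd_swap sh ee.
all: exact: (smooth_near_diff (smooth_near_pd _ sh) ee).
Qed.

(** The exterior derivative commutes with the pull-back to the leaf. The derivatives of the slopes
    cancel because they are second derivatives of the height function, and what remains is the
    closedness of [F] evaluated on the frame. *)
Lemma closed_pullback s (F : 'rV[R]_4 -> 'M[R]_4) (y : 'rV[R]_3) : smooth_mx_near ext F ->
  (forall p, (F p)^T = - F p) -> sdom y -> (forall i j k, d2 F i j k (emb B s y) = 0) ->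
  \sum_i pd i (fun z => dual3 (frame B s z) (F (emb B s z)) 0 i) y = 0.
Proof.
move=> sF aF ys cF.
have Fa p i j : F p i j = - F p j i by rewrite -[F p i j]opprK -[in RHS](trmxK (F p)) mxE aF !mxE opprK.
have sl i : differentiable (fun z => slope B s z i) y by exact: smooth_near_diff (smooth_slope hfol s i) ys.
have FD i j : differentiable (fun z => F (emb B s z) i j) y.
  exact: smooth_near_diff (smooth_at_emb hfol s (sF i j)) ys.
have P i j z : pair (F (emb B s z)) (frame B s z i) (frame B s z j) =
    F (emb B s z) (lift ord0 i) (lift ord0 j) + slope B s z i * F (emb B s z) 0 (lift ord0 j)
    - slope B s z j * F (emb B s z) 0 (lift ord0 i).
  have E k (w : 'rV[R]_4) : (w *m (frame B s z k)^T) 0 0 = slope B s z k * w 0 0 + w 0 (lift ord0 k).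
    rewrite mxE big_ord_recl frameE !mxE unlift_none /= mulrC; congr (_ + _).
    rewrite (bigD1 k)//= !mxE liftK /= mxE !eqxx mulr1 big1 ?addr0// => l /negbTE lk.
    by rewrite !mxE liftK /= mxE lk mulr0.
  rewrite /pair E.
  have row i' j' : (frame B s z i' *m F (emb B s z)) 0 j' = slope B s z i' * F (emb B s z) 0 j' + F (emb B s z) (lift ord0 i') j'.
    rewrite [LHS]mxE big_ord_recl frameE [X in X * _ + _]mxE unlift_none /=; congr (_ + _).
    rewrite (bigD1 i')//= [X in X * _]mxE liftK /= mxE !eqxx mul1r big1 ?addr0// => l /negbTE ll.
    by rewrite [X in X * _]mxE liftK /= mxE ll mul0r.
  rewrite !row (Fa _ (lift ord0 i) 0).
  have -> : F (emb B s z) 0 0 = 0.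
    by apply/eqP; rewrite -[_ == 0](@mulrn_eq0 _ _ 2) mulr2n {1}Fa addNr.
  by move: (F _ _ _) (F _ _ _) (F _ _ _) (slope _ _ _ _) (slope _ _ _ _) => f1 f2 f3 s1 s2; ring.
have DP i j k : pd k (fun z => pair (F (emb B s z)) (frame B s z i) (frame B s z j)) y =
    pd k (fun z => F (emb B s z) (lift ord0 i) (lift ord0 j)) y
    + (pd k (fun z => slope B s z i) y * F (emb B s y) 0 (lift ord0 j)
      + slope B s y i * pd k (fun z => F (emb B s z) 0 (lift ord0 j)) y)
    - (pd k (fun z => slope B s z j) y * F (emb B s y) 0 (lift ord0 i)
      + slope B s y j * pd k (fun z => F (emb B s z) 0 (lift ord0 i)) y).
  transitivity (pd k (fun z => F (emb B s z) (lift ord0 i) (lift ord0 j) + slope B s z i * F (emb B s z) 0 (lift ord0 j)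
    - slope B s z j * F (emb B s z) 0 (lift ord0 i)) y).
    by congr (pd k _ y); apply/funext => z; exact: P.
  have DM c i' j' : differentiable (fun z => slope B s z c * F (emb B s z) i' j') y by exact: differentiableM.
  by rewrite pdB ?pdD ?pdM//; apply: differentiableD.
rewrite sum3_ring.
have row0 z : dual3 (frame B s z) (F (emb B s z)) 0 0 = pair (F (emb B s z)) (frame B s z 1) (frame B s z 2) by rewrite row3E.
have row1 z : dual3 (frame B s z) (F (emb B s z)) 0 1 = pair (F (emb B s z)) (frame B s z 2) (frame B s z 0) by rewrite row3E.
have row2 z : dual3 (frame B s z) (F (emb B s z)) 0 2 = pair (F (emb B s z)) (frame B s z 0) (frame B s z 1) by rewrite row3E.
rewrite (funext row0) (funext row1) (funext row2) !DP.
rewrite (pd_slope_sym s 1 0 ys) (pd_slope_sym s 2 0 ys) (pd_slope_sym s 2 1 ys).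
rewrite !(fun i j => pd_emb s _ (sF i j) ys).
have N i j k : pd k (fun q => F q i j) (emb B s y) = - pd k (fun q => F q j i) (emb B s y).
  rewrite -pdN; last by exact: smooth_near_diff (sF j i) (ext_emb s ys).
  by congr (pd k _ _); apply/funext => q; exact: Fa.
have := cF 1 2 3; have := cF 0 1 2; have := cF 0 2 3; have := cF 0 1 3.
rewrite /d2 !lift0E !(N 2 0) !(N 3 0) !(N 3 1).
move: (slope B s y 0) (slope B s y 1) (slope B s y 2) => s0 s1 s2.
clear; move: (pd _ _ y) (pd _ _ y) (pd _ _ y) => a01 a02 a12.
move: (F _ _ _) (F _ _ _) (F _ _ _) => f1 f2 f3.
generalize (pd 0 (fun q : 'rV[R]_4 => F q 1 2) (emb B s y)) (pd 0 (fun q : 'rV[R]_4 => F q 1 3) (emb B s y))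
  (pd 0 (fun q : 'rV[R]_4 => F q 2 3) (emb B s y)) (pd 0 (fun q : 'rV[R]_4 => F q 0 1) (emb B s y))
  (pd 0 (fun q : 'rV[R]_4 => F q 0 2) (emb B s y)) (pd 0 (fun q : 'rV[R]_4 => F q 0 3) (emb B s y)).
generalize (pd 1 (fun q : 'rV[R]_4 => F q 0 2) (emb B s y)) (pd 1 (fun q : 'rV[R]_4 => F q 0 3) (emb B s y))
  (pd 1 (fun q : 'rV[R]_4 => F q 2 3) (emb B s y)) (pd 2 (fun q : 'rV[R]_4 => F q 0 1) (emb B s y))
  (pd 2 (fun q : 'rV[R]_4 => F q 0 3) (emb B s y)) (pd 2 (fun q : 'rV[R]_4 => F q 1 3) (emb B s y))
  (pd 3 (fun q : 'rV[R]_4 => F q 0 1) (emb B s y)) (pd 3 (fun q : 'rV[R]_4 => F q 0 2) (emb B s y))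
  (pd 3 (fun q : 'rV[R]_4 => F q 1 2) (emb B s y)).
move=> b1 b2 b3 b4 b5 b6 b7 b8 b9 c1 c2 c3 c4 c5 c6 h1 h2 h3 h4.
(* Expanding the closedness identity on the frame multiplies its components with a time index by
   slopes. These products are formed beforehand, so the conclusion is linear in the hypotheses. *)
have k1 := congr1 (fun x => s1 * x) h1; have k2 := congr1 (fun x => s0 * x) h2.
have k3 := congr1 (fun x => s2 * x) h3; move: k1 k2 k3 h4; clear; rewrite /= !mulr0 => k1 k2 k3 h4.
by lra.
Qed.

Lemma smooth_Fstat qe qb : smooth_mx_near away (Fstat B qe qb).
Proof.
apply: (smooth_mx_eq open_away _ (F := fun p => qe *: Fel B p + qb *: Fma B p)); first by [].
  by move=> p _; rewrite (FstatE hsub hfol).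
apply: smooth_mxD; apply: smooth_mxZ; try exact: smooth_near_cst.
  exact: smooth_Fel.
exact: smooth_Fma.
Qed.

Lemma comb_tr (c d : R) (A W : 'M[R]_4) : A^T = - A -> W^T = - W -> (c *: A + d *: W)^T = - (c *: A + d *: W).
Proof. by move=> aA aW; rewrite trmxD !trmxZ aA aW !scalerN opprD. Qed.

Lemma Fstat_tr qe qb p : (Fstat B qe qb p)^T = - Fstat B qe qb p.
Proof.
by rewrite (FstatE hsub hfol); apply: comb_tr; [exact: Fel_tr|exact: Fma_tr].
Qed.

Lemma hodge_FstatE qe qb p : away p -> hodge B (Fstat B qe qb) p = Fstat B (- qb) qe p.
Proof. by move=> Ap; rewrite (hodge_Fstat hsub hfol)// (FstatE hsub hfol). Qed.

Lemma d2_Fstat qe qb i j k p : away p -> d2 (Fstat B qe qb) i j k p = 0.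
Proof.
move=> Ap.
have D1 x y : differentiable (fun q => Fel B q x y) p by exact: smooth_near_diff (smooth_Fel B x y) Ap.
have D2 x y : differentiable (fun q => Fma B q x y) p by exact: smooth_near_diff (smooth_Fma B x y) Ap.
have Z c (G : 'rV[R]_4 -> 'M[R]_4) : (forall x y, differentiable (fun q => G q x y) p) ->
    forall x y, differentiable (fun q => (c *: G q) x y) p.
  move=> DG x y; rewrite (_ : (fun _ => _) = fun q => c * G q x y); last by apply/funext => q; rewrite mxE.
  by apply: differentiableM => //; exact: differentiable_cst.
transitivity (d2 (fun p => qe *: Fel B p + qb *: Fma B p) i j k p).
  by congr (d2 _ i j k p); apply/funext => q; rewrite (FstatE hsub hfol).
rewrite d2D; [|exact: Z|exact: Z].
by rewrite !d2Z// d2_Fel// d2_Fma// !mulr0 addr0.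
Qed.

Lemma d2_hodge_Fstat qe qb i j k p : away p -> d2 (hodge B (Fstat B qe qb)) i j k p = 0.
Proof.
move=> Ap; rewrite -[RHS](d2_Fstat (- qb) qe i j k Ap); apply: d2_near.
by apply: filterS (near_away Ap) => q Aq; rewrite hodge_FstatE.
Qed.

Lemma pds_zero (U : set 'rV[R]_4) f w p : open U -> (forall q, U q -> f q = 0) -> U p -> pds w f p = 0.
Proof.
move=> opU f0; elim: w p => [|i w IH] p Up /=; first exact: f0.
rewrite -(pd_cst i 0 p); apply: pd_eq.
have := open_nbhs_nbhs (conj opU Up); apply: filterS => q Uq; exact: IH.
Qed.

Lemma stat_dataE qe qb : stat_data B qe qb = data_of B 0 (slice B 0 (Fstat B qe qb)).
Proof.
rewrite /stat_data /Ue /Um /add_data /scale_data /data_of /slice /=; congr (_, _); apply/funext => z; apply/rowP => i.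
  by rewrite !mx_linE [X in _ = X]mxE [X in qe * X + _]mxE [X in _ + qb * X]mxE /Fstat pairD !pairZ.
rewrite !mx_linE [X in _ = X]mxE [X in qe * X + _]mxE [X in _ + qb * X]mxE /Fstat starD !starZ pairD !pairZ.
by rewrite opprD !mulrN.
Qed.

Lemma smooth_data_of s (F : 'rV[R]_4 -> 'M[R]_4) : smooth_mx_near ext F ->
  smooth_mx_near sdom (data_of B s (slice B s F)).1 /\ smooth_mx_near sdom (data_of B s (slice B s F)).2.
Proof.
move=> sF; have sn := smooth_mx_at_emb hfol s (smooth_normal hsub hfol).
split=> i j.
  apply: (smooth_near_ext (f := fun y => pair (F (emb B s y)) (frame B s y j) (normal B (emb B s y)))).
    by move=> y; rewrite [RHS]mxE.
  by apply: smooth_pair => //; [exact: smooth_mx_at_emb|exact: smooth_frame].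
apply: (smooth_near_ext (f := fun y => - pair (star (kn_metric B (emb B s y)) (F (emb B s y))) (frame B s y j) (normal B (emb B s y)))).
  by move=> y; rewrite [RHS]mxE.
apply: smooth_nearN; apply: smooth_pair => //; last exact: smooth_frame.
apply: (smooth_mx_at_emb hfol s (F := fun p => star (kn_metric B p) (F p))).
apply: smooth_star => //; last exact: smooth_kn_ext.
by move=> p ep; apply: kn_det_lt0; exact: (ext_away hsub ep).
Qed.

Lemma zero_to_boundary3 (f : 'rV[R]_3 -> R) : smooth_near sdom f ->
  (forall y, rp < radius y -> f y = 0) -> forall y, sdom y -> f y = 0.
Proof.
move=> sf f0 y ys.
have := zero_to_boundary hsub (f := fun q => f (sp q)) _ _ (ext_ev 0 ys); rewrite sp_ev; apply.
  move=> q qe; apply: (smooth_near_cont (A := ext)) qe.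
  apply: smooth_near_comp sf; first by [].
  by move=> i j; rewrite (ord1 i); exact: smooth_sp.
by move=> q qi; exact: f0.
Qed.

Lemma open_inner : open [set y : 'rV[R]_3 | rp < radius y].
Proof.
have c : continuous (ev 0 : 'rV[R]_3 -> 'rV[R]_4).
  move=> y; apply: cont_mx => i j; rewrite (ord1 i); have [k ->|->] := unliftP ord0 j.
    apply: (cont_ext (f := fun z : 'rV[R]_3 => z 0 k)); first by move=> z; rewrite mxE liftK.
    exact: coord_continuous.
  apply: (cont_ext (f := fun z : 'rV[R]_3 => 0)); first by move=> z; rewrite mxE unlift_none.
  exact: cont_cst.
have -> : [set y : 'rV[R]_3 | rp < radius y] = (ev 0) @^-1` (interior4 B).
  by apply/seteqP; split=> y; rewrite /interior4 /= sp_ev.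
by apply: open_comp (open_interior4 hsub) => y _; exact: c.
Qed.

(** The pull-back of [F] and the density of [e] are equal only on the closed exterior, so their
    derivatives are compared in its interior and the vanishing of the divergence is extended to the
    horizon by continuity. *)
Lemma divergence_closed (F : 'rV[R]_4 -> 'M[R]_4) (e : 'rV[R]_3 -> 'rV[R]_3) :
  smooth_mx_near ext F -> (forall p, (F p)^T = - F p) ->
  (forall p, ext p -> forall i j k, d2 F i j k p = 0) -> smooth_mx_near sdom e ->
  (forall y, sdom y -> dual3 (frame B 0 y) (F (emb B 0 y)) = densitized B 0 e y) ->
  forall y, sdom y -> divergence B 0 e y = 0.
Proof.
move=> sF aF cF se FE y ys; have sd := smooth_densitized hsub hfol 0 se.
suff : \sum_i pd i (fun z => densitized B 0 e z 0 i) y = 0.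
  move=> d0; rewrite /divergence; apply/eqP; rewrite mulf_eq0; apply/orP; right; apply/eqP.
  rewrite -[RHS]d0; apply: eq_bigr => i _; congr (pd i _ y).
  by apply/funext => z; rewrite scaleE.
move: y ys; apply: zero_to_boundary3.
  by apply: smooth_near_sum => i; apply: smooth_near_pd; exact: sd.
move=> y yi; have ys : sdom y by exact: ltW.
rewrite -[RHS](closed_pullback (s := 0) sF aF ys (cF _ (ext_emb 0 ys))).
apply: eq_bigr => i _; apply: pd_eq.
have := open_nbhs_nbhs (conj open_inner yi); apply: filterS => z zi.
by rewrite FE//; exact: ltW.
Qed.

(** The constraint on the magnetic part is the closedness of the field. The constraint on the
    electric part is the closedness of its dual, which is the stationary field with charges
    [(- qb, qe)]. *)
Lemma smooth_stat_data qe qb : smooth_data B (stat_data B qe qb).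
Proof.
have sF x y := smooth_mx_sub (ext_away hsub) (smooth_Fstat x y).
have [s1 s2] := smooth_data_of 0 (sF qe qb).
rewrite stat_dataE; split=> // y ys; split; move: y ys.
- apply: (divergence_closed (sF (- qb) qe)) => //; first exact: Fstat_tr.
    by move=> p ep i j k; apply: d2_Fstat; exact: (ext_away hsub ep).
  move=> y ys; rewrite -hodge_FstatE; last exact: (ext_away hsub (ext_emb 0 ys)).
  by apply: (dual3_star_data hsub hfol 0 ys (G := slice B 0 (Fstat B qe qb))); exact: Fstat_tr.
- apply: (divergence_closed (sF qe qb)) => //; first exact: Fstat_tr.
    by move=> p ep i j k; apply: d2_Fstat; exact: (ext_away hsub ep).
  move=> y ys.
  by apply: (dual3_data hsub hfol 0 ys (G := slice B 0 (Fstat B qe qb))); exact: Fstat_tr.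
Qed.

Lemma prolongs_stat_data qe qb : prolongs B (stat_data B qe qb) (Fstat B qe qb).
Proof.
have sub : leaf B 0 `<=` away by move=> p [ep _]; exact: (ext_away hsub ep).
split.
- exact: Fstat_tr.
- exact: smooth_mx_sub sub (smooth_Fstat qe qb).
- by move=> y ys; rewrite stat_dataE.
- move=> w i j k p lp; split; apply: (pds_zero (U := away)) (sub _ lp).
  + exact: open_away.
  + by move=> q Aq; exact: d2_Fstat.
  + exact: open_away.
  + by move=> q Aq; exact: d2_hodge_Fstat.
Qed.

Lemma field_of_stat_data qe qb y : sdom y ->
  field_of B 0 (stat_data B qe qb) y = Fstat B qe qb (emb B 0 y).
Proof.
move=> ys; rewrite stat_dataE (field_of_data_of hsub hfol 0 ys)//; exact: Fstat_tr.
Qed.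

End stationary_data.

(** * Bounds in the far region *)

Section bounded_functions.
Context {R : realType} (B : setting R) (R2 : R).
Hypotheses (R20 : 0 < R2).
Local Notation a := (spin B).
Local Notation M := (mass B).
Local Notation Q := (chg B).

Definition far (p : 'rV[R]_4) : Prop := R2 <= radius (sp p).
(** Bounded functions on the far region form an algebra, so the closure lemmas for [Pmx] apply.
    Decay is expressed by boundedness after multiplication by a power of the radius. *)
Definition bd (f : 'rV[R]_4 -> R) : Prop := exists C, forall p, far p -> `|f p| <= C.

Lemma bd_cst (c : R) : bd (fun=> c). Proof. by exists `|c|. Qed.
Lemma bdD f g : bd f -> bd g -> bd (fun p => f p + g p).
Proof.
move=> [C HC] [D HD]; exists (C + D) => p fp.
by apply: le_trans (ler_normD _ _) _; apply: lerD; [exact: HC|exact: HD].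
Qed.
Lemma bdM f g : bd f -> bd g -> bd (fun p => f p * g p).
Proof.
move=> [C HC] [D HD]; exists (C * D) => p fp; rewrite normrM.
by apply: ler_pM => //; [exact: HC|exact: HD].
Qed.
Lemma bd_ext f g : (forall p, far p -> f p = g p) -> bd f -> bd g.
Proof. by move=> fg [C HC]; exists C => p fp; rewrite -fg//; exact: HC. Qed.
Lemma bdN f : bd f -> bd (fun p => - f p).
Proof. by move=> [C HC]; exists C => p fp; rewrite normrN; exact: HC. Qed.
Lemma bdX f k : bd f -> bd (fun p => f p ^+ k).
Proof.
move=> bf; elim: k => [|k IH]; first exact: bd_cst.
by apply: bd_ext (bdM bf IH) => p _; rewrite exprS.
Qed.

Lemma bdmx_ext k l (F G : 'rV[R]_4 -> 'M[R]_(k, l)) : (forall p, far p -> F p = G p) ->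
  Pmx bd F -> Pmx bd G.
Proof. by move=> FG bF i j; apply: bd_ext (bF i j) => p fp; rewrite FG. Qed.

Lemma bd_row4 f0 f1 f2 f3 : bd f0 -> bd f1 -> bd f2 -> bd f3 ->
  Pmx bd (fun p => row4 (f0 p) (f1 p) (f2 p) (f3 p)).
Proof.
move=> b0 b1 b2 b3 i; rewrite (ord1 i); apply: ord4P.
- by apply: bd_ext b0 => p _; rewrite row4E.
- by apply: bd_ext b1 => p _; rewrite row4E.
- by apply: bd_ext b2 => p _; rewrite row4E.
- by apply: bd_ext b3 => p _; rewrite row4E.
Qed.

Lemma bd_wedge u v : Pmx bd u -> Pmx bd v -> Pmx bd (fun p => wedge (u p) (v p)).
Proof.
move=> bu bv; apply: (PmxB bd_cst bdD bdM); apply: (PmxM bd_cst bdD bdM) => //; exact: PmxT.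
Qed.

Lemma bd_det k (F : 'rV[R]_4 -> 'M[R]_k) : Pmx bd F -> bd (fun p => \det (F p)).
Proof.
move=> bF; apply: (P_sum bd_cst bdD) => s; apply: bdM; first exact: bd_cst.
have H (I : Type) (t : seq I) (G : I -> 'rV[R]_4 -> R) : (forall i, bd (G i)) -> bd (fun p => \prod_(i <- t) G i p).
  move=> bG; elim: t => [|i t IH]; first by apply: bd_ext (bd_cst 1) => p _; rewrite big_nil.
  by apply: bd_ext (bdM (bG i) IH) => p _; rewrite big_cons.
by apply: (H) => i.
Qed.

Lemma far_away p : far p -> away p. Proof. exact: lt_le_trans. Qed.

Lemma norm_coord (y : 'rV[R]_3) i : `|y 0 i| <= radius y.
Proof.
rewrite -sqrtr_sqr /radius; apply: ler_wsqrtr; rewrite (bigD1 i)//= lerDl.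
by apply: sumr_ge0 => j _; exact: sqr_ge0.
Qed.

Lemma bd_dir i : bd (fun p => sp p 0 i / radius (sp p)).
Proof.
exists 1 => p fp; have r0 := far_away fp.
by rewrite normrM normfV [`|radius _|]gtr0_norm// ler_pdivrMr// mul1r norm_coord.
Qed.

Lemma bd_rV : bd (fun p => (radius (sp p))^-1).
Proof.
exists R2^-1 => p fp; have r0 := far_away fp.
by rewrite normfV gtr0_norm// lef_pV2 ?posrE.
Qed.

Lemma bd_row_dr : Pmx bd (fun p => cov_dr p).
Proof.
apply: bdmx_ext (bd_row4 (bd_cst 0) (bd_dir 0) (bd_dir 1) (bd_dir 2)) => p fp.
by rewrite cov_drE.
Qed.

Lemma bd_u0 : bd (fun p => sp p 0 0 / radius (sp p) + a * (sp p 0 1 / radius (sp p)) / radius (sp p)).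
Proof.
apply: bdD; first exact: bd_dir.
by apply: bdM bd_rV; apply: bdM; [exact: bd_cst|exact: bd_dir].
Qed.
Lemma bd_u1 : bd (fun p => sp p 0 1 / radius (sp p) - a * (sp p 0 0 / radius (sp p)) / radius (sp p)).
Proof.
apply: bdD; first exact: bd_dir.
by apply: bdN; apply: bdM bd_rV; apply: bdM; [exact: bd_cst|exact: bd_dir].
Qed.

Lemma bd_row_u : Pmx bd (fun p => cov_dr p - a *: cov_phi p).
Proof.
apply: bdmx_ext (bd_row4 (bd_cst 0) bd_u0 bd_u1 (bd_dir 2)) => p fp.
by rewrite (cov_uE B (far_away fp)).
Qed.

Lemma bd_row_l : Pmx bd (cov_l B).
Proof.
apply: bdmx_ext (bd_row4 (bd_cst 1) bd_u0 bd_u1 (bd_dir 2)) => p fp.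
by rewrite (cov_lE B (far_away fp)).
Qed.

Local Notation r p := (radius (sp p)).
Local Notation S p := (SigmaKN B (sp p)).

Lemma S_ge p : r p ^+ 2 <= S p.
Proof. by rewrite /SigmaKN lerDl mulr_ge0 ?sqr_ge0. Qed.

Lemma bd_Sr : bd (fun p => S p / r p ^+ 2).
Proof.
have b : bd (fun p => 1 + a ^+ 2 * (sp p 0 2 / r p) ^+ 2 * (r p)^-1 ^+ 2).
  apply: bdD; first exact: bd_cst.
  by apply: bdM; [apply: bdM; [exact: bd_cst|exact: bdX (bd_dir 2)]|exact: bdX bd_rV].
apply: bd_ext b => p fp; have r0 := far_away fp.
rewrite /SigmaKN; move: (sp p 0 2 / r p) => x; have rn : r p != 0 by rewrite gt_eqF.
by rewrite mulrDl mulfV ?expf_neq0// exprVn.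
Qed.

Lemma bd_rS : bd (fun p => r p ^+ 2 / S p).
Proof.
exists 1 => p fp; have r0 := far_away fp; have s0 : 0 < S p by exact: SigmaKN_gt0.
rewrite ger0_norm; last by rewrite divr_ge0 ?sqr_ge0// ltW.
by rewrite ler_pdivrMr// mul1r S_ge.
Qed.

Lemma bd_H : bd (fun p => (2 * M * r p - Q ^+ 2) / S p).
Proof.
have b : bd (fun p => (2 * M * (r p)^-1 - Q ^+ 2 * (r p)^-1 ^+ 2) * (r p ^+ 2 / S p)).
  apply: bdM bd_rS; apply: bdD; first by apply: bdM; [exact: bd_cst|exact: bd_rV].
  by apply: bdN; apply: bdM; [exact: bd_cst|exact: bdX bd_rV].
apply: bd_ext b => p fp; have r0 := far_away fp; have s0 : 0 < S p by exact: SigmaKN_gt0.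
by move: (S p) s0 => s s0; field; rewrite !gt_eqF.
Qed.

Lemma bd_outer (u v : 'rV[R]_4 -> 'rV[R]_4) : Pmx bd u -> Pmx bd v -> Pmx bd (fun p => (u p)^T *m v p).
Proof. by move=> bu bv; apply: (PmxM bd_cst bdD bdM) => //; exact: PmxT. Qed.

Lemma bdmx_cst k l (F : 'M[R]_(k, l)) : Pmx bd (fun=> F).
Proof. by move=> i j; exact: bd_cst. Qed.

Lemma bd_kn : Pmx bd (kn_metric B).
Proof.
have bD := @PmxD R _ bd bdD 4 4; have bN := @PmxN R _ bd bd_cst bdM 4 4.
have bZ := @PmxZ R _ bd bdM 4 4.
rewrite /kn_metric; apply: (bD); [apply: (bD); [apply: (bD)|]|].
- by apply: (bN); exact: bdmx_cst.
- by apply: bd_outer; exact: bd_row_u.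
- apply: (bZ); first exact: bd_Sr.
  apply: (bD); first exact: bdmx_cst.
  by apply: (bN); apply: bd_outer; exact: bd_row_dr.
- by apply: (bZ); [exact: bd_H|apply: bd_outer; exact: bd_row_l].
Qed.

(** The cofactor formula: the adjugate is polynomial in bounded entries, and the determinant
    [- (S / r^2)^2] is bounded away from 0 because [S] is at least [r^2]. *)
Lemma bd_inv_kn : Pmx bd (fun p => invmx (kn_metric B p)).
Proof.
have bZ := @PmxZ R _ bd bdM 4 4.
have b : Pmx bd (fun p => (- (r p ^+ 2 / S p) ^+ 2) *: \adj (kn_metric B p)).
  apply: (bZ); first by apply: bdN; exact: bdX bd_rS.
  move=> i j; apply: (bd_ext (f := fun p => (-1) ^+ (j + i) * \det (row' j (col' i (kn_metric B p))))).
    by move=> p _; rewrite [RHS]mxE.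
  apply: bdM; first exact: bd_cst.
  apply: bd_det => k l; apply: bd_ext (bd_kn (lift j k) (lift i l)) => p _.
  by rewrite [RHS]mxE [RHS]mxE.
apply: bdmx_ext b => p fp; have r0 := far_away fp; have s0 : 0 < S p by exact: SigmaKN_gt0.
rewrite /invmx (kn_unit B r0) (kn_det B r0); congr (_ *: _).
by move: (S p) s0 => s s0; field; rewrite !gt_eqF.
Qed.

(** The sum of the squares of [alpha] and [beta] is [S^-2], hence at most [r^-4]. *)
Lemma bd_r2alpha : bd (fun p => r p ^+ 2 * alpha B p) /\ bd (fun p => r p ^+ 2 * beta B p).
Proof.
have H p : far p -> (r p ^+ 2 * alpha B p) ^+ 2 + (r p ^+ 2 * beta B p) ^+ 2 <= 1.
  move=> fp; have r0 := far_away fp; have s0 : 0 < S p by exact: SigmaKN_gt0.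
  have E (u v w : R) : (w * u) ^+ 2 + (w * v) ^+ 2 = w ^+ 2 * (u ^+ 2 + v ^+ 2) by ring.
  rewrite E (alpha_beta B r0) -exprVn -exprMn.
  have q0 : 0 <= r p ^+ 2 / S p by rewrite divr_ge0 ?sqr_ge0// ltW.
  by rewrite exprn_ile1// ler_pdivrMr// mul1r S_ge.
split; exists 1 => p fp; have := H p fp; move: (_ * alpha _ _) (_ * beta _ _) => x y h.
  by rewrite -(@ler_sqr _ `|x|) ?nnegrE// real_normK ?num_real// expr1n; apply: le_trans h; rewrite lerDl sqr_ge0.
by rewrite -(@ler_sqr _ `|y|) ?nnegrE// real_normK ?num_real// expr1n; apply: le_trans h; rewrite lerDr sqr_ge0.
Qed.

Lemma bd_formA : Pmx bd (formA B).
Proof. by apply: bd_wedge; [exact: bd_row_l|exact: bd_row_dr]. Qed.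

Lemma bd_asym4 (f1 f2 f3 f4 f5 f6 : 'rV[R]_4 -> R) : bd f1 -> bd f2 -> bd f3 -> bd f4 -> bd f5 -> bd f6 ->
  Pmx bd (fun p => asym4 (f1 p) (f2 p) (f3 p) (f4 p) (f5 p) (f6 p)).
Proof.
move=> b1 b2 b3 b4 b5 b6 i j.
apply: (bd_ext (f := fun p => (nth [::] [:: [:: 0; f1 p; f2 p; f3 p]; [:: - f1 p; 0; f4 p; f5 p];
  [:: - f2 p; - f4 p; 0; f6 p]; [:: - f3 p; - f5 p; - f6 p; 0]] i)`_j)).
  by move=> p _; rewrite [RHS]mxE.
have b0 := bd_cst 0.
by move: i j; apply: ord4P; apply: ord4P => //=; exact: bdN.
Qed.

Lemma bd_formW : Pmx bd (formW B).
Proof.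
have bD := @PmxD R _ bd bdD 4 4; have bZ := @PmxZ R _ bd bdM 4 4.
rewrite /formW; apply: (bD).
  have b : Pmx bd (fun p => (1 + a ^+ 2 * (r p)^-1 ^+ 2) *: asym4 0 0 0 (sp p 0 2 / r p) (- (sp p 0 1 / r p)) (sp p 0 0 / r p)).
    apply: (bZ).
      by apply: bdD; [exact: bd_cst|apply: bdM; [exact: bd_cst|exact: bdX bd_rV]].
    by apply: bd_asym4; rewrite //=; try exact: bd_cst; try exact: bd_dir; exact: bdN (bd_dir 1).
  apply: bdmx_ext b => p fp; have r0 := far_away fp; have rn : r p != 0 by rewrite gt_eqF.
  by rewrite /mono scalerA; congr (_ *: _); rewrite mulrDl mulfV ?expf_neq0// exprVn.
apply: (bZ); first exact: bd_cst.
apply: bd_wedge; last first.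
  by apply: (@PmxD R _ bd bdD 1 4); [exact: bdmx_cst|exact: bd_row_dr].
apply: bd_row4; first exact: bd_cst.
- by apply: bdM bd_rV; apply: bdN; apply: bdM; exact: bd_dir.
- by apply: bdM bd_rV; apply: bdN; apply: bdM; exact: bd_dir.
- apply: bdM bd_rV; apply: bdD; [exact: bd_cst|apply: bdN; apply: bdM; exact: bd_dir].
Qed.

Lemma bd_stationary (x y : R) : Pmx bd (fun p => r p ^+ 2 *: (x *: Fel B p + y *: Fma B p)).
Proof.
have bD := @PmxD R _ bd bdD 4 4; have bZ := @PmxZ R _ bd bdM 4 4.
have [bA bB] := bd_r2alpha.
have b : Pmx bd (fun p => (- x * (r p ^+ 2 * alpha B p) + y * (r p ^+ 2 * beta B p)) *: formA B p
   + (x * (r p ^+ 2 * beta B p) + y * (r p ^+ 2 * alpha B p)) *: formW B p).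
  by apply: (bD); apply: (bZ); rewrite ?[Pmx _ _]/(Pmx _ _); try exact: bd_formA; try exact: bd_formW;
    apply: bdD; apply: bdM => //; exact: bd_cst.
apply: bdmx_ext b => p fp; have r0 := far_away fp; rewrite (FelE B r0) (FmaE B r0).
move: (formA B p) (formW B p) (alpha B p) (beta B p) (r p ^+ 2) => A W al be r2.
by apply/matrixP => i j; rewrite !mx_linE; ring.
Qed.

End bounded_functions.

(** * Finite energy of the stationary fields *)

Section finite_energy_of_stationary_fields.
Context {R : realType} (B : setting R).
Hypotheses (hsub : subextremal B) (hfol : regular_foliation B) (hmult : redshift_multiplier B).
Local Notation sdom := (slice_dom B).
Local Notation rp := (rplus B).
Local Notation leb := (@lebesgue_measure R).
Variables (qe qb : R).
Local Notation F := (Fstat B qe qb).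
Local Notation G := (fun y => F (emb B 0 y)).

(** The energy is quadratic, so rescaling the field by [r^2] to a bounded one extracts [r^-4]. The
    rest is bounded: far out the multiplier is [T], and the volume density times the normal is
    rational in the metric and [dtau]. *)
Lemma far_energy_bound : exists R2 C : R, [/\ rp < R2, 0 <= C & forall y, R2 <= radius y ->
  vol_density B 0 y * energy_density B 0 y (G y) <= C * ((radius y)^-1 ^+ 4)].
Proof using hsub hfol hmult.
have [R0 [Ck [R0p Ck0 tau_far]]] := far_dtau hsub hfol.
have [_ _ [R1 T1] _] := hmult.
(* Strictly beyond [R0], where the expansion of [dtau] is available, and at least [R1], from where
   the multiplier is [T]. *)
pose R2 : R := Num.max (R0 + 1) R1.
have R02 : R0 < R2 by rewrite lt_max ltrDl ltr01.
have R12 : R1 <= R2 by rewrite le_max lexx orbT.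
have Rp2 : rp < R2 by exact: lt_trans R02.
have R20 : 0 < R2 by exact: lt_trans (rplus_gt0 hsub) Rp2.
clearbody R2.
have bdt : Pmx (bd R2) (dtau B).
  have [C1 HC1] : exists C, forall j p, R2 <= radius (sp p) -> `|cov_dr p 0 j| <= C.
    have b j := bd_row_dr R20 0 j.
    have [c0 h0] := b 0; have [c1 h1] := b 1; have [c2 h2] := b 2; have [c3 h3] := b 3.
    exists (`|c0| + `|c1| + `|c2| + `|c3|); apply: ord4P => p fp.
    - apply: le_trans (h0 p fp) _; have := ler_norm c0; move: (normr_ge0 c1) (normr_ge0 c2) (normr_ge0 c3).
      by clear; move: `|c0| `|c1| `|c2| `|c3| => n0 n1 n2 n3 *; lra.
    - apply: le_trans (h1 p fp) _; have := ler_norm c1; move: (normr_ge0 c0) (normr_ge0 c2) (normr_ge0 c3).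
      by clear; move: `|c0| `|c1| `|c2| `|c3| => n0 n1 n2 n3 *; lra.
    - apply: le_trans (h2 p fp) _; have := ler_norm c2; move: (normr_ge0 c1) (normr_ge0 c0) (normr_ge0 c3).
      by clear; move: `|c0| `|c1| `|c2| `|c3| => n0 n1 n2 n3 *; lra.
    - apply: le_trans (h3 p fp) _; have := ler_norm c3; move: (normr_ge0 c1) (normr_ge0 c2) (normr_ge0 c0).
      by clear; move: `|c0| `|c1| `|c2| `|c3| => n0 n1 n2 n3 *; lra.
  move=> i j; rewrite (ord1 i); exists (`|cov_dt 0 j| + Ck * C1) => p fp.
  have [k kE kC] := tau_far p (lt_le_trans R02 fp).
  rewrite kE !mx_linE; apply: le_trans (ler_normD _ _) _; apply: lerD => //.
  by rewrite normrM; apply: ler_pM => //; exact: HC1.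
(* This is the volume density times the energy density of the rescaled field, with the volume
   density times the normal replaced by its value from [vol_density_normal]; the time component of
   [dtau] is 1 here. *)
have bE : bd R2 (fun p => - (SigmaKN B (sp p) / radius (sp p) ^+ 2) *
   pair (stress (kn_metric B p) (radius (sp p) ^+ 2 *: (qe *: Fel B p + qb *: Fma B p)))
     (Tfield p) (dtau B p *m invmx (kn_metric B p))).
  have b0 : bd R2 (fun p => SigmaKN B (sp p) / radius (sp p) ^+ 2) by exact: bd_Sr.
  have b1 : bd R2 (fun p => - (SigmaKN B (sp p) / radius (sp p) ^+ 2)) by apply: (bdN b0).
  apply: (bdM b1).
  apply: (P_pair (@bd_cst _ R2) (@bdD _ R2) (@bdM _ R2)).
  - apply: (P_stress (@bd_cst _ R2) (@bdD _ R2) (@bdM _ R2)); [exact: bd_kn|exact: bd_inv_kn|exact: bd_stationary].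
  - exact: bdmx_cst.
  - by apply: (PmxM (@bd_cst _ R2) (@bdD _ R2) (@bdM _ R2)) => //; exact: bd_inv_kn.
have [C HC] := bE; exists R2, `|C|; split=> // y yr.
have ys : sdom y by exact: le_trans (ltW Rp2) yr.
have r0 : 0 < radius y by exact: lt_le_trans R20 yr.
have fp : far R2 (emb B 0 y) by rewrite /far sp_ev.
have := HC _ fp; have Ap := ext_away hsub (ext_emb 0 ys).
rewrite -(FstatE hsub hfol) -(kn_sqrt_det B Ap) sp_ev.
have t1 : dtau B (emb B 0 y) 0 0 = 1.
  have [k -> _] := tau_far _ (lt_le_trans R02 fp).
  by rewrite !mx_linE /cov_dr evE mulr0 addr0 cov_dtE row4E.
have V := vol_density_normal hsub hfol 0 ys; rewrite t1 divr1 in V.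
rewrite -pairZr -V pairZr -(T1 _ (le_trans R12 fp)).
rewrite -/(energy_density B 0 y (radius y ^+ 2 *: F (emb B 0 y))) energy_densityZ.
move=> h; have {}h := le_trans (ler_norm _) (le_trans h (ler_norm C)).
rewrite exprVn ler_pdivlMr ?exprn_gt0//; apply: le_trans h.
by rewrite -exprM [leRHS]mulrCA mulrC.
Qed.

Lemma near_energy_bound (R2 : R) : rp <= R2 -> exists2 C : R, 0 <= C & forall q,
  box3 rp R2 0 pi 0 (2 * pi) q -> `|energy_integrand B G q| <= C.
Proof using hsub hfol hmult.
move=> rR; apply: (continuous_on_compact_bound (f := energy_integrand B G) (@box3_compact R rp R2 0 pi 0 (2 * pi))) => q hb.
have ys : sdom (sph q).
  case: hb => -[/=]; rewrite in_itv /= => /andP[h _] _ _; case: q h => -[x y] z /= h.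
  by rewrite /slice_dom /= radius_sph// (le_trans (ltW (rplus_gt0 hsub))).
pose P := @cont R _ q.
have Ps f : smooth_near sdom f -> P (fun q => f (sph q)) by move=> sf; exact: smooth_cont_sph sf ys.
have sF := smooth_mx_sub (ext_away hsub) (smooth_Fstat hsub hfol qe qb).
have PG : Pmx P (fun q => F (emb B 0 (sph q))).
  by move=> i j; apply: (Ps (fun y => F (emb B 0 y) i j)); exact: (smooth_mx_at_emb hfol 0 sF).
have PE := P_energy hsub hfol (P := P) (@cont_cst _ _ ^~ q) (fun f g => @contD _ _ f g q)
  (fun f g => @contM _ _ f g q) Ps 0 hmult PG.
apply: (contM PE); apply: contM; last by apply: cont_sin; exact: cont_2.
by apply: contM; [exact: (Ps _ (smooth_vol_density hsub hfol 0))|apply: contX; exact: cont_1].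
Qed.

Lemma energy_integrand_decay : exists2 C : R, 0 <= C & forall q, ext_sph B q ->
  energy_integrand B G q <= C * (q.1.1)^-1 ^+ 2.
Proof using hsub hfol hmult.
have [R2 [C [Rp2 C0 HC]]] := far_energy_bound.
have [D D0 HD] := near_energy_bound (ltW Rp2).
have R20 : 0 < R2 by exact: lt_trans (rplus_gt0 hsub) Rp2.
(* [D] bounds the integrand up to radius [R2], where [R2^2 / r^2] is at least 1; [C] comes from the
   far region, where the weight [r^2] turns [r^-4] into [r^-2]. *)
exists (C + D * R2 ^+ 2); first by rewrite addr_ge0// mulr_ge0// sqr_ge0.
move=> q hq; have [r0 rr s0 ys] := ext_sphP hsub hq.
have rq : radius (sph q) = q.1.1 by case: (q) r0 => -[x y] z /= x0; rewrite radius_sph// ltW.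
rewrite mulrDl; have [h|h] := lerP q.1.1 R2.
  apply: ler_wpDl; first by rewrite mulr_ge0// sqr_ge0.
  apply: (@le_trans _ _ D).
    apply: le_trans (ler_norm _) _; apply: HD; move: hq h; case: (q) rr => -[x y] z /= rr [/= _ hy hz] h.
    by split; [split|]; rewrite /= in_itv /= ?rr.
  rewrite -mulrA -exprMn ler_peMr// exprn_ege1//.
  by rewrite ler_pdivlMr// mul1r.
apply: ler_wpDr; first by apply: mulr_ge0; [apply: mulr_ge0 => //|]; exact: sqr_ge0.
have s1 := sin_le1 q.1.2.
have := HC (sph q); rewrite rq => /(_ (ltW h)) {}HC.
have E0 : 0 <= energy_density B 0 (sph q) (G (sph q)).
  by apply: energy_density_ge0 => //; exact: Fstat_tr.
have V0 := ltW (vol_density_gt0 hsub hfol 0 ys).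
rewrite /energy_integrand; move: HC E0 V0; rewrite exprVn exprVn.
move: (energy_density _ _ _ _) (vol_density _ _ _) (sin _) s0 s1 (q.1.1) r0 => E V s s0 s1 r r0 HC E0 V0.
have rn : r != 0 by rewrite gt_eqF.
apply: (@le_trans _ _ (V * E * r ^+ 2)).
  rewrite [leRHS](_ : _ = E * (V * r ^+ 2) * 1); last by ring.
  by rewrite mulrA; apply: ler_wpM2l => //; apply: mulr_ge0 => //; apply: mulr_ge0 => //; exact: sqr_ge0.
apply: le_trans (ler_wpM2r (sqr_ge0 r) HC) _.
by rewrite le_eqVlt; apply/orP; left; apply/eqP; field.
Qed.

Lemma integral_inv_sqr : (\int[leb]_(x in `[rp, +oo[) (x^-1 ^+ 2)%:E < +oo)%E.
Proof using hsub.
have rp0 := rplus_gt0 hsub.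
have D (x : R) : rp <= x -> is_derive x 1 (fun x => - x^-1) (x^-1 ^+ 2).
  move=> xr; have x0 : x != 0 by rewrite gt_eqF// (lt_le_trans rp0).
  have h := is_deriveV (f := id) x0 (is_derive_id x 1).
  by apply: is_derive_eq; rewrite /GRing.scale /= mulr1 opprK exprVn.
rewrite (@ge0_continuous_FTC2y R (fun x => x^-1 ^+ 2) (fun x => - x^-1) rp 0).
- by rewrite -EFinB ltry.
- by move=> x _; exact: sqr_ge0.
- apply: continuous_in_subspaceT => x; rewrite inE /= in_itv /= andbT => xr.
  have x0 : x != 0 by rewrite gt_eqF// (lt_le_trans rp0).
  by apply: (contX (f := fun x : R => x^-1)); apply: inv_continuous.
- rewrite -oppr0; apply: cvgN; apply/gtr0_cvgV0; last exact: cvg_id.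
  by near=> x; near: x; apply: nbhs_pinfty_gt; exact: num_real.
- by move=> x /ltW xr; have [] := D x xr.
- have cF : {for rp, continuous (fun x : R => - x^-1)}.
    by have [h _] := D rp (lexx _); apply: differentiable_continuous; exact/derivable1_diffP.
  by apply: cvg_at_right_filter; exact: cF.
- move=> x; rewrite in_itv /= andbT => /ltW xr; rewrite derive1E.
  by have [_ ->] := D x xr.
Unshelve. all: by end_near. Qed.

(** The measure is Lebesgue measure in the coordinates [(r, theta, phi)], the weight having been
    absorbed in the integrand, so the angles contribute the constant [2 pi^2]. *)
Lemma integral_ext_sph (f : R -> R) : (forall x, 0 <= f x) -> measurable_fun `[rp, +oo[%classic f ->
  (\int[mu3]_(q in ext_sph B) (f q.1.1)%:E =
   \int[leb]_(x in `[rp, +oo[) ((pi * (2 * pi))%:E * (f x)%:E))%E.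
Proof using B.
move=> f0 mf.
have pi0 : 0 < pi :> R := pi_gt0 R.
have pi2 : 0 < 2 * pi :> R by rewrite mulr_gt0.
have mrp : measurable (`[rp, +oo[%classic : set R) by exact: measurable_itv.
have setE : ext_sph B = (`[rp, +oo[%classic `*` `[0, pi]%classic) `*` `[0, 2 * pi]%classic.
  rewrite /ext_sph sph_dom_prod; congr ((_ `*` _) `*` _).
  by apply/seteqP; split=> r /=; rewrite in_itv /= andbT.
rewrite setE.
have mA : measurable (`[rp, +oo[%classic `*` `[0, pi]%classic : set (R * R)).
  by apply: measurableX => //; exact: measurable_itv.
have m11 : measurable_fun ((`[rp, +oo[%classic `*` `[0, pi]%classic) `*` `[0, 2 * pi]%classic : set (R * R * R))
    (fun q : R * R * R => (f q.1.1)%:E).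
  apply/measurable_EFinP.
  apply: (measurable_comp (F := `[rp, +oo[%classic) (f := f) (g := fun q : R * R * R => q.1.1)) => //.
    by move=> x [q [[/= h _] _] <-].
  by apply: measurable_funTS; apply: (measurableT_comp (f := fst) (g := fst)); exact: measurable_fst.
have m1 : measurable_fun (`[rp, +oo[%classic `*` `[0, pi]%classic : set (R * R))
    (fun q : R * R => ((2 * pi)%:E * (f q.1)%:E)%E).
  apply: measurable_funeM; apply/measurable_EFinP.
  apply: (measurable_comp (F := `[rp, +oo[%classic) (f := f) (g := fun q : R * R => q.1)) => //.
    by move=> x [q [/= h _] <-].
  by apply: measurable_funTS; exact: measurable_fst.
transitivity (\int[(leb \x leb)%E]_(q in `[rp, +oo[%classic `*` `[0%R, pi]%classic) ((2 * pi)%:E * (f q.1)%:E))%E.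
  have H := @box_tonelli12 _ _ _ _ R (product_sf leb leb) leb _ `[0, 2 * pi]%classic (fun q => (f q.1.1)%:E) mA
    (measurable_itv _) m11.
  apply: (etrans (H _)); first by move=> z _; rewrite lee_fin.
  apply: eq_integral => q _ /=; rewrite integral_cst//= lebesgue_measure_itv /= lte_fin pi2.
  by rewrite -EFinD subr0 muleC.
have H := @box_tonelli12 _ _ _ _ R leb leb `[rp, +oo[%classic `[0, pi]%classic (fun q => ((2 * pi)%:E * (f q.1)%:E)%E)
  mrp (measurable_itv _) m1.
apply: (etrans (H _)); first by move=> z _; rewrite mule_ge0// lee_fin// ltW.
apply: eq_integral => x _ /=; rewrite integral_cst//= lebesgue_measure_itv /= lte_fin pi0.
by rewrite -EFinD subr0 -!EFinM; congr (_%:E); ring.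
Qed.

Lemma energy0_Fstat_fin : (energy0 B 0 (slice B 0 F) < +oo)%E.
Proof using hsub hfol hmult.
have [C C0 HC] := energy_integrand_decay.
have sF := smooth_mx_sub (ext_away hsub) (smooth_Fstat hsub hfol qe qb).
have mG i j : measurable_fun (ext_sph B) (fun q => G (sph q) i j).
  by apply: (smooth_measurable hsub (f := fun y => F (emb B 0 y) i j)); exact: (smooth_mx_at_emb hfol 0 sF).
have mrp : measurable (`[rp, +oo[%classic : set R) by exact: measurable_itv.
have mV : measurable_fun `[rp, +oo[%classic (fun x : R => C * x^-1 ^+ 2).
  apply: subspace_continuous_measurable_fun => //.
  apply: continuous_in_subspaceT => x; rewrite inE /= in_itv /= andbT => xr.
  have x0 : x != 0 by rewrite gt_eqF// (lt_le_trans (rplus_gt0 hsub)).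
  apply: (contM (f := fun=> C) (g := fun x : R => x^-1 ^+ 2)); first exact: cont_cst.
  by apply: (contX (f := fun x : R => x^-1)); apply: inv_continuous.
rewrite energy0E; apply: (@le_lt_trans _ _ (\int[mu3]_(q in ext_sph B) (C * (q.1.1)^-1 ^+ 2)%:E)%E).
  apply: ge0_le_integral.
  - exact: ext_sph_measurable.
  - move=> q qe'; rewrite lee_fin; apply: energy_integrand_ge0 => //; exact: Fstat_tr.
  - by apply/measurable_EFinP; exact: measurable_energy_integrand.
  - apply/measurable_EFinP.
    apply: (measurable_comp (F := `[rp, +oo[%classic) (f := fun x : R => C * x^-1 ^+ 2) (g := fun q : R * R * R => q.1.1)) => //.
      by move=> x [q /(ext_sphP hsub)[_ h _ _] <-]; rewrite /= in_itv /= h.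
    by apply: measurable_funTS; apply: (measurableT_comp (f := fst) (g := fst)); exact: measurable_fst.
  - by move=> q qe'; rewrite lee_fin; exact: HC.
rewrite (integral_ext_sph (f := fun x => C * x^-1 ^+ 2)).
- rewrite (_ : (fun x => _) = fun x : R => ((pi * (2 * pi) * C)%:E * (x^-1 ^+ 2)%:E)%E); last first.
    by apply/funext => x; rewrite -!EFinM; congr (_%:E); ring.
  rewrite ge0_integralZl_EFin//.
  + rewrite lte_mul_pinfty//; last exact: integral_inv_sqr.
    by rewrite lee_fin !mulr_ge0// pi_ge0.
  + by move=> x _; rewrite lee_fin sqr_ge0.
  + apply/measurable_EFinP; apply: subspace_continuous_measurable_fun => //.
    apply: continuous_in_subspaceT => x; rewrite inE /= in_itv /= andbT => xr.
    have x0 : x != 0 by rewrite gt_eqF// (lt_le_trans (rplus_gt0 hsub)).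
    by apply: (contX (f := fun x : R => x^-1)); apply: inv_continuous.
  + by rewrite !mulr_ge0// pi_ge0.
- by move=> x; rewrite mulr_ge0// sqr_ge0.
- exact: mV.
Qed.

End finite_energy_of_stationary_fields.

(** * Boxes of positive measure *)

Section positive_boxes.
Context {R : realType}.
Local Notation leb := (@lebesgue_measure R).

Lemma itv_gt0 (x0 x1 : R) : x0 < x1 -> (0 < leb `[x0, x1])%E.
Proof. by move=> h; rewrite lebesgue_measure_itv /= lte_fin h -EFinB lte_fin subr_gt0. Qed.

Lemma box2_gt0 (x0 x1 y0 y1 : R) : x0 < x1 -> y0 < y1 -> (0 < (leb \x leb)%E (box2 x0 x1 y0 y1))%E.
Proof.
move=> h1 h2; rewrite product_measure1E; [|exact: measurable_itv|exact: measurable_itv].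
by apply: mule_gt0; exact: itv_gt0.
Qed.

Lemma box3_gt0 (x0 x1 y0 y1 z0 z1 : R) : x0 < x1 -> y0 < y1 -> z0 < z1 ->
  (0 < ((leb \x leb) \x leb)%E (box3 x0 x1 y0 y1 z0 z1))%E.
Proof.
move=> h1 h2 h3; rewrite product_measure1E; [|exact: box2_measurable|exact: measurable_itv].
by apply: mule_gt0; [exact: box2_gt0|exact: itv_gt0].
Qed.
End positive_boxes.

(** * Lower bounds for stationary fields on every leaf *)

Section stationary_fields_do_not_decay.
Context {R : realType} (B : setting R).
Hypotheses (hsub : subextremal B) (hfol : regular_foliation B).
Local Notation a := (spin B).
Local Notation sdom := (slice_dom B).
Local Notation rp := (rplus B).
Local Notation leb := (@lebesgue_measure R).

(** Contracting [G] and its dual with the normal gives the electric and magnetic covectors up to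
    sign. They annihilate the normal, so their norm for the inverse metric of spacetime is their
    norm for the inverse metric of the leaf. The result no longer mentions the frame. *)
Lemma local_density_data s (G : 'rV[R]_3 -> 'M[R]_4) y : sdom y -> (G y)^T = - G y ->
  local_density B s (data_of B s G) y =
  pair (invmx (kn_metric B (emb B s y))) (normal B (emb B s y) *m G y) (normal B (emb B s y) *m G y)
  + pair (invmx (kn_metric B (emb B s y))) (normal B (emb B s y) *m star (kn_metric B (emb B s y)) (G y))
      (normal B (emb B s y) *m star (kn_metric B (emb B s y)) (G y)).
Proof.
move=> ys aG; set g := kn_metric B _; set n := normal B _.
have Ap := ext_away hsub (ext_emb s ys).
have gs : g^T = g := kn_sym B Ap; have gu : g \in unitmx := kn_unit B Ap.
have om := dtau_timelike hfol (ext_emb s ys); have o0 := dtau0_gt0 hsub hfol s ys.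
have nE : n = - (Num.sqrt (- pair (invmx g) (dtau B (emb B s y)) (dtau B (emb B s y))))^-1
  *: (dtau B (emb B s y) *m invmx g) by [].
have sE i : dtau B (emb B s y) 0 (lift ord0 i) + dtau B (emb B s y) 0 0 * slope B s y i = 0.
  have := chain_tau hsub hfol (lift ord0 i) (ext_ev s ys).
  have L : (lift ord0 i == 0 :> 'I_4) = false by [].
  by rewrite -embE L /= mul1r mulrC addrC.
pose X := basis_mx n (frame B s y).
have uX : X \in unitmx.
  by rewrite unitmxE unitfE gt_eqF// (detX_gt0 gs om o0 nE (frameE B s y) sE).
(* A covector annihilating the normal is the metric dual of a tangent vector [u], whose frame
   coefficients are obtained with the inverse of the induced metric; the two covectors agree on the
   whole adapted basis. *)
have H (w : 'rV[R]_4) (e : 'rV[R]_3) : (w *m n^T) 0 0 = 0 ->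
    (forall i, (w *m (frame B s y i)^T) 0 0 = e 0 i) ->
    pair (invmx g) w w = (e *m invmx (ind_metric B s y) *m e^T) 0 0.
  move=> wn we; pose c := e *m invmx (ind_metric B s y).
  pose u := \sum_i c 0 i *: frame B s y i.
  have uw : u *m g = w.
    apply/eqP; rewrite -subr_eq0; apply/eqP.
    suff : (u *m g - w) *m X^T = 0.
      have uXT : X^T \in unitmx by rewrite unitmx_tr.
      by move=> h; rewrite -[LHS]mulmx1 -(mulmxV uXT) mulmxA h mul0mx.
    apply/rowP => b; rewrite [RHS]mxE.
    have -> : ((u *m g - w) *m X^T) 0 b = ((u *m g - w) *m (row b X)^T) 0 0.
      by rewrite [LHS]mxE [RHS]mxE; apply: eq_bigr => l _; congr (_ * _); rewrite !mxE.
    rewrite mulmxBl [LHS]mxE [X in _ + X]mxE.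
    have P k : (u *m g *m k^T) 0 0 = \sum_i c 0 i * pair g (frame B s y i) k.
      rewrite /u !mulmx_suml summxE; apply: eq_bigr => i _.
      by rewrite -!scalemxAl scaleE.
    have [j ->|->] := unliftP ord0 b.
      rewrite rowXS P we; apply/eqP; rewrite subr_eq0; apply/eqP.
      have -> : e = c *m ind_metric B s y by rewrite /c mulmxKV// (ind_metric_unit hsub hfol s ys).
      by rewrite [RHS]mxE; apply: eq_bigr => i _; rewrite [ind_metric _ _ _ _ _]mxE.
    rewrite rowX0 P wn subr0 big1// => i _.
    by rewrite (gfr_n gs (kn_det_lt0 B Ap) nE (frameE B s y) sE) mulr0.
  have wE : w *m invmx g = u by rewrite -uw mulmxK.
  rewrite /pair wE -/c /u mulmx_suml summxE [RHS]mxE; apply: eq_bigr => i _.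
  rewrite -scalemxAl scaleE [e^T _ _]mxE -we; congr (_ * _).
  by rewrite [LHS]mxE [RHS]mxE; apply: eq_bigr => l _; rewrite [X in _ * X]mxE [X in _ = _ * X]mxE mulrC.
have nn (F : 'M[R]_4) : F^T = - F -> (n *m F *m n^T) 0 0 = 0.
  move=> aF; have := pair_asym n n aF; rewrite /pair => h; apply/eqP.
  by rewrite -[_ == 0](@mulrn_eq0 _ _ 2) mulr2n {1}h addNr.
have asG : (star g (G y))^T = - star g (G y) by apply: star_tr => //; exact: kn_det_lt0.
rewrite /local_density; congr (_ + _).
- set E := (data_of B s G).1 y.
  rewrite (H _ (- E) (nn _ aG)).
    by rewrite trmxN mulmxN !mulNmx opprK.
  move=> i; rewrite [RHS]mxE [E _ _]mxE.
  by rewrite -/(pair (G y) n (frame B s y i)) (pair_asym _ _ aG).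
- set E := (data_of B s G).2 y.
  rewrite (H _ E (nn _ asG))// => i; rewrite [E _ _]mxE.
  by rewrite -/(pair (star g (G y)) n (frame B s y i)) (pair_asym _ _ asG).
Qed.

(** The trace form is, up to a factor, the wedge product of two-forms: it is symmetric, and a
    decomposable form has zero square. *)
Lemma tr_wedge (u v x w : 'rV[R]_4) : \tr (wedge u v *m hat (wedge x w)) = \tr (wedge x w *m hat (wedge u v)) /\
  \tr (wedge u v *m hat (wedge u v)) = 0.
Proof.
rewrite (row4P u) (row4P v) (row4P x) (row4P w) !wedge_row4 !tr_asym4_hat; split; ring.
Qed.

Lemma tr_wedge_pair (F : 'M[R]_4) (u v : 'rV[R]_4) : F^T = - F ->
  \tr (F *m wedge u v) = - 2 * pair F u v.
Proof.
move=> aF; rewrite /wedge mulmxBr raddfB /= !mulmxA.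
have T (x w : 'rV[R]_4) : \tr (F *m x^T *m w) = pair F w x.
  by rewrite mxtrace_mulC mulmxA /pair /mxtrace big_ord1.
by rewrite !T (pair_asym v u aF); ring.
Qed.

Lemma wedge_asym (u v : 'rV[R]_4) : (wedge u v)^T = - wedge u v.
Proof. exact: wedge_tr. Qed.

Lemma tr_hat_sym (A W : 'M[R]_4) : A^T = - A -> W^T = - W -> \tr (W *m hat A) = \tr (A *m hat W).
Proof.
move=> aA aW; rewrite (asym4E aA) (asym4E aW) !tr_asym4_hat.
move: (A 0 1) (A 0 2) (A 0 3) (A 1 2) (A 1 3) (A 2 3) (W 0 1) (W 0 2) (W 0 3) (W 1 2) (W 1 3) (W 2 3).
by move=> *; ring.
Qed.

Lemma electric_ge0 (g G : 'M[R]_4) (n : 'rV[R]_4) : lorentzian g -> pair g n n = -1 -> G^T = - G ->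
  0 <= pair (invmx g) (n *m G) (n *m G).
Proof.
move=> lg gn aG; have [Y [uY YE nE]] := orthonormal_basis lg gn.
rewrite (basis_inv_pair uY YE) pair_eta.
have -> : (n *m G *m Y^T) 0 0 = 0.
  have := pair_asym n n aG; rewrite /pair => h.
  have {}h : (n *m G *m n^T) 0 0 = 0.
    by apply/eqP; rewrite -[_ == 0](@mulrn_eq0 _ _ 2) mulr2n {1}h addNr.
  rewrite -[RHS]h [LHS]mxE [RHS]mxE; apply: eq_bigr => i _.
  by rewrite -nE; congr (_ * _); rewrite !mxE.
by rewrite mul0r oppr0 add0r -!expr2 !addr_ge0 ?sqr_ge0.
Qed.

(** [formA] is decomposable and [formW] is the dual of a decomposable bivector, so both have square
    zero and only their mixed product [- 2 k] counts. The invariants are then [- 4 k x y] and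
    [- 2 k (y^2 - x^2)], the parts of the square of a complex number. *)
Lemma stationary_invariants p (x y : R) : away p ->
  let G := x *: formA B p + y *: formW B p in
  let k := SigmaKN B (sp p) / radius (sp p) ^+ 2 in
  inv1 G ^+ 2 + inv2 (kn_metric B p) G ^+ 2 = 4 * k ^+ 2 * (x ^+ 2 + y ^+ 2) ^+ 2.
Proof.
move=> Ap; have r0 : 0 < radius (sp p) by []; have rn : radius (sp p) != 0 by rewrite gt_eqF.
set A := formA B p; set W := formW B p; move=> G k.
have aA : A^T = - A by exact: wedge_asym.
have aW : W^T = - W by exact: formW_tr.
have hW : hat W = (radius (sp p) ^+ 2)^-1 *: wedge (vec1 p) (vec2 B p) by exact: hat_formW.
have WE : W = hat ((radius (sp p) ^+ 2)^-1 *: wedge (vec1 p) (vec2 B p)) by rewrite -hW hatK.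
have tAA : \tr (A *m hat A) = 0 by exact: (tr_wedge _ _ 0 0).2.
have tWW : \tr (W *m hat W) = 0.
  rewrite {1}WE hW hatZ -scalemxAl -scalemxAr !mxtraceZ mxtrace_mulC (tr_wedge _ _ 0 0).2.
  by rewrite !mulr0.
have n1 := unit_direction r0.
have lv1 : (vec1 p *m (cov_l B p)^T) 0 0 = 0.
  rewrite (cov_lE B r0) [LHS]mxE sum4 ![_^T _ _]mxE !row4E.
  move: n1; move: (sp p 0 0 / _) (sp p 0 1 / _) (sp p 0 2 / _) => m1 m2 m3 n1.
  transitivity (1 - (m1 * m1 + m2 * m2 + m3 * m3)); last by rewrite n1 subrr.
  by ring.
have dv1 : (vec1 p *m (cov_dr p)^T) 0 0 = -1.
  rewrite cov_drE [LHS]mxE sum4 ![_^T _ _]mxE !row4E.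
  move: n1; move: (sp p 0 0 / _) (sp p 0 1 / _) (sp p 0 2 / _) => m1 m2 m3 n1.
  transitivity (- (m1 * m1 + m2 * m2 + m3 * m3)); last by rewrite n1.
  by ring.
have SE : SigmaKN B (sp p) = radius (sp p) ^+ 2 + a ^+ 2 * (sp p 0 2 / radius (sp p)) ^+ 2 by [].
have lv2 : (vec2 B p *m (cov_l B p)^T) 0 0 = SigmaKN B (sp p).
  rewrite (cov_lE B r0) SE [LHS]mxE sum4 ![_^T _ _]mxE !row4E.
  move: n1; move: (sp p 0 0 / _) (sp p 0 1 / _) (sp p 0 2 / _) => m1 m2 m3 n1.
  transitivity ((radius (sp p) ^+ 2 + a ^+ 2) * (m1 * m1 + m2 * m2 + m3 * m3)
    - a ^+ 2 * (m1 * m1 + m2 * m2 + m3 * m3) + a ^+ 2 * m3 ^+ 2); last by rewrite n1; ring.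
  by field.
have tAW : \tr (A *m hat W) = - 2 * k.
  rewrite hW -scalemxAr mxtraceZ tr_wedge_pair// /A /formA pair_wedge lv1 dv1 lv2 /k.
  by field.
have tWA : \tr (W *m hat A) = - 2 * k by rewrite -tAW tr_hat_sym.
have sG : star (kn_metric B p) G = y *: A - x *: W.
  by rewrite /G starD !starZ star_formA// star_formW// scalerN addrC.
have E1 : inv1 G = - 4 * k * x * y.
  rewrite /inv1 /G hatD !hatZ !mulmxDl !mulmxDr -!scalemxAl -!scalemxAr !raddfD /= !mxtraceZ.
  by rewrite tAA tWW tAW tWA; ring.
have E2 : inv2 (kn_metric B p) G = - 2 * k * (y ^+ 2 - x ^+ 2).
  rewrite /inv2 sG /G hatD !hatZ mulmxBl !mulmxDr -!scalemxAl -!scalemxAr raddfB /= !raddfD /= !mxtraceZ.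
  by rewrite tAA tWW tAW tWA; ring.
by rewrite E1 E2; ring.
Qed.

Variables (qe qb : R).
Local Notation F := (Fstat B qe qb).

(** The factor [4 k^2] of the invariants equals [- 4 det g], so it cancels in [invariants_le] and a
    bound depending only on the radius and theta is left. *)
Lemma local_density_ge s y : sdom y ->
  (qe ^+ 2 + qb ^+ 2) / SigmaKN B y ^+ 2 <= local_density B s (data_of B s (slice B s F)) y.
Proof.
move=> ys; have Ap := ext_away hsub (ext_emb s ys).
rewrite local_density_data//; last exact: Fstat_tr.
have := invariants_le (kn_lorentzian B Ap) (normal_unit hsub hfol s ys) (Fstat_tr hsub hfol qe qb (emb B s y)).
rewrite /slice; set L := pair _ _ _ + pair _ _ _ => h.
have L0 : 0 <= L.
  have lg := kn_lorentzian B Ap; have nn := normal_unit hsub hfol s ys.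
  rewrite /L; apply: addr_ge0; apply: (electric_ge0 lg nn); first exact: Fstat_tr.
  by apply: star_tr; [exact: kn_sym|exact: kn_det_lt0|exact: Fstat_tr].
pose x := - qe * alpha B (emb B s y) + qb * beta B (emb B s y).
pose z := qe * beta B (emb B s y) + qb * alpha B (emb B s y).
have GE : F (emb B s y) = x *: formA B (emb B s y) + z *: formW B (emb B s y).
  rewrite (FstatE hsub hfol) (FelE B Ap) (FmaE B Ap) /x /z.
  by move: (formA B _) (formW B _) => A W; apply/matrixP => i j; rewrite !mx_linE; ring.
have xz : x ^+ 2 + z ^+ 2 = (qe ^+ 2 + qb ^+ 2) / SigmaKN B y ^+ 2.
  have := alpha_beta B Ap; rewrite [sp (emb B s y)]sp_ev => <-.
  by rewrite /x /z; move: (alpha B _) (beta B _) => al be; ring.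
have k0 : 0 < SigmaKN B (sp (emb B s y)) / radius (sp (emb B s y)) ^+ 2.
  by rewrite divr_gt0 ?exprn_gt0// SigmaKN_gt0.
move: h; rewrite {1 2}GE stationary_invariants// (kn_det B Ap) opprK -xz.
move: (SigmaKN B (sp _) / radius (sp _) ^+ 2) k0 => k k0.
have k4 : 0 < 4 * k ^+ 2 by apply: mulr_gt0 => //; exact: exprn_gt0.
rewrite (ler_pM2l k4) ler_sqr ?nnegrE//; apply: addr_ge0; exact: sqr_ge0.
Qed.

Lemma smooth_Fstat_ext : smooth_mx_near (exterior B) F.
Proof. exact: smooth_mx_sub (ext_away hsub) (smooth_Fstat hsub hfol qe qb). Qed.

Lemma smooth_local_density s : smooth_near sdom (local_density B s (data_of B s (slice B s F))).
Proof.
have [s1 s2] := smooth_data_of hsub hfol s smooth_Fstat_ext.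
have sh := smooth_inv_ind_metric hsub hfol s.
apply: smooth_nearD.
  exact: (smooth_mxM (smooth_mxM s1 sh) (smooth_mx_tr s1) 0 0).
exact: (smooth_mxM (smooth_mxM s2 sh) (smooth_mx_tr s2) 0 0).
Qed.

Definition local_integrand s (q : R * R * R) : R :=
  local_density B s (data_of B s (slice B s F)) (sph q) * (vol_density B s (sph q) * q.1.1 ^+ 2 * sin q.1.2).

Lemma cont_local_integrand s q : sdom (sph q) -> cont q (local_integrand s).
Proof.
move=> qs.
have c1 := smooth_cont_sph (smooth_local_density s) qs.
have c2 := smooth_cont_sph (smooth_vol_density hsub hfol s) qs.
apply: (contM c1); apply: contM; last by apply: cont_sin; exact: cont_2.
by apply: (contM c2); apply: contX; exact: cont_1.
Qed.

Lemma measurable_local_integrand s : measurable_fun (ext_sph B) (local_integrand s).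
Proof.
have me := ext_sph_measurable B.
have cont_meas (f : R * R * R -> R) : (forall q, cont q f) -> measurable_fun (ext_sph B) f.
  by move=> cf; apply: (continuous_on_measurable3 (U := setT)); [exact: openT|by []|exact: me|by move=> q _; exact: cf].
apply: measurable_funM; first exact: (smooth_measurable hsub (smooth_local_density s)).
apply: measurable_funM; last by apply: cont_meas => q; apply: cont_sin; exact: cont_2.
apply: measurable_funM; first exact: (smooth_measurable hsub (smooth_vol_density hsub hfol s)).
by apply: cont_meas => q; apply: contX; exact: cont_1.
Qed.

Lemma local_integrand_ge0 s q : ext_sph B q -> 0 <= local_integrand s q.
Proof.
move=> /(ext_sphP hsub)[r0 _ s0 ys]; apply: mulr_ge0.
  by apply: le_trans (local_density_ge s ys); rewrite divr_ge0 ?addr_ge0 ?sqr_ge0.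
by rewrite !mulr_ge0// ?sqr_ge0// ltW// vol_density_gt0.
Qed.

Section compact_set_of_radii.
Variable K : set R.
Hypotheses (cK : compact K) (Kext : K `<=` [set r | rp <= r]).

Lemma sph_dom_ext : sph_dom K `<=` ext_sph B.
Proof. by move=> q [/Kext]. Qed.

Lemma measurable_sph_dom : measurable (sph_dom K).
Proof. by apply: sph_dom_measurable; exact: compact_measurable. Qed.

Lemma compact_ubound : exists r1 : R, forall r, K r -> r <= r1.
Proof.
have [M [Mr HM]] := compact_bounded cK; exists (M + 1) => r Kr.
by apply: le_trans (ler_norm r) _; apply: HM => //; rewrite ltrDl.
Qed.

Lemma local_integral_fin s : (leaf_integral B s K (local_density B s (data_of B s (slice B s F))) < +oo)%E.
Proof.
have [r1 Hr1] := compact_ubound.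
have boxs q : box3 rp r1 0 pi 0 (2 * pi) q -> ext_sph B q.
  by case: q => -[x y] z [[/=]]; rewrite !in_itv /= => /andP[].
have [D D0 HD] : exists2 D : R, 0 <= D & forall q, box3 rp r1 0 pi 0 (2 * pi) q -> `|local_integrand s q| <= D.
  apply: (continuous_on_compact_bound (f := local_integrand s) (@box3_compact R rp r1 0 pi 0 (2 * pi))) => q /boxs qe'.
  by apply: cont_local_integrand; have [] := ext_sphP hsub qe'.
have L : (leaf_integral B s K (local_density B s (data_of B s (slice B s F))) <=
    \int[((leb \x leb) \x leb)%E]_(q in box3 rp r1 0 pi 0 (2 * pi)) (cst D%:E q))%E.
  apply: (@le_trans _ _ (\int[((leb \x leb) \x leb)%E]_(q in sph_dom K) (cst D%:E q))%E).
    apply: ge0_le_integral.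
    - exact: measurable_sph_dom.
    - by move=> q /sph_dom_ext qe'; rewrite lee_fin local_integrand_ge0.
    - apply/measurable_EFinP; apply: (measurable_funS (ext_sph_measurable B) sph_dom_ext).
      exact: measurable_local_integrand.
    - exact: measurable_cst.
    - move=> q qK; rewrite lee_fin; apply: le_trans (ler_norm _) (HD q _).
      case: q qK => -[x y] z [/= Kx hy hz]; split; [split|]; rewrite /= in_itv /=.
      + by rewrite Hr1// andbT; exact: Kext.
      + exact: hy.
      + exact: hz.
  apply: ge0_subset_integral.
  - exact: measurable_sph_dom.
  - exact: box3_measurable.
  - exact: measurable_cst.
  - by move=> q _; rewrite lee_fin.
  - case=> -[x y] z [/= Kx hy hz]; split; [split|]; rewrite /= in_itv /=.
    + by rewrite Hr1// andbT; exact: Kext.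
    + exact: hy.
    + exact: hz.
apply: (le_lt_trans L); rewrite integral_cst; last exact: box3_measurable.
by rewrite lte_mul_pinfty// ?lee_fin//; exact: box3_finite.
Qed.

(** The pointwise bound does not depend on the leaf, but the volume form does. On a compact set of
    radii the foliation compares it with the volume form of the leaf 0, which makes the integral
    bound uniform in [s]. *)
Lemma local_integral_lower (b0 b1 : R) : 0 < qe ^+ 2 + qb ^+ 2 -> b0 < b1 -> (forall r, b0 <= r <= b1 -> K r) ->
  exists2 d : R, 0 < d & forall s, (d%:E <= leaf_integral B s K (local_density B s (data_of B s (slice B s F))))%E.
Proof.
move=> q0 b01 bK; have [_ _ _ _ [volC _]] := hfol.
have [r1 Hr1] := compact_ubound; have [C C0 HC] := volC r1.
pose m (q : R * R * R) : R := (qe ^+ 2 + qb ^+ 2) / SigmaKN B (sph q) ^+ 2 *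
  (vol_density B 0 (sph q) * q.1.1 ^+ 2 * sin q.1.2).
have pi0 : 0 < pi :> R by exact: pi_gt0.
(* Theta is kept in a range away from the poles, where sin(theta) would vanish, so the comparison
   integrand has a positive minimum. *)
pose bx := box3 b0 b1 (pi / 4) (pi / 2) 0 (2 * pi).
have bxE q : bx q -> sph_dom K q /\ 0 < sin q.1.2.
  case: q => -[x y] z [[/=]]; rewrite !in_itv /= => hx /andP[y1 y2] hz.
  have y0 : 0 < y by apply: lt_le_trans y1; rewrite divr_gt0.
  have ypi : y < pi by apply: le_lt_trans y2 _; rewrite ltr_pdivrMr// ltr_pMr// ltr1n.
  split; last by apply: sin_gt0_pi; rewrite y0.
  by split => //=; [exact: bK|rewrite !ltW].
have mb : measurable bx by exact: box3_measurable.
have [c c0 Hc] : exists2 c, 0 < c & forall q, bx q -> c <= m q.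
  apply: (continuous_on_compact_min (f := m) (@box3_compact R b0 b1 (pi / 4) (pi / 2) 0 (2 * pi))) => q /bxE[/sph_dom_ext/(ext_sphP hsub)[x0 _ _ ys] s0].
    have sS : smooth_near sdom (fun y => (qe ^+ 2 + qb ^+ 2) / SigmaKN B y ^+ 2).
      apply: smooth_nearM; first exact: smooth_near_cst.
      apply: smooth_nearV.
        move=> y ys'; rewrite expf_neq0// gt_eqF//.
        have := @SigmaKN_gt0 _ B (ev 0 y); rewrite sp_ev; apply.
        exact: lt_le_trans (rplus_gt0 hsub) ys'.
      apply: smooth_nearX; apply: smooth_nearD.
        by apply: smooth_nearX; exact: sdom_smooth_r.
      apply: smooth_nearM; first exact: smooth_near_cst.
      apply: smooth_nearX; apply: smooth_nearM; first exact: smooth_near_coord.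
      apply: smooth_nearV; last exact: sdom_smooth_r.
      by move=> y ys'; rewrite gt_eqF// (lt_le_trans (rplus_gt0 hsub)).
    apply: (contM (smooth_cont_sph sS ys)); apply: contM; last by apply: cont_sin; exact: cont_2.
    apply: (contM (smooth_cont_sph (smooth_vol_density hsub hfol 0) ys)); apply: contX; exact: cont_1.
  have S0 : 0 < SigmaKN B (sph q).
    have := @SigmaKN_gt0 _ B (ev 0 (sph q)); rewrite sp_ev; apply.
    exact: lt_le_trans (rplus_gt0 hsub) ys.
  by rewrite mulr_gt0 ?divr_gt0 ?exprn_gt0// !mulr_gt0 ?exprn_gt0// vol_density_gt0.
(* [c] is the minimum of the comparison integrand on the leaf 0 and [C] the constant comparing the
   volume forms. *)
have lower s q : bx q -> C^-1 * c <= local_integrand s q.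
  move=> qb'; have [qK s0] := bxE q qb'; have [x0 _ _ ys] := ext_sphP hsub (sph_dom_ext qK).
  apply: (@le_trans _ _ (C^-1 * m q)); first by apply: ler_wpM2l; [rewrite invr_ge0 ltW|exact: Hc].
  have ry : radius (sph q) <= r1.
    by case: (q) qK x0 => -[x y] z [/= Kx _ _] x0; rewrite radius_sph; [exact: Hr1|exact: ltW].
  have vs : C^-1 * vol_density B 0 (sph q) <= vol_density B s (sph q).
    by rewrite ler_pdivrMl//; exact: HC.
  rewrite /m /local_integrand mulrCA; apply: ler_pM.
  - by rewrite divr_ge0 ?addr_ge0 ?sqr_ge0.
  - apply: mulr_ge0; first by rewrite invr_ge0 ltW.
    apply: mulr_ge0; last exact: ltW.
    by apply: mulr_ge0; [exact: ltW (vol_density_gt0 hsub hfol 0 ys)|exact: sqr_ge0].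
  - exact: local_density_ge.
  - have h := ler_wpM2r (ltW s0) (ler_wpM2r (sqr_ge0 q.1.1) vs); apply: le_trans h.
    move: C^-1 (vol_density B 0 (sph q)) (q.1.1) (sin q.1.2) => C' v r t.
    by rewrite (_ : C' * (v * r ^+ 2 * t) = C' * v * r ^+ 2 * t); [exact: lexx|ring].
have mupos : (0 < ((leb \x leb) \x leb)%E bx)%E.
  have h1 : pi / 4 < pi / 2 :> R by rewrite ltr_pM2l// ltf_pV2 ?posrE// ltr_nat.
  have h2 : 0 < 2 * pi :> R by rewrite mulr_gt0.
  exact: box3_gt0.
have mufin : (((leb \x leb) \x leb)%E bx < +oo)%E by exact: box3_finite.
exists (C^-1 * c * fine (((leb \x leb) \x leb)%E bx)).
  by rewrite !mulr_gt0 ?invr_gt0// fine_gt0// mupos mufin.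
move=> s; apply: (@le_trans _ _ (\int[((leb \x leb) \x leb)%E]_(q in bx) (cst (C^-1 * c)%:E q))%E).
  rewrite integral_cst// EFinM fineK// ge0_fin_numE//.
apply: (@le_trans _ _ (\int[((leb \x leb) \x leb)%E]_(q in bx) (local_integrand s q)%:E)%E).
  apply: ge0_le_integral.
  - exact: mb.
  - by move=> q _; rewrite lee_fin; apply: mulr_ge0; [rewrite invr_ge0|]; exact: ltW.
  - exact: measurable_cst.
  - apply/measurable_EFinP; apply: (measurable_funS (ext_sph_measurable B)); last exact: measurable_local_integrand.
    by move=> q /bxE[/sph_dom_ext].
  - by move=> q qb'; rewrite lee_fin; exact: lower.
apply: ge0_subset_integral.
- exact: mb.
- exact: measurable_sph_dom.
- apply/measurable_EFinP; apply: (measurable_funS (ext_sph_measurable B) sph_dom_ext).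
  exact: measurable_local_integrand.
- by move=> q /sph_dom_ext qe'; rewrite lee_fin; exact: local_integrand_ge0.
- by move=> q /bxE[].
Qed.

Lemma stationary_no_decay nu : (qe, qb) <> (0, 0) -> interior K !=set0 -> local_norm_equiv B K nu ->
  ~ decays_locally B nu F.
Proof.
move=> q0 [x0 Kx0] [c [C [c0 C0 Hnu]]] dec.
have q2 : 0 < qe ^+ 2 + qb ^+ 2.
  rewrite lt_neqAle addr_ge0 ?sqr_ge0// andbT eq_sym paddr_eq0 ?sqr_ge0// !sqrf_eq0.
  by apply/negP => /andP[/eqP e1 /eqP e2]; apply: q0; rewrite e1 e2.
have [e /= e0 He] := (nbhs_ballP _ _).1 Kx0.
(* Halving the radius of the ball makes a closed interval of radii fit inside [K]. *)
have bK r : x0 - e / 2 <= r <= x0 + e / 2 -> K r.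
  move=> /andP[h1 h2]; apply: He; rewrite /ball /= ltr_distlC.
  have e2 : e / 2 < e by rewrite ltr_pdivrMr// ltr_pMr// ltr1n.
  apply/andP; split; first by apply: lt_le_trans h1; rewrite ltrD2l ltrN2.
  by apply: le_lt_trans h2 _; rewrite ltrD2l.
have b01 : x0 - e / 2 < x0 + e / 2.
  by have e2 : 0 < e / 2 by [rewrite divr_gt0]; rewrite ltrD2l; apply: lt_trans e2; rewrite oppr_lt0 divr_gt0.
have [d d0 Hd] := local_integral_lower q2 b01 bK.
have lb s : c * Num.sqrt d <= nu s (data_of B s (slice B s F)).
  have [s1 s2] := smooth_data_of hsub hfol s smooth_Fstat_ext.
  have md : measurable_data B (data_of B s (slice B s F)).
    by move=> i; split; [exact: (smooth_measurable hsub (s1 0 i))|exact: (smooth_measurable hsub (s2 0 i))].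
  have fin := local_integral_fin s.
  have /andP[h _] := Hnu s _ md fin; apply: le_trans h; apply: ler_wpM2l; first exact: ltW.
  rewrite /local_L2; apply: ler_wsqrtr; have := Hd s; move: fin.
  by case: (leaf_integral _ _ _ _) => [z| |] //= _; rewrite ?lee_fin// leNye_eq.
have cd0 : 0 < c * Num.sqrt d by rewrite mulr_gt0// sqrtr_gt0.
have near0 : \forall s \near +oo%R, `|nu s (data_of B s (slice B s F))| < c * Num.sqrt d.
  by move/cvgr0Pnorm_lt : dec => /(_ _ cd0).
have [s /= hs] := filter_ex near0.
have := le_trans (lb s) (ler_norm _); by rewrite leNgt hs.
Qed.

End compact_set_of_radii.

End stationary_fields_do_not_decay.

(** * The direct sum and the decomposition of fields *)

Section charge_decomposition.
Context {R : realType} (B : setting R).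
Hypotheses (hsub : subextremal B) (hfol : regular_foliation B) (hmult : redshift_multiplier B).
Local Notation sdom := (slice_dom B).
Local Notation tensor := ('rV[R]_4 -> 'M[R]_4).

(** Almost-everywhere identities of data are deduced from pointwise implications; transitivity and
    the compatibility with sums and differences are instances. *)
Lemma data_ae_pointwise2 (U V U' V' W W' : data R) : data_ae_eq B U V -> data_ae_eq B U' V' ->
  (forall y, U.1 y = V.1 y /\ U.2 y = V.2 y -> U'.1 y = V'.1 y /\ U'.2 y = V'.2 y ->
    W.1 y = W'.1 y /\ W.2 y = W'.2 y) -> data_ae_eq B W W'.
Proof.
move=> e1 e2 h; apply: ae_mu3S (ae_mu3I e1 e2) => q [h1 h2] qe.
by apply: h; [exact: h1|exact: h2].
Qed.

Lemma data_ae_refl U : data_ae_eq B U U.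
Proof. by apply: ae_mu3T => q _. Qed.

Lemma data_ae_pointwise (U V W W' : data R) : data_ae_eq B U V ->
  (forall y, U.1 y = V.1 y /\ U.2 y = V.2 y -> W.1 y = W'.1 y /\ W.2 y = W'.2 y) -> data_ae_eq B W W'.
Proof. by move=> e h; apply: (data_ae_pointwise2 e (data_ae_refl U)) => y h1 _; exact: h. Qed.

Lemma data_ae_sym U V : data_ae_eq B U V -> data_ae_eq B V U.
Proof. by move=> e; apply: (data_ae_pointwise e) => y []. Qed.

Lemma data_ae_trans U V W : data_ae_eq B U V -> data_ae_eq B V W -> data_ae_eq B U W.
Proof. by move=> e1 e2; apply: (data_ae_pointwise2 e1 e2) => y [-> ->]. Qed.

Lemma data_ae_eqfun (U V : data R) : (forall y, U.1 y = V.1 y /\ U.2 y = V.2 y) -> data_ae_eq B U V.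
Proof. by move=> h; apply: (data_ae_pointwise (data_ae_refl U)) => y _. Qed.

Lemma sub_dataE (U V : data R) y : (sub_data U V).1 y = U.1 y - V.1 y /\ (sub_data U V).2 y = U.2 y - V.2 y.
Proof. by rewrite /sub_data /add_data /scale_data /= !scaleN1r. Qed.

Lemma open_all4 (A : set 'rV[R]_4) (P : 'I_4 -> set 'rV[R]_4 -> Prop) :
  (forall i U V, U `<=` V -> P i V -> P i U) ->
  (forall i, exists U, [/\ open U, A `<=` U & P i U]) ->
  exists U, [/\ open U, A `<=` U & forall i, P i U].
Proof.
move=> mono h; have [U0 [p0 a0 h0]] := h 0; have [U1 [p1 a1 h1]] := h 1.
have [U2 [p2 a2 h2]] := h 2; have [U3 [p3 a3 h3]] := h 3.
exists (U0 `&` U1 `&` (U2 `&` U3)); split.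
- by apply: openI; exact: openI.
- by move=> p Ap; split; split; [exact: a0|exact: a1|exact: a2|exact: a3].
- apply: ord4P.
  + by apply: mono h0 => p [[]].
  + by apply: mono h1 => p [[]].
  + by apply: mono h2 => p [_ []].
  + by apply: mono h3 => p [_ []].
Qed.

Lemma smooth_mx_domain (A : set 'rV[R]_4) (G : tensor) : smooth_mx_near A G ->
  exists U, [/\ open U, A `<=` U & forall i j k, Ck U k (fun p => G p i j)].
Proof.
move=> sG; apply: (@open_all4 A (fun i U => forall j k, Ck U k (fun p => G p i j))).
  by move=> i U V UV h j k; exact: Ck_sub UV (h j k).
move=> i; apply: (@open_all4 A (fun j U => forall k, Ck U k (fun p => G p i j))).
  by move=> j U V UV h k; exact: Ck_sub UV (h k).
by move=> j; apply/smooth_nearP; exact: sG.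
Qed.

(** Antisymmetry is required on an open neighbourhood: the Lie derivative differentiates in all
    directions, so antisymmetry on the leaf alone would not be inherited by the commuted fields. *)
Definition near_form (A : set 'rV[R]_4) (G : tensor) := smooth_mx_near A G /\
  exists W, [/\ open W, A `<=` W & forall p, W p -> (G p)^T = - G p].

Lemma smooth_commutator (A : set 'rV[R]_4) c : smooth_mx_near A (commutator_field c).
Proof.
have s0 : smooth_near A (fun=> 0 : R) by exact: smooth_near_cst.
have sN j : smooth_near A (fun p => - sp p 0 j) by apply: smooth_nearN; exact: smooth_sp.
have r3 : smooth_mx_near A (@rot3 R).
  by apply: smooth_ev => //; apply: smooth_row3 => //; exact: smooth_sp.
move: c; apply: ord6P; rewrite /commutator_field /=.
- exact: smooth_mx_cst.
- exact: r3.
- by apply: smooth_ev => // i j; rewrite (ord1 i); exact: smooth_sp.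
- by apply: smooth_ev => //; apply: smooth_row3 => //; exact: smooth_sp.
- by apply: smooth_ev => //; apply: smooth_row3 => //; exact: smooth_sp.
- exact: r3.
Qed.

Lemma lie_form (A : set 'rV[R]_4) X (G : tensor) : smooth_mx_near A X -> near_form A G ->
  near_form A (lie X G).
Proof.
move=> sX [sG [W [pW AW aG]]]; split.
  move=> i j; apply: (smooth_near_ext (f := fun p => \sum_k X p 0 k * pd k (fun q => G q i j) p
     + \sum_k G p k j * pd i (fun q => X q 0 k) p + \sum_k G p i k * pd j (fun q => X q 0 k) p)).
    by move=> p; rewrite [RHS]mxE.
  apply: smooth_nearD; [apply: smooth_nearD|]; apply: smooth_near_sum => k; apply: smooth_nearM => //;
    exact: smooth_near_pd.
have [U [pU AU HU]] := smooth_mx_domain sG.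
exists (U `&` W); split; first exact: openI.
  by move=> p Ap; split; [exact: AU|exact: AW].
move=> p [Up Wp]; apply/matrixP => i j; rewrite [LHS]mxE [LHS]mxE [RHS]mxE [in RHS]mxE.
have E a b : G p a b = - G p b a.
  by have := congr1 (fun M : 'M[R]_4 => M b a) (aG p Wp); rewrite /= [LHS]mxE [RHS]mxE.
have D k : pd k (fun q => G q j i) p = - pd k (fun q => G q i j) p.
  rewrite -pdN; last exact: Ck_diff (HU i j 0%N) Up.
  apply: pd_eq; have := open_nbhs_nbhs (conj pW Wp); apply: filterS => q Wq.
  by have := congr1 (fun M : 'M[R]_4 => M i j) (aG q Wq); rewrite /= [LHS]mxE [RHS]mxE.
rewrite -addrA [X in _ + X]addrC addrA !opprD -!sumrN; congr (_ + _ + _); apply: eq_bigr => k _.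
- by rewrite D mulrN.
- by rewrite (E j k) mulNr.
- by rewrite (E k i) mulNr.
Qed.

Lemma lie_word_form (A : set 'rV[R]_4) w (G : tensor) : near_form A G -> near_form A (lie_word w G).
Proof. by move=> nG; elim: w => [|c w IH] //=; apply: lie_form => //; exact: smooth_commutator. Qed.

Lemma leaf_emb y : sdom y -> leaf B 0 (emb B 0 y).
Proof.
move=> ys; split; first exact: ext_emb.
by rewrite embE (tau_leaf_point hfol (ext_ev 0 ys)) mxE unlift_none.
Qed.

Lemma slice_asym G : near_form (leaf B 0) G -> asym_field B (slice B 0 G).
Proof. by move=> [_ [W [_ AW aG]]] y ys; apply: aG; apply: AW; exact: leaf_emb. Qed.

Lemma slice_meas G : smooth_mx_near (leaf B 0) G -> meas_field B (slice B 0 G).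
Proof.
move=> sG i j; apply: (smooth_measurable hsub (f := fun y => G (emb B 0 y) i j)).
by apply: smooth_near_comp (smooth_emb hfol 0) (sG i j) => y ys; exact: leaf_emb.
Qed.

Lemma energy_E0 (G : tensor) : energy B 0 0 G = energy0 B 0 (slice B 0 G).
Proof.
rewrite /energy big_ord_recl big_ord0 adde0 (bigD1 [tuple])//= big1 ?adde0//.
by move=> w /eqP[]; apply: val_inj; case: w => -[|c s] h.
Qed.

(** The empty word contributes the energy of order 0, and every other term is nonnegative because a
    Lie derivative of a two-form is again a two-form. *)
Lemma energy0_le k G : near_form (leaf B 0) G -> (energy0 B 0 (slice B 0 G) <= energy B k 0 G)%E.
Proof.
move=> nG; have p0 m (w : m.-tuple 'I_6) : (0 <= energy0 B 0 (slice B 0 (lie_word w G)))%E.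
  by apply: energy0_ge0 => //; apply: slice_asym; exact: lie_word_form.
rewrite /energy big_ord_recl (bigD1 [tuple])//= -addeA leeDl// adde_ge0//.
  by apply: sume_ge0 => w _; exact: p0.
by apply: sume_ge0 => m _; apply: sume_ge0 => w _; exact: p0.
Qed.

Lemma prolongs_form U G : prolongs B U G -> near_form (leaf B 0) G.
Proof.
move=> [aG sG _ _]; split=> //; exists setT; split=> //; first exact: openT.
Qed.

Lemma form_sub (A : set 'rV[R]_4) F G : near_form A F -> near_form A G -> near_form A (fun p => F p - G p).
Proof.
move=> [sF [W [pW AW aF]]] [sG [V [pV AV aG]]]; split; first exact: smooth_mxB.
exists (W `&` V); split; first exact: openI.
  by move=> p Ap; split; [exact: AW|exact: AV].
by move=> p [Wp Vp]; rewrite trmxD trmxN aF// aG// opprD.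
Qed.

Lemma pds_open (U : set 'rV[R]_4) f g w p : open U -> (forall q, U q -> f q = g q) -> U p ->
  pds w f p = pds w g p.
Proof.
move=> pU fg; elim: w p => [|i w IH] p Up /=; first exact: fg.
by apply: pd_eq; have := open_nbhs_nbhs (conj pU Up); apply: filterS => q Uq; exact: IH.
Qed.

Lemma smooth_hodge_leaf G : smooth_mx_near (leaf B 0) G -> smooth_mx_near (leaf B 0) (hodge B G).
Proof.
have sub : leaf B 0 `<=` away by move=> p [ep _]; exact: (ext_away hsub ep).
move=> sG; apply: smooth_star => //; last exact: smooth_mx_sub sub (smooth_kn B).
by move=> p lp; apply: kn_det_lt0; exact: sub.
Qed.

Lemma data_ofD s (F G : tensor) y :
  (data_of B s (slice B s (fun p => F p + G p))).1 y =
    (data_of B s (slice B s F)).1 y + (data_of B s (slice B s G)).1 y /\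
  (data_of B s (slice B s (fun p => F p + G p))).2 y =
    (data_of B s (slice B s F)).2 y + (data_of B s (slice B s G)).2 y.
Proof.
split; apply/rowP => i; rewrite [LHS]mxE [RHS]mxE ![(\row__ _) _ _]mxE /slice.
  by rewrite pairD.
by rewrite starD pairD opprD.
Qed.

(** The stationary field solves Maxwell's equations on an open set containing the leaf, so adding it
    changes none of the iterated derivatives of the equations there. *)
Lemma prolongs_add_stat qe qb U G : prolongs B U G ->
  prolongs B (add_data (stat_data B qe qb) U) (fun p => Fstat B qe qb p + G p).
Proof.
move=> pG; have [aG sG dG mG] := pG; have [aF sF dF mF] := prolongs_stat_data hsub hfol qe qb.
have sub : leaf B 0 `<=` away by move=> p [ep _]; exact: (ext_away hsub ep).
have aFG : two_form (fun p => Fstat B qe qb p + G p).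
  by move=> p; rewrite trmxD aF aG [RHS]opprD.
split; [exact: aFG|exact: smooth_mxD| |].
- move=> y ys; have [d1 d2] := dG y ys; have [e1 e2] := dF y ys.
  have [A1 A2] := data_ofD 0 (Fstat B qe qb) G y.
  by split; [exact: etrans A1 (congr2 (fun u v => u + v) e1 d1)|exact: etrans A2 (congr2 (fun u v => u + v) e2 d2)].
- move=> w i j k p lp.
  have H (X Y : tensor) : (forall q, away q -> d2 X i j k q = 0) -> smooth_mx_near away X ->
      smooth_mx_near (leaf B 0) Y -> pds w (d2 Y i j k) p = 0 -> pds w (d2 (fun q => X q + Y q) i j k) p = 0.
    move=> X0 sX sY Y0; have [V [pV AV HV]] := smooth_mx_domain sY.
    rewrite -Y0; apply: (pds_open (U := away `&` V)).
    - by apply: openI => //; exact: open_away.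
    - move=> q [Aq Vq]; rewrite d2D; first by rewrite X0// add0r.
        by move=> a b; exact: smooth_near_diff (sX a b) Aq.
      by move=> a b; exact: Ck_diff (HV a b 0%N) Vq.
    - by split; [exact: sub|exact: AV].
  have [m1 m2] := mG w i j k p lp; split.
    apply: (H (Fstat B qe qb) G) => //; last exact: smooth_Fstat.
    by move=> q Aq; exact: d2_Fstat.
  have -> : hodge B (fun p => Fstat B qe qb p + G p) = fun q => hodge B (Fstat B qe qb) q + hodge B G q.
    by apply/funext => q; rewrite /hodge starD.
  apply: (H (hodge B (Fstat B qe qb)) (hodge B G)) => //.
  + by move=> q Aq; exact: d2_hodge_Fstat.
  + by apply: smooth_hodge; exact: smooth_Fstat.
  + exact: smooth_hodge_leaf.
Qed.

Lemma measurable_stat_data qe qb : measurable_data B (stat_data B qe qb).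
Proof. by apply: smooth_measurable_data => //; exact: smooth_stat_data. Qed.

Lemma energy0_data_ae U V : measurable_data B U -> measurable_data B V -> data_ae_eq B U V ->
  energy0 B 0 (field_of B 0 U) = energy0 B 0 (field_of B 0 V).
Proof.
move=> mU mV e; apply: energy0_ae => //; [exact: meas_field_of|exact: meas_field_of|].
by apply: ae_mu3S e => q h qe; rewrite /field_of; have [-> ->] := h qe.
Qed.

Lemma approximates_congr k U V Us Gs : measurable_data B U -> measurable_data B V -> data_ae_eq B V U ->
  approximates B k U Us Gs -> approximates B k V Us Gs.
Proof.
move=> mU mV e [sU fin cau lim].
have E : (fun n => energy0 B 0 (field_of B 0 (sub_data (Us n) V))) =
         (fun n => energy0 B 0 (field_of B 0 (sub_data (Us n) U))).
  apply/funext => n; have mn := smooth_measurable_data hsub (sU n).1.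
  apply: energy0_data_ae; [exact: measurable_data_sub|exact: measurable_data_sub|].
  apply: (data_ae_pointwise e) => y [h1 h2].
  by rewrite !(sub_dataE _ _ y).1 !(sub_dataE _ _ y).2 h1 h2.
by split; [exact: sU|exact: fin|exact: cau|rewrite E; exact: lim].
Qed.

Lemma H0space_congr k U V : measurable_data B V -> data_ae_eq B V U -> H0space B k U -> H0space B k V.
Proof.
move=> mV e [mU [Us [Gs [ap ne]]]]; split; first exact: mV.
by exists Us, Gs; split; [exact: approximates_congr mU mV e ap|exact: ne].
Qed.

Lemma cE_stat qe qb : cE B (stat_data B qe qb) = qe.
Proof.
apply: (chargeE_Fstat hsub hfol (qe := qe) (qb := qb)) => y ys.
by rewrite (field_of_stat_data hsub hfol).
Qed.

Lemma cB_stat qe qb : cB B (stat_data B qe qb) = qb.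
Proof.
apply: (chargeB_Fstat hsub hfol (qe := qe) (qb := qb)) => y ys.
by rewrite (field_of_stat_data hsub hfol).
Qed.

(** Both the Cauchy differences and the differences from the limit lose the stationary part, so only
    finiteness of the energies is new. The conclusion is of order 0, which is what the extended
    charges refer to and avoids Lie derivatives of the stationary field. *)
Lemma approximates_add_stat k qe qb U U0 Us Gs : measurable_data B U -> measurable_data B U0 ->
  data_ae_eq B U (add_data (stat_data B qe qb) U0) -> approximates B k U0 Us Gs ->
  approximates B 0 U (fun n => add_data (stat_data B qe qb) (Us n))
    (fun n p => Fstat B qe qb p + Gs n p).
Proof.
move=> mU mU0 e [sU fin cau lim].
have nG n := prolongs_form (sU n).2.
have mS := measurable_stat_data qe qb.
have nF x y := prolongs_form (prolongs_stat_data hsub hfol x y).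
split.
- move=> n; split; first by apply: smooth_data_add => //; [exact: smooth_stat_data|exact: (sU n).1].
  by apply: prolongs_add_stat; exact: (sU n).2.
- move=> n; rewrite energy_E0.
  (* The sum is rewritten as a difference with the field of opposite charges, since [energy0_sub]
     bounds differences. *)
  have -> : slice B 0 (fun p => Fstat B qe qb p + Gs n p) =
      fun y => slice B 0 (Gs n) y - slice B 0 (Fstat B (- qe) (- qb)) y.
    apply/funext => y; rewrite /slice !(FstatE hsub hfol) !scaleNr opprD !opprK addrC.
    by [].
  have [sGn _] := nG n; have [sFn _] := nF (- qe) (- qb).
  have L := energy0_sub hsub hfol hmult (slice_asym (nG n)) (slice_asym (nF (- qe) (- qb))) (slice_meas sGn) (slice_meas sFn).
  apply: (le_lt_trans L); apply: lte_add_pinfty; apply: lte_mul_pinfty; rewrite ?lee_fin//.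
    exact: le_lt_trans (energy0_le k (nG n)) (fin n).
  exact: energy0_Fstat_fin.
- move=> eps eps0; have [n0 H] := cau eps eps0; exists n0 => m n hm hn.
  rewrite energy_E0; apply: le_trans (H m n hm hn).
  have -> : slice B 0 (fun p => (Fstat B qe qb p + Gs m p) - (Fstat B qe qb p + Gs n p)) =
      slice B 0 (fun p => Gs m p - Gs n p).
    by apply/funext => y; rewrite /slice opprD addrACA subrr add0r.
  by apply: energy0_le; exact: form_sub.
- have -> : (fun n => energy0 B 0 (field_of B 0 (sub_data (add_data (stat_data B qe qb) (Us n)) U))) =
          (fun n => energy0 B 0 (field_of B 0 (sub_data (Us n) U0))); last by [].
  apply/funext => n; have mn := smooth_measurable_data hsub (sU n).1.
  apply: energy0_data_ae.
  + by apply: measurable_data_sub => //; exact: measurable_data_add.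
  + exact: measurable_data_sub.
  + apply: (data_ae_pointwise e) => y [h1 h2]; move: (stat_data B qe qb) h1 h2 => S h1 h2.
    rewrite /sub_data /add_data /scale_data /= h1 h2 /add_data /=.
    by split; rewrite !scaleN1r opprD addrACA subrr add0r.
Qed.

(** Along the stationary translate of a neutral approximating sequence the charges are constant,
    equal to [qe] and [qb]; uniqueness of the extended charge identifies them with the chosen
    values. Every uniqueness assertion of the decomposition rests on this. *)
Lemma charges_of k qe qb U U0 : measurable_data B U -> H0space B k U0 ->
  data_ae_eq B U (add_data (stat_data B qe qb) U0) -> qE B U = qe /\ qB B U = qb.
Proof.
move=> mU [mU0 [Us [Gs [ap ne]]]] e.
have ap' := approximates_add_stat mU mU0 e ap; have [sU _ _ _] := ap.
have sS := smooth_stat_data hsub hfol qe qb.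
have eE : extends_charge B (cE B) U qe.
  exists (fun n => add_data (stat_data B qe qb) (Us n)), (fun n p => Fstat B qe qb p + Gs n p); split=> //.
  have -> : (fun n => cE B (add_data (stat_data B qe qb) (Us n))) = fun=> qe; last exact: cvg_cst.
  apply/funext => n; rewrite cE_add//; last exact: (sU n).1.
  by rewrite cE_stat /cE (ne n).1 addr0.
have eB : extends_charge B (cB B) U qb.
  exists (fun n => add_data (stat_data B qe qb) (Us n)), (fun n p => Fstat B qe qb p + Gs n p); split=> //.
  have -> : (fun n => cB B (add_data (stat_data B qe qb) (Us n))) = fun=> qb; last exact: cvg_cst.
  apply/funext => n; rewrite cB_add//; last exact: (sU n).1.
  by rewrite cB_stat /cB (ne n).2 addr0.
split.
- apply: (extends_charge_unique hsub hfol hmult (energy_bounds_cE hsub hfol hmult) (additive_cE hsub hfol) mU _ eE).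
  by apply: (@getPex _ [set c | extends_charge B (cE B) U c]); exists qe.
- apply: (extends_charge_unique hsub hfol hmult (energy_bounds_cB hsub hfol hmult) (additive_cB hsub hfol) mU _ eB).
  by apply: (@getPex _ [set c | extends_charge B (cB B) U c]); exists qb.
Qed.

Lemma lie_zero X : lie X (fun=> 0) = (fun=> 0 : 'M[R]_4).
Proof.
apply/funext => p; apply/matrixP => i j; rewrite [LHS]mxE [RHS]mxE.
have Z k a b : pd k (fun q : 'rV[R]_4 => (0 : 'M[R]_4) a b) p = 0.
  by rewrite (_ : (fun _ => _) = fun=> 0) ?pd_cst//; apply/funext => q; rewrite mxE.
rewrite !big1 ?addr0// => k _; first by rewrite mxE mul0r.
  by rewrite mxE mul0r.
by rewrite Z mulr0.
Qed.

Lemma energy_zero k : energy B k 0 (fun=> 0) = 0%E.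
Proof.
rewrite /energy big1// => m _; rewrite big1// => w _.
have -> : lie_word w (fun=> 0) = (fun=> 0 : 'M[R]_4) by elim: (tval w) => [|c v IH] //=; rewrite IH lie_zero.
rewrite energy0E -[RHS](integral0 (@mu3 R) (ext_sph B)); apply: eq_integral => q _.
rewrite /energy_integrand /slice /energy_density /stress !mul0mx mxtrace0 mulr0 scale0r subrr.
by rewrite /pair mulmx0 mul0mx mxE mul0r.
Qed.

Lemma smooth_zero_data : smooth_data B (@zero_data R).
Proof.
split; [exact: smooth_mx_cst|exact: smooth_mx_cst|move=> y ys].
have H : divergence B 0 (fun=> 0) y = 0.
  apply/(div_densitizedP _ _ _ ys) => //; rewrite big1// => i _.
  by rewrite (_ : (fun _ => _) = fun=> 0) ?pd_cst//; apply/funext => z; rewrite /densitized mul0mx scaler0 mxE.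
by [].
Qed.

Lemma pair_zero (u v : 'rV[R]_4) : pair 0 u v = 0.
Proof. by rewrite /pair mulmx0 mul0mx mxE. Qed.

Lemma star_zero (g : 'M[R]_4) : star g 0 = 0.
Proof. by rewrite -[X in star g X](scale0r (0 : 'M[R]_4)) starZ scale0r. Qed.

Lemma prolongs_zero : prolongs B (@zero_data R) (fun=> 0).
Proof.
have D i j k q : d2 (fun=> 0 : 'M[R]_4) i j k q = 0.
  have Z l a b : pd l (fun q : 'rV[R]_4 => (0 : 'M[R]_4) a b) q = 0.
    by rewrite (_ : (fun _ => _) = fun=> 0) ?pd_cst//; apply/funext => z; rewrite mxE.
  by rewrite /d2 !Z !addr0.
split.
- by move=> p; rewrite trmx0 oppr0.
- exact: smooth_mx_cst.
- move=> y ys; split; apply/rowP => i; rewrite [LHS]mxE [RHS]mxE /slice ?star_zero pair_zero ?oppr0//.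
- have -> : hodge B (fun=> 0) = (fun=> 0) by apply/funext => p; exact: star_zero.
  by move=> w i j k p _; split; apply: (pds_zero (U := setT)) => //; exact: openT.
Qed.

Lemma zero_scale : @zero_data R = scale_data 0 (@zero_data R).
Proof. by rewrite /scale_data /zero_data /=; congr (_, _); apply/funext => y; rewrite scaler0. Qed.

Lemma neutral_zero : neutral B (@zero_data R).
Proof.
by split; [change (cE B (@zero_data R) = 0)|change (cB B (@zero_data R) = 0)];
  rewrite zero_scale (cE_scale, cB_scale) ?mul0r//; exact: smooth_zero_data.
Qed.

Lemma approximates_zero k : approximates B k (@zero_data R) (fun=> @zero_data R) (fun _ _ => 0).
Proof.
split.
- by move=> n; split; [exact: smooth_zero_data|exact: prolongs_zero].
- by move=> n; rewrite energy_zero.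
- move=> eps eps0; exists 0%N => m n _ _.
  have -> : (fun p : 'rV[R]_4 => 0 - 0 : 'M[R]_4) = fun=> 0 by apply/funext => p; rewrite subrr.
  by rewrite energy_zero lee_fin ltW.
- have -> : field_of B 0 (sub_data (@zero_data R) (@zero_data R)) = slice B 0 (fun=> 0).
    by apply/funext => y; rewrite field_of_sub subrr.
  rewrite -energy_E0 energy_zero; exact: cvg_cst.
Qed.

Lemma H0space_zero k : H0space B k (@zero_data R).
Proof.
split; first by apply: smooth_measurable_data => //; exact: smooth_zero_data.
exists (fun=> @zero_data R), (fun _ _ => 0); split; first exact: approximates_zero.
by move=> n; exact: neutral_zero.
Qed.

Lemma H0norm_zero k : H0norm B k (@zero_data R) = 0.
Proof.
rewrite /H0norm; set E := [set nu : R | _].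
have E0 : E 0.
  split=> //; exists (fun=> @zero_data R), (fun _ _ => 0); split.
  - exact: approximates_zero.
  - by move=> n; exact: neutral_zero.
  - by rewrite energy_zero expr0n; exact: cvg_cst.
have lb : lbound E 0 by move=> x [].
apply/eqP; rewrite eq_le; apply/andP; split; first by apply: ge_inf => //; exists 0.
by apply: lb_le_inf => //; exists 0.
Qed.

Lemma Hspace_charges k U : Hspace B k U -> exists U0,
  H0space B k U0 /\ data_ae_eq B U (add_data (stat_data B (qE B U) (qB B U)) U0).
Proof.
move=> [mU [qe [qb [U0 [hU0 e]]]]]; exists U0; split=> //.
by have [-> ->] := charges_of mU hU0 e.
Qed.

Lemma stat_data_zero : data_ae_eq B (stat_data B 0 0) (@zero_data R).
Proof.
by apply: data_ae_eqfun => y; rewrite /stat_data /add_data /scale_data /= !scale0r addr0.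
Qed.

Lemma direct_sum (k : nat) :
    [/\ forall U, Hspace B k U <-> measurable_data B U /\
          exists S U0, [/\ stat_span B S, H0space B k U0 &
                           data_ae_eq B U (add_data S U0)],
        forall S, stat_span B S -> H0space B k S ->
          data_ae_eq B S (@zero_data R),
        forall U S U0, stat_span B S -> H0space B k U0 -> measurable_data B U ->
          data_ae_eq B U (add_data S U0) ->
          [/\ H0space B k (Pi_0 B U), data_ae_eq B (Pi_stat B U) S &
              data_ae_eq B (Pi_0 B U) U0] &
        forall nu : data R -> R, admissible_norm B k nu ->
          exists C : R, forall U, Hspace B k U ->
            nu (Pi_stat B U) <= C * nu U /\ nu (Pi_0 B U) <= C * nu U].
Proof.
have add_ae S S' U0 : data_ae_eq B S S' -> data_ae_eq B (add_data S U0) (add_data S' U0).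
  by move=> e; apply: (data_ae_pointwise e) => y [h1 h2]; rewrite /add_data /= h1 h2.
have Pi0_ae U U0 qe qb : Pi_stat B U = stat_data B qe qb -> data_ae_eq B U (add_data (stat_data B qe qb) U0) ->
    data_ae_eq B (Pi_0 B U) U0.
  move=> PE; rewrite /Pi_0 PE; move: (stat_data B qe qb) => S e; apply: (data_ae_pointwise e) => y [h1 h2].
  rewrite /sub_data /add_data /scale_data /= h1 h2 /add_data /=.
  by split; rewrite scaleN1r addrAC subrr add0r.
split.
- move=> U; split.
    move=> [mU [qe [qb [U0 [hU0 e]]]]]; split=> //; exists (stat_data B qe qb), U0; split=> //.
    by exists qe, qb; exact: data_ae_refl.
  move=> [mU [S [U0 [[qe [qb eS]] hU0 e]]]]; split=> //; exists qe, qb, U0; split=> //.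
  by apply: data_ae_trans e _; exact: add_ae.
- move=> S [qe [qb eS]] hS; have [mS _] := hS.
  (* The data in the intersection decompose in two ways, with all of it in the stationary summand or
     all of it in the neutral one; comparing charges gives zero. *)
  have e1 : data_ae_eq B S (add_data (stat_data B qe qb) (@zero_data R)).
    by apply: (data_ae_pointwise eS) => y [h1 h2]; rewrite h1 h2 /= !addr0.
  have e2 : data_ae_eq B S (add_data (stat_data B 0 0) S).
    by apply: (data_ae_pointwise stat_data_zero) => y [h1 h2]; move: (stat_data B 0 0) h1 h2 => S' h1 h2; rewrite /add_data /= h1 h2 /= !add0r.
  have [q1 q2] := charges_of mS (H0space_zero k) e1.
  have [q3 q4] := charges_of mS hS e2.
  apply: data_ae_trans eS _; rewrite -q1 -q2 q3 q4; exact: stat_data_zero.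
- move=> U S U0 [qe [qb eS]] hU0 mU e.
  have e1 : data_ae_eq B U (add_data (stat_data B qe qb) U0) by apply: data_ae_trans e _; exact: add_ae.
  have [q1 q2] := charges_of mU hU0 e1.
  have PE : Pi_stat B U = stat_data B qe qb by rewrite /Pi_stat q1 q2.
  have e0 := Pi0_ae _ _ _ _ PE e1.
  have mP : measurable_data B (Pi_0 B U).
    by apply: measurable_data_sub => //; rewrite PE; exact: measurable_stat_data.
  split; [exact: H0space_congr mP e0 hU0|by rewrite PE; exact: data_ae_sym|exact: e0].
(* The norm lies between [c] and [C] times a Pythagorean norm, which does not increase when either
   summand is deleted; hence the constant. *)
- move=> nu [_ _ [c [C [c0 C0 H]]]]; exists (C / c) => U hU; have [mU _] := hU.
  have [U0 [hU0 e]] := Hspace_charges hU.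
  have /andP[h1 _] := H _ _ _ _ hU0 mU e.
  have mS := measurable_stat_data (qE B U) (qB B U).
  have eS : data_ae_eq B (Pi_stat B U) (add_data (stat_data B (qE B U) (qB B U)) (@zero_data R)).
    by apply: data_ae_eqfun => y; rewrite /add_data /= !addr0.
  have /andP[_ h2] := H _ _ _ _ (H0space_zero k) mS eS.
  have e0 : data_ae_eq B (Pi_0 B U) U0 by exact: Pi0_ae e.
  have mP : measurable_data B (Pi_0 B U) by apply: measurable_data_sub.
  have eP : data_ae_eq B (Pi_0 B U) (add_data (stat_data B 0 0) U0).
    by apply: (data_ae_pointwise2 e0 stat_data_zero) => y [h3 h4] [h5 h6]; rewrite h3 h4; move: (stat_data B 0 0) h5 h6 => S' h5 h6; rewrite /add_data /= h5 h6 /= !add0r.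
  have /andP[_ h3] := H _ _ _ _ hU0 mP eP.
  have M x z : x <= z -> c * Num.sqrt z <= nu U -> C * Num.sqrt x <= C / c * nu U.
    move=> xz hz; rewrite -mulrA; apply: ler_wpM2l; first exact: ltW.
    rewrite mulrC ler_pdivlMr// mulrC; apply: le_trans hz; apply: ler_wpM2l; first exact: ltW.
    exact: ler_wsqrtr.
  split.
    apply: (le_trans h2); apply: M h1; rewrite H0norm_zero expr0n addr0 lerDl; exact: sqr_ge0.
  apply: (le_trans h3); apply: M h1; rewrite expr0n !add0r lerDr; apply: addr_ge0; exact: sqr_ge0.
Qed.

Lemma data_of_sub_stat s qe qb (F : tensor) y :
  (data_of B s (slice B s (fun p => F p - Fstat B qe qb p))).1 y =
    (data_of B s (slice B s F)).1 y - (data_of B s (slice B s (Fstat B qe qb))).1 y /\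
  (data_of B s (slice B s (fun p => F p - Fstat B qe qb p))).2 y =
    (data_of B s (slice B s F)).2 y - (data_of B s (slice B s (Fstat B qe qb))).2 y.
Proof.
split; apply/rowP => i; rewrite [LHS]mxE !mx_linE ![(\row__ _) _ _]mxE /slice.
  by rewrite pairD pairN.
by rewrite starB pairD pairN opprB addrC opprK.
Qed.

Lemma maxwell_sub_stat t qe qb (F : tensor) : smooth_mx_near (slab B t) F -> maxwell_on B (slab B t) F ->
  maxwell_on B (slab B t) (fun p => F p - Fstat B qe qb p).
Proof.
move=> sF mF p sp i j k; have Ap : away p by case: sp => ep _; exact: (ext_away hsub ep).
have sub : slab B t `<=` away by move=> q [ep _]; exact: (ext_away hsub ep).
have FE q : Fstat B (- qe) (- qb) q = - Fstat B qe qb q.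
  by rewrite !(FstatE hsub hfol) !scaleNr opprD.
have D (X : tensor) (A : set 'rV[R]_4) : A p -> smooth_mx_near A X -> forall a b, differentiable (fun q => X q a b) p.
  by move=> Aq sX a b; exact: smooth_near_diff (sX a b) Aq.
have sH : smooth_mx_near (slab B t) (hodge B F).
  apply: smooth_star => //; last exact: smooth_mx_sub sub (smooth_kn B).
  by move=> q sq; apply: kn_det_lt0; exact: sub.
have [m1 m2] := mF p sp i j k; split.
  have -> : (fun p => F p - Fstat B qe qb p) = fun p => F p + Fstat B (- qe) (- qb) p.
    by apply/funext => q; rewrite FE.
  rewrite d2D; [|exact: (D _ _ sp sF)|exact: (D _ _ Ap (smooth_Fstat hsub hfol _ _))].
  by rewrite m1 (d2_Fstat hsub hfol)// addr0.
have -> : hodge B (fun p => F p - Fstat B qe qb p) = fun p => hodge B F p + hodge B (Fstat B (- qe) (- qb)) p.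
  by apply/funext => q; rewrite /hodge FE starN starB.
have sHS : smooth_mx_near away (hodge B (Fstat B (- qe) (- qb))).
  by apply: smooth_hodge; exact: smooth_Fstat.
rewrite d2D; [|exact: (D _ _ sp sH)|by move=> i' j'; exact: smooth_near_diff (sHS i' j') Ap].
by rewrite m2 (d2_hodge_Fstat hsub hfol)// addr0.
Qed.

(** The stationary field is subtracted from each approximating solution as well, so all energy
    differences on a slab are unchanged; on the initial leaf only the stationary coefficients of the
    data move. *)
Lemma finite_energy_sub_stat k (F : tensor) qe qb : finite_energy_maxwell B k F ->
  finite_energy_maxwell B k (fun p => F p - Fstat B qe qb p) /\
  qE_field B (fun p => F p - Fstat B qe qb p) = qE_field B F - qe /\
  qB_field B (fun p => F p - Fstat B qe qb p) = qB_field B F - qb.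
Proof.
move=> [aF mF hF sF].
have [mD [q1 [q2 [U0 [hU0 e]]]]] := hF.
have aS p := Fstat_tr hsub hfol qe qb p.
have sS := smooth_mx_sub (ext_away hsub) (smooth_Fstat hsub hfol qe qb).
pose V := data_of B 0 (slice B 0 (fun p => F p - Fstat B qe qb p)).
have mV : measurable_data B V.
  have m := measurable_data_sub mD (measurable_stat_data qe qb).
  have VE : V = sub_data (data_of B 0 (slice B 0 F)) (stat_data B qe qb).
    have [V1 V2] : (forall y, V.1 y = (sub_data (data_of B 0 (slice B 0 F)) (stat_data B qe qb)).1 y) /\
        (forall y, V.2 y = (sub_data (data_of B 0 (slice B 0 F)) (stat_data B qe qb)).2 y).
      split=> y; [rewrite (sub_dataE _ _ y).1|rewrite (sub_dataE _ _ y).2]; rewrite stat_dataE.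
        exact: (data_of_sub_stat 0 qe qb F y).1.
      exact: (data_of_sub_stat 0 qe qb F y).2.
    by rewrite [LHS]surjective_pairing [RHS]surjective_pairing; congr (_, _); apply/funext.
  by rewrite VE.
have eV : data_ae_eq B V (add_data (stat_data B (q1 - qe) (q2 - qb)) U0).
  apply: (data_ae_pointwise e) => y [h1 h2].
  rewrite /V (data_of_sub_stat 0 qe qb F y).1 (data_of_sub_stat 0 qe qb F y).2 h1 h2 -!stat_dataE.
  rewrite /stat_data; move: (Ue B) (Um B) (U0) => [a d] [b f] [c g].
  rewrite /add_data /scale_data /= !scalerBl.
  move: (a y) (b y) (c y) (d y) (f y) (g y) => {}a {}b {}c {}d {}f {}g.
  by split; apply/rowP => i; rewrite !mx_linE; ring.
have [c1 c2] := charges_of mD hU0 e; have [c3 c4] := charges_of mV hU0 eV.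
split; last by rewrite /qE_field /qB_field c3 c4 c1 c2.
split.
- by move=> p; rewrite trmxD trmxN aF aS [RHS]opprD.
- move=> s i j s0; rewrite (_ : (fun q => _) = fun q => slice B s F (sph q) i j - Fstat B qe qb (emb B s (sph q)) i j).
    apply: measurable_funB; first exact: mF.
    apply: (smooth_measurable hsub (f := fun y => Fstat B qe qb (emb B s y) i j)).
    exact: (smooth_mx_at_emb hfol s sS).
  by apply/funext => q; rewrite /slice !mx_linE.
- by split=> //; exists (q1 - qe), (q2 - qb), U0.
- move=> t t0; have [Fs [H1 H2 H3]] := sF t t0.
  exists (fun n p => Fs n p - Fstat B qe qb p); split.
  + move=> n; have [a1 a2 a3] := H1 n; split.
    * by move=> p; rewrite trmxD trmxN a1 aS [RHS]opprD.
    * apply: smooth_mxB => //; apply: smooth_mx_sub sS; by move=> p [].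
    * exact: maxwell_sub_stat.
  + move=> eps eps0; have [n0 h] := H2 eps eps0; exists n0 => m n s hm hn hs.
    have -> : (fun p => (Fs m p - Fstat B qe qb p) - (Fs n p - Fstat B qe qb p)) = fun p => Fs m p - Fs n p.
      by apply/funext => p; rewrite opprB addrA subrK.
    exact: h.
  + move=> eps eps0; have [n0 h] := H3 eps eps0; exists n0 => n s hn hs.
    have -> : (fun p => (Fs n p - Fstat B qe qb p) - (F p - Fstat B qe qb p)) = fun p => Fs n p - F p.
      by apply/funext => p; rewrite opprB addrA subrK.
    exact: h.
Qed.

Lemma data_of_field_ae (F G : tensor) : field_ae_eq B F G ->
  data_ae_eq B (data_of B 0 (slice B 0 F)) (data_of B 0 (slice B 0 G)).
Proof.
move=> /(_ 0 (lexx _)) e; apply: ae_mu3S e => q h qe; have {}h := h qe.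
by split; apply/rowP => i; rewrite [LHS]mxE [RHS]mxE h.
Qed.

(** The charges are read off on the initial leaf and fix the coefficients of any decomposition. Once
    these agree, the remainders agree on every later leaf by subtraction, without solving the Cauchy
    problem. *)
Lemma radiative_part (k : nat) (F : tensor) : finite_energy_maxwell B k F ->
    exists Frad : tensor,
      [/\ finite_energy_maxwell B k Frad,
          field_ae_eq B F (fun p => Fstat B (qE_field B F) (qB_field B F) p
                                    + Frad p),
          qE_field B Frad = 0 /\ qB_field B Frad = 0 &
          forall (qe qb : R) (F' : tensor),
            finite_energy_maxwell B k F' ->
            qE_field B F' = 0 -> qB_field B F' = 0 ->
            field_ae_eq B F (fun p => Fstat B qe qb p + F' p) ->
            [/\ qe = qE_field B F, qb = qB_field B F &
                field_ae_eq B F' Frad]].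
Proof.
move=> hF; have [hR [r1 r2]] := finite_energy_sub_stat (qE_field B F) (qB_field B F) hF.
exists (fun p => F p - Fstat B (qE_field B F) (qB_field B F) p).
split; [exact: hR| |exact: (conj (etrans r1 (subrr _)) (etrans r2 (subrr _)))|].
  by move=> s s0; apply: ae_mu3T => q _; rewrite /slice addrC subrK.
move=> qe qb F' hF' c1 c2 e.
have [_ _ [mD' [q1 [q2 [U0 [hU0 e']]]]] _] := hF'; have [_ _ [mD _] _] := hF.
have [k1 k2] := charges_of mD' hU0 e'.
have z1 : q1 = 0 := etrans (esym k1) c1.
have z2 : q2 = 0 := etrans (esym k2) c2.
(* The competitor [F'] has vanishing charges, so its data are their own neutral part [U0]; adding
   the stationary field exhibits [qe] and [qb] as the charges of the data of [F]. *)
have e2 : data_ae_eq B (data_of B 0 (slice B 0 F)) (add_data (stat_data B qe qb) U0).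
  apply: (data_ae_pointwise2 (data_of_field_ae e) e') => y [h1 h2] [h3 h4]; rewrite h1 h2.
  have H := data_of_sub_stat 0 (- qe) (- qb) F' y.
  have FE : (fun p => F' p - Fstat B (- qe) (- qb) p) = fun p => Fstat B qe qb p + F' p.
    by apply/funext => p; rewrite !(FstatE hsub hfol) !scaleNr -opprD opprK addrC.
  rewrite FE -!stat_dataE h3 h4 z1 z2 in H; rewrite H.1 H.2.
  rewrite /stat_data /add_data /scale_data /= !scale0r !scaleNr.
  move: (qe *: (Ue B).1 y) (qb *: (Um B).1 y) (U0.1 y) (qe *: (Ue B).2 y) (qb *: (Um B).2 y) (U0.2 y) => a b c d f g.
  by split; apply/rowP => i; rewrite !mx_linE; ring.
have [k3 k4] := charges_of mD hU0 e2.
split; [exact: esym k3|exact: esym k4|].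
move=> s s0; apply: ae_mu3S (e s s0) => q h qe'; have {}h := h qe'.
rewrite (k3 : qE_field B F = qe) (k4 : qB_field B F = qb); move: h; rewrite /slice => ->.
by rewrite [RHS]addrC addKr.
Qed.

End charge_decomposition.

Theorem theorem1 (R : realType) (B : setting R)
  (hsub : subextremal B)
  (hfol : regular_foliation B)
  (hmult : redshift_multiplier B) :
  (forall k : nat,
    [/\ forall U, Hspace B k U <-> measurable_data B U /\
          exists S U0, [/\ stat_span B S, H0space B k U0 &
                           data_ae_eq B U (add_data S U0)],
        forall S, stat_span B S -> H0space B k S ->
          data_ae_eq B S zero_data,
        forall U S U0, stat_span B S -> H0space B k U0 -> measurable_data B U ->
          data_ae_eq B U (add_data S U0) ->
          [/\ H0space B k (Pi_0 B U), data_ae_eq B (Pi_stat B U) S &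
              data_ae_eq B (Pi_0 B U) U0] &
        forall nu : data R -> R, admissible_norm B k nu ->
          exists C : R, forall U, Hspace B k U ->
            nu (Pi_stat B U) <= C * nu U /\ nu (Pi_0 B U) <= C * nu U]) /\
  (forall (k : nat) (F : 'rV[R]_4 -> 'M[R]_4), finite_energy_maxwell B k F ->
    exists Frad : 'rV[R]_4 -> 'M[R]_4,
      [/\ finite_energy_maxwell B k Frad,
          field_ae_eq B F (fun p => Fstat B (qE_field B F) (qB_field B F) p
                                    + Frad p),
          qE_field B Frad = 0 /\ qB_field B Frad = 0 &
          forall (qe qb : R) (F' : 'rV[R]_4 -> 'M[R]_4),
            finite_energy_maxwell B k F' ->
            qE_field B F' = 0 -> qB_field B F' = 0 ->
            field_ae_eq B F (fun p => Fstat B qe qb p + F' p) ->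
            [/\ qe = qE_field B F, qb = qB_field B F &
                field_ae_eq B F' Frad]]) /\
  (forall (qe qb : R) (K : set R) (nu : R -> data R -> R),
    (qe, qb) <> (0, 0) ->
    compact K -> K `<=` [set r | rplus B <= r] -> interior K !=set0 ->
    local_norm_equiv B K nu ->
    ~ decays_locally B nu (Fstat B qe qb)).
Proof.
split; first by move=> k; exact: (direct_sum hsub hfol hmult k).
split; first by move=> k F; exact: (radiative_part hsub hfol hmult).
by move=> qe qb K nu q0 cK Kext iK hnu; exact: (stationary_no_decay hsub hfol cK Kext q0 iK hnu).
Qed.
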